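(* Suppose: $X\in\mathbb{R}^{N\times d_0}$ has i.i.d. rows uniformly distributed on the unit sphere of $\mathbb{R}^{d_0}$; $y\in\mathbb{R}^N$ satisfies $|y_i|=\mathcal{O}(1)$ for all $i$ (so $\|y\|_2=\mathcal{O}(\sqrt N)$); $v\in\mathbb{R}^{d_1}$ is fixed with half of its entries equal to $\|y\|_2/\sqrt{Nd_1}$ and the other half equal to $-\|y\|_2/\sqrt{Nd_1}$; $W_0\in\mathbb{R}^{d_0\times d_1}$ has i.i.d. $\mathcal{N}(0,1)$ entries. Assume $d_0\in[\sqrt N,N]$ and $$d_1\ge C\max\Big(\frac{N\log N}{d_0},\frac{N^5}{d_0^4}\Big)$$ for a suitable absolute constant $C$. Then with high probability, every solution $W$ of the differential inclusion $W(0)=W_0$, $\frac{d}{ds}W(s)\in-\partial\mathcal{L}(W(s))$ for a.e. $s$, can be extended to a solution on $[0,\infty)$, and every such extension satisfies $\mathcal{L}(W(t))\le\mathcal{L}(W(0))\exp(-ct\beta_0^2)$ for all $t\ge0$, for some absolute constant $c>0$.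
   Context: $\phi(x)=\max(x,0)$ entrywise; $\mathcal{L}(W)=\frac12\|\phi(XW)v-y\|_2^2$ as a function of $W\in\mathbb{R}^{d_0\times d_1}$ only ($v$ fixed). $\partial$ is the Clarke subdifferential; solutions are absolutely continuous curves. For $A\in\mathbb{R}^{N\times p}$, $B\in\mathbb{R}^{N\times q}$ the Khatri–Rao product $A\star B\in\mathbb{R}^{N\times pq}$ has $i$-th row $A_{i:}\otimes B_{i:}$. $R_0\in\mathbb{R}^{N\times d_1}$ is the matrix of (generalized) derivatives of $\phi$ at the entries of $XW_0$, which almost surely equals $(R_0)_{ij}=\mathbf 1\{X_{i:}(W_0)_{:j}>0\}$; $\beta_0=\sigma_{\min}\big((X\star(R_0\,\mathrm{diag}(v)))^T\big)$ with $\sigma_{\min}(A)=\sqrt{\lambda_{\min}(A^TA)}$. $d_0,d_1$ may depend on $N$; ''with high probability'' means with probability tending to $1$ as $N\to\infty$, and $\mathcal{O}$ refers to $N\to\infty$. *)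

(* Defs.v *)
From HB Require Import structures.
From mathcomp Require Import all_boot all_order all_algebra.
From mathcomp Require Import all_classical all_reals all_analysis.
Set Implicit Arguments. Unset Strict Implicit. Unset Printing Implicit Defensive.
Import Order.TTheory GRing.Theory Num.Theory.
Import numFieldNormedType.Exports.
Local Open Scope classical_set_scope.
Local Open Scope ring_scope.

Section Defs.
Variable R : realType.

Definition relu_mx m n (A : 'M[R]_(m, n)) : 'M[R]_(m, n) :=
  map_mx (fun x => Num.max x 0) A.

Definition sqnorm n (u : 'cV[R]_n) : R := \sum_i (u i 0) ^+ 2.

Definition loss N d0 d1 (X : 'M[R]_(N, d0)) (v : 'cV[R]_d1) (y : 'cV[R]_N)
  (W : 'M[R]_(d0, d1)) : R :=
  2^-1 * sqnorm (relu_mx (X *m W) *m v - y).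

Definition frob m n (A B : 'M[R]_(m, n)) : R := \sum_i \sum_j A i j * B i j.

(* xi is in the Clarke subdifferential of f at W:
   <xi, V> <= f°(W; V) := limsup_{W' -> W, t \downarrow 0} (f(W'+tV) - f(W'))/t
   for every direction V (limsup written out). *)
Definition clarke_subdiff m n (f : 'M[R]_(m, n) -> R) (W xi : 'M[R]_(m, n)) :=
  forall V : 'M[R]_(m, n), forall eps : R, 0 < eps -> forall delta : R, 0 < delta ->
    exists W' : 'M[R]_(m, n), exists t : R,
      [/\ forall i j, `|W' i j - W i j| < delta, 0 < t, t < delta &
          frob xi V - eps < (f (W' + t *: V) - f W') / t].

Definition abs_cont_on (f : R -> R) (a b : R) :=
  forall eps : R, 0 < eps -> exists2 delta : R, 0 < delta &
    forall (n : nat) (l r : 'I_n -> R),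
      (forall k, a <= l k /\ l k <= r k /\ r k <= b) ->
      (forall k k', k != k' -> r k <= l k' \/ r k' <= l k) ->
      \sum_k (r k - l k) < delta ->
      \sum_k `|f (r k) - f (l k)| < eps.

Definition deriv_mx m n (W : R -> 'M[R]_(m, n)) (s : R) : 'M[R]_(m, n) :=
  \matrix_(i, j) derive1 (fun t => W t i j) s.

Definition sol_on m n (f : 'M[R]_(m, n) -> R) (W0 : 'M[R]_(m, n))
  (T : R) (W : R -> 'M[R]_(m, n)) :=
  [/\ W 0 = W0,
      forall T', 0 <= T' -> T' < T -> forall i j, abs_cont_on (fun s => W s i j) 0 T' &
      (@lebesgue_measure R).-negligible
        [set s | 0 <= s /\ s < T /\
           ~ ((forall i j, derivable (fun t => W t i j) s 1) /\
              clarke_subdiff f (W s) (- deriv_mx W s))]].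

Definition sol_global m n (f : 'M[R]_(m, n) -> R) (W0 : 'M[R]_(m, n))
  (W : R -> 'M[R]_(m, n)) :=
  [/\ W 0 = W0,
      forall T', 0 <= T' -> forall i j, abs_cont_on (fun s => W s i j) 0 T' &
      (@lebesgue_measure R).-negligible
        [set s | 0 <= s /\
           ~ ((forall i j, derivable (fun t => W t i j) s 1) /\
              clarke_subdiff f (W s) (- deriv_mx W s))]].

(* Khatri-Rao product: i-th row is A_i \otimes B_i *)
Definition khatri_rao N p q (A : 'M[R]_(N, p)) (B : 'M[R]_(N, q)) : 'M[R]_(N, p * q) :=
  \matrix_(i < N) mxvec ((row i A)^T *m row i B).

Definition lambda_min n (S : 'M[R]_n) : R := inf [set a | eigenvalue S a].

Definition sigma_min m n (A : 'M[R]_(m, n)) : R := Num.sqrt (lambda_min (A^T *m A)).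

Definition act_pattern N d0 d1 (X : 'M[R]_(N, d0)) (W0 : 'M[R]_(d0, d1)) : 'M[R]_(N, d1) :=
  \matrix_(i, j) (if 0 < (X *m W0) i j then 1 else 0).

Definition beta0 N d0 d1 (X : 'M[R]_(N, d0)) (W0 : 'M[R]_(d0, d1)) (v : 'cV[R]_d1) : R :=
  sigma_min (khatri_rao X (act_pattern X W0 *m diag_mx v^T))^T.

Definition good_event N d0 d1 (c : R) (X : 'M[R]_(N, d0)) (v : 'cV[R]_d1)
  (y : 'cV[R]_N) (W0 : 'M[R]_(d0, d1)) : Prop :=
  let L := loss X v y in
  (forall T W, 0 < T -> sol_on L W0 T W ->
     exists2 W', sol_global L W0 W' & forall s, 0 <= s -> s < T -> W' s = W s) /\
  (forall W, sol_global L W0 W -> forall t, 0 <= t ->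
     L (W t) <= L W0 * expR (- (c * t * beta0 X W0 v ^+ 2))).

End Defs.

Section Prob.
Local Open Scope ereal_scope.
Variables (R : realType) (dd : measure_display) (Om : measurableType dd) (P : probability Om R).

Definition gen_sigma (I : finType) (f : I -> Om -> R) : set (set Om) :=
  <<s \bigcup_(k in [set: I]) preimage_set_system setT (f k) measurable >>.

Definition mutually_independent (K : finType) (I : K -> finType)
  (f : forall k, I k -> Om -> R) : Prop :=
  forall A : K -> set Om, (forall k, gen_sigma (f k) (A k)) ->
    P (\bigcap_(k in [set: K]) A k) = \prod_(k : K) P (A k).

(* the random vector x : Om -> 'rV_n is uniformly distributed on the unit sphere:
   it lies on the sphere almost surely and its law is invariant under every
   orthogonal transformation (the uniform distribution is the unique
   rotation-invariant probability on the sphere); equality of laws is tested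
   on measurable rectangles, which generate the Borel sets of R^n. *)
Definition uniform_sphere n (x : Om -> 'rV[R]_n) : Prop :=
  (forall j, measurable_fun setT (fun w => x w ord0 j)) /\
  P [set w | (\sum_j (x w ord0 j) ^+ 2 = 1)%R] = 1 /\
  forall Q : 'M[R]_n, (Q *m Q^T = 1%:M)%R ->
    forall B : 'I_n -> set R, (forall j, measurable (B j)) ->
      P (\bigcap_(j in [set: 'I_n]) [set w | (x w *m Q)%R ord0 j \in B j]) =
      P (\bigcap_(j in [set: 'I_n]) [set w | x w ord0 j \in B j]).

Definition std_gaussian (g : Om -> R) : Prop :=
  measurable_fun setT g /\
  forall B, measurable B -> P (g @^-1` B) = normal_prob 0%R 1%R B.

End Prob.

(* Main.v *)
Require Import Defs.
From HB Require Import structures.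
From mathcomp Require Import all_boot all_order all_algebra.
From mathcomp Require Import all_classical all_reals all_analysis.
From mathcomp Require Import measurable_realfun.
From mathcomp Require Import ring lra.
Set Implicit Arguments. Unset Strict Implicit. Unset Printing Implicit Defensive.
Import Order.TTheory GRing.Theory Num.Theory.
Import numFieldNormedType.Exports.
Local Open Scope classical_set_scope.
Local Open Scope ring_scope.

(** The argument has a deterministic and a probabilistic half.

    Deterministic half. If the kernel
    [u |-> sum_j |X^T diag(1{X w_j > 0}) u|^2] is at least [kappa * d1 * |u|^2] at the initialization, and
    few pre-activations are small, then few activations can flip within distance [r] of [W0], so there every
    subgradient satisfies [|xi|^2 >= c beta0^2 L]; the length of a trajectory is at most of order
    [sqrt (L W0) / beta0], so it never leaves that ball and the loss decays exponentially. Global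
    solutions exist by linear growth of the subgradients.

    Probabilistic half, with [d0 = D] and [d1 = n]. Put [B] of order [N / D]. The data satisfy
    [|X|^2 <= B] and, off the diagonal, [<x_i, x_k>^4 <= 1 / (2 B)]. The mean of the kernel is bounded below
    by testing against the fifth Hermite polynomial, whose covariances are [<x_i, x_k>^5]: the resulting
    Gram matrix has entries [<x_i, x_k>^6] and is diagonally dominant because
    [sum_k <x_i, x_k>^6 <= 1 + (2 B)^-1 sum_k <x_i, x_k>^2]. Chernoff bounds over the independent columns
    of [W0] and a net of the unit sphere give the uniform lower bound; a fourth moment computation bounds the
    initial loss. The condition [d1 >= C N^5 / d0^4] is what makes the number of flips negligible. *)

(** * Absolute continuity *)

(** The degree five is dictated by the range of [d0]. Apart from degree 0, only odd Hermite
    polynomials pair with the step function, and degree [k] produces Gram entries [rho^(k + 1)]. A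
    row is bounded by the largest [rho^(k - 1)] times the row sum of [rho^2], which is of order
    [N / d0]. Since [rho^2] is of order [log N / d0], degree 3 would ask for [d0^2] above [N log N]
    and fail at [d0 = sqrt N], while degree 5 asks only for [d0^3] above [N (log N)^2].

    On the deterministic side the obstacle is that a trajectory may stay on kinks of the loss, where
    no chain rule holds. Solutions are analysed through a single inequality, an explicit upper bound
    [slope_bound] for the support function of the Clarke subdifferential. A pre-activation can
    vanish with non-zero speed at countably many times only; at the other times of
    differentiability, testing the inequality with the velocity and with its opposite forces the
    derivative of the loss to be minus the squared speed. *)

Section AbsCont.
Variable R : realType.
Implicit Types (a b x : R) (f g : R -> R).

(** The local hypothesis at the supremum of the points reachable from [a] first attains it and then
    passes it, unless it equals [b]. This stands in for compactness in the arguments on absolutely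
    continuous functions. *)
Lemma cousin a b (Q : R -> R -> Prop) : a <= b ->
  (forall u v w, u <= v -> v <= w -> Q u v -> Q v w -> Q u w) ->
  (forall x, a <= x -> x <= b -> exists2 d : R, 0 < d & forall u v, a <= u -> u <= x ->
     x <= v -> v <= b -> v - u < d -> Q u v) -> Q a b.
Proof.
move=> ab Qadd Qloc.
pose S := [set x | [/\ a <= x, x <= b & Q a x]].
have Sa : S a.
  split=> //; have [d d0 H] := Qloc a (lexx _) ab.
  by apply: H => //; rewrite subrr.
have hS : has_sup S by split; [exists a | exists b => x []].
have aS : a <= sup S by exact: (ub_le_sup (proj2 hS) Sa).
have Sb : sup S <= b by apply: ge_sup => //; [exists a | move=> x []].
have [d d0 H] := Qloc _ aS Sb.
have [x Sx xS] : exists2 x, S x & sup S - d / 2 < x.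
  by apply: sup_adherent => //; rewrite divr_gt0.
have [ax xb Qx] := Sx.
have xs : x <= sup S by exact: (ub_le_sup (proj2 hS) Sx).
(* [x] is within [d / 2] of the supremum, so a third of [d] beyond it keeps the interval from [x] to
   [v] shorter than [d]. *)
pose v := Num.min b (sup S + d / 3).
have vb : v <= b by rewrite /v ge_min lexx.
have sv : sup S <= v by rewrite /v le_min Sb lerDl divr_ge0// ltW.
have vd : v <= sup S + d / 3 by rewrite /v ge_min lexx orbT.
have Qv : Q a v.
  apply: (Qadd _ x) => //; first exact: le_trans sv.
  apply: H => //; lra.
have Sv : S v by split => //; apply: le_trans sv.
have vS : v <= sup S by exact: (ub_le_sup (proj2 hS) Sv).
have vE : v = b.
  move: vS; rewrite /v /Num.min; case: ifP => // _; lra.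
by rewrite -vE.
Qed.

Lemma derivable_approx f x : derivable f x 1 -> forall e : R, 0 < e ->
  exists2 d : R, 0 < d & forall h, `|h| < d ->
   `|f (x + h) - f x - derive1 f x * h| <= e * `|h|.
Proof.
move=> df e e0.
rewrite derive1E; have : h^-1 *: ((f \o shift x) (h *: 1) - f x) @[h --> 0^'] --> ('D_1 f x : R) by exact: df.
move: ('D_1 f x : R) => l /cvgrPdist_le /(_ _ e0).
rewrite near_withinE => /nbhs_ballP[d /= d0 H]; exists d => // h hd.
have [->|h0] := eqVneq h 0; first by rewrite addr0 subrr mulr0 subrr normr0 mulr0.
have := H h; rewrite /ball /= sub0r normrN => /(_ hd h0).
rewrite /= [h *: 1]mulr1 => /(ler_wpM2r (normr_ge0 h)); rewrite -normrM => h1; apply: le_trans h1.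
rewrite (addrC h x); rewrite distrC mulrBl mulrAC.
by rewrite [X in l * h - X * _](_ : _ = 1) ?mul1r // -[RHS](mulVf h0).
Qed.

(** The little-o form carries the value of the derivative: no quotient is formed at [h = 0], and the
    rules of calculus compose without separate existence conditions. *)
Definition has_deriv f x (l : R) := forall e : R, 0 < e ->
  exists2 d : R, 0 < d & forall h, `|h| < d -> `|f (x + h) - f x - l * h| <= e * `|h|.

Lemma derivable_has_deriv f x : derivable f x 1 -> has_deriv f x (derive1 f x).
Proof. exact: derivable_approx. Qed.

Lemma has_derivP f x l : has_deriv f x l -> derivable f x 1 /\ derive1 f x = l.
Proof.
move=> H.
have K : h^-1 *: ((f \o shift x) (h *: 1) - f x) @[h --> 0^'] --> l.
  apply/cvgrPdist_le => e e0; have [d d0 Hd] := H _ e0.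
  rewrite near_withinE; apply/nbhs_ballP; exists d => // h; rewrite /ball /= sub0r normrN => hd h0.
  have := Hd _ hd; rewrite [h *: 1]mulr1 (addrC h x) => Hh.
  have hn : 0 < `|h| by rewrite normr_gt0.
  rewrite -(ler_pM2r hn) -normrM; apply: le_trans Hh; rewrite distrC mulrBl.
  rewrite mulrAC [X in `|_ - X * _|](_ : _ = 1) ?mul1r //; exact: mulVf.
by split; [apply/cvg_ex; exists l|rewrite derive1E; exact/cvg_lim].
Qed.

Lemma has_deriv_near f g x l (d : R) : 0 < d -> (forall h, `|h| < d -> f (x + h) = g (x + h)) ->
  has_deriv f x l -> has_deriv g x l.
Proof.
move=> d0 E H e /H[d' d'0 Hd]; exists (Num.min d d'); first by rewrite lt_min d0.
move=> h; rewrite lt_min => /andP[h1 h2]; rewrite -E// -{2}(addr0 x) -E ?normr0// addr0; exact: Hd.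
Qed.

Lemma has_deriv_id x : has_deriv id x 1.
Proof.
move=> e e0; exists 1 => // h _; rewrite /id (_ : x + h - x - 1 * h = 0); last by ring.
by rewrite normr0 mulr_ge0// ltW.
Qed.

Lemma has_deriv_cst (k : R) x : has_deriv (fun=> k) x 0.
Proof. by move=> e e0; exists 1 => // h _; rewrite mul0r !subr0 subrr normr0 mulr_ge0// ltW. Qed.

Lemma has_derivD f g x l m : has_deriv f x l -> has_deriv g x m ->
  has_deriv (fun s => f s + g s) x (l + m).
Proof.
move=> Hf Hg e e0; have e20 : 0 < e / 2 by rewrite divr_gt0.
have [d d0 H] := Hf _ e20; have [d' d'0 H'] := Hg _ e20.
exists (Num.min d d'); first by rewrite lt_min d0.
move=> h; rewrite lt_min => /andP[/H h1 /H' h2].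
rewrite (_ : _ - _ = (f (x + h) - f x - l * h) + (g (x + h) - g x - m * h)); last by ring.
by apply: le_trans (ler_normD _ _) _; lra.
Qed.

Lemma has_derivZ f x l k : has_deriv f x l -> has_deriv (fun s => k * f s) x (k * l).
Proof.
move=> Hf e e0; have k0 : 0 < `|k| + 1 by rewrite ltr_wpDl.
have [d d0 H] := Hf _ (divr_gt0 e0 k0); exists d => // h /H h1.
rewrite (_ : _ - _ = k * (f (x + h) - f x - l * h)); last by ring.
rewrite normrM; apply: le_trans (_ : (`|k| + 1) * (e / (`|k| + 1) * `|h|) <= _).
  by apply: ler_pM => //; lra.
by rewrite mulrA mulrCA divff ?mulr1// gt_eqF.
Qed.

Lemma has_deriv_cont f x l : has_deriv f x l -> forall e : R, 0 < e ->
  exists2 d : R, 0 < d & forall h, `|h| < d -> `|f (x + h) - f x| < e.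
Proof.
move=> /(_ 1 ltr01)[d d0 Hd] e e0; have k0 : 0 < 1 + `|l| by rewrite ltr_pwDl.
exists (Num.min d (e / (1 + `|l|))); first by rewrite lt_min d0 divr_gt0.
move=> h; rewrite lt_min ltr_pdivlMr// => /andP[/Hd h1 h2].
have := ler_normD (f (x + h) - f x - l * h) (l * h); rewrite subrK normrM; lra.
Qed.

Lemma has_deriv_comp f g x l m : has_deriv f x l -> has_deriv g (f x) m ->
  has_deriv (fun s => g (f s)) x (m * l).
Proof.
move=> Hf Hg e e0; have l0 : 0 < `|l| + 1 by rewrite ltr_wpDl.
have m0 : 0 < `|m| + 1 by rewrite ltr_wpDl.
pose e1 := e / 2 / (`|l| + 1); pose e2 := Num.min 1 (e / 2 / (`|m| + 1)).
have e10 : 0 < e1 by rewrite !divr_gt0.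
have e20 : 0 < e2 by rewrite lt_min ltr01 !divr_gt0.
have [d1 d10 H1] := Hg _ e10; have [d2 d20 H2] := Hf _ e20; have [d3 d30 H3] := has_deriv_cont Hf d10.
exists (Num.min d2 d3); first by rewrite lt_min d20.
move=> h; rewrite lt_min => /andP[/H2 h2 /H3 h3].
have {H1} := H1 _ h3; rewrite subrKC; set k := f (x + h) - f x in h2 h3 * => h1.
rewrite (_ : _ - _ = (g (f (x + h)) - g (f x) - m * k) + m * (k - l * h)); last by ring.
apply: le_trans (ler_normD _ _) _; rewrite normrM.
have hk : `|k| <= (`|l| + 1) * `|h|.
  have := ler_normD (k - l * h) (l * h); rewrite subrK normrM.
  have : e2 * `|h| <= 1 * `|h| by rewrite ler_wpM2r// ge_min lexx.
  lra.
have q1 : e1 * `|k| <= e / 2 * `|h|.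
  apply: le_trans (_ : e1 * ((`|l| + 1) * `|h|) <= _); first by rewrite ler_pM2l.
  by rewrite mulrA divfK ?gt_eqF.
have q2 : `|m| * `|k - l * h| <= e / 2 * `|h|.
  apply: le_trans (_ : (`|m| + 1) * (e / 2 / (`|m| + 1) * `|h|) <= _).
    apply: ler_pM => //; first by lra.
    by apply: le_trans h2 _; rewrite ler_wpM2r// ge_min lexx orbT.
  by rewrite mulrA mulrCA divff ?gt_eqF// mulr1.
lra.
Qed.

Lemma has_deriv_sqr x : has_deriv (fun s => s ^+ 2) x (2 * x).
Proof.
move=> e e0; exists e => // h /ltW he; rewrite (_ : _ - _ = h * h); last by ring.
by rewrite normrM ler_wpM2r.
Qed.

(** By polarization, [f g] is half of [(f + g)^2 - f^2 - g^2], so the chain rule for the square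
    suffices. *)
Lemma has_derivM f g x l m : has_deriv f x l -> has_deriv g x m ->
  has_deriv (fun s => f s * g s) x (l * g x + f x * m).
Proof.
move=> Hf Hg.
have Hs := has_deriv_comp (has_derivD Hf Hg) (has_deriv_sqr _).
have Hf2 := has_deriv_comp Hf (has_deriv_sqr _); have Hg2 := has_deriv_comp Hg (has_deriv_sqr _).
have := has_derivZ 2^-1 (has_derivD Hs (has_derivZ (-1) (has_derivD Hf2 Hg2))).
rewrite (_ : 2^-1 * _ = l * g x + f x * m); last by field.
by rewrite (_ : (fun _ => _) = (fun s => f s * g s)); last by apply/funext => s; field.
Qed.

Lemma has_deriv_sum (I : finType) (F : I -> R -> R) (l : I -> R) x :
  (forall i, has_deriv (F i) x (l i)) -> has_deriv (fun s => \sum_i F i s) x (\sum_i l i).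
Proof.
move=> H; rewrite (_ : (fun s => _) = (\sum_i F i)); last by apply/funext => s; rewrite fct_sumE.
elim/big_ind2 : _ => [|f m g n|//]; [exact: has_deriv_cst|exact: has_derivD].
Qed.

Local Notation mu := (@lebesgue_measure R).

Lemma lebesgue_negligibleS (A B : set R) : A `<=` B -> mu.-negligible B -> mu.-negligible A.
Proof. by move=> AB; apply: negligibleS. Qed.

(** A zero with non-zero derivative is isolated. The sets [A n] of zeros isolated at scale
    [1 / (n + 1)] are countable and cover all of them. This is what allows the chain rule for [relu]
    at almost every time. *)
Lemma zero_crossing_negligible (z : R -> R) :
  mu.-negligible [set s : R | z s = 0 /\ exists2 l, has_deriv z s l & l <> 0].
Proof.
pose A (n : nat) : set R := [set s | z s = 0 /\ forall h, h != 0 -> `|h| < n.+1%:R^-1 -> z (s + h) != 0].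
(* Two points with the same floor lie in one cell of length [1 / (n + 1)], closer than the isolation
   radius, hence coincide. *)
have cA n : countable (A n).
  apply/countable_injP; exists (fun s => pickle (Num.floor (s * n.+1%:R))) => s t.
  rewrite !inE => -[zs hs] [zt ht] /(pcan_inj pickleK) E.
  apply/eqP; apply: contrapT => /negP st.
  have : z (s + (t - s)) != 0.
    apply: hs; first by rewrite subr_eq0 eq_sym.
    have /andP[h1 h2] := floor_itv (s * n.+1%:R); have /andP[h3 h4] := floor_itv (t * n.+1%:R).
    move: h1 h2 h3 h4; rewrite E intrD => h1 h2 h3 h4.
    by rewrite -[_^-1]mul1r ltr_pdivlMr// -[X in _ * X](@gtr0_norm _ n.+1%:R)// -normrM mulrBl ltr_norml; apply/andP; split; lra.
  by rewrite subrKC zt eqxx.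
have nA : mu.-negligible (\bigcup_n A n).
  apply: negligible_bigcup => n; apply/negligibleP; last exact: countable_lebesgue_measure0.
  by apply: countable_measurable => // t; exact: measurable_set1.
apply: lebesgue_negligibleS nA => s [zs [l Hl l0]].
have l20 : 0 < `|l| / 2 by rewrite divr_gt0// normr_gt0; apply/eqP.
have [d d0 Hd] := Hl _ l20.
have [n nd] : exists n : nat, n.+1%:R^-1 < d.
  have [n _ Hn] := near_infty_natSinv_lt (PosNum d0); exists n; exact: (Hn n (leqnn n)).
exists n => //; split=> // h h0 /lt_trans /(_ nd) /Hd; rewrite zs subr0.
apply: contraTN => /eqP ->; rewrite sub0r normrN normrM -ltNge ltr_pM2r ?normr_gt0//.
by have := l20; lra.
Qed.

Lemma negligible_exists_fin (I : finType) (A : I -> set R) :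
  (forall i, mu.-negligible (A i)) -> mu.-negligible [set s | exists i, A i s].
Proof.
move=> H; have : mu.-negligible [set s | exists2 i, i \in enum I & A i s].
  elim: (enum I) => [|i e IH].
    by apply: (lebesgue_negligibleS _ (negligible_set0 mu)) => s [].
  apply: lebesgue_negligibleS (negligibleU (H i) IH) => s [k].
  by rewrite inE => /orP[/eqP -> As|ke As]; [left|right; exists k].
by apply: lebesgue_negligibleS => s [i Ai]; exists i; rewrite ?mem_enum.
Qed.

(** The exceptional null set is covered by an open [U] of measure below the [dl] of absolute
    continuity. Intervals around an exceptional point are collected in the list [s] and charged to
    [U]; around the other points [f] grows by at most [e'] per unit length. [cousin] adds up the two
    kinds, and absolute continuity bounds the collected increments. *)
Lemma abs_cont_nonincr f a b : a <= b -> abs_cont_on f a b ->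
  mu.-negligible [set s | (a < s /\ s < b) /\ ~ (derivable f s 1 /\ derive1 f s <= 0)] ->
  f b <= f a.
Proof.
move=> ab acf ngl.
rewrite -subr_le0; apply/ler_addgt0Pl => e e0; rewrite addr0.
have e20 : 0 < e / 2 by rewrite divr_gt0.
have [dl dl0 Hac] := acf _ e20.
pose N := [set s | (a < s /\ s < b) /\ ~ (derivable f s 1 /\ derive1 f s <= 0)] `|` [set a] `|` [set b].
have nN : mu.-negligible N.
  apply: negligibleU; first apply: negligibleU => //; apply/negligibleP => //; exact: lebesgue_measure_set1.
have [M [mM M0 NM]] := nN.
have M0' : (mu M < +oo)%E by rewrite M0 ltry.
have [U [oU MU UM]] := lebesgue_regularity_outer mM M0' dl0.
have mU : measurable U by exact: open_measurable.
have mUdl : (mu U < dl%:E)%E.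
  have h0 : mu (U `&` M) = 0%E.
    by apply/eqP; rewrite eq_le measure_ge0 andbT -M0; apply: le_measure; rewrite ?inE//; exact: measurableI.
  rewrite (measureDI mu mU mM) [X in (_ + X)%E](_ : _ = 0%E); last exact: h0.
  by rewrite adde0.
(* Half-open intervals make [m] additive under concatenation. *)
pose m u v := mu (U `&` `[u, v[%classic).
pose Q u v := exists s : seq (R * R),
  [/\ forall p, p \in s -> [/\ u <= p.1, p.1 <= p.2 & p.2 <= v],
      pairwise (fun p q => p.2 <= q.1) s,
      ((\sum_(p <- s) (p.2 - p.1))%:E <= m u v)%E &
      f v - f u <= e / 2 / (1 + (b - a)) * (v - u) + \sum_(p <- s) `|f p.2 - f p.1|].
have ba0 : 0 < 1 + (b - a) by lra.
set e' := e / 2 / (1 + (b - a)) in Q.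
have e'0 : 0 < e' by rewrite divr_gt0.
have : Q a b.
  apply: cousin => //.
    move=> u v w uv vw [s [s1 s2 s3 s4]] [t [t1 t2 t3 t4]]; exists (s ++ t); split.
    - move=> p; rewrite mem_cat => /orP[/s1[]|/t1[]] h1 h2 h3; split => //.
        exact: le_trans vw.
      exact: le_trans h1.
    - rewrite pairwise_cat s2 t2 !andbT; apply/allrelP => p q /s1[_ _ h] /t1[h' _ _].
      exact: le_trans h'.
    - rewrite big_cat /= EFinD /m.
      have -> : `[u, w[%classic = `[u, v[%classic `|` `[v, w[%classic :> set R.
        by rewrite -itv_bndbnd_setU // bnd_simp.
      rewrite setIUr measureU; [exact: leeD| exact: measurableI|exact: measurableI|].
      rewrite -setIIr; apply/seteqP; split=> // x [_ []]; rewrite /= !in_itv /=.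
      by move=> /andP[_ h] /andP[h' _]; have := lt_le_trans h h'; rewrite ltxx.
    - rewrite big_cat /=; lra.
  move=> x ax xb; have [Nx|Nx] := pselect (N x).
    have /nbhs_ballP[d /= d0 Hd] : nbhs x U by apply: open_nbhs_nbhs; split=> //; apply/MU/NM.
    exists d => // u v au ux xv vb vud; exists [:: (u, v)]; split=> //.
    - by move=> p; rewrite inE => /eqP ->; split=> //=; apply: le_trans xv.
    - rewrite big_seq1 /= /m setIidr.
        rewrite lebesgue_measure_itv /= lte_fin; case: ltP => //.
        by rewrite lee_fin subr_le0.
      move=> z; rewrite /= in_itv /= => /andP[uz zv]; apply: Hd; rewrite /ball /=.
      by rewrite ltr_norml; apply/andP; split; lra.
    - rewrite big_seq1 /=; have := ler_norm (f v - f u).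
      have : 0 <= e' * (v - u) by apply: mulr_ge0; [exact: ltW|lra].
      lra.
  have [df f'0] : derivable f x 1 /\ derive1 f x <= 0.
    apply: contrapT => h; apply: Nx; have [->|xa] := eqVneq x a; first by left; right.
    have [->|xb'] := eqVneq x b; first by right.
    by left; left; split=> //; split; rewrite lt_neqAle ?ax ?xb ?andbT // eq_sym.
  have [d d0 H] := derivable_approx df e'0.
  exists d => // u v au ux xv vb vud; exists [::]; split=> //.
    by rewrite big_nil /m.
  rewrite big_nil addr0.
  have := H (v - x); have := H (u - x).
  rewrite !subrKC (ger0_norm (_ : 0 <= v - x)) ?subr_ge0// (ler0_norm (_ : u - x <= 0)) ?subr_le0//.
  have h1 : - (u - x) < d by lra.
  have h2 : v - x < d by lra.
  move=> /(_ h1) + /(_ h2).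
  rewrite !ler_norml => /andP[+ _] => k1 /andP[_ k2].
  have : derive1 f x * (v - u) <= 0 by apply: mulr_le0_ge0 => //; lra.
  move: k1 k2; lra.
move=> [s [s1 s2 s3 s4]].
have sdl : \sum_(p <- s) (p.2 - p.1) < dl.
  rewrite -lte_fin; apply: le_lt_trans mUdl; apply: le_trans s3 _.
  by apply: le_measure; rewrite ?inE//; exact: measurableI.
have := Hac (size s) (fun k => (nth (0, 0) s k).1) (fun k => (nth (0, 0) s k).2).
have E (g : R * R -> R) : \sum_(k < size s) g (nth (0, 0) s k) = \sum_(p <- s) g p.
  by rewrite (big_nth (0, 0)) big_mkord.
rewrite (E (fun p => p.2 - p.1)) (E (fun p => `|f p.2 - f p.1|)) => H.
have : \sum_(p <- s) `|f p.2 - f p.1| < e / 2.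
  apply: H => //.
    by move=> k; have [] := s1 _ (mem_nth (0, 0) (ltn_ord k)).
  move=> k k' kk'; have /(pairwiseP (0, 0)) sP := s2.
  have [lt|lt|/val_inj /eqP] := ltngtP k k'; [left|right|by rewrite (negbTE kk')].
    by apply: sP lt; exact: ltn_ord.
  by apply: sP lt; exact: ltn_ord.
have : e' * (b - a) <= e / 2.
  rewrite /e' mulrAC ler_pdivrMr // ler_wpM2l ?ltW //; lra.
lra.
Qed.

(** Since [(M + 1) x - F x] is nondecreasing too, the Stieltjes measure of [F] has a Radon-Nikodym
    density with respect to Lebesgue measure; [F] is then an indefinite integral, and the
    fundamental theorem of calculus gives its derivative almost everywhere. *)
Lemma nondecr_lipschitz_derivable (F : R -> R) (M a b : R) : a < b ->
  (forall x y, x <= y -> 0 <= F y - F x <= M * (y - x)) ->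
  mu.-negligible [set s | (a < s /\ s < b) /\ ~ derivable F s 1].
Proof.
move=> ab H.
have M0 : 0 <= M by have /andP[h1 h2] := H 0 1 ler01; move: (le_trans h1 h2); rewrite subr0 mulr1.
have ndF : nondecreasing F by move=> x y /H /andP[h _]; rewrite -subr_ge0.
have ndG : nondecreasing (fun x => (M + 1) * x - F x).
  by move=> x y xy; have /andP[_ h] := H _ _ xy; lra.
have cF : continuous F.
  move=> x; apply/cvgrPdist_le => e e0; near=> y.
  have : `|x - y| <= e / (1 + M) by near: y; apply: cvgr_dist_le => //; rewrite divr_gt0//; lra.
  rewrite ler_pdivlMr; last lra.
  apply: le_trans; have [xy|/ltW yx] := leP x y.
    have /andP[h1 h2] := H _ _ xy; rewrite distrC ger0_norm// distrC ger0_norm ?subr_ge0//; nra.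
  have /andP[h1 h2] := H _ _ yx; rewrite ger0_norm// ger0_norm ?subr_ge0//; nra.
have cG : continuous (fun x => (M + 1) * x - F x).
  by move=> x; apply: cvgB; [apply: cvgMr; exact: cvg_id|exact: cF].
pose mF := isCumulative.Build R _ R F ndF (right_continuousW cF).
pose F' : cumulative R R := HB.pack F mF.
pose mG := isCumulative.Build R _ R _ ndG (right_continuousW cG).
pose G' : cumulative R R := HB.pack (fun x => (M + 1) * x - F x) mG.
pose nu : {measure set (measurableTypeR R) -> \bar R} := lebesgue_stieltjes_measure F'.
pose nuG : {measure set (measurableTypeR R) -> \bar R} := lebesgue_stieltjes_measure G'.
have nuE x y : x <= y -> nu `]x, y]%classic = (F y - F x)%:E.
  move=> xy; rewrite /nu /nuG /= /lebesgue_stieltjes_measure /measure_extension.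
  by rewrite measurable_mu_extE /= ?wlength_itv_bnd //; exact: is_ocitv.
have nuGE x y : x <= y -> nuG `]x, y]%classic = ((M + 1) * y - F y - ((M + 1) * x - F x))%:E.
  move=> xy; rewrite /nu /nuG /= /lebesgue_stieltjes_measure /measure_extension.
  by rewrite measurable_mu_extE /= ?wlength_itv_bnd //; exact: is_ocitv.
have nuab : (nu `]a, b]%classic < +oo)%E by rewrite nuE ?ltW// ltry.
have dom (A : set (measurableTypeR R)) : measurable A -> mu A = 0%E -> nu A = 0%E.
  move=> mA A0.
  have M10 : 0 <= (M + 1)^-1 by rewrite invr_ge0; lra.
  (* The two Stieltjes measures add up to [M + 1] times Lebesgue measure on half-open intervals,
     hence everywhere, so a Lebesgue null set is null for each. The 1 keeps the factor invertible
     when [M = 0]. *)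
  pose m2 : {measure set (measurableTypeR R) -> \bar R} := mscale (NngNum M10) (measure_add nu nuG).
  have m2D X : m2 X = (((M + 1)^-1)%:E * (nu X + nuG X))%E.
    by rewrite /m2 -measure_addE.
  have m2E X : ocitv X -> mu X = m2 X.
    case=> -[x y] _ <- /=; have [xy|yx] := leP x y; last first.
      by rewrite set_itv_ge ?measure0 // -leNgt bnd_simp ltW.
    rewrite m2D nuE // nuGE // lebesgue_measure_itv /= lte_fin.
    rewrite -EFinD -EFinM (_ : _ - F x + _ = (M + 1) * (y - x)); last by ring.
    rewrite mulKf; last by rewrite gt_eqF//; lra.
    by case: ltP => // yx; rewrite (le_anti (_ : x <= y <= x)) ?subrr // xy yx.
  have : m2 A = 0%E by rewrite -(lebesgue_measure_unique m2E).
  rewrite m2D => /eqP.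
  rewrite mule_eq0 eqe invr_eq0 gt_eqF /=; last lra.
  by rewrite padde_eq0 // => /andP[/eqP].
have mab : measurable (`]a, b]%classic : set (measurableTypeR R)) by exact: measurable_itv.
pose nu1 : {finite_measure set (measurableTypeR R) -> \bar R} := mfrestr mab nuab.
have dom1 : nu1 `<< mu.
  apply/null_content_dominatesP => A mA A0; apply: dom; first exact: measurableI.
  apply/eqP; rewrite eq_le measure_ge0 andbT -A0; apply: le_measure; rewrite ?inE//; exact: measurableI.
pose g := Radon_Nikodym_SigmaFinite.f nu1 mu.
have g0 := Radon_Nikodym_SigmaFinite.f_ge0 dom1.
have gf := Radon_Nikodym_SigmaFinite.f_fin_num dom1.
have gi := Radon_Nikodym_SigmaFinite.f_integrable dom1.
have gE := Radon_Nikodym_SigmaFinite.f_integral dom1.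
rewrite -/g in g0 gf gi gE.
have gEE : EFin \o (fine \o g) = g by apply/funext => x /=; rewrite fineK.
have gi' : mu.-integrable setT (EFin \o (fine \o g)) by rewrite gEE.
have := @FTC1 R (fine \o g) (BRight a).
have h1 : forall y, mu.-integrable [set` Interval (BRight a) (BRight y)] (EFin \o (fine \o g)).
  by move=> y; apply: integrableS gi'.
have h2 : locally_integrable [set: R] (fine \o g).
  by apply: open_integrable_locally => //; exact: openT.
move=> /(_ h1 h2) /= h3.
have sub : [set s : R | (a < s /\ s < b) /\ ~ derivable F s 1] `<=`
    [set s : R | ~ ((a%:E < s%:E)%E -> derivable (fun x : R => \int[mu]_(t in `]a, x]) (fine \o g) t) s 1 /\
      derive1 (fun x : R => \int[mu]_(t in `]a, x]) (fine \o g) t) s = (fine \o g) s)]; last by exact: (lebesgue_negligibleS sub h3).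
move=> s [[as_ sb] nd] /= h; apply: nd.
have [] := h; first by rewrite lte_fin.
set F0 := (X in derivable X s 1) => dF0 _.
have dF1 := has_derivD (derivable_has_deriv dF0) (has_deriv_cst (F a) s).
have d0 : 0 < Num.min (s - a) (b - s) by rewrite lt_min !subr_gt0 as_.
apply: (proj1 (has_derivP (has_deriv_near (g := F) d0 _ dF1))) => k.
rewrite lt_min !ltr_norml => /andP[/andP[k1 k2] /andP[k3 k4]]; set y := s + k.
have ay : a < y by rewrite /y; lra.
have yb : y < b by rewrite /y; lra.
have : nu1 `]a, y]%classic = (F y - F a)%:E.
  rewrite -nuE ?ltW// /nu1 /mfrestr /mrestr /=; congr (lebesgue_stieltjes_measure _ _).
  by rewrite setIidl // => z /=; rewrite !in_itv/= => /andP[-> h5]; apply: le_trans h5 (ltW yb).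
rewrite gE; last exact: measurable_itv.
rewrite -gEE => h5.
by rewrite /F0 /Rintegral h5 /= subrK.
Unshelve. all: by end_near. Qed.

(** The argument is clamped to [[a, b]] and [K] times it is added: the result is nondecreasing and
    Lipschitz with constant [2 K] on the whole line, and near an interior point it differs from [f]
    by a linear term only. *)
Lemma lipschitz_ae_derivable f (K a b : R) : a < b ->
  (forall x y, a <= x -> x <= y -> y <= b -> `|f y - f x| <= K * (y - x)) ->
  mu.-negligible [set s | (a < s /\ s < b) /\ ~ derivable f s 1].
Proof.
move=> ab Hf.
pose cl x := Num.max a (Num.min b x).
have cla x : a <= cl x by rewrite /cl le_max lexx.
have clb x : cl x <= b by rewrite /cl ge_max ge_min lexx ltW.
have clE x : a <= x -> x <= b -> cl x = x.
  by move=> ax xb; rewrite /cl (min_idPr xb) (max_idPr ax).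
have cl_nd x y : x <= y -> cl x <= cl y /\ cl y - cl x <= y - x.
  by move=> xy; rewrite /cl /Num.max /Num.min; do ! case: ifPn; rewrite -?leNgt => *; split; lra.
have K0 : 0 <= K.
  by have := Hf _ _ (lexx _) (ltW ab) (lexx _); move/(le_trans (normr_ge0 _)); rewrite pmulr_lge0// subr_gt0.
pose F x := f (cl x) + K * cl x.
have HF x y : x <= y -> 0 <= F y - F x <= 2 * K * (y - x).
  move=> xy; have [h1 h2] := cl_nd _ _ xy.
  have := Hf _ _ (cla x) h1 (clb y); rewrite ler_norml /F => /andP[h3 h4].
  have : K * (cl y - cl x) <= K * (y - x) by rewrite ler_wpM2l.
  by move=> h5; apply/andP; split; lra.
have sub : [set s : R | (a < s /\ s < b) /\ ~ derivable f s 1] `<=`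
    [set s : R | (a < s /\ s < b) /\ ~ derivable F s 1].
  move=> s [[as_ sb] nd]; split; first by split.
  move=> /derivable_has_deriv dF; apply: nd.
  have dF1 := has_derivD dF (has_derivZ (- K) (has_deriv_id s)).
  have d0 : 0 < Num.min (s - a) (b - s) by rewrite lt_min !subr_gt0 as_.
  apply: (proj1 (has_derivP (has_deriv_near (g := f) d0 _ dF1))) => h.
  rewrite lt_min !ltr_norml => /andP[/andP[h1 h2] /andP[h3 h4]].
  rewrite /F clE; [ring|lra|lra].
exact: (lebesgue_negligibleS sub (nondecr_lipschitz_derivable ab HF)).
Qed.

(** The route by which absolute continuity passes to residuals, losses, inner products and square
    roots: their increments are controlled by those of finitely many absolutely continuous
    functions. *)
Lemma abs_cont_dominated (I : finType) (F : I -> R -> R) g (C a b : R) :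
  (forall i, abs_cont_on (F i) a b) ->
  (forall l r, a <= l -> l <= r -> r <= b -> `|g r - g l| <= C * \sum_i `|F i r - F i l|) ->
  abs_cont_on g a b.
Proof.
move=> acF H e e0.
pose C' := `|C| + 1; have C'0 : 0 < C' by rewrite /C' ltr_wpDl.
(* The successor of the cardinal keeps the last inequality strict and covers an empty index type. *)
pose e' := e / (C' * (#|I|.+1)%:R).
have e'0 : 0 < e' by rewrite divr_gt0// mulr_gt0.
have /choice[d Hd] i : exists d : R, 0 < d /\
    forall (n : nat) (l r : 'I_n -> R),
      (forall k, a <= l k /\ l k <= r k /\ r k <= b) ->
      (forall k k', k != k' -> r k <= l k' \/ r k' <= l k) ->
      \sum_k (r k - l k) < d -> \sum_k `|F i (r k) - F i (l k)| < e'.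
  by have [d d0 Hd] := acF i _ e'0; exists d.
exists (\big[Num.min/1]_i d i); first by apply: lt_bigmin => // i _; case: (Hd i).
move=> n l r h1 h2 h3.
have : \sum_k `|g (r k) - g (l k)| <= \sum_k C' * \sum_i `|F i (r k) - F i (l k)|.
  apply: ler_sum => k _; have [h4 [h5 h6]] := h1 k; apply: le_trans (H _ _ h4 h5 h6) _.
  apply: ler_wpM2r; first by apply: sumr_ge0.
  by rewrite /C'; have := ler_norm C; lra.
move=> /le_lt_trans; apply.
rewrite -mulr_sumr exchange_big /=.
have : \sum_i \sum_k `|F i (r k) - F i (l k)| <= \sum_(i : I) e'.
  apply: ler_sum => i _; apply: ltW; apply: (proj2 (Hd i)) => //.
  by apply: lt_le_trans h3 _; exact: bigmin_le_cond.
rewrite sumr_const => h4.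
have : C' * (\sum_i \sum_k `|F i (r k) - F i (l k)|) <= C' * (e' *+ #|I|) by rewrite ler_wpM2l// ltW.
move=> /le_lt_trans; apply.
rewrite -mulr_natr /e' invfM !mulrA (mulrAC C') -mulrA mulrAC.
rewrite (_ : C' * e / C' = e); last by rewrite mulrAC divff ?mul1r// gt_eqF.
by rewrite gtr_pMr// mulrC ltr_pdivrMr ?ltr0n// mul1r ltr_nat.
Qed.

Lemma lipschitz_abs_cont g (C a b : R) :
  (forall l r, a <= l -> l <= r -> r <= b -> `|g r - g l| <= C * (r - l)) ->
  abs_cont_on g a b.
Proof.
move=> H; apply: (@abs_cont_dominated unit (fun _ x => x) g C) => [_ e e0|l r al lr rb].
  exists e => // n l r h1 h2 h3; apply: le_lt_trans h3.
  by apply: ler_sum => k _; rewrite ger0_norm ?subr_ge0//; have [_ []] := h1 k.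
by rewrite big_const card_unit /= addr0 (ger0_norm (_ : 0 <= r - l)) ?subr_ge0//; exact: H.
Qed.

Lemma abs_cont_onS f (a b a' b' : R) : a <= a' -> b' <= b ->
  abs_cont_on f a b -> abs_cont_on f a' b'.
Proof.
move=> aa bb H e /H[d d0 Hd]; exists d => // n l r h1 h2; apply: Hd => // k.
have [h3 [h4 h5]] := h1 k; split; first exact: le_trans h3.
by split=> //; exact: le_trans bb.
Qed.

Lemma abs_cont_unif f (a b e : R) : abs_cont_on f a b -> 0 < e ->
  exists2 d : R, 0 < d & forall x y, a <= x -> x <= y -> y <= b -> y - x < d -> `|f y - f x| < e.
Proof.
move=> H /H[d d0 Hd]; exists d => // x y ax xy yb yx.
have := Hd 1%N (fun=> x) (fun=> y); rewrite !big_ord1; apply => //.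
by move=> k k'; rewrite !ord1 eqxx.
Qed.

Lemma abs_cont_bounded f (a b : R) : a <= b -> abs_cont_on f a b ->
  exists M : R, forall x, a <= x -> x <= b -> `|f x| <= M.
Proof.
move=> ab H; have [d d0 Hd] := abs_cont_unif H ltr01.
apply: (@cousin a b (fun u v => exists M : R, forall x, u <= x -> x <= v -> `|f x| <= M)) => //.
  move=> u v w uv vw [M1 h1] [M2 h2]; exists (Num.max M1 M2) => x ux xw.
  rewrite le_max; have [xv|/ltW vx] := leP x v; first by rewrite h1.
  by rewrite h2 ?orbT.
move=> x ax xb; exists d => // u v au ux xv vb uv; exists (`|f u| + 1) => z uz zv.
have := Hd u z au uz; have h1 : z <= b by lra.
have h2 : z - u < d by lra.
move=> /(_ h1 h2) h3; have := ler_normD (f u) (f z - f u); rewrite subrKC; lra.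
Qed.

(** The monotonicity criterion is applied to [f s - K s] and to [- f s - K s]. *)
Lemma abs_cont_ae_lipschitz f (K a b : R) : abs_cont_on f a b ->
  mu.-negligible [set s | (a < s /\ s < b) /\ ~ (derivable f s 1 /\ `|derive1 f s| <= K)] ->
  forall x y, a <= x -> x <= y -> y <= b -> `|f y - f x| <= K * (y - x).
Proof.
move=> acf ng x y ax xy yb.
have acf' : abs_cont_on f x y by apply: abs_cont_onS acf.
have aci (c : R) : abs_cont_on (fun s => c * s) x y.
  apply: (@lipschitz_abs_cont _ `|c|) => l r _ lr _.
  by rewrite -mulrBr normrM (ger0_norm (_ : 0 <= r - l)) ?subr_ge0.
have key (h : R -> R) : abs_cont_on h x y ->
    (forall s, derivable f s 1 -> `|derive1 f s| <= K -> derivable h s 1 /\ derive1 h s <= 0) -> h y <= h x.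
  move=> ach hh; apply: (abs_cont_nonincr xy ach).
  have sub : [set s : R | (x < s /\ s < y) /\ ~ (derivable h s 1 /\ derive1 h s <= 0)] `<=`
    [set s : R | (a < s /\ s < b) /\ ~ (derivable f s 1 /\ `|derive1 f s| <= K)].
    move=> s [[xs sy] nd]; split.
      by split; [exact: le_lt_trans xs|exact: lt_le_trans yb].
    by move=> [d1 d2]; apply: nd; exact: hh.
  exact: lebesgue_negligibleS sub ng.
rewrite ler_norml; apply/andP; split.
  have : (fun s => - f s - K * s) y <= (fun s => - f s - K * s) x; last by move=> /=; lra.
  apply: (key (fun s => - f s - K * s)) => [|s d1 d2].
    have acb (b0 : bool) : abs_cont_on (fun s => if b0 then f s else K * s) x y by case: b0.
    apply: (abs_cont_dominated (C := 1) acb).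
    move=> l r _ _ _; rewrite big_bool /= mul1r.
    rewrite [X in `|X| <= _](_ : _ = - (f r - f l) - (K * r - K * l)); last by ring.
    by rewrite -(normrN (f r - f l)); exact: ler_normB.
  have := has_derivD (has_derivZ (-1) (derivable_has_deriv d1)) (has_derivZ (- K) (has_deriv_id s)).
  rewrite (_ : (fun _ => _) = (fun s => - f s - K * s)); last by apply/funext => z; ring.
  move=> /has_derivP[h1 ->]; split=> //; move: d2; rewrite ler_norml => /andP[]; lra.
have : (fun s => f s - K * s) y <= (fun s => f s - K * s) x; last by move=> /=; lra.
apply: (key (fun s => f s - K * s)) => [|s d1 d2].
  have acb (b0 : bool) : abs_cont_on (fun s => if b0 then f s else K * s) x y by case: b0.
    apply: (abs_cont_dominated (C := 1) acb).
  move=> l r _ _ _; rewrite big_bool /= mul1r.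
  rewrite [X in `|X| <= _](_ : _ = (f r - f l) - (K * r - K * l)); last by ring.
  exact: ler_normB.
have := has_derivD (derivable_has_deriv d1) (has_derivZ (- K) (has_deriv_id s)).
rewrite (_ : (fun _ => _) = (fun s => f s - K * s)); last by apply/funext => z; ring.
move=> /has_derivP[h1 ->]; split=> //; move: d2; rewrite ler_norml => /andP[]; lra.
Qed.
End AbsCont.

(** * Differential inclusions *)

Section Euler.
Variables (R : realType) (m n : nat).
Implicit Types (W V : 'M[R]_(m, n)).

Definition l1norm W : R := \sum_i \sum_j `|W i j|.

Lemma l1norm_ge0 W : 0 <= l1norm W.
Proof. by do 2! apply: sumr_ge0 => ? _. Qed.

Lemma ler_l1norm W i j : `|W i j| <= l1norm W.
Proof.
rewrite /l1norm (bigD1 i) //= (bigD1 j) //= -addrA lerDl addr_ge0 //.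
  by apply: sumr_ge0.
by do 2! apply: sumr_ge0 => ? _.
Qed.

Lemma l1normD W V : l1norm (W + V) <= l1norm W + l1norm V.
Proof.
rewrite /l1norm -big_split /=; apply: ler_sum => i _; rewrite -big_split /=.
by apply: ler_sum => j _; rewrite mxE ler_normD.
Qed.

Lemma l1normZ k W : l1norm (k *: W) = `|k| * l1norm W.
Proof.
rewrite /l1norm mulr_sumr; apply: eq_bigr => i _; rewrite mulr_sumr.
by apply: eq_bigr => j _; rewrite mxE normrM.
Qed.

Lemma frobDl W1 W2 V : frob (W1 + W2) V = frob W1 V + frob W2 V.
Proof.
rewrite /frob -big_split; apply: eq_bigr => i _; rewrite -big_split.
by apply: eq_bigr => j _; rewrite mxE mulrDl.
Qed.

Lemma frobZl k W V : frob (k *: W) V = k * frob W V.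
Proof.
rewrite /frob mulr_sumr; apply: eq_bigr => i _; rewrite mulr_sumr.
by apply: eq_bigr => j _; rewrite mxE mulrA.
Qed.

Lemma frobNl W V : frob (- W) V = - frob W V.
Proof. by rewrite -scaleN1r frobZl mulN1r. Qed.

Lemma frobBl W1 W2 V : frob (W1 - W2) V = frob W1 V - frob W2 V.
Proof. by rewrite frobDl frobNl. Qed.

Lemma frob_suml (I : Type) (r : seq I) (F : I -> 'M[R]_(m, n)) V :
  frob (\sum_(k <- r) F k) V = \sum_(k <- r) frob (F k) V.
Proof.
elim/big_ind2 : _ => [|? ? ? ? <- <-|//]; last by rewrite frobDl.
by rewrite /frob big1// => i _; rewrite big1// => j _; rewrite mxE mul0r.
Qed.

Lemma frob_l1 W V (e : R) : (forall i j, `|W i j| <= e) -> `|frob W V| <= e * l1norm V.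
Proof.
move=> H; rewrite /frob /l1norm; apply: le_trans (ler_norm_sum _ _ _) _; rewrite mulr_sumr.
apply: ler_sum => i _; apply: le_trans (ler_norm_sum _ _ _) _; rewrite mulr_sumr.
by apply: ler_sum => j _; rewrite normrM ler_wpM2r.
Qed.

Variables (f : 'M[R]_(m, n) -> R) (g : 'M[R]_(m, n) -> 'M[R]_(m, n)) (A : R).
Hypothesis A0 : 0 <= A.
Hypothesis gP : forall W, clarke_subdiff f W (g W).
Hypothesis gA : forall W, l1norm (g W) <= A * (1 + l1norm W).
Variables (T0 : R) (W0 : 'M[R]_(m, n)).

Let h (N : nat) : R := N.+1%:R^-1.
Fixpoint euler N k := if k is k'.+1 then euler N k' - h N *: g (euler N k') else W0.
Definition euler_step N (s : R) : nat := Num.truncn ((s - T0) / h N).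
(** Piecewise constant rather than interpolated: every value is an Euler iterate, at which [gP]
    supplies a Clarke subgradient. *)
Definition euler_curve N (s : R) := euler N (euler_step N s).

Let h0 N : 0 < h N. Proof. by rewrite invr_gt0. Qed.

Let B (tau : R) := (1 + l1norm W0) * expR (A * tau).

(** A discrete Gronwall inequality: a step multiplies [1 + l1norm] by at most [1 + A h], which is
    below [expR (A h)]. *)
Lemma euler_bound N k : 1 + l1norm (euler N k) <= B (h N * k%:R).
Proof.
elim: k => [|k IH]; first by rewrite /B !mulr0 expR0 mulr1.
rewrite /=.
have : l1norm (euler N k - h N *: g (euler N k)) <= l1norm (euler N k) + h N * (A * (1 + l1norm (euler N k))).
  apply: le_trans (l1normD _ _) _; rewrite lerD2l -scaleNr l1normZ normrN gtr0_norm //.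
  by rewrite ler_pM2l.
have : (1 + l1norm (euler N k)) * (1 + A * h N) <= B (h N * k%:R) * expR (A * h N).
  apply: ler_pM => //; first by rewrite addr_ge0// l1norm_ge0.
  - by rewrite addr_ge0// mulr_ge0// ltW.
  - exact: expR_ge1Dx.
rewrite /B -mulrA -expRD (_ : A * (h N * k%:R) + A * h N = A * (h N * k.+1%:R)); last by rewrite -natr1; ring.
lra.
Qed.

Let G (tau : R) := A * B tau.

Let B_le s t : s <= t -> B s <= B t.
Proof. by move=> st; rewrite /B ler_pM2l ?ler_expR ?ler_wpM2l// ltr_wpDr// l1norm_ge0. Qed.

Lemma euler_diff N (tau : R) k k' : (k <= k')%N -> h N * k'%:R <= tau -> forall i j,
  `|euler N k' i j - euler N k i j| <= G tau * (h N * (k' - k)%:R).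
Proof.
move=> + + i j; elim: k' => [|k' IH].
  by rewrite leqn0 => /eqP -> _; rewrite !subrr normr0 !mulr0.
rewrite leq_eqVlt => /orP[/eqP -> _|]; first by rewrite subnn subrr normr0 !mulr0.
rewrite ltnS => kk' ht.
have ht' : h N * k'%:R <= tau by apply: le_trans ht; rewrite ler_pM2l// ler_nat.
have H := IH kk' ht'.
rewrite /= !mxE (subSn kk') -natr1.
have : `|h N * g (euler N k') i j| <= h N * G tau.
  rewrite normrM gtr0_norm// ler_pM2l//; apply: le_trans (ler_l1norm _ _ _) _.
  apply: le_trans (gA _) _; rewrite ler_wpM2l//.
  by apply: le_trans (euler_bound _ _) _; exact: B_le.
have := ler_normB (euler N k' i j - euler N k i j) (h N * g (euler N k') i j).
rewrite (_ : euler N k' i j - euler N k i j - h N * g (euler N k') i j =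
  euler N k' i j - h N * g (euler N k') i j - euler N k i j); last by ring.
lra.
Qed.

Lemma euler_sum N k k' : (k <= k')%N ->
  euler N k - euler N k' = h N *: \sum_(k <= l < k') g (euler N l).
Proof.
elim: k' => [|k' IH]; first by rewrite leqn0 => /eqP ->; rewrite big_geq // subrr scaler0.
rewrite leq_eqVlt => /orP[/eqP ->|]; first by rewrite big_geq// subrr scaler0.
rewrite ltnS => kk'; rewrite big_nat_recr //= scalerDr -IH //.
by rewrite opprB addrCA addrC.
Qed.

Lemma euler_stepP N s : T0 <= s ->
  h N * (euler_step N s)%:R <= s - T0 /\ s - T0 < h N * (euler_step N s)%:R + h N.
Proof.
move=> Ts; have x0 : 0 <= (s - T0) / h N by rewrite divr_ge0 ?subr_ge0// ltW.
have /andP[h1 h2] := truncn_itv x0; split.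
  by rewrite mulrC -ler_pdivlMr.
by move: h2; rewrite ltr_pdivrMr// -natr1 mulrC mulrDr mulr1.
Qed.

Lemma euler_step_le N s t : s <= t -> (euler_step N s <= euler_step N t)%N.
Proof. by move=> st; apply: le_truncn; rewrite ler_pM2r ?invr_gt0// lerB. Qed.

Lemma euler_curve_lip N tau s t i j : T0 <= s -> s <= t -> t <= T0 + tau ->
  `|euler_curve N t i j - euler_curve N s i j| <= G tau * (t - s + h N).
Proof.
move=> Ts st tt.
have Tt : T0 <= t by exact: le_trans st.
have [h1 h2] := euler_stepP N Ts; have [h3 h4] := euler_stepP N Tt.
have h5 : h N * (euler_step N t)%:R <= tau by lra.
have le := euler_step_le N st.
apply: le_trans (euler_diff le h5 _ _) _.
apply: ler_wpM2l; last by rewrite natrB// mulrBr; lra.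
by rewrite mulr_ge0 // mulr_ge0 ?expR_ge0// addr_ge0// l1norm_ge0.
Qed.

Lemma euler_curve_bound N tau s i j : T0 <= s -> s <= T0 + tau -> `|euler_curve N s i j| <= B tau.
Proof.
move=> Ts st; have [h1 h2] := euler_stepP N Ts.
apply: le_trans (ler_l1norm _ _ _) _; have := euler_bound N (euler_step N s).
have : B (h N * (euler_step N s)%:R) <= B tau by apply: B_le; lra.
rewrite /euler_curve; lra.
Qed.

(* Limit of Euler polygons along an ultrafilter on the step size: no Arzela-Ascoli extraction is needed. *)
Lemma clarke_flow_exists : exists Z : R -> 'M[R]_(m, n),
  [/\ Z T0 = W0,
    forall tau : R, 0 <= tau -> exists2 K : R, 0 <= K & forall i j s t, T0 <= s -> s <= t -> t <= T0 + tau ->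
      `|Z t i j - Z s i j| <= K * (t - s) &
    forall s, T0 < s -> (forall i j, derivable (fun t => Z t i j) s 1) ->
      clarke_subdiff f (Z s) (- deriv_mx Z s)].
Proof.
have [U [uU sU]] := @ultraFilterLemma nat \oo _.
have G0 tau : 0 <= G tau by rewrite mulr_ge0// mulr_ge0 ?expR_ge0// addr_ge0// l1norm_ge0.
have hU (e : R) : 0 < e -> \forall N \near U, h N < e.
  by move=> e0; apply: sU; apply: near_infty_natSinv_lt (PosNum e0).
(* A bounded sequence converges along an ultrafilter, since its values stay in a compact segment;
   [0] is a default value for times before [T0]. *)
have limex s i j : exists z : R, T0 <= s -> forall e : R, 0 < e -> \forall N \near U, `|euler_curve N s i j - z| < e.
  have [Ts|/negP Ts] := boolP (T0 <= s); last by exists 0.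
  pose F := (fun N => euler_curve N s i j) @ U.
  have FU : ProperFilter F by exact: fmap_proper_filter.
  have FB : F `[- B (s - T0), B (s - T0)]%classic.
    rewrite /F /= ; near=> N; rewrite /= in_itv /= -ler_norml.
    by apply: euler_curve_bound => //; lra.
  have /(_ F FU FB) [z [_ Fz]] : compact `[- B (s - T0), B (s - T0)]%classic by exact: segment_compact.
  exists z => _ e e0; pose S := [set N | `|euler_curve N s i j - z| < e].
  have [//|US] := in_ultra_setVsetC S uU.
  have [y [Hy1 Hy2]] : [set y | e <= `|y - z|] `&` ball z e !=set0.
    have US' : F [set y | e <= `|y - z|].
      by rewrite /F /=; apply: filterS US => N h1 /=; case: leP => // h2; exfalso; exact: h1 h2.
    exact: Fz US' (nbhsx_ballx z e e0).
  by move: Hy2; rewrite /ball /= distrC ltNge Hy1.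
pose Z s : 'M[R]_(m, n) := \matrix_(i, j) sval (cid (limex s i j)).
have ZP s : T0 <= s -> forall e : R, 0 < e -> \forall N \near U, forall i j, `|euler_curve N s i j - Z s i j| < e.
  move=> Ts e e0; apply: filter_forall => i; apply: filter_forall => j.
  by have := svalP (cid (limex s i j)) Ts e e0; rewrite mxE.
clearbody Z; exists Z; split.
- apply/matrixP => i j; apply/eqP; rewrite -subr_eq0 -normr_le0; apply/ler_addgt0Pl => e e0.
  have [N HN] := filter_ex (ZP _ (lexx T0) _ e0).
  by have := HN i j; rewrite /euler_curve /euler_step subrr mul0r truncn0 /= distrC addr0 => /ltW.
- move=> tau tau0; exists (G tau) => // i j s t Ts st tT; apply/ler_addgt0Pl => e e0.
  have e1 : 0 < e / 3 by rewrite divr_gt0.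
  have e2 : 0 < e / (3 * (1 + G tau)) by rewrite divr_gt0// mulr_gt0// ltr_pwDl.
  have Tt : T0 <= t by exact: le_trans st.
  have [N [[H1 H2] H3]] := filter_ex (filterI (filterI (ZP _ Ts _ e1) (ZP _ Tt _ e1)) (hU _ e2)).
  have := euler_curve_lip N i j Ts st tT.
  have := H1 i j; have := H2 i j.
  have : G tau * h N <= e / 3.
    apply: le_trans (_ : (1 + G tau) * (e / (3 * (1 + G tau))) <= _).
      by apply: ler_pM => //; [exact: ltW|lra|exact: ltW].
    have gn : 1 + G tau != 0 by rewrite gt_eqF// ltr_pwDl.
    by rewrite [leLHS](_ : _ = e / 3) //; field.
  have := ler_normD (Z t i j - euler_curve N t i j + (euler_curve N t i j - euler_curve N s i j)) (euler_curve N s i j - Z s i j).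
  have := ler_normD (Z t i j - euler_curve N t i j) (euler_curve N t i j - euler_curve N s i j).
  rewrite (distrC (Z t i j)) !addrA subrK subrK.
  lra.
(* Over a short time [dt] the increment of the Euler curve averages the values of [g], so some
   iterate [l] has [frob (g (euler N l)) V] above [frob xi V - eps / 2]. A Clarke test point of that
   iterate for [eps / 2] and [delta / 2] is then one of [Z s] for [eps] and [delta]. *)
- move=> s Ts ds V eps eps0 delta delta0.
  pose xi : 'M[R]_(m, n) := - deriv_mx Z s; rewrite -/xi.
  (* The errors of the averaging per unit of [eta * dt]: three times [l1norm V] from the two limits
     and the derivative, and the absolute value because the number of steps within [dt] is known
     only up to that error. *)
  pose c := 3 * l1norm V + `|frob xi V - eps / 2|.
  have c0 : 0 <= c by rewrite addr_ge0// mulr_ge0// l1norm_ge0.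
  pose eta := Num.min 1 (eps / 3 / (1 + c)).
  have eta0 : 0 < eta by rewrite lt_min ltr01 divr_gt0 ?divr_gt0// ltr_pwDl.
  have etac : eta * c < eps / 2.
    apply: le_lt_trans (_ : eta * (1 + c) < _); first by rewrite ler_wpM2l ?ltW//; lra.
    apply: le_lt_trans (_ : eps / 3 < _); last by lra.
    by rewrite -ler_pdivlMr ?ltr_pwDl// /eta ge_min lexx orbT.
  have eta1 : eta <= 1 by rewrite ge_min lexx.
  pose K := G (s - T0 + 1).
  have K0 : 0 <= K by exact: G0.
  have /choice[d Hd] ij : exists d : R, 0 < d /\ forall k, `|k| < d ->
      `|Z (s + k) ij.1 ij.2 - Z s ij.1 ij.2 - deriv_mx Z s ij.1 ij.2 * k| <= eta * `|k|.
    have [d d0 Hd] := derivable_approx (ds ij.1 ij.2) eta0; exists d; split=> // k /Hd.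
    by rewrite mxE.
  (* The first bound makes the derivative approximation valid for all entries at once; the second
     keeps the iterates of this window within [delta / 4] of [Z s], entry by entry. *)
  pose dt := Num.min (\big[Num.min/1]_ij d ij / 2) (delta / 4 / (1 + 2 * K)).
  have dm0 : 0 < \big[Num.min/1]_ij d ij by apply: lt_bigmin => // ij _; case: (Hd ij).
  have K20 : 0 < 1 + 2 * K by rewrite ltr_pwDl// mulr_ge0.
  have dt0 : 0 < dt by rewrite lt_min !divr_gt0.
  have dtd ij : dt < d ij.
    apply: lt_le_trans (_ : \big[Num.min/1]_ij d ij <= _); last exact: bigmin_le_cond.
    apply: le_lt_trans (_ : \big[Num.min/1]_ij d ij / 2 < _); first by rewrite ge_min lexx.
    lra.
  have dt1 : dt <= 1.
    apply: le_trans (_ : \big[Num.min/1]_ij d ij / 2 <= _); first by rewrite ge_min lexx.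
    by have : \big[Num.min/1]_ij d ij <= 1 by [exact: bigmin_le_id]; lra.
  have dtK : dt * (1 + 2 * K) <= delta / 4.
    by rewrite -ler_pdivlMr// ge_min lexx orbT.
  have edt0 : 0 < eta * dt by rewrite mulr_gt0.
  have Tsd : T0 <= s + dt by lra.
  have Ts' : T0 <= s by exact: ltW.
  have [N [[H1 H2] H3]] := filter_ex (filterI (filterI (ZP _ Ts' _ edt0) (ZP _ Tsd _ edt0)) (hU _ edt0)).
  have [q1 q2] := euler_stepP N Ts'; have [q3 q4] := euler_stepP N Tsd.
  have le : (euler_step N s <= euler_step N (s + dt))%N by apply: euler_step_le; lra.
  set a := euler_step N s in q1 q2 le; set b := euler_step N (s + dt) in q3 q4 le.
  have sumE := congr1 (fun W => frob W V) (euler_sum N le).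
  rewrite /= frobZl frob_suml in sumE.
  have lb : dt * frob xi V - 3 * eta * dt * l1norm V <= frob (euler N a - euler N b) V.
    have : `|frob (euler N a - euler N b - dt *: xi) V| <= 3 * eta * dt * l1norm V.
      apply: frob_l1 => i j; rewrite !mxE.
      have := H1 i j; have := H2 i j; rewrite -/a -/b /euler_curve -/a -/b.
      have := (proj2 (Hd (i, j))) dt; rewrite /= gtr0_norm// mxE => /(_ (dtd _)).
      rewrite !ltr_norml !ler_norml => /andP[? ?] /andP[? ?] /andP[? ?].
      apply/andP; split; lra.
    by rewrite (frobBl (euler N a - euler N b)) (frobZl dt) ler_norml => /andP[]; lra.
  have [l /andP[al lb'] Hl] : exists2 l, (a <= l < b)%N & frob xi V - eps / 2 < frob (g (euler N l)) V.
    apply: contrapT => /forall2NP Hn.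
    have ub : h N * \sum_(a <= l < b) frob (g (euler N l)) V <= h N * ((b - a)%:R * (frob xi V - eps / 2)).
      rewrite ler_pM2l//; rewrite (_ : (b - a)%:R * _ = \sum_(a <= l < b) (frob xi V - eps / 2)); last first.
        by rewrite sumr_const_nat mulr_natl.
      rewrite !big_nat; apply: ler_sum => l hl; have [//|/negP] := Hn l.
      by rewrite -leNgt.
    have hb : `|h N * (b - a)%:R - dt| <= eta * dt.
      by rewrite natrB// mulrBr ler_norml; apply/andP; split; lra.
    have : `|(h N * (b - a)%:R - dt) * (frob xi V - eps / 2)| <= eta * dt * `|frob xi V - eps / 2|.
      by rewrite normrM ler_wpM2r.
    rewrite ler_norml mulrBl => /andP[_].
    rewrite -sumE in ub.
    have : eta * c * dt < eps / 2 * dt by rewrite ltr_pM2r.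
    rewrite /c; lra.
  have eps20 : 0 < eps / 2 by rewrite divr_gt0.
  have delta20 : 0 < delta / 2 by rewrite divr_gt0.
  have [W' [t [k1 k2 k3 k4]]] := gP (euler N l) V eps20 delta20.
  exists W', t; split => //.
  + move=> i j.
    have hl : h N * l%:R <= s - T0 + 1.
      apply: le_trans (_ : h N * b%:R <= _); last by lra.
      by rewrite ler_pM2l// ler_nat ltnW.
    have := euler_diff al hl i j; rewrite -/K.
    have : K * (h N * (l - a)%:R) <= K * (2 * dt).
      apply: ler_wpM2l => //; apply: le_trans (_ : h N * (b - a)%:R <= _).
        by rewrite ler_pM2l// ler_nat leq_sub2r// ltnW.
      rewrite natrB// mulrBr.
      have : eta * dt <= dt by rewrite ger_pMl.
      lra.
    have := k1 i j; have := H1 i j; rewrite /euler_curve -/a.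
    have := ler_normD (W' i j - euler N l i j + (euler N l i j - euler N a i j)) (euler N a i j - Z s i j).
    have := ler_normD (W' i j - euler N l i j) (euler N l i j - euler N a i j).
    have : eta * dt <= dt by rewrite ger_pMl.
    rewrite !addrA subrK subrK; lra.
  + lra.
  + lra.
Unshelve. all: by end_near. Qed.

End Euler.

(** * Clarke subgradients of the loss *)

Section SmallPos.
Variable R : realType.

Lemma small_pos (I : finType) (A B : I -> R) : (forall i, 0 < B i) ->
  exists2 d : R, 0 < d & forall i, d * `|A i| < B i.
Proof.
move=> B0; have q i : 0 < B i / (1 + `|A i|) by rewrite divr_gt0// ltr_pwDl.
exists (\big[Num.min/1]_i (B i / (1 + `|A i|))); first exact: lt_bigmin.
move=> i; apply: le_lt_trans (_ : B i / (1 + `|A i|) * `|A i| < _).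
  by rewrite ler_wpM2r//; exact: bigmin_le_cond.
by rewrite mulrAC ltr_pdivrMr ?ltr_pwDl// ltr_pM2l//; lra.
Qed.

End SmallPos.

Section Relu.
Variables (R : realType) (N d0 d1 : nat).
Variables (X : 'M[R]_(N, d0)) (v : 'cV[R]_d1) (y : 'cV[R]_N).
Implicit Types (W V xi : 'M[R]_(d0, d1)).

Definition relu (x : R) := Num.max x 0.
Definition residual W i := \sum_j relu ((X *m W) i j) * v j 0 - y i 0.
Local Notation L := (loss X v y).
Local Notation res := residual.

Lemma lossE W : L W = 2^-1 * \sum_i res W i ^+ 2.
Proof.
rewrite /loss /sqnorm; congr (_ * _); apply: eq_bigr => i _; rewrite !mxE; congr ((_ - _) ^+ 2).
by apply: eq_bigr => j _; rewrite /relu_mx mxE.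
Qed.

Lemma loss_ge0 W : 0 <= L W.
Proof. by rewrite lossE mulr_ge0// ?invr_ge0//; apply: sumr_ge0 => i _; exact: sqr_ge0. Qed.

Lemma relu_cases (x : R) : (relu x = x /\ 0 <= x) \/ (relu x = 0 /\ x <= 0).
Proof.
rewrite /relu; case: (leP 0 x) => h; [left|right]; split=> //; exact: ltW.
Qed.

(** An exact slope in place of a derivative: difference quotients of the loss can be written down at
    kinks as well, and the slope is forced as soon as the increment cannot change the sign. *)
Lemma relu_slope (a h : R) : exists p : R,
  [/\ 0 <= p, p <= 1, relu (a + h) - relu a = p * h, `|h| < a -> p = 1 & `|h| < - a -> p = 0].
Proof.
have [->|h0] := eqVneq h 0.
  exists (if 0 < a then 1 else 0); rewrite normr0 addr0 subrr mulr0; split=> //; try by case: ifP.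
  by case: ifP => // a0; rewrite oppr_gt0 => ?; lra.
exists ((relu (a + h) - relu a) / h); rewrite divfK//; split=> //.
- have [h1|h1] := ltP 0 h.
    apply: divr_ge0; last exact: ltW.
    case: (relu_cases (a + h)) => [] [-> ?]; case: (relu_cases a) => [] [-> ?]; lra.
  have h2 : h < 0 by rewrite lt_neqAle h0.
  rewrite -mulrNN -invrN; apply: divr_ge0; last by rewrite oppr_ge0 ltW.
  case: (relu_cases (a + h)) => [] [-> ?]; case: (relu_cases a) => [] [-> ?]; lra.
- have [h1|h1] := ltP 0 h.
    by rewrite ler_pdivrMr// mul1r; case: (relu_cases (a + h)) => [] [-> ?]; case: (relu_cases a) => [] [-> ?]; lra.
  have h2 : h < 0 by rewrite lt_neqAle h0.
  by rewrite ler_ndivrMr// mul1r; case: (relu_cases (a + h)) => [] [-> ?]; case: (relu_cases a) => [] [-> ?]; lra.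
- rewrite ltr_norml => /andP[h1 h2]; rewrite [X in X / _](_ : _ = h) ?divff//.
  by case: (relu_cases (a + h)) => [] [-> ?]; case: (relu_cases a) => [] [-> ?]; lra.
- rewrite ltr_norml opprK => /andP[h1 h2]; rewrite [X in X / _](_ : _ = 0) ?mul0r//.
  by case: (relu_cases (a + h)) => [] [-> ?]; case: (relu_cases a) => [] [-> ?]; lra.
Qed.

Let Bz : R := l1norm X.
Let Lr : R := (\sum_j `|v j 0|) * Bz.

Lemma preact_lip W W' i j : `|(X *m W') i j - (X *m W) i j| <= Bz * l1norm (W' - W).
Proof.
rewrite !mxE -sumrB; apply: le_trans (ler_norm_sum _ _ _) _.
apply: le_trans (_ : \sum_a `|X i a| * l1norm (W' - W) <= _).
  apply: ler_sum => a _; rewrite -mulrBr normrM ler_wpM2l//.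
  by have := ler_l1norm (W' - W) a j; rewrite !mxE.
rewrite -mulr_suml ler_wpM2r ?l1norm_ge0// /Bz /l1norm (bigD1 i)//= lerDl.
by do 2! apply: sumr_ge0 => ? _.
Qed.

Lemma relu_lip (a b : R) : `|relu b - relu a| <= `|b - a|.
Proof.
have [p [p0 p1 + _ _]] := relu_slope a (b - a).
by rewrite subrKC => ->; rewrite normrM ger0_norm// ler_piMl.
Qed.

Lemma residual_lip W W' i : `|res W' i - res W i| <= Lr * l1norm (W' - W).
Proof.
rewrite /residual (_ : _ - _ - _ = (\sum_j relu ((X *m W') i j) * v j 0) - (\sum_j relu ((X *m W) i j) * v j 0)); last by ring.
rewrite -sumrB; apply: le_trans (ler_norm_sum _ _ _) _.
rewrite /Lr -mulrA mulr_suml; apply: ler_sum => j _.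
rewrite -mulrBl normrM mulrC ler_wpM2l//.
by apply: le_trans (relu_lip _ _) _; exact: preact_lip.
Qed.

Lemma frob_trmulmx (A : 'M[R]_(N, d1)) V : frob (X^T *m A) V = frob A (X *m V).
Proof.
rewrite /frob.
under eq_bigr do under eq_bigr do rewrite mxE mulr_suml.
under [RHS]eq_bigr do under eq_bigr do rewrite mxE mulr_sumr.
under eq_bigr do rewrite exchange_big /=.
rewrite exchange_big /=; apply: eq_bigr => i _; rewrite exchange_big /=.
by apply: eq_bigr => j _; apply: eq_bigr => a _; rewrite mxE; ring.
Qed.

Lemma residual_diff W V (t : R) : exists p : 'I_N -> 'I_d1 -> R,
  [/\ forall i j, 0 <= p i j /\ p i j <= 1,
     forall i j, `|t * (X *m V) i j| < (X *m W) i j -> p i j = 1,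
     forall i j, `|t * (X *m V) i j| < - (X *m W) i j -> p i j = 0 &
     forall i, res (W + t *: V) i = res W i + t * \sum_j p i j * (v j 0 * (X *m V) i j)].
Proof.
have /choice[p Hp] ij : exists p : R, [/\ 0 <= p, p <= 1,
    relu ((X *m W) ij.1 ij.2 + t * (X *m V) ij.1 ij.2) - relu ((X *m W) ij.1 ij.2) = p * (t * (X *m V) ij.1 ij.2),
    `|t * (X *m V) ij.1 ij.2| < (X *m W) ij.1 ij.2 -> p = 1 &
    `|t * (X *m V) ij.1 ij.2| < - (X *m W) ij.1 ij.2 -> p = 0] by exact: relu_slope.
exists (fun i j => p (i, j)); split.
- by move=> i j; case: (Hp (i, j)).
- by move=> i j; case: (Hp (i, j)).
- by move=> i j; case: (Hp (i, j)).
move=> i; rewrite /residual [RHS]addrAC; congr (_ - _); rewrite mulr_sumr -big_split; apply: eq_bigr => j _ /=.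
have [_ _ /= h _ _] := Hp (i, j).
have -> : (X *m (W + t *: V)) i j = (X *m W) i j + t * (X *m V) i j.
  by rewrite mulmxDr -scalemxAr mxE; congr (_ + _); rewrite mxE.
by move/eqP: h; rewrite subr_eq => /eqP ->; ring.
Qed.

(* The pointwise maximum, over the slopes of relu compatible with the sign of each pre-activation,
   of the corresponding contribution to the directional derivative. *)
Definition slope_bound W V i j : R :=
  let c := res W i * (v j 0 * (X *m V) i j) in
  if 0 < (X *m W) i j then c else if (X *m W) i j < 0 then 0 else Num.max c 0.

Let dotb V i : R := \sum_j `|v j 0 * (X *m V) i j|.
Let K V : R := \sum_i dotb V i.

Lemma slope_sum_bound V (p : 'I_d1 -> R) i : (forall j, 0 <= p j /\ p j <= 1) ->
  `|\sum_j p j * (v j 0 * (X *m V) i j)| <= dotb V i.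
Proof.
move=> Hp; apply: le_trans (ler_norm_sum _ _ _) _; apply: ler_sum => j _.
by have [p0 p1] := Hp j; rewrite normrM ger0_norm// ler_piMl.
Qed.

Let dotb_ge0 V i : 0 <= dotb V i. Proof. by apply: sumr_ge0. Qed.
Let K_ge0 V : 0 <= K V. Proof. by apply: sumr_ge0. Qed.
Let dotb_le V i : dotb V i <= K V.
Proof. by rewrite /K (bigD1 i)//= lerDl; apply: sumr_ge0. Qed.

(** With prescribed slopes the loss is a quadratic polynomial in [t] along the segment. The two
    error terms are the change of the residuals between [W] and [W'] and the quadratic term. *)
Lemma loss_quotient W W' V (t : R) (s : 'I_N -> R) : 0 < t ->
  (forall i, res (W' + t *: V) i = res W' i + t * s i) ->
  (forall i, `|s i| <= dotb V i) ->
  `|(L (W' + t *: V) - L W') / t - \sum_i res W i * s i| <= Lr * l1norm (W' - W) * K V + t * K V ^+ 2.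
Proof.
move=> t0 H Hs.
have -> : (L (W' + t *: V) - L W') / t = \sum_i res W' i * s i + t / 2 * \sum_i s i ^+ 2.
  rewrite !lossE -mulrBr -sumrB; apply: (canLR (mulfK _)); first by rewrite gt_eqF.
  rewrite mulrDl mulr_suml -[X in _ = _ + X]mulrA [X in _ = _ + X * _]mulrC.
  rewrite -mulrA [X in _ = _ + _ * X]mulrC.
  rewrite [RHS](_ : _ = 2^-1 * (\sum_i (2 * (res W' i * s i * t)) + \sum_i (t * t) * s i ^+ 2)); last first.
    by rewrite -!mulr_sumr; field.
  by rewrite -big_split; congr (_ * _); apply: eq_bigr => i _ /=; rewrite H; ring.
rewrite addrAC -sumrB; apply: le_trans (ler_normD _ _) _; apply: lerD.
  apply: le_trans (ler_norm_sum _ _ _) _; rewrite mulr_sumr; apply: ler_sum => i _.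
  rewrite -mulrBl normrM; apply: ler_pM => //; exact: residual_lip.
rewrite normrM ger0_norm; last by rewrite divr_ge0// ltW.
rewrite ger0_norm; last by apply: sumr_ge0 => i _; exact: sqr_ge0.
have h : \sum_i s i ^+ 2 <= K V ^+ 2.
  rewrite expr2 {1}/K mulr_suml; apply: ler_sum => i _; rewrite -real_normK ?num_real// expr2.
  by apply: ler_pM => //; apply: le_trans (dotb_le V i).
have : 0 <= \sum_i s i ^+ 2 by apply: sumr_ge0 => i _; exact: sqr_ge0.
have : t * (\sum_i s i ^+ 2) <= t * K V ^+ 2 by rewrite ler_pM2l.
rewrite mulrAC => h1 h2.
have : 0 <= t * \sum_i s i ^+ 2 by rewrite mulr_ge0// ltW.
lra.
Qed.

Lemma l1norm_entry_lt W (d : R) : (forall i j, `|W i j| < d) -> l1norm W <= (d0 * d1)%:R * d.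
Proof.
move=> H; rewrite /l1norm; apply: le_trans (_ : \sum_(i < d0) \sum_(j < d1) d <= _).
  by apply: ler_sum => i _; apply: ler_sum => j _; exact: ltW.
by rewrite !sumr_const !card_ord -mulrnA mulr_natl mulnC.
Qed.

(** A test point close to [W] keeps the sign of every non-zero pre-activation, so its slope there is
    0 or 1 as at [W]. Where the pre-activation vanishes the slope can be anything in [[0, 1]], and
    the worst case is the maximum with 0. *)
Lemma clarke_relu_upper xi W V : clarke_subdiff L W xi ->
  frob xi V <= \sum_i \sum_j slope_bound W V i j.
Proof.
move=> H; apply/ler_addgt0Pl => e e0.
have e40 : 0 < e / 4 by rewrite divr_gt0.
(* One scale [dl] has to meet all conditions: the [inl] part preserves the signs of the non-zero
   pre-activations (1 is a default at a zero), the [inr] part keeps each error of [loss_quotient]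
   below [e / 4]. *)
pose mz (k : 'I_N * 'I_d1 + bool) : R := match k with
  | inl ij => if (X *m W) ij.1 ij.2 == 0 then 1 else `|(X *m W) ij.1 ij.2| | inr b => e / 4 end.
have mz0 k : 0 < mz k.
  by case: k => //= ij; case: ifPn => // h; rewrite normr_gt0.
pose az (k : 'I_N * 'I_d1 + bool) : R := match k with
  | inl ij => Bz * (d0 * d1)%:R + `|(X *m V) ij.1 ij.2|
  | inr b => if b then Lr * (d0 * d1)%:R * K V else K V ^+ 2 end.
have [dl dl0 Hdl] := small_pos az mz0.
have [W' [t [h1 t0 h2 h3]]] := H V _ e40 _ dl0.
have hl : l1norm (W' - W) <= (d0 * d1)%:R * dl.
  by apply: l1norm_entry_lt => i j; rewrite !mxE; exact: h1.
have Bz0 : 0 <= Bz by exact: l1norm_ge0.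
have Lr0 : 0 <= Lr by rewrite mulr_ge0//; apply: sumr_ge0.
have [p [p01 p1 p0 pE]] := residual_diff W' V t.
have := loss_quotient W t0 pE (fun i => slope_sum_bound V i (p01 i)).
have g1 := Hdl (inr true); rewrite /= ger0_norm in g1; last by apply: mulr_ge0 => //; apply: mulr_ge0.
have g2 := Hdl (inr false); rewrite /= ger0_norm in g2; last by rewrite exprn_ge0.
have : Lr * l1norm (W' - W) * K V <= dl * (Lr * (d0 * d1)%:R * K V).
  rewrite (_ : dl * _ = Lr * ((d0 * d1)%:R * dl) * K V); last by ring.
  by rewrite ler_wpM2r// ler_wpM2l.
have : t * K V ^+ 2 <= dl * K V ^+ 2 by rewrite ler_wpM2r ?exprn_ge0// ltW.
suff : \sum_i res W i * (\sum_j p i j * (v j 0 * (X *m V) i j)) <= \sum_i \sum_j slope_bound W V i j.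
  by rewrite ler_norml => ? ? ? /andP[]; lra.
apply: ler_sum => i _; rewrite mulr_sumr; apply: ler_sum => j _.
rewrite mulrCA /slope_bound; set c := res W i * _.
have [p0' p1'] := p01 i j.
have := Hdl (inl (i, j)); rewrite /= ger0_norm; last by rewrite addr_ge0// mulr_ge0.
have hz : `|(X *m W') i j - (X *m W) i j| <= dl * (Bz * (d0 * d1)%:R).
  apply: le_trans (preact_lip _ _ _ _) _.
  by rewrite mulrCA ler_wpM2l// mulrC.
have ht : `|t * (X *m V) i j| <= dl * `|(X *m V) i j|.
  by rewrite normrM gtr0_norm// ler_wpM2r// ltW.
have [zp|zn|z0] := ltgtP 0 ((X *m W) i j).
- rewrite (gtr0_norm zp) => hh; rewrite p1 ?mul1r//.
  move: hz; rewrite ler_norml => /andP[]; lra.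
- rewrite (ltr0_norm zn) => hh; rewrite p0 ?mul0r//.
  move: hz; rewrite ler_norml => /andP[]; lra.
- move=> _; rewrite le_max; have [c0|c0] := leP 0 c; first by rewrite ler_piMl.
  by rewrite [X in _ || X](_ : _ = true) ?orbT//; apply: mulr_ge0_le0 => //; exact: ltW.
Qed.

(** Rows are treated one at a time: a small multiple of the new row repairs its own product without
    destroying those already non-zero. Moving all columns of [W] along this direction leaves no kink
    for the non-zero rows. *)
Lemma generic_direction : exists z : 'cV[R]_d0,
  forall i, (exists a, X i a != 0) -> (X *m z) i 0 != 0.
Proof.
suff [z Hz] : exists z : 'cV[R]_d0, forall i, i \in enum 'I_N -> (exists a, X i a != 0) -> (X *m z) i 0 != 0.
  by exists z => i; apply: Hz; rewrite mem_enum.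
elim: (enum _) => [|i s [z Hz]]; first by exists 0.
have [hi|/not_implyP[ha /negP]] := pselect ((exists a, X i a != 0) -> (X *m z) i 0 != 0).
  by exists z => k; rewrite inE => /orP[/eqP -> //|]; exact: Hz.
rewrite negbK => /eqP hz.
pose x : 'cV[R]_d0 := (row i X)^T.
have xx : 0 < (X *m x) i 0.
  have [a ha'] := ha; rewrite mxE (bigD1 a)//= !mxE -expr2 ltr_pwDl ?exprn_even_gt0//.
  by apply: sumr_ge0 => b _; rewrite !mxE -expr2 sqr_ge0.
pose B k : R := if (X *m z) k 0 == 0 then 1 else `|(X *m z) k 0|.
have B0 k : 0 < B k by rewrite /B; case: ifPn => // h; rewrite normr_gt0.
have [t t0 Ht] := small_pos (fun k => (X *m x) k 0) B0.
exists (z + t *: x) => k; rewrite inE => /orP[/eqP -> _|ks hk].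
  by rewrite mulmxDr -scalemxAr mxE hz add0r mxE mulf_neq0// gt_eqF.
have zk := Hz _ ks hk; have := Ht k; rewrite /B (negbTE zk) => h.
rewrite mulmxDr -scalemxAr mxE [X in _ + X]mxE; apply: contraTN h => /eqP h.
rewrite -leNgt (_ : (X *m z) k 0 = - (t * (X *m x) k 0)); last by apply/eqP; rewrite -subr_eq0 opprK; apply/eqP.
by rewrite normrN normrM gtr0_norm.
Qed.

(** The selected [g W] is the gradient with ties broken by the sign of a generic direction [zeta].
    At [W + tau Zg] every pre-activation of a non-zero row has a definite sign agreeing with this
    choice, so [g W] is a limit of true slopes and passes the Clarke test. It is bounded by a
    residual, hence grows linearly. *)
Lemma clarke_selection : exists g : 'M[R]_(d0, d1) -> 'M[R]_(d0, d1), exists A : R,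
  [/\ 0 <= A, forall W, clarke_subdiff L W (g W) & forall W, l1norm (g W) <= A * (1 + l1norm W)].
Proof.
have [zg Hzg] := generic_direction.
pose zeta i := (X *m zg) i 0.
pose p W i j : R := if (0 < (X *m W) i j) || ((X *m W) i j == 0) && (0 < zeta i) then 1 else 0.
pose g W := X^T *m (\matrix_(i, j) (res W i * v j 0 * p W i j)).
have p01 W i j : 0 <= p W i j /\ p W i j <= 1 by rewrite /p; case: ifP.
have gE W V : frob (g W) V = \sum_i res W i * \sum_j p W i j * (v j 0 * (X *m V) i j).
  rewrite /g frob_trmulmx /frob; apply: eq_bigr => i _; rewrite mulr_sumr.
  by apply: eq_bigr => j _; rewrite mxE; ring.
have Bz0 : 0 <= Bz by exact: l1norm_ge0.
have Sv0 : 0 <= \sum_j `|v j 0| by apply: sumr_ge0.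
have Lr0 : 0 <= Lr by rewrite mulr_ge0.
pose Y := \sum_i `|res 0 i| + Lr; have Y0 : 0 <= Y by rewrite addr_ge0//; apply: sumr_ge0.
have resB W i : `|res W i| <= Y * (1 + l1norm W).
  have := residual_lip 0 W i; rewrite subr0 => h1.
  have := ler_normD (res W i - res 0 i) (res 0 i); rewrite subrK.
  have : `|res 0 i| <= \sum_i `|res 0 i| by rewrite (bigD1 i)//= lerDl; apply: sumr_ge0.
  have : 0 <= (\sum_i `|res 0 i|) * l1norm W by apply: mulr_ge0; [apply: sumr_ge0|exact: l1norm_ge0].
  rewrite /Y; lra.
exists g, ((d0 * d1)%:R * (Bz * (\sum_j `|v j 0|) * Y)); split.
- by do ! apply: mulr_ge0 => //.
- move=> W V eps eps0 dl dl0.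
  pose Zg : 'M[R]_(d0, d1) := \matrix_(a, j) zg a 0.
  have ZgE i j : (X *m Zg) i j = zeta i by rewrite /zeta !mxE; apply: eq_bigr => a _; rewrite !mxE.
  pose B1 (k : 'I_N * 'I_d1 + bool) : R := match k with
    | inl ij => if (X *m W) ij.1 ij.2 == 0 then 1 else `|(X *m W) ij.1 ij.2| | inr b => if b then dl else eps / 3 end.
  have B10 k : 0 < B1 k.
    by case: k => [ij|[]] //=; [case: ifPn => // h; rewrite normr_gt0|rewrite divr_gt0].
  pose A1 (k : 'I_N * 'I_d1 + bool) : R := match k with
    | inl ij => zeta ij.1 | inr b => if b then l1norm Zg else Lr * l1norm Zg * K V end.
  have [tau tau0 Htau] := small_pos A1 B10.
  pose W' := W + tau *: Zg.
  have W'E i j : (X *m W') i j = (X *m W) i j + tau * zeta i.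
    by rewrite /W' mulmxDr -scalemxAr mxE; congr (_ + _); rewrite mxE ZgE.
  have sgnW' i j : (exists a, X i a != 0) -> (p W i j = 1 /\ 0 < (X *m W') i j) \/ (p W i j = 0 /\ (X *m W') i j < 0).
    move=> /Hzg; rewrite -/(zeta i) => zi; rewrite W'E /p.
    have := Htau (inl (i, j)); rewrite /=; have [->|] := eqVneq ((X *m W) i j) 0.
      rewrite ltxx add0r /= => _; have [zp|zn|/esym z0] := ltgtP 0 (zeta i).
      - by left; rewrite mulr_gt0.
      - by right; split=> //; rewrite pmulr_rlt0.
      - by rewrite z0 eqxx in zi.
    move=> nz; rewrite orbF -{1}(gtr0_norm tau0) -normrM.
    have [zp|zn|/esym z0] := ltgtP 0 ((X *m W) i j).
    - rewrite (gtr0_norm zp) ltr_norml => /andP[? ?]; left; split=> //; lra.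
    - rewrite (ltr0_norm zn) ltr_norml => /andP[? ?]; right; split=> //; lra.
    - by rewrite z0 eqxx in nz.
  pose B2 (k : 'I_N * 'I_d1 + bool) : R := match k with
    | inl ij => if (X *m W') ij.1 ij.2 == 0 then 1 else `|(X *m W') ij.1 ij.2| | inr b => if b then dl else eps / 3 end.
  have B20 k : 0 < B2 k.
    by case: k => [ij|[]] //=; [case: ifPn => // h; rewrite normr_gt0|rewrite divr_gt0].
  pose A2 (k : 'I_N * 'I_d1 + bool) : R := match k with
    | inl ij => (X *m V) ij.1 ij.2 | inr b => if b then 1 else K V ^+ 2 end.
  have [t t0 Ht] := small_pos A2 B20.
  have [q [q01 q1 q0 qE]] := residual_diff W' V t.
  (* For small [t] the slopes at [W'] are the selected ones; on a zero row of [X] both sides vanish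
     whatever the slopes are. *)
  have qp i : \sum_j q i j * (v j 0 * (X *m V) i j) = \sum_j p W i j * (v j 0 * (X *m V) i j).
    have [hi|hi] := pselect (exists a, X i a != 0).
      apply: eq_bigr => j _; congr (_ * _); have := Ht (inl (i, j)); rewrite /=.
      rewrite -{1}(gtr0_norm t0) -normrM; have [[-> zp]|[-> zn]] := sgnW' i j hi.
        by rewrite (gt_eqF zp) (gtr0_norm zp) => /q1.
      by rewrite (lt_eqF zn) (ltr0_norm zn) => /q0.
    rewrite !big1// => j _; rewrite (_ : (X *m V) i j = 0) ?mulr0// mxE big1// => a _.
      by rewrite (_ : X i a = 0) ?mul0r//; apply/eqP; apply: contrapT => /negP h; apply: hi; exists a.
    by rewrite (_ : X i a = 0) ?mul0r//; apply/eqP; apply: contrapT => /negP h; apply: hi; exists a.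
  exists W', t; split=> //.
  + move=> a j; rewrite /W' [X in `|X - _|]mxE addrAC subrr add0r mxE normrM gtr0_norm//.
    have := Htau (inr true); rewrite /= ger0_norm ?l1norm_ge0//; apply: le_lt_trans.
    by rewrite ler_pM2l// ler_l1norm.
  + by have := Ht (inr true); rewrite /= normr1 mulr1.
  + have := loss_quotient W t0 qE (fun i => slope_sum_bound V i (q01 i)).
    rewrite (eq_bigr _ (fun i _ => congr1 (fun x => res W i * x) (qp i))) -gE.
    have := Htau (inr false); rewrite /= ger0_norm; last by apply: mulr_ge0 => //; apply: mulr_ge0 => //; exact: l1norm_ge0.
    have := Ht (inr false); rewrite /= ger0_norm ?exprn_ge0//.
    have WW : W' - W = tau *: Zg by rewrite /W' addrC addKr.
    rewrite WW l1normZ (gtr0_norm tau0) => h1 h2.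
    rewrite ler_norml => /andP[h3 _]; lra.
- move=> W; apply: le_trans (_ : \sum_(a < d0) \sum_(b < d1) (Bz * (\sum_j `|v j 0|) * Y) * (1 + l1norm W) <= _); last first.
    rewrite -[X in _ <= X]mulrA; move: (Bz * _ * Y * _) => c.
    by rewrite !sumr_const !card_ord -mulrnA mulr_natl mulnC.
  apply: ler_sum => a _; apply: ler_sum => b _; rewrite /g mxE.
  apply: le_trans (ler_norm_sum _ _ _) _.
  apply: le_trans (_ : \sum_i `|X i a| * ((\sum_j `|v j 0|) * (Y * (1 + l1norm W))) <= _).
    apply: ler_sum => i _; rewrite mxE normrM ler_wpM2l// mxE normrM.
    have [p0 p1] := p01 W i b; rewrite (ger0_norm p0) normrM.
    apply: le_trans (_ : `|res W i| * `|v b 0| * 1 <= _); first by rewrite ler_wpM2l// mulr_ge0.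
    rewrite mulr1 mulrC; apply: ler_pM => //.
    by rewrite (bigD1 b)//= lerDl; apply: sumr_ge0.
  rewrite -mulr_suml (_ : Bz * _ * Y * (1 + l1norm W) = Bz * ((\sum_j `|v j 0|) * (Y * (1 + l1norm W)))); last by ring.
  apply: ler_wpM2r; first by rewrite !mulr_ge0// addr_ge0// l1norm_ge0.
  rewrite /Bz /l1norm; apply: ler_sum => i _; rewrite (bigD1 a)//= lerDl.
  by apply: sumr_ge0.
Qed.

End Relu.

(** * Solutions of the flow *)

Section Flow.
Variables (R : realType) (N d0 d1 : nat).
Variables (X : 'M[R]_(N, d0)) (v : 'cV[R]_d1) (y : 'cV[R]_N).
Implicit Types (W V xi D : 'M[R]_(d0, d1)).
Local Notation L := (loss X v y).
Local Notation res := (residual X v y).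
Local Notation mu := (@lebesgue_measure R).

(** At a zero of [z] with vanishing derivative, [|relu (z t)| <= |z t|] is already negligible; away
    from zeros [relu] is locally the identity or 0. *)
Lemma relu_has_deriv (z : R -> R) (s l : R) : has_deriv z s l -> (z s = 0 -> l = 0) ->
  has_deriv (fun t => relu (z t)) s (if 0 < z s then l else 0).
Proof.
move=> Hz Hl; have [zp|zn|z0] := ltgtP 0 (z s).
- have [d dp Hd] := has_deriv_cont Hz zp.
  apply: (has_deriv_near dp _ Hz) => h /Hd; rewrite ltr_norml => /andP[h1 _].
  by case: (relu_cases (z (s + h))) => [] [-> ?] //; lra.
- have zn' : 0 < - z s by rewrite oppr_gt0.
  have [d dp Hd] := has_deriv_cont Hz zn'.
  apply: (has_deriv_near dp _ (has_deriv_cst 0 s)) => h /Hd; rewrite ltr_norml => /andP[_ h1].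
  by case: (relu_cases (z (s + h))) => [] [-> ?] //; lra.
- rewrite (Hl (esym z0)) in Hz; move=> e /Hz[d dp Hd]; exists d => // h /Hd.
  rewrite -z0 !mul0r !subr0; apply: le_trans; rewrite [relu 0]/relu maxxx subr0.
  by have := relu_lip 0 (z (s + h)); rewrite [relu 0]/relu maxxx !subr0.
Qed.

Lemma residual_has_deriv (W : R -> 'M[R]_(d0, d1)) (s : R) D :
  (forall a b, has_deriv (fun t => W t a b) s (D a b)) ->
  (forall i j, (X *m W s) i j = 0 -> (X *m D) i j = 0) ->
  forall i, has_deriv (fun t => res (W t) i) s (\sum_j (if 0 < (X *m W s) i j then (X *m D) i j else 0) * v j 0).
Proof.
move=> HW H0 i.
have Hz j : has_deriv (fun t => (X *m W t) i j) s ((X *m D) i j).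
  rewrite (_ : (fun t => _) = (fun t => \sum_a X i a * W t a j)); last by apply/funext => t; rewrite mxE.
  by rewrite mxE; apply: has_deriv_sum => a; exact: has_derivZ.
rewrite -[X in has_deriv _ _ X]addr0 /residual.
apply: (has_derivD _ (has_deriv_cst (- y i 0) s)).
apply: has_deriv_sum => j.
rewrite (_ : (fun t => _) = (fun t => v j 0 * relu ((X *m W t) i j))); last by apply/funext => t; rewrite mulrC.
by rewrite mulrC; apply: has_derivZ; apply: relu_has_deriv (Hz j) _; exact: H0.
Qed.

(** With [S] the derivative of the loss along the curve, terms with zero pre-activation drop out and
    the bound [clarke_relu_upper] is linear on the line of [D]. Testing with [D] and [- D] gives
    [- |D|^2 <= S] and [|D|^2 <= - S]. *)
Lemma loss_has_deriv (W : R -> 'M[R]_(d0, d1)) (s : R) D :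
  (forall a b, has_deriv (fun t => W t a b) s (D a b)) ->
  (forall i j, (X *m W s) i j = 0 -> (X *m D) i j = 0) ->
  clarke_subdiff L (W s) (- D) ->
  has_deriv (fun t => L (W t)) s (- frob D D).
Proof.
move=> HW H0 HD.
have Hr := residual_has_deriv HW H0.
pose S := \sum_i res (W s) i * (\sum_j (if 0 < (X *m W s) i j then (X *m D) i j else 0) * v j 0).
have HL : has_deriv (fun t => L (W t)) s S.
  rewrite (_ : (fun t => _) = (fun t => 2^-1 * \sum_i res (W t) i ^+ 2)); last by apply/funext => t; rewrite lossE.
  rewrite (_ : S = 2^-1 * \sum_i (2 * res (W s) i) * (\sum_j (if 0 < (X *m W s) i j then (X *m D) i j else 0) * v j 0)); last first.
    by rewrite /S mulr_sumr; apply: eq_bigr => i _; field.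
  by apply: has_derivZ; apply: has_deriv_sum => i; exact: (has_deriv_comp (Hr i) (has_deriv_sqr _)).
have sE (e : R) : \sum_i \sum_j slope_bound X v y (W s) (e *: D) i j = e * S.
  rewrite /S mulr_sumr; apply: eq_bigr => i _; rewrite !mulr_sumr; apply: eq_bigr => j _.
  have E : (X *m (e *: D)) i j = e * (X *m D) i j by rewrite -scalemxAr mxE.
  rewrite /slope_bound E.
  have [zp|zn|z0] := ltgtP 0 ((X *m W s) i j); first by ring.
    by rewrite mul0r !mulr0.
  by rewrite (H0 _ _ (esym z0)) !(mulr0, mul0r) maxxx.
have := clarke_relu_upper D HD; rewrite -[X in slope_bound _ _ _ _ X]scale1r sE mul1r frobNl => h1.
have := clarke_relu_upper (- D) HD; rewrite -[X in slope_bound _ _ _ _ X]scaleN1r sE mulN1r => h2.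
rewrite (_ : - frob D D = S) //.
have E : frob (- D) (- D) = frob D D.
  by rewrite /frob; apply: eq_bigr => i _; apply: eq_bigr => j _; rewrite !mxE mulrNN.
rewrite E in h2; lra.
Qed.

Definition flow_pt (W : R -> 'M[R]_(d0, d1)) (s : R) :=
  [/\ has_deriv (fun t => L (W t)) s (- frob (deriv_mx W s) (deriv_mx W s)),
      forall a b, has_deriv (fun t => W t a b) s (deriv_mx W s a b) &
      clarke_subdiff L (W s) (- deriv_mx W s)].

(** The exceptional times are those allowed by the notion of solution together with the crossings of
    a pre-activation through zero at non-zero speed. *)
Lemma sol_flow_pt (W0 : 'M[R]_(d0, d1)) (T : R) (W : R -> 'M[R]_(d0, d1)) : sol_on L W0 T W ->
  mu.-negligible [set s : R | (0 < s /\ s < T) /\ ~ flow_pt W s].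
Proof.
move=> [_ _ ng].
have nz : mu.-negligible [set s : R | exists ij : 'I_N * 'I_d1,
    [set s : R | (X *m W s) ij.1 ij.2 = 0 /\ exists2 l, has_deriv (fun s => (X *m W s) ij.1 ij.2) s l & l <> 0] s].
  by apply: negligible_exists_fin => ij; exact: zero_crossing_negligible.
apply: lebesgue_negligibleS (negligibleU nz ng) => s [[s0 sT] nf]; apply: contrapT => /not_orP[h1 h2].
apply: nf; have [dW cW] : (forall i j, derivable (fun t => W t i j) s 1) /\ clarke_subdiff L (W s) (- deriv_mx W s).
  by apply: contrapT => h; apply: h2; split; [exact: ltW|split].
have HW a b : has_deriv (fun t => W t a b) s (deriv_mx W s a b).
  by rewrite mxE; exact: derivable_has_deriv.
split=> //; apply: loss_has_deriv => // i j zij; apply: contrapT => nz0.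
apply: h1; exists (i, j); split=> //=; exists ((X *m deriv_mx W s) i j) => //.
rewrite (_ : (fun t => _) = (fun t => \sum_a X i a * W t a j)); last by apply/funext => t; rewrite mxE.
by rewrite mxE; apply: has_deriv_sum => a; exact: has_derivZ.
Qed.

Lemma loss_abs_cont (a b : R) (W : R -> 'M[R]_(d0, d1)) : a <= b ->
  (forall i j, abs_cont_on (fun s => W s i j) a b) -> abs_cont_on (fun s => L (W s)) a b.
Proof.
move=> ab acW.
have acr i : abs_cont_on (fun s => res (W s) i) a b.
  apply: (abs_cont_dominated (F := fun k : 'I_d0 * 'I_d1 => fun s => W s k.1 k.2) (C := (\sum_j `|v j 0|) * l1norm X)).
    by move=> k; exact: acW.
  move=> l r al lr rb; apply: le_trans (residual_lip _ _ _ _ _ _) _.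
  rewrite -(pair_bigA _ (fun i j => `|W r i j - W l i j|)) /=.
  rewrite [X in _ * X <= _](_ : _ = \sum_i \sum_j `|W r i j - W l i j|) //.
  by apply: eq_bigr => p _; apply: eq_bigr => q _; rewrite !mxE.
have /choice[M HM] i := abs_cont_bounded ab (acr i).
apply: (abs_cont_dominated acr (C := \sum_i `|M i|)) => l r al lr rb.
have lb : l <= b by exact: le_trans rb.
have ar : a <= r by exact: le_trans lr.
rewrite !lossE -mulrBr -sumrB mulr_sumr; apply: le_trans (ler_norm_sum _ _ _) _.
rewrite mulr_sumr; apply: ler_sum => i _.
rewrite subr_sqr mulrCA normrM mulrC ler_wpM2r//.
have := ler_normD (res (W r) i) (res (W l) i); have := HM i _ al lb; have := HM i _ ar rb => h1 h2 h3.
rewrite normrM gtr0_norm ?invr_gt0//.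
have : `|M i| <= \sum_i `|M i| by rewrite (bigD1 i)//= lerDl; apply: sumr_ge0.
have := ler_norm (M i); lra.
Qed.

Lemma sol_abs_cont W0 (T : R) (W : R -> 'M[R]_(d0, d1)) s t : sol_on L W0 T W -> 0 <= s -> s <= t -> t < T ->
  forall i j, abs_cont_on (fun s => W s i j) s t.
Proof.
move=> [_ acW _] s0 st tT i j; apply: (abs_cont_onS s0 (lexx t)); apply: acW => //.
exact: le_trans st.
Qed.

(** The common form in which the loss, the potential of [travel_bound] and the exponentially
    weighted loss are shown to decrease. *)
Lemma flow_nonincr W0 (T : R) (W : R -> 'M[R]_(d0, d1)) (f : R -> R) s t :
  sol_on L W0 T W -> 0 <= s -> s <= t -> t < T -> abs_cont_on f s t ->
  (forall u, s < u -> u < t -> flow_pt W u -> exists2 l, has_deriv f u l & l <= 0) -> f t <= f s.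
Proof.
move=> sW s0 st tT acf Hf; apply: (abs_cont_nonincr st acf).
apply: lebesgue_negligibleS (sol_flow_pt sW) => u [[su ut] nd]; split.
  by split; [exact: le_lt_trans su|exact: lt_trans tT].
move=> fu; apply: nd; have [l /has_derivP[h1 h2] l0] := Hf _ su ut fu.
by rewrite h2.
Qed.

Lemma frob_ge0 D : 0 <= frob D D.
Proof. by apply: sumr_ge0 => i _; apply: sumr_ge0 => j _; rewrite -expr2 sqr_ge0. Qed.

Lemma sol_loss_nonincr W0 (T : R) (W : R -> 'M[R]_(d0, d1)) s t :
  sol_on L W0 T W -> 0 <= s -> s <= t -> t < T -> L (W t) <= L (W s).
Proof.
move=> sW s0 st tT; apply: (flow_nonincr sW s0 st tT (f := fun s => L (W s))).
  by apply: loss_abs_cont => //; exact: sol_abs_cont sW _ _ _.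
by move=> u su ut [h _ _]; exists (- frob (deriv_mx W u) (deriv_mx W u)) => //; rewrite oppr_le0 frob_ge0.
Qed.

(** Each residual is at most [sqrt (2 L)], which bounds [slope_bound]; the entries of a subgradient
    are read off by testing with plus and minus the coordinate matrices. *)
Lemma clarke_relu_bound : exists2 G : R, 0 <= G & forall W xi, clarke_subdiff L W xi ->
  forall a b, `|xi a b| <= G * Num.sqrt (2 * L W).
Proof.
pose KV V : R := \sum_i \sum_j `|v j 0 * (X *m V) i j|.
have KV0 V : 0 <= KV V by do 2! apply: sumr_ge0 => ? _.
pose G := \sum_(ab : 'I_d0 * 'I_d1) (KV (delta_mx ab.1 ab.2) + KV (- delta_mx ab.1 ab.2)).
exists G; first by apply: sumr_ge0 => ab _; rewrite addr_ge0.
move=> W xi Hxi a b.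
have hV V : frob xi V <= KV V * Num.sqrt (2 * L W).
  apply: le_trans (clarke_relu_upper V Hxi) _; rewrite /KV mulr_suml; apply: ler_sum => i _.
  rewrite mulr_suml; apply: ler_sum => j _.
  have h : res W i * (v j 0 * (X *m V) i j) <= `|v j 0 * (X *m V) i j| * Num.sqrt (2 * L W).
    apply: le_trans (ler_norm _) _; rewrite normrM mulrC ler_wpM2l//.
    rewrite lossE mulrA divff// mul1r -sqrtr_sqr; apply: ler_wsqrtr.
    by rewrite (bigD1 i)//= lerDl; apply: sumr_ge0 => k _; exact: sqr_ge0.
  have h0 : 0 <= `|v j 0 * (X *m V) i j| * Num.sqrt (2 * L W) by rewrite mulr_ge0// sqrtr_ge0.
  by rewrite /slope_bound; case: ifP => // _; case: ifP => // _; rewrite ge_max h h0.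
have hd (e : R) : frob xi (e *: delta_mx a b) = e * xi a b.
  rewrite /frob (bigD1 a)//= (bigD1 b)//= !mxE !eqxx mulr1 big1 ?addr0; last first.
    by move=> j jb; rewrite !mxE (negbTE jb) andbF !mulr0.
  rewrite big1 ?addr0 ?(mulrC e)//; move=> i ia; rewrite big1// => j _; rewrite !mxE (negbTE ia) !mulr0 //.
have h1 := hV (1 *: delta_mx a b); have h2 := hV (-1 *: delta_mx a b).
rewrite hd mul1r scale1r in h1; rewrite hd mulN1r scaleN1r in h2.
have hG : KV (delta_mx a b) + KV (- delta_mx a b) <= G.
  rewrite /G (bigD1 (a, b))//= lerDl; apply: sumr_ge0 => ab _; exact: addr_ge0.
have s0 : 0 <= Num.sqrt (2 * L W) by exact: sqrtr_ge0.
have : (KV (delta_mx a b) + KV (- delta_mx a b)) * Num.sqrt (2 * L W) <= G * Num.sqrt (2 * L W) by rewrite ler_wpM2r.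
have := mulr_ge0 (KV0 (delta_mx a b)) s0; have := mulr_ge0 (KV0 (- delta_mx a b)) s0.
by move=> q1 q2 q3; rewrite ler_norml; apply/andP; split; lra.
Qed.

(** As the loss does not increase, the bound on subgradients is uniform in time, which excludes
    blow-up before [T]. *)
Lemma sol_lipschitz W0 (T : R) (W : R -> 'M[R]_(d0, d1)) : sol_on L W0 T W ->
  exists2 M : R, 0 <= M & forall i j s t, 0 <= s -> s <= t -> t < T -> `|W t i j - W s i j| <= M * (t - s).
Proof.
move=> sW; have [G G0 HG] := clarke_relu_bound.
exists (G * Num.sqrt (2 * L W0)); first by rewrite mulr_ge0// sqrtr_ge0.
move=> i j s t s0 st tT.
have acW := sol_abs_cont sW s0 st tT i j.
apply: (abs_cont_ae_lipschitz acW _ (lexx s) st (lexx t)).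
apply: lebesgue_negligibleS (sol_flow_pt sW) => u [[su ut] nd]; split.
  by split; [exact: le_lt_trans su|exact: lt_trans tT].
move=> [_ h2 h3]; apply: nd; have [h4 h5] := has_derivP (h2 i j); split=> //.
rewrite h5; have := HG _ _ h3 i j; rewrite mxE normrN => /le_trans; apply.
rewrite ler_wpM2l//; apply: ler_wsqrtr; rewrite ler_pM2l//.
have [W00 _ _] := sW; rewrite -W00; apply: (sol_loss_nonincr sW) => //; first by apply: ltW; exact: le_lt_trans su.
exact: lt_trans tT.
Qed.

(** The Lipschitz bound yields a left limit at [T], from which a global Euler limit is started and
    glued on. Its velocity lies in the differential inclusion wherever it is differentiable, which
    is almost everywhere because it is locally Lipschitz. *)
Lemma sol_extends W0 (T : R) (W : R -> 'M[R]_(d0, d1)) : 0 < T -> sol_on L W0 T W ->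
  exists2 W', sol_global L W0 W' & forall s, 0 <= s -> s < T -> W' s = W s.
Proof.
move=> T0 sW; have [M M0 HM] := sol_lipschitz sW; have [W00 _ ng] := sW.
have /choice[wT HwT] ij : exists w : R, forall s, 0 <= s -> s < T -> `|w - W s ij.1 ij.2| <= M * (T - s).
  (* Adding [M s] makes the entry nondecreasing, so that its left limit at [T] is a supremum. *)
  pose u s := W s ij.1 ij.2 + M * s.
  have u1 s t : 0 <= s -> s <= t -> t < T -> u s <= u t /\ u t <= u s + 2 * M * (t - s).
    move=> s0 st tT; have := HM ij.1 ij.2 _ _ s0 st tT; rewrite ler_norml /u => /andP[? ?]; split; lra.
  pose S := [set u s | s in [set s | 0 <= s /\ s < T]].
  have ub s : 0 <= s -> s < T -> ubound S (u s + 2 * M * (T - s)).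
    move=> s0 sT _ [t [t0 tT] <-]; have [st|/ltW ts] := leP s t.
      have [_ /le_trans] := u1 _ _ s0 st tT; apply; rewrite lerD2l ler_wpM2l ?mulr_ge0//; lra.
    have [/le_trans h _] := u1 _ _ t0 ts sT; apply: h; rewrite lerDl mulr_ge0 ?mulr_ge0//; lra.
  have Su s : 0 <= s -> s < T -> S (u s) by move=> s0 sT; exists s.
  have hS : has_sup S by split; [exists (u 0); exact: Su|exists (u 0 + 2 * M * (T - 0)); exact: ub].
  exists (sup S - M * T) => s s0 sT.
  have h1 := ub_le_sup (proj2 hS) (Su _ s0 sT).
  have h2 : sup S <= u s + 2 * M * (T - s) by apply: ge_sup; [exact: (proj1 hS)|exact: ub].
  by move: h1 h2; rewrite ler_norml /u => ? ?; apply/andP; split; lra.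
pose WT : 'M[R]_(d0, d1) := \matrix_(i, j) wT (i, j).
have [g [A [A0 gP gA]]] := clarke_selection X v y.
have [Z [ZT Zlip Zcl]] := clarke_flow_exists A0 gP gA T WT.
(* [W] is constrained before [T] only; its value at [T] is replaced by the left limit, where [Z]
   starts. *)
pose W' s := if s < T then W s else Z s.
have W'l s : s < T -> W' s = W s by rewrite /W' => ->.
have W'r s : T <= s -> W' s = Z s by rewrite /W' leNgt => /negbTE ->.
exists W'; last by move=> s _; exact: W'l.
split; first by rewrite W'l.
- move=> T' T'0 i j.
  have [K K0 HK] : exists2 K : R, 0 <= K & forall i j s t, T <= s -> s <= t -> t <= T' -> `|Z t i j - Z s i j| <= K * (t - s).
    have [TT|/ltW TT] := leP T T'.
      have [|K K0 HK] := Zlip (T' - T); first by rewrite subr_ge0.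
      by exists K => // p q s t Ts st tT; apply: HK => //; lra.
    by exists 1 => // p q s t Ts st tT; have -> : t = s; [lra|rewrite !subrr normr0 mulr0].
  apply: (@lipschitz_abs_cont _ _ (M + K)) => l r l0 lr rT'.
  have [rT|Tr] := ltP r T.
    rewrite !W'l//; last exact: le_lt_trans rT.
    apply: le_trans (HM i j _ _ l0 lr rT) _; rewrite ler_wpM2r ?subr_ge0// lerDl//.
  have [lT|Tl] := ltP l T; last first.
    rewrite !W'r//; apply: le_trans (HK i j _ _ Tl lr rT') _; rewrite ler_wpM2r ?subr_ge0// lerDr//.
  rewrite W'r// W'l//.
  have h1 := HK i j _ _ (lexx T) Tr rT'; have h2 := HwT (i, j) _ l0 lT; rewrite ZT mxE in h1.
  have := ler_normD (Z r i j - wT (i, j)) (wT (i, j) - W l i j); rewrite addrA subrK.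
  have : 0 <= K * (T - l) by rewrite mulr_ge0// subr_ge0 ltW.
  have : 0 <= M * (r - T) by rewrite mulr_ge0// subr_ge0.
  by rewrite /= in h2; lra.
(* [Z] is Lipschitz on bounded intervals only, so the half-line is exhausted by countably many
   windows. *)
have nd n : mu.-negligible [set s : R | exists ij : 'I_d0 * 'I_d1,
    [set s : R | (T < s /\ s < T + n.+1%:R) /\ ~ derivable (fun t => Z t ij.1 ij.2) s 1] s].
  apply: negligible_exists_fin => ij; have [//|K K0 HK] := Zlip n.+1%:R.
  by apply: (lipschitz_ae_derivable (K := K)); [rewrite ltrDl|move=> x z Tx xz zT; exact: HK].
have nT : mu.-negligible ([set 0; T] : set R).
  by apply: negligibleU; apply/negligibleP => //; exact: lebesgue_measure_set1.
have nall := negligibleU (negligibleU nT ng) (negligible_bigcup nd).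
apply: lebesgue_negligibleS nall => s [s0 nd'].
have [->|s0'] := eqVneq s 0; first by left; left; left.
have [->|sT'] := eqVneq s T; first by left; left; right.
have {s0'}s0' : 0 < s by rewrite lt_neqAle eq_sym s0' s0.
have [sT|Ts] := ltP s T.
  left; right; split; first exact: ltW.
  split; first exact: sT.
  move=> [dW cW]; apply: nd'.
  have HW i j : has_deriv (fun t => W' t i j) s (deriv_mx W s i j).
    have d0' : 0 < T - s by rewrite subr_gt0.
    rewrite mxE; apply: (has_deriv_near d0' _ (derivable_has_deriv (dW i j))) => h.
    by rewrite ltr_norml => /andP[_ h1]; rewrite W'l//; lra.
  split; first by move=> i j; exact: (proj1 (has_derivP (HW i j))).
  rewrite W'l// (_ : deriv_mx W' s = deriv_mx W s)//.
  by apply/matrixP => i j; rewrite mxE; exact: (proj2 (has_derivP (HW i j))).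
have {Ts sT'}Ts : T < s by rewrite lt_neqAle eq_sym sT' Ts.
right; apply: contrapT => hn; apply: nd'.
have dZ i j : derivable (fun t => Z t i j) s 1.
  apply: contrapT => nz; apply: hn.
  exists (Num.truncn (s - T)) => //; exists (i, j); split=> //; split=> //.
  have h0 : 0 <= s - T by rewrite subr_ge0 ltW.
  by have /andP[_] := truncn_itv h0; lra.
have HW i j : has_deriv (fun t => W' t i j) s (deriv_mx Z s i j).
  have d0' : 0 < s - T by rewrite subr_gt0.
  rewrite mxE; apply: (has_deriv_near d0' _ (derivable_has_deriv (dZ i j))) => h.
  by rewrite ltr_norml => /andP[h1 _]; rewrite W'r//; lra.
split; first by move=> i j; exact: (proj1 (has_derivP (HW i j))).
rewrite W'r ?ltW// (_ : deriv_mx W' s = deriv_mx Z s); first exact: Zcl.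
by apply/matrixP => i j; rewrite mxE; exact: (proj2 (has_derivP (HW i j))).
Qed.

Lemma sol_global_on W0 (T : R) (W : R -> 'M[R]_(d0, d1)) : sol_global L W0 W -> sol_on L W0 T W.
Proof.
move=> [h1 h2 h3]; split=> //; first by move=> T' T'0 _ i j; exact: h2.
by apply: lebesgue_negligibleS h3 => s [s0 [_ h]].
Qed.

End Flow.

(** * Decay along the flow *)

Section CauchySchwarz.
Variable R : realType.

Lemma cauchy_schwarz_sum (I : finType) (a b : I -> R) :
  (\sum_i a i * b i) ^+ 2 <= (\sum_i a i ^+ 2) * (\sum_i b i ^+ 2).
Proof.
set A := \sum_i a i ^+ 2; set B := \sum_i b i ^+ 2; set C := \sum_i a i * b i.
have B0 : 0 <= B by apply: sumr_ge0 => i _; exact: sqr_ge0.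
have H : 0 <= B * (A * B - C ^+ 2).
  have : 0 <= \sum_i (B * a i - C * b i) ^+ 2 by apply: sumr_ge0 => i _; exact: sqr_ge0.
  rewrite (_ : \sum_i _ = B ^+ 2 * A - 2 * B * C * C + C ^+ 2 * B); first by move=> h; rewrite (le_trans h)// le_eqVlt; apply/orP; left; apply/eqP; ring.
  have E i : (B * a i - C * b i) ^+ 2 = B ^+ 2 * a i ^+ 2 - 2 * B * C * (a i * b i) + C ^+ 2 * b i ^+ 2 by ring.
  by rewrite (eq_bigr _ (fun i _ => E i)) big_split sumrB -!mulr_sumr.
have [B00|/eqP Bn] := eqVneq B 0; last first.
  by move: H; rewrite pmulr_rge0 ?subr_ge0// lt_neqAle B0 eq_sym andbT; apply/eqP.
have b0 i : b i = 0.
  apply/eqP; rewrite -sqrf_eq0; apply/eqP; apply: le_anti; rewrite sqr_ge0 andbT -B00.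
  by rewrite /B (bigD1 i)//= lerDl; apply: sumr_ge0 => k _; exact: sqr_ge0.
by rewrite B00 mulr0 /C big1 ?expr0n// => i _; rewrite b0 mulr0.
Qed.

Lemma ler_of_sqr (a b : R) : 0 <= b -> a ^+ 2 <= b ^+ 2 -> a <= b.
Proof.
move=> b0; apply: contraTT; rewrite -!ltNge => ba.
by rewrite ltr_pXn2r ?nnegrE// ltW// (le_lt_trans b0 ba).
Qed.

Lemma frob_pair m n (A B : 'M[R]_(m, n)) : frob A B = \sum_(p : 'I_m * 'I_n) A p.1 p.2 * B p.1 p.2.
Proof. by rewrite /frob pair_bigA. Qed.

Lemma frob_sqr m n (A : 'M[R]_(m, n)) : frob A A = \sum_(p : 'I_m * 'I_n) A p.1 p.2 ^+ 2.
Proof. by rewrite frob_pair; apply: eq_bigr => p _; rewrite expr2. Qed.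

Lemma frob_cauchy m n (A B : 'M[R]_(m, n)) : `|frob A B| <= Num.sqrt (frob A A) * Num.sqrt (frob B B).
Proof.
rewrite -sqrtrM ?frob_ge0// -sqrtr_sqr; apply: ler_wsqrtr.
rewrite !frob_sqr frob_pair; exact: cauchy_schwarz_sum.
Qed.

Lemma frobC m n (A B : 'M[R]_(m, n)) : frob A B = frob B A.
Proof. by apply: eq_bigr => i _; apply: eq_bigr => j _; rewrite mulrC. Qed.

End CauchySchwarz.

Section Derivs.
Variable R : realType.

Lemma has_deriv_expR (c s : R) : has_deriv (fun t => expR (c * t)) s (c * expR (c * s)).
Proof.
have h : has_deriv expR (c * s) (expR (c * s)).
  have [d e] := is_derive_expR (c * s).
  by have := derivable_has_deriv d; rewrite derive1E e.
rewrite mulrC.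
have := has_derivZ c (has_deriv_id s); rewrite mulr1 => h2.
exact: (has_deriv_comp h2 h).
Qed.

Lemma has_deriv_sqrt (x : R) : 0 < x -> has_deriv Num.sqrt x (2 * Num.sqrt x)^-1.
Proof.
move=> x0 e e0; set r := Num.sqrt x; have r0 : 0 < r by rewrite sqrtr_gt0.
exists (Num.min x (e * (2 * r ^+ 3))); first by rewrite lt_min x0 !mulr_gt0// exprn_gt0.
move=> h; rewrite lt_min => /andP[h1 h2].
have xh : 0 < x + h by move: h1; rewrite ltr_norml => /andP[]; lra.
set q := Num.sqrt (x + h); have q0 : 0 < q by rewrite sqrtr_gt0.
have hE : h = q ^+ 2 - r ^+ 2 by rewrite !sqr_sqrtr ?ltW// addrAC subrr add0r.
have rn : r != 0 by rewrite gt_eqF.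
have qr : q + r != 0 by rewrite gt_eqF// addr_gt0.
rewrite (_ : _ - _ = - (h ^+ 2 / (2 * r * (q + r) ^+ 2))); last by rewrite hE; field; rewrite rn qr.
have D0 : 0 < 2 * r * (q + r) ^+ 2 by rewrite !mulr_gt0 ?exprn_gt0// addr_gt0.
rewrite normrN ger0_norm; last by rewrite divr_ge0 ?sqr_ge0// ltW.
rewrite ler_pdivrMr// -real_normK ?num_real// expr2 mulrAC ler_wpM2r//.
apply: le_trans (ltW h2) _; rewrite ler_pM2l// -mulrA ler_pM2l//.
rewrite exprS ler_pM2l// lerXn2r ?nnegrE ?addr_ge0// ?ltW//; lra.
Qed.

Lemma abs_cont_expR (c a b : R) : 0 <= c -> abs_cont_on (fun t => expR (c * t)) a b.
Proof.
move=> c0; apply: (@lipschitz_abs_cont _ _ (c * expR (c * b))) => l r al lr rb.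
rewrite ger0_norm ?subr_ge0 ?ler_expR ?ler_wpM2l//.
have h : expR (c * r) * (1 - c * (r - l)) <= expR (c * l).
  rewrite [X in _ <= expR X](_ : _ = c * r + - (c * (r - l))); last by ring.
  by rewrite expRD ler_pM2l ?expR_gt0// expR_ge1Dx.
have : expR (c * r) <= expR (c * b) by rewrite ler_expR ler_wpM2l.
have : 0 <= c * (r - l) by rewrite mulr_ge0// subr_ge0.
move=> h1 h2; have := ler_wpM2r h1 h2; lra.
Qed.

End Derivs.

Section Decay.
Variables (R : realType) (N d0 d1 : nat).
Variables (X : 'M[R]_(N, d0)) (v : 'cV[R]_d1) (y : 'cV[R]_N).
Implicit Types (W V xi D : 'M[R]_(d0, d1)).
Local Notation L := (loss X v y).
Local Notation res := (residual X v y).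

Lemma frob_has_deriv (W : R -> 'M[R]_(d0, d1)) U s D :
  (forall a b, has_deriv (fun t => W t a b) s (D a b)) -> has_deriv (fun t => frob U (W t)) s (frob U D).
Proof. by move=> H; apply: has_deriv_sum => a; apply: has_deriv_sum => b; exact: has_derivZ. Qed.

Lemma frob_abs_cont (W : R -> 'M[R]_(d0, d1)) U (a b : R) :
  (forall i j, abs_cont_on (fun s => W s i j) a b) -> abs_cont_on (fun t => frob U (W t)) a b.
Proof.
move=> H; apply: (abs_cont_dominated (F := fun k : 'I_d0 * 'I_d1 => fun s => W s k.1 k.2) (C := l1norm U)).
  by move=> k; exact: H.
move=> l r _ _ _; rewrite !frob_pair -sumrB; apply: le_trans (ler_norm_sum _ _ _) _.
rewrite mulr_sumr; apply: ler_sum => k _; rewrite -mulrBr normrM ler_wpM2r//.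
exact: ler_l1norm.
Qed.

Section Gradient.
Variables (W0 : 'M[R]_(d0, d1)) (m r : R).
Hypotheses (m0 : 0 < m) (r0 : 0 < r).
(* Polyak-Lojasiewicz inequality *)
Hypothesis PL : forall W xi, frob (W - W0) (W - W0) <= r ^+ 2 -> clarke_subdiff L W xi ->
  m / 2 * L W <= frob xi xi.
Hypothesis rL : 8 * L W0 < m * r ^+ 2.

(* The potential <U, W> + c sqrt (L W) with U = W t - W0 decreases along the flow; [e] smooths the square root at L = 0. *)
Lemma travel_bound (W : R -> 'M[R]_(d0, d1)) (t : R) : sol_global L W0 W -> 0 <= t ->
  (forall s, 0 < s -> s < t -> frob (W s - W0) (W s - W0) <= r ^+ 2) ->
  Num.sqrt (frob (W t - W0) (W t - W0)) <= 2 / Num.sqrt (m / 2) * Num.sqrt (L W0).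
Proof.
move=> gW t0 Hball.
set q := Num.sqrt (m / 2); have q0 : 0 < q by rewrite sqrtr_gt0 divr_gt0.
have q2 : q ^+ 2 = m / 2 by rewrite sqr_sqrtr// ltW// divr_gt0.
set k := 2 / q; have k0 : 0 < k by rewrite divr_gt0.
set U := W t - W0; set n := Num.sqrt (frob U U).
have [->|nn] := eqVneq n 0; first by rewrite mulr_ge0 ?sqrtr_ge0// ltW.
have n0 : 0 < n by rewrite lt_neqAle eq_sym nn sqrtr_ge0.
have n2 : n ^+ 2 = frob U U by rewrite sqr_sqrtr// frob_ge0.
have tT : t < t + 1 by rewrite ltrDl.
have sW := sol_global_on (t + 1) gW.
have acW := sol_abs_cont sW (lexx 0) t0 tT.
have W00 : W 0 = W0 by case: gW.
have key e : 0 < e -> n <= k * Num.sqrt (L W0 + e) + q * Num.sqrt e * t.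
  move=> e0.
  pose f s := frob U (W s) + (n * k * Num.sqrt (L (W s) + e) + - (n * (q * Num.sqrt e)) * s).
  have : f t <= f 0.
    apply: (flow_nonincr sW (lexx 0) t0 tT).
      have ac3 (i : 'I_3) : abs_cont_on (nth (fun=> 0) [:: fun s => frob U (W s); fun s => Num.sqrt (L (W s) + e); id] i) 0 t.
        case: i => -[|[|[|//]]] h /=; first exact: frob_abs_cont.
          have acL := loss_abs_cont X v y t0 acW.
          apply: (abs_cont_dominated (F := fun _ : unit => fun s => L (W s)) (C := (2 * Num.sqrt e)^-1)) => // a b _ _ _.
          rewrite big_const card_unit /= addr0.
          have se0 : 0 < Num.sqrt e by rewrite sqrtr_gt0.
          rewrite mulrC ler_pdivlMr ?mulr_gt0//.
          set x := L (W b); set z := L (W a); have x0 : 0 <= x by exact: loss_ge0.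
          have z0 : 0 <= z by exact: loss_ge0.
          have xe : Num.sqrt e <= Num.sqrt (x + e) by apply: ler_wsqrtr; lra.
          have ze : Num.sqrt e <= Num.sqrt (z + e) by apply: ler_wsqrtr; lra.
          have -> : x - z = (Num.sqrt (x + e) - Num.sqrt (z + e)) * (Num.sqrt (x + e) + Num.sqrt (z + e)).
            by rewrite -subr_sqr !sqr_sqrtr; [ring|lra|lra].
          rewrite normrM ler_wpM2l// ger0_norm; lra.
        by apply: (@lipschitz_abs_cont _ _ 1) => a b _ ab _; rewrite mul1r ger0_norm// subr_ge0.
      apply: (abs_cont_dominated ac3 (C := 1 + n * k + n * (q * Num.sqrt e))) => a b _ _ _.
      rewrite !big_ord_recr big_ord0 /= add0r /f.
      have nk0 : 0 <= n * k by rewrite mulr_ge0 ?ltW.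
      have nq0 : 0 <= n * (q * Num.sqrt e) by rewrite mulr_ge0 ?mulr_ge0 ?sqrtr_ge0// ltW.
      set A := frob U (W b) - frob U (W a); set B := Num.sqrt (L (W b) + e) - Num.sqrt (L (W a) + e).
      rewrite (_ : _ - _ = A + (n * k * B + - (n * (q * Num.sqrt e) * (b - a)))); last by rewrite /A /B; ring.
      apply: le_trans (ler_normD _ _) _.
      have := ler_normD (n * k * B) (- (n * (q * Num.sqrt e) * (b - a))).
      have -> : `|n * k * B| = n * k * `|B| by rewrite normrM (ger0_norm nk0).
      have -> : `|- (n * (q * Num.sqrt e) * (b - a))| = n * (q * Num.sqrt e) * `|b - a|.
        by rewrite normrN normrM (ger0_norm nq0).
      have p1 : 0 <= (n * k + n * (q * Num.sqrt e)) * `|A| by rewrite mulr_ge0// addr_ge0.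
      have p2 : 0 <= (1 + n * (q * Num.sqrt e)) * `|B| by rewrite mulr_ge0// addr_ge0.
      have p3 : 0 <= (1 + n * k) * `|b - a| by rewrite mulr_ge0// addr_ge0.
      lra.
    move=> u u0 ut [dL dW cW]; set D := deriv_mx W u in dL dW cW.
    have Le0 : 0 < L (W u) + e by rewrite ltr_wpDl// loss_ge0.
    have dS := has_deriv_comp (has_derivD dL (has_deriv_cst e u)) (has_deriv_sqrt Le0).
    have := has_derivD (frob_has_deriv U dW) (has_derivD (has_derivZ (n * k) dS) (has_derivZ (- (n * (q * Num.sqrt e))) (has_deriv_id u))).
    move=> df; eexists; first exact: df.
    have PLu := PL (Hball u u0 ut) cW.
    have DD : frob (- D) (- D) = frob D D.
      by rewrite /frob; apply: eq_bigr => i _; apply: eq_bigr => j _; rewrite !mxE mulrNN.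
    rewrite DD in PLu.
    set S := Num.sqrt (L (W u) + e); have S0 : 0 < S by rewrite sqrtr_gt0.
    set w := Num.sqrt (frob D D); have w0 : 0 <= w by exact: sqrtr_ge0.
    have w2 : w ^+ 2 = frob D D by rewrite sqr_sqrtr// frob_ge0.
    have UD : frob U D <= n * w by apply: le_trans (ler_norm _) (frob_cauchy _ _).
    set l := Num.sqrt (L (W u)); have l0 : 0 <= l by exact: sqrtr_ge0.
    have l2 : l ^+ 2 = L (W u) by rewrite sqr_sqrtr// loss_ge0.
    have se0 : 0 <= Num.sqrt e by exact: sqrtr_ge0.
    have S2 : S ^+ 2 = l ^+ 2 + Num.sqrt e ^+ 2 by rewrite !sqr_sqrtr ?loss_ge0 ?ltW.
    have Sle : S <= l + Num.sqrt e.
      apply: ler_of_sqr; first exact: addr_ge0.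
      by rewrite S2; have := mulr_ge0 l0 se0; lra.
    have wl : q * l <= w.
      by apply: ler_of_sqr => //; rewrite exprMn q2 l2 w2.
    rewrite -w2 addr0 mulr1.
    (* The difference equals [w (q S - w) / (q S)]. It is nonpositive when [q S <= w]; otherwise
       [w / (q S) <= 1] and [wl] gives [q S - w <= q (S - l) <= q sqrt e]. *)
    suff : w - k * ((2 * S)^-1 * w ^+ 2) <= q * Num.sqrt e.
      move=> h; have := ler_wpM2l (ltW n0) h; lra.
    have -> : w - k * ((2 * S)^-1 * w ^+ 2) = w * (q * S - w) / (q * S).
      by rewrite /k; field; rewrite !gt_eqF.
    rewrite ler_pdivrMr ?mulr_gt0//.
    have [h|/ltW h] := leP (q * S) w.
      apply: le_trans (_ : 0 <= _); last by apply: mulr_ge0; apply: mulr_ge0 => //; exact: ltW.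
      by rewrite mulr_ge0_le0// subr_le0.
    rewrite mulrC; apply: ler_pM => //; first by rewrite subr_ge0.
    apply: le_trans (_ : q * S - q * l <= _); first by rewrite lerD2l lerN2.
    rewrite -mulrBr; apply: ler_wpM2l; [exact: ltW|lra].
  have S0 : 0 <= Num.sqrt (L (W t) + e) by exact: sqrtr_ge0.
  have : 0 <= n * k * Num.sqrt (L (W t) + e) by apply: mulr_ge0 => //; apply: mulr_ge0; exact: ltW.
  rewrite /f W00 mulr0 addr0 => h1 h2.
  have h3 : frob U U = frob U (W t) - frob U W0.
    by rewrite [in RHS]frobC [X in _ = _ - X]frobC -frobBl frobC.
  have : n * n <= n * (k * Num.sqrt (L W0 + e) + q * Num.sqrt e * t).
    by rewrite -expr2 n2 h3; lra.
  by rewrite ler_pM2l.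
apply/ler_addgt0Pl => e e0.
pose a := k + q * t; have a0 : 0 < a by rewrite /a ltr_pwDl// mulr_ge0// ltW.
(* With this square the two square-root terms together cost [(k + q t) (e / a) = e]. *)
have := key ((e / a) ^+ 2) (exprn_gt0 _ (divr_gt0 e0 a0)).
have ea0 : 0 <= e / a by rewrite divr_ge0 ?(ltW a0) ?(ltW e0).
rewrite sqrtr_sqr (ger0_norm ea0).
have : Num.sqrt (L W0 + (e / a) ^+ 2) <= Num.sqrt (L W0) + e / a.
  have L0 := loss_ge0 X v y W0; have sL := sqrtr_ge0 (L W0).
  apply: ler_of_sqr; first exact: addr_ge0.
  rewrite sqr_sqrtr ?addr_ge0 ?exprn_ge0// sqrrD (sqr_sqrtr L0) lerD2r lerDl.
  by rewrite mulrn_wge0// mulr_ge0.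
move=> h1 h2; have := ler_wpM2l (ltW k0) h1.
have : a * (e / a) = e by rewrite mulrC divfK// gt_eqF.
rewrite {1}/a => h3; lra.
Qed.

(** A bootstrap at the first exit time: up to it the travel bound gives a distance [b] strictly
    below [r], and the Lipschitz bound leaves no room to exceed [r] immediately afterwards. *)
Lemma flow_in_ball (W : R -> 'M[R]_(d0, d1)) : sol_global L W0 W -> forall t, 0 <= t ->
  frob (W t - W0) (W t - W0) <= r ^+ 2.
Proof.
move=> gW.
set b := 2 / Num.sqrt (m / 2) * Num.sqrt (L W0).
have b0 : 0 <= b by rewrite mulr_ge0 ?divr_ge0 ?sqrtr_ge0.
(* The square of [b] is [8 L W0 / m], the quantity compared with [r ^+ 2] in [rL]. *)
have br : b < r.
  rewrite -(@ltr_pXn2r _ 2%N) ?nnegrE ?(ltW r0)// /b exprMn expr_div_n (sqr_sqrtr (loss_ge0 _ _ _ _)) sqr_sqrtr; last by rewrite divr_ge0// ltW.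
  rewrite (_ : _ / _ * _ = 8 * L W0 / m); last by field; rewrite gt_eqF.
  by rewrite ltr_pdivrMr// [X in _ < X]mulrC.
move=> t t0; apply: contrapT => /negP; rewrite -ltNge => ht.
pose S := [set s | 0 <= s /\ r ^+ 2 < frob (W s - W0) (W s - W0)].
have hS : has_inf S by split; [exists t|exists 0 => s []].
have i0 : 0 <= inf S by apply: lb_le_inf; [exists t|move=> s []].
have below s : 0 < s -> s < inf S -> frob (W s - W0) (W s - W0) <= r ^+ 2.
  move=> s0 si; rewrite leNgt; apply/negP => h.
  have := ge_inf (proj2 hS) (conj (ltW s0) h : S s); lra.
have := travel_bound gW i0 below; rewrite -/b => hb.
have it : inf S <= t by apply: ge_inf; [exact: (proj2 hS)|].
have [M M0 HM] := sol_lipschitz (sol_global_on (inf S + 2) gW).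
pose C := Num.sqrt ((d0 * d1)%:R * M ^+ 2).
have C0 : 0 <= C by exact: sqrtr_ge0.
pose dl := Num.min 1 ((r - b) / (1 + C)).
have dl0 : 0 < dl by rewrite lt_min ltr01 divr_gt0 ?subr_gt0// ltr_pwDl.
have [s [s0 hs] si] := inf_adherent dl0 hS.
have is_ : inf S <= s by apply: ge_inf; [exact: (proj2 hS)|].
have dl1 : dl <= 1 by rewrite ge_min lexx.
have hd : Num.sqrt (frob (W s - W (inf S)) (W s - W (inf S))) <= C * (s - inf S).
  rewrite /C -(@ger0_norm _ (s - inf S)) ?subr_ge0// -sqrtr_sqr -sqrtrM; last by rewrite mulr_ge0// exprn_ge0.
  apply: ler_wsqrtr; rewrite frob_sqr.
  apply: le_trans (_ : \sum_(p : 'I_d0 * 'I_d1) (M * (s - inf S)) ^+ 2 <= _); last first.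
    by rewrite sumr_const card_prod !card_ord exprMn mulr_natl mulrnAl.
  apply: ler_sum => p _; rewrite !mxE -real_normK ?num_real// lerXn2r ?nnegrE ?mulr_ge0 ?subr_ge0//.
  apply: HM => //; lra.
have tri (A B : 'M[R]_(d0, d1)) : Num.sqrt (frob (A + B) (A + B)) <= Num.sqrt (frob A A) + Num.sqrt (frob B B).
  have hA := sqrtr_ge0 (frob A A); have hB := sqrtr_ge0 (frob B B).
  rewrite -(@ler_pXn2r _ 2%N) ?nnegrE ?addr_ge0 ?sqrtr_ge0//.
  rewrite sqrrD !sqr_sqrtr ?frob_ge0//.
  have -> : frob (A + B) (A + B) = frob A A + frob A B *+ 2 + frob B B.
    by rewrite frobDl [frob A _]frobC [frob B _]frobC !frobDl (frobC B A) mulr2n; ring.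
  by rewrite lerD2r lerD2l lerMn2r /=; apply: le_trans (ler_norm _) (frob_cauchy _ _).
have := tri (W s - W (inf S)) (W (inf S) - W0).
rewrite addrA subrK => h1.
have h2 : C * (s - inf S) <= C * ((r - b) / (1 + C)).
  by rewrite ler_wpM2l//; apply: le_trans (_ : dl <= _); [lra|rewrite ge_min lexx orbT].
have h3 : C * ((r - b) / (1 + C)) <= r - b.
  rewrite mulrA ler_pdivrMr ?ltr_pwDl//; have : 0 <= r - b by rewrite subr_ge0 ltW.
  by move=> h; lra.
have : r < Num.sqrt (frob (W s - W0) (W s - W0)).
  by rewrite -(@ltr_pXn2r _ 2%N) ?nnegrE ?sqrtr_ge0 ?ltW// sqr_sqrtr// frob_ge0.
lra.
Qed.

(** Gronwall's argument: the loss times [expR (m / 2 * s)] is nonincreasing, [PL] being available at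
    all times by [flow_in_ball]. *)
Lemma flow_decay (W : R -> 'M[R]_(d0, d1)) : sol_global L W0 W -> forall t, 0 <= t ->
  L (W t) <= L W0 * expR (- (m / 2 * t)).
Proof.
move=> gW t t0; have W00 : W 0 = W0 by case: gW.
have tT : t < t + 1 by rewrite ltrDl.
have sW := sol_global_on (t + 1) gW.
have acW := sol_abs_cont sW (lexx 0) t0 tT.
have m20 : 0 <= m / 2 by rewrite divr_ge0// ltW.
have : (fun s => L (W s) * expR (m / 2 * s)) t <= (fun s => L (W s) * expR (m / 2 * s)) 0.
  apply: (flow_nonincr (f := fun s => L (W s) * expR (m / 2 * s)) sW (lexx 0) t0 tT).
    have acL := loss_abs_cont X v y t0 acW.
    have acE := abs_cont_expR 0 t m20.
    have ac2 (b : bool) : abs_cont_on (if b then (fun s => L (W s)) else (fun s => expR (m / 2 * s))) 0 t by case: b.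
    apply: (abs_cont_dominated ac2 (C := expR (m / 2 * t) + L W0)) => a b a0 ab bt.
    rewrite big_bool /=.
    rewrite (_ : _ - _ = (L (W b) - L (W a)) * expR (m / 2 * b) + L (W a) * (expR (m / 2 * b) - expR (m / 2 * a))); last by ring.
    apply: le_trans (ler_normD _ _) _; rewrite [`|(L (W b) - L (W a)) * _|]normrM [`|L (W a) * _|]normrM (ger0_norm (expR_ge0 _)) (ger0_norm (loss_ge0 X v y (W a))).
    have h1 : expR (m / 2 * b) <= expR (m / 2 * t) by rewrite ler_expR ler_wpM2l.
    have h2 : L (W a) <= L W0.
      by rewrite -W00; apply: (sol_loss_nonincr sW) => //; apply: le_lt_trans tT; exact: le_trans bt.
    have h3 := ler_wpM2l (normr_ge0 (L (W b) - L (W a))) h1.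
    have h4 := ler_wpM2r (normr_ge0 (expR (m / 2 * b) - expR (m / 2 * a))) h2.
    have h5 : 0 <= L W0 * `|L (W b) - L (W a)| by rewrite mulr_ge0// loss_ge0.
    have h6 : 0 <= expR (m / 2 * t) * `|expR (m / 2 * b) - expR (m / 2 * a)| by rewrite mulr_ge0// expR_ge0.
    lra.
  move=> u u0 ut [dL dW cW]; eexists; first exact: (has_derivM dL (has_deriv_expR (m / 2) u)).
  have := PL (flow_in_ball gW (ltW u0)) cW.
  have -> : frob (- deriv_mx W u) (- deriv_mx W u) = frob (deriv_mx W u) (deriv_mx W u).
    by rewrite /frob; apply: eq_bigr => i _; apply: eq_bigr => j _; rewrite !mxE mulrNN.
  move=> h; have := ler_wpM2r (expR_ge0 (m / 2 * u)) h; lra.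
rewrite /= mulr0 expR0 mulr1 W00 expRN => h.
by rewrite ler_pdivlMr// expR_gt0.
Qed.

End Gradient.
End Decay.

(** * The activation kernel *)

Section LambdaMin.
Variable R : realType.

Definition dotv n (u w : 'cV[R]_n) : R := \sum_i u i 0 * w i 0.

Lemma dotvE n (u w : 'cV[R]_n) : dotv u w = (u^T *m w) 0 0.
Proof. by rewrite mxE; apply: eq_bigr => i _; rewrite mxE. Qed.

Lemma dotvC n (u w : 'cV[R]_n) : dotv u w = dotv w u.
Proof. by apply: eq_bigr => i _; rewrite mulrC. Qed.

Lemma dotvDl n (u1 u2 w : 'cV[R]_n) : dotv (u1 + u2) w = dotv u1 w + dotv u2 w.
Proof. by rewrite /dotv -big_split; apply: eq_bigr => i _; rewrite mxE mulrDl. Qed.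

Lemma dotvZl n k (u w : 'cV[R]_n) : dotv (k *: u) w = k * dotv u w.
Proof. by rewrite /dotv mulr_sumr; apply: eq_bigr => i _; rewrite mxE mulrA. Qed.

Lemma dotvDr n (u1 u2 w : 'cV[R]_n) : dotv w (u1 + u2) = dotv w u1 + dotv w u2.
Proof. by rewrite dotvC dotvDl !(dotvC w). Qed.

Lemma dotvZr n k (u w : 'cV[R]_n) : dotv w (k *: u) = k * dotv w u.
Proof. by rewrite dotvC dotvZl dotvC. Qed.

Lemma dotv_mul m n (A : 'M[R]_(m, n)) (u : 'cV[R]_m) (w : 'cV[R]_n) : dotv u (A *m w) = dotv (A^T *m u) w.
Proof. by rewrite !dotvE trmx_mul trmxK mulmxA. Qed.

Lemma sqnormE n (u : 'cV[R]_n) : sqnorm u = dotv u u.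
Proof. by apply: eq_bigr => i _; rewrite expr2. Qed.

Lemma sqnorm_ge0 n (u : 'cV[R]_n) : 0 <= sqnorm u.
Proof. by apply: sumr_ge0 => i _; exact: sqr_ge0. Qed.

Lemma sqnorm_eq0 n (u : 'cV[R]_n) : (sqnorm u == 0) = (u == 0).
Proof.
apply/eqP/eqP => [h|->]; last by rewrite /sqnorm big1// => i _; rewrite mxE expr0n.
apply/matrixP => i j; rewrite ord1 mxE; apply/eqP; rewrite -sqrf_eq0; apply/eqP/le_anti.
rewrite sqr_ge0 andbT -h /sqnorm (bigD1 i)//= lerDl; apply: sumr_ge0 => k _; exact: sqr_ge0.
Qed.

Lemma sqnormZ n k (u : 'cV[R]_n) : sqnorm (k *: u) = k ^+ 2 * sqnorm u.
Proof. by rewrite !sqnormE dotvZl dotvZr mulrA expr2. Qed.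

Lemma dotv_cauchy n (u w : 'cV[R]_n) : dotv u w ^+ 2 <= sqnorm u * sqnorm w.
Proof. exact: cauchy_schwarz_sum. Qed.

Lemma sqnorm_mul_le m n (A : 'M[R]_(m, n)) (u : 'cV[R]_n) : sqnorm (A *m u) <= frob A A * sqnorm u.
Proof.
rewrite /sqnorm /frob mulr_suml; apply: ler_sum => i _; rewrite mxE.
apply: le_trans (cauchy_schwarz_sum _ _) _; rewrite ler_wpM2r//; first exact: sqnorm_ge0.
Qed.

(* Cauchy-Schwarz for the form replaces compactness of the sphere. *)
Lemma psd_unit_bound n (T : 'M[R]_n) : T^T = T -> (forall u, 0 <= dotv u (T *m u)) -> T \in unitmx ->
  exists2 e : R, 0 < e & forall u, e * sqnorm u <= dotv u (T *m u).
Proof.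
move=> Ts Tp Tu.
have cs u w : dotv u (T *m w) ^+ 2 <= dotv u (T *m u) * dotv w (T *m w).
  set a := dotv u (T *m u); set b := dotv w (T *m w); set c := dotv u (T *m w).
  have c' : dotv w (T *m u) = c by rewrite /c dotv_mul Ts dotvC.
  have q (s t : R) : 0 <= s ^+ 2 * a + 2 * s * t * c + t ^+ 2 * b.
    have := Tp (s *: u + t *: w).
    rewrite mulmxDr -!scalemxAr !dotvDl !dotvDr !dotvZl !dotvZr -/a -/b -/c c' => h.
    by apply: le_trans h _; rewrite le_eqVlt; apply/orP; left; apply/eqP; ring.
  have [b0|bn] := eqVneq b 0.
    have a0 : 0 <= a by exact: Tp.
    have [->|cn] := eqVneq c 0; first by rewrite expr0n b0 mulr0.
    have := q 1 (- (a + 1) / (2 * c)); rewrite b0 mulr0 addr0 expr1n mul1r mulr1.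
    rewrite (_ : 2 * _ * c = - (a + 1)); last by field.
    lra.
  have b0 : 0 < b by rewrite lt_neqAle eq_sym bn; exact: Tp.
  have := q b (- c); rewrite -(pmulr_rge0 _ b0) => h.
  rewrite -(ler_pM2l b0) -subr_ge0 -(pmulr_rge0 _ b0).
  by apply: le_trans h _; rewrite le_eqVlt; apply/orP; left; apply/eqP; ring.
pose c1 := 1 + frob T T; pose c2 := 1 + frob (invmx T) (invmx T).
have c10 : 0 < c1 by rewrite ltr_pwDl// frob_ge0.
have c20 : 0 < c2 by rewrite ltr_pwDl// frob_ge0.
exists (c1 * c2)^-1; first by rewrite invr_gt0 mulr_gt0.
move=> u; rewrite mulrC ler_pdivrMr ?mulr_gt0//.
set w := T *m u.
have h1 : dotv w (T *m w) <= c1 * sqnorm w.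
  have := dotv_cauchy w (T *m w); have := sqnorm_mul_le T w => h2 h3.
  have w0 := sqnorm_ge0 w; have F0 := frob_ge0 T.
  apply: ler_of_sqr; first by rewrite mulr_ge0// ltW.
  apply: le_trans h3 _; rewrite exprMn.
  apply: le_trans (_ : sqnorm w * (frob T T * sqnorm w) <= _); first by rewrite ler_wpM2l.
  rewrite mulrCA -expr2 ler_wpM2r ?sqr_ge0// /c1; nra.
have h2 : sqnorm w <= c1 * dotv u (T *m u).
  have := cs u w; rewrite {1}dotv_mul Ts -/w -sqnormE => h3.
  have w0 := sqnorm_ge0 w; have [->|wn] := eqVneq (sqnorm w) 0; first by rewrite mulr_ge0// ltW.
  have wp : 0 < sqnorm w by rewrite lt_neqAle eq_sym wn.
  rewrite -(ler_pM2r wp) -expr2; apply: le_trans h3 _.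
  by rewrite mulrAC mulrC; apply: ler_wpM2r.
have h3 : sqnorm u <= c2 * sqnorm w.
  have -> : u = invmx T *m w by rewrite /w mulmxA mulVmx// mul1mx.
  apply: le_trans (sqnorm_mul_le _ _) _.
  by rewrite ler_wpM2r ?sqnorm_ge0// /c2; lra.
apply: le_trans h3 _; rewrite mulrA (mulrC _ c1) -mulrA (mulrC (dotv _ _)) mulrCA; rewrite ler_pM2l//.
Qed.

(** [lambda_min] is an infimum over eigenvalues, so an eigenvalue has to be produced. The infimum
    [m] of the Rayleigh quotient is one: otherwise [S - m] would be positive semidefinite and
    invertible, hence bounded below by some [e > 0] on unit vectors, and [m] could be raised by [e].
    Every other eigenvalue is a Rayleigh quotient. *)
Lemma sigma_min_spec p q (A : 'M[R]_(p, q)) (k : R) : (0 < q)%N -> 0 <= k ->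
  (forall u : 'cV[R]_q, k * sqnorm u <= sqnorm (A *m u)) ->
  k <= sigma_min A ^+ 2 /\ forall u : 'cV[R]_q, sigma_min A ^+ 2 * sqnorm u <= sqnorm (A *m u).
Proof.
case: q A => // q A _ k0 Hk.
pose S := A^T *m A.
have SE u : dotv u (S *m u) = sqnorm (A *m u) by rewrite /S -mulmxA dotv_mul trmxK -sqnormE.
pose Ra := [set sqnorm (A *m u) / sqnorm u | u in [set u : 'cV[R]_q.+1 | u != 0]].
have sp (u : 'cV[R]_q.+1) : u != 0 -> 0 < sqnorm u by move=> un; rewrite lt_neqAle eq_sym sqnorm_eq0 un sqnorm_ge0.
have lb : lbound Ra k by move=> _ [u /= un <-]; rewrite ler_pdivlMr ?sp.
pose e1 : 'cV[R]_q.+1 := delta_mx 0 0.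
have e1n : e1 != 0.
  by apply/eqP => /matrixP /(_ 0 0); rewrite !mxE !eqxx => /eqP; rewrite oner_eq0.
have hR : has_inf Ra by split; [exists (sqnorm (A *m e1) / sqnorm e1); exists e1|exists k].
pose m := inf Ra.
have mk : k <= m by apply: lb_le_inf => //; exact: (proj1 hR).
have Hm (u : 'cV[R]_q.+1) : m * sqnorm u <= sqnorm (A *m u).
  have [->|un] := eqVneq u 0; first by rewrite mulmx0 /sqnorm !big1 ?mulr0// => i _; rewrite mxE expr0n.
  by rewrite -ler_pdivlMr ?sp//; apply: ge_inf; [exact: (proj2 hR)|exists u].
have St : S^T = S by rewrite /S trmx_mul trmxK.
have eig : eigenvalue S m.
  apply: contrapT => /negP ne.
  have Tt : (S - m%:M)^T = S - m%:M by rewrite linearB /= St tr_scalar_mx.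
  have TE (u : 'cV[R]_q.+1) : dotv u ((S - m%:M) *m u) = sqnorm (A *m u) - m * sqnorm u.
    by rewrite mulmxBl mul_scalar_mx -scaleNr dotvDr dotvZr SE mulNr -sqnormE.
  have Tp (u : 'cV[R]_q.+1) : 0 <= dotv u ((S - m%:M) *m u) by rewrite TE subr_ge0.
  have Tu : S - m%:M \in unitmx.
    move: ne; rewrite /eigenvalue negbK /eigenspace => /eqP ne.
    by rewrite -row_free_unit -kermx_eq0 ne.
  have [e e0 He] := psd_unit_bound Tt Tp Tu.
  have : m + e <= m; last by rewrite gerDl leNgt e0.
  apply: lb_le_inf; first exact: (proj1 hR).
  move=> _ [u /= un <-]; rewrite ler_pdivlMr ?sp//.
  by have := He u; rewrite TE; lra.
have lm : lambda_min S = m.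
  apply/eqP; rewrite eq_le; apply/andP; split.
    apply: ge_inf => //; exists m => a /eigenvalueP[w wS wn].
    have wn' : w^T != 0 by apply: contra wn => /eqP h; rewrite -(trmxK w) h trmx0.
    have := Hm w^T; rewrite -SE (_ : S *m w^T = a *: w^T); last by rewrite -[LHS]trmxK trmx_mul trmxK St wS linearZ.
    by rewrite dotvZr -sqnormE ler_pM2r ?sp.
  apply: lb_le_inf; first by exists m.
  move=> a /eigenvalueP[w wS wn].
  have wn' : w^T != 0 by apply: contra wn => /eqP h; rewrite -(trmxK w) h trmx0.
  have := Hm w^T; rewrite -SE (_ : S *m w^T = a *: w^T); last by rewrite -[LHS]trmxK trmx_mul trmxK St wS linearZ.
  by rewrite dotvZr -sqnormE ler_pM2r ?sp.
have -> : sigma_min A ^+ 2 = m by rewrite /sigma_min -/S lm sqr_sqrtr// (le_trans k0).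
by [].
Qed.

End LambdaMin.

(** * Gradient lower bound near the initialization *)

Section GoodEvent.
Variables (R : realType) (N d0 d1 : nat).
Variables (X : 'M[R]_(N, d0)) (v : 'cV[R]_d1) (y : 'cV[R]_N) (W0 : 'M[R]_(d0, d1)).
Implicit Types (W V xi D : 'M[R]_(d0, d1)).
Local Notation L := (loss X v y).
Local Notation res := (residual X v y).
Local Notation P := (act_pattern X W0).

(** Indexing the rows of the transposed product by pairs of an input coordinate and a neuron splits
    the norm into one term per neuron; this turns [beta0] into a statement on the activation
    kernel. *)
Lemma khatri_rao_mul (Pm : 'M[R]_(N, d1)) (u : 'cV[R]_N) :
  sqnorm ((khatri_rao X (Pm *m diag_mx v^T))^T *m u) =
  \sum_j v j 0 ^+ 2 * sqnorm (X^T *m (\col_i (Pm i j * u i 0))).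
Proof.
have E a j : ((khatri_rao X (Pm *m diag_mx v^T))^T *m u) (mxvec_index a j) 0 =
    v j 0 * (X^T *m (\col_i (Pm i j * u i 0))) a 0.
  rewrite !mxE mulr_sumr; apply: eq_bigr => i _.
  have -> : (khatri_rao X (Pm *m diag_mx v^T))^T (mxvec_index a j) i = X i a * (Pm i j * v j 0).
    by rewrite mxE /khatri_rao mxE mxvecE mxE big_ord1 mul_mx_diag !mxE.
  by rewrite !mxE; ring.
rewrite /sqnorm (reindex _ (curry_mxvec_bij d0 d1)) /=.
transitivity (\sum_(p : 'I_d0 * 'I_d1) (v p.2 0 * (X^T *m (\col_i (Pm i p.2 * u i 0))) p.1 0) ^+ 2).
  by apply: eq_bigr => -[a j] _ /=; rewrite E.
rewrite -(pair_bigA _ (fun a j => (v j 0 * (X^T *m (\col_i (Pm i j * u i 0))) a 0) ^+ 2)) /=.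
rewrite exchange_big /=; apply: eq_bigr => j _; rewrite mulr_sumr; apply: eq_bigr => a _.
by rewrite exprMn.
Qed.

Variables (a B m : R).
Hypothesis Xrow : forall i, \sum_k X i k ^+ 2 = 1.
Hypothesis va : forall j, v j 0 ^+ 2 = a ^+ 2.
Hypothesis XB : forall q : 'cV[R]_N, sqnorm (X^T *m q) <= B * sqnorm q.
Hypothesis Hm : forall u : 'cV[R]_N, m * sqnorm u <= sqnorm ((khatri_rao X (P *m diag_mx v^T))^T *m u).
Hypothesis B0 : 0 <= B.

Let col_sq W j : R := \sum_k W k j ^+ 2.

Lemma preact_diff W W' i j : ((X *m W') i j - (X *m W) i j) ^+ 2 <= col_sq (W' - W) j.
Proof.
rewrite !mxE -sumrB; under eq_bigr do rewrite -mulrBr.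
apply: le_trans (cauchy_schwarz_sum _ _) _; rewrite Xrow mul1r.
by rewrite /col_sq; under [leRHS]eq_bigr do rewrite !mxE.
Qed.

(** Contains every neuron whose activation on sample [i] can differ from the initial one: rows of
    [X] have norm 1, so a pre-activation moves by at most the displacement of its column. *)
Definition flip W i := [set j | ((X *m W0) i j) ^+ 2 <= col_sq (W - W0) j]%SET.

(** The subgradient is tested against [V], minus the gradient formed with the current residuals and
    the initial pattern, for which [Hm] gives [|V|^2 >= m |res|^2]. Unflipped slopes are the initial
    ones; flipped ones cause an error of at most [|V|^2 / 2], because [B a^2] times their number is
    at most [m / 4]. Cauchy-Schwarz then leaves [|xi|^2 >= |V|^2 / 4], and the loss is half of
    [|res|^2]. *)
Lemma gradient_lower_bound W xi :
  (forall i, B * a ^+ 2 * #|flip W i|%:R <= m / 4) -> clarke_subdiff L W xi ->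
  m / 2 * L W <= frob xi xi.
Proof.
move=> Hflip Hxi.
pose rv : 'cV[R]_N := \col_i res W i.
pose rho := sqnorm rv.
have rhoE : rho = \sum_i res W i ^+ 2 by apply: eq_bigr => i _; rewrite mxE.
pose A : 'M[R]_(N, d1) := \matrix_(i, j) (res W i * v j 0 * P i j).
pose V := - (X^T *m A).
have FB (Q : 'M[R]_(N, d1)) : frob (X^T *m Q) (X^T *m Q) = \sum_j sqnorm (X^T *m col j Q).
  rewrite /frob exchange_big /=; apply: eq_bigr => j _; apply: eq_bigr => k _.
  by rewrite -expr2; congr (_ ^+ 2); rewrite !mxE; apply: eq_bigr => i _; rewrite !mxE.
have FQ (Q : 'M[R]_(N, d1)) : frob (X^T *m Q) (X^T *m Q) <= B * frob Q Q.
  rewrite FB /frob [X in _ <= B * X]exchange_big /= mulr_sumr; apply: ler_sum => j _.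
  apply: le_trans (XB _) _; rewrite ler_wpM2l// le_eqVlt; apply/orP; left; apply/eqP.
  by apply: eq_bigr => i _; rewrite mxE expr2.
pose S := frob V V.
have SE : S = frob (X^T *m A) (X^T *m A).
  by rewrite /S /frob; apply: eq_bigr => i _; apply: eq_bigr => j _; rewrite !mxE mulrNN.
have Sm : m * rho <= S.
  apply: le_trans (Hm rv) _; rewrite khatri_rao_mul SE FB le_eqVlt; apply/orP; left; apply/eqP.
  apply: eq_bigr => j _; rewrite -sqnormZ scalemxAr; congr (sqnorm (_ *m _)).
  by apply/matrixP => i k; rewrite !mxE; ring.
(* Flipped entries get the largest possible coefficient with the sign of [X V], so that the total
   error is again an inner product with [V]. *)
pose Q : 'M[R]_(N, d1) := \matrix_(i, j) (if j \in flip W i then `|res W i * v j 0| * Num.sg ((X *m V) i j) else 0).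
have sb i j : slope_bound X v y W V i j <= (A i j + Q i j) * (X *m V) i j.
  rewrite /slope_bound [A i j]mxE [Q i j]mxE; set b := (X *m V) i j.
  set c := res W i * (v j 0 * b).
  have cE : c = res W i * v j 0 * b by rewrite /c mulrA.
  have [fj|] := boolP (j \in flip W i).
    rewrite mulrDl -[X in _ + X]mulrA (_ : Num.sg b * b = `|b|); last by rewrite [RHS]normrEsg.
    rewrite -normrM -cE (_ : res W i * v j 0 * P i j * b = c * P i j); last by rewrite cE; ring.
    have [p0 p1] : 0 <= P i j /\ P i j <= 1 by rewrite mxE; case: ifP.
    have h1 : - `|c| <= c * P i j - c.
      rewrite (_ : _ - c = - (c * (1 - P i j))); last by ring.
      rewrite lerN2; apply: le_trans (ler_norm _) _; rewrite normrM ler_piMr// ger0_norm; lra.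
    have h2 : - `|c| <= c * P i j.
      rewrite lerNl; apply: le_trans (ler_norm _) _; rewrite normrN normrM ler_piMr// ger0_norm; lra.
    by case: ifP => _; [|case: ifP => _; [|rewrite ge_max; apply/andP; split]]; lra.
  rewrite inE -ltNge addr0 => hz.
  have h := le_lt_trans (preact_diff W0 W i j) hz.
  have {}h : `|(X *m W) i j - (X *m W0) i j| < `|(X *m W0) i j|.
    rewrite -(@ltr_pXn2r _ 2%N) ?nnegrE// !real_normK ?num_real//.
  rewrite (_ : res W i * v j 0 * P i j * b = c * P i j); last by rewrite cE; ring.
  rewrite [P i j]mxE; have [z0p|z0n|z00] := ltgtP 0 ((X *m W0) i j).
  - rewrite (gtr0_norm z0p) in h; move: h; rewrite ltr_norml => /andP[h1 h2].
    by rewrite (_ : 0 < (X *m W) i j) ?mulr1//; lra.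
  - rewrite (ltr0_norm z0n) in h; move: h; rewrite ltr_norml => /andP[h1 h2].
    have zn : (X *m W) i j < 0 by lra.
    by rewrite (lt_gtF zn) zn mulr0.
  - by move: h; rewrite -z00 normr0 ltNge normr_ge0.
have up : frob xi V <= - S + frob (X^T *m Q) V.
  apply: le_trans (clarke_relu_upper V Hxi) _.
  have -> : - S = frob A (X *m V).
    by rewrite -frob_trmulmx SE [in RHS]frobC /V frobNl.
  rewrite frob_trmulmx -frobDl /frob; apply: ler_sum => i _; apply: ler_sum => j _.
  by rewrite [(A + Q) i j]mxE; exact: sb.
have FQ2 : frob Q Q <= a ^+ 2 * \sum_i (res W i ^+ 2 * #|flip W i|%:R).
  rewrite /frob mulr_sumr; apply: ler_sum => i _.
  apply: le_trans (_ : \sum_(j in flip W i) a ^+ 2 * res W i ^+ 2 <= _); last first.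
    have -> : \sum_(j in flip W i) a ^+ 2 * res W i ^+ 2 = a ^+ 2 * res W i ^+ 2 * #|flip W i|%:R by rewrite sumr_const mulr_natr.
    have E (c : R) : a ^+ 2 * res W i ^+ 2 * c <= a ^+ 2 * (res W i ^+ 2 * c) by rewrite le_eqVlt -(mulrA (a ^+ 2) (res W i ^+ 2) c) eqxx.
    exact: E.
  rewrite [X in _ <= X]big_mkcond /=; apply: ler_sum => j _; rewrite mxE.
  case: ifP => _; last by rewrite mulr0.
  rewrite -expr2 exprMn real_normK ?num_real// exprMn va (mulrC (res W i ^+ 2)) ler_piMr//.
    by rewrite mulr_ge0 ?sqr_ge0.
  by rewrite sqr_sg; case: (_ != 0).
have FQ3 : frob (X^T *m Q) (X^T *m Q) <= m / 4 * rho.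
  apply: le_trans (FQ _) _; apply: le_trans (ler_wpM2l B0 FQ2) _.
  rewrite rhoE !mulr_sumr; apply: ler_sum => i _.
  rewrite (_ : B * _ = B * a ^+ 2 * #|flip W i|%:R * res W i ^+ 2); last by ring.
  by rewrite ler_wpM2r// sqr_ge0.
have S0 : 0 <= S by exact: frob_ge0.
have cs : frob (X^T *m Q) V <= S / 2.
  apply: le_trans (ler_norm _) _; apply: le_trans (frob_cauchy _ _) _.
  rewrite -/S -sqrtrM ?frob_ge0//; apply: ler_of_sqr; first by rewrite divr_ge0.
  rewrite sqr_sqrtr ?mulr_ge0 ?frob_ge0//.
  apply: le_trans (_ : m / 4 * rho * S <= _); first by rewrite ler_wpM2r.
  have := ler_wpM2r S0 Sm; rewrite expr_div_n; lra.
have h1 : S / 2 <= Num.sqrt (frob xi xi) * Num.sqrt S.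
  apply: le_trans (frob_cauchy xi V); rewrite -normrN; apply: le_trans (ler_norm _); lra.
have h2 : S / 4 <= frob xi xi.
  have [->|Sn] := eqVneq S 0; first by rewrite mul0r frob_ge0.
  have Sp : 0 < S by rewrite lt_neqAle eq_sym Sn.
  have h3 : (S / 2) ^+ 2 <= frob xi xi * S.
    rewrite -(sqr_sqrtr (frob_ge0 xi)) -(sqr_sqrtr S0) -exprMn lerXn2r ?nnegrE ?mulr_ge0 ?sqrtr_ge0 ?divr_ge0 ?sqr_ge0//.
    by rewrite (sqr_sqrtr S0).
  by rewrite -(ler_pM2r Sp); apply: le_trans h3; rewrite expr_div_n; lra.
apply: le_trans h2; rewrite lossE -rhoE; lra.
Qed.

(** A flipped neuron either starts within [tau] of zero or has a column displaced by more than
    [tau]; Markov's inequality over the columns counts the latter. *)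
Lemma card_flip_le W i (tau : R) : 0 < tau ->
  #|flip W i|%:R <= #|[set j | (X *m W0) i j ^+ 2 <= tau ^+ 2]%SET|%:R + frob (W - W0) (W - W0) / tau ^+ 2.
Proof.
move=> t0; set T1 := [set j | _]%SET; pose T2 := [set j | tau ^+ 2 < col_sq (W - W0) j]%SET.
have sub : flip W i \subset (T1 :|: T2)%SET.
  apply/fintype.subsetP => j; rewrite !inE => h; have [//|h1] := leP ((X *m W0) i j ^+ 2) (tau ^+ 2).
  exact: lt_le_trans h.
have h1 : (#|flip W i| <= #|T1| + #|T2|)%N.
  by apply: leq_trans (subset_leq_card sub) _; rewrite cardsU leq_subr.
apply: le_trans (_ : (#|T1| + #|T2|)%:R <= _); first by rewrite ler_nat.
rewrite natrD lerD2l ler_pdivlMr ?exprn_gt0//.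
rewrite /frob exchange_big /=.
apply: le_trans (_ : \sum_(j in T2) col_sq (W - W0) j <= _).
  apply: le_trans (_ : \sum_(j in T2) tau ^+ 2 <= _); first by rewrite sumr_const mulr_natl.
  by apply: ler_sum => j; rewrite inE => /ltW.
rewrite [leRHS](bigID (mem T2))/= -[leLHS]addr0; apply: lerD.
  by apply: ler_sum => j _; apply: ler_sum => k _; rewrite expr2.
by apply: sumr_ge0 => j _; apply: sumr_ge0 => k _; rewrite -expr2 sqr_ge0.
Qed.

End GoodEvent.

Section Main.
Variables (R : realType) (N d0 d1 : nat).
Variables (X : 'M[R]_(N, d0)) (v : 'cV[R]_d1) (y : 'cV[R]_N) (W0 : 'M[R]_(d0, d1)).

(** Interface to probability: [kappa] is the kernel bound per neuron, [k] the number of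
    pre-activations within [tau] of zero, [l] a bound on twice the initial loss, [r] the radius of
    the ball. The Polyak-Lojasiewicz constant is [beta0 ^+ 2] itself; its lower bound
    [kappa * (a ^+ 2 * d1)] serves only to check that flips and travel are small. *)
Lemma good_event_deterministic (a B kappa tau k l r : R) : (0 < N)%N ->
  (forall i, \sum_k X i k ^+ 2 = 1) -> (forall j, v j 0 ^+ 2 = a ^+ 2) ->
  (forall q : 'cV[R]_N, sqnorm (X^T *m q) <= B * sqnorm q) ->
  (forall u : 'cV[R]_N, kappa * d1%:R * sqnorm u <=
     \sum_j sqnorm (X^T *m (\col_i (act_pattern X W0 i j * u i 0)))) ->
  (forall i, #|[set j | (X *m W0) i j ^+ 2 <= tau ^+ 2]%SET|%:R <= k) ->
  2 * loss X v y W0 <= l -> 0 < a ^+ 2 * d1%:R -> 0 <= B -> 0 < kappa -> 0 < tau -> 0 < r ->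
  B * (k + r ^+ 2 / tau ^+ 2) <= kappa * d1%:R / 4 ->
  4 * l < kappa * (a ^+ 2 * d1%:R) * r ^+ 2 ->
  good_event 2^-1 X v y W0.
Proof.
move=> N0 Xrow va XB HK Hcount Hl ad0 B0 k0 tau0 r0 Hflip Hr.
have Hk : forall u : 'cV[R]_N, kappa * (a ^+ 2 * d1%:R) * sqnorm u <=
    sqnorm ((khatri_rao X (act_pattern X W0 *m diag_mx v^T))^T *m u).
  move=> u; rewrite khatri_rao_mul; under [leRHS]eq_bigr do rewrite va.
  rewrite -mulr_sumr; apply: le_trans (ler_wpM2l (sqr_ge0 a) (HK u)).
  by rewrite le_eqVlt; apply/orP; left; apply/eqP; ring.
have kad0 : 0 < kappa * (a ^+ 2 * d1%:R) by rewrite mulr_gt0.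
have [] := sigma_min_spec N0 (ltW kad0) Hk.
rewrite -[sigma_min _]/(beta0 X W0 v) => h1 h2.
have m0 : 0 < beta0 X W0 v ^+ 2 by apply: lt_le_trans h1.
have a0 : 0 <= a ^+ 2 by exact: sqr_ge0.
split.
  by move=> T W T0 sW; exact: sol_extends sW.
move=> W gW t t0.
rewrite (_ : 2^-1 * t * beta0 X W0 v ^+ 2 = beta0 X W0 v ^+ 2 / 2 * t); last by field.
apply: (flow_decay (r := r)) => //.
  move=> W1 xi W1r Hxi. apply: (gradient_lower_bound Xrow va XB h2 B0 _ Hxi) => i.
  have c1 := card_flip_le X W0 W1 i tau0.
  have : B * a ^+ 2 * #|flip X W0 W1 i|%:R <= a ^+ 2 * (B * (k + r ^+ 2 / tau ^+ 2)).
    rewrite (mulrC B) -mulrA ler_wpM2l// ler_wpM2l//; apply: le_trans c1 _.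
    apply: lerD => //; rewrite ler_wpM2r// invr_ge0 exprn_ge0// ltW//.
  have := ler_wpM2l a0 Hflip; lra.
have : kappa * (a ^+ 2 * d1%:R) * r ^+ 2 <= beta0 X W0 v ^+ 2 * r ^+ 2 by rewrite ler_wpM2r ?sqr_ge0.
lra.
Qed.

(** The case [y = 0], in which the loss vanishes identically. *)
Lemma good_event_degenerate (c : R) : (forall j, v j 0 = 0) -> (forall i, y i 0 = 0) -> good_event c X v y W0.
Proof.
move=> v0 y0; split; first by move=> T W T0 sW; exact: sol_extends sW.
move=> W _ t _; have E W1 : loss X v y W1 = 0.
  rewrite lossE big1 ?mulr0// => i _; rewrite /residual y0 big1 ?subr0 ?expr0n// => j _.
  by rewrite v0 mulr0.
by rewrite !E mul0r.
Qed.

End Main.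

(** * Independence and moments *)

Section SubSigmaAlgebra.
Context d (Om : measurableType d) (R : realType) (P : probability Om R).
Local Open Scope ereal_scope.

Section One.
Variable G : set (set Om).
Hypothesis mG : G `<=` measurable.

Lemma gen_measurable (A : set Om) : <<s G >> A -> measurable A.
Proof. by apply: smallest_sub => //; exact: sigma_algebra_measurable. Qed.

Lemma measurable_from_sub d' (T : measurableType d') (F : g_sigma_algebraType G -> T) :
  measurable_fun setT F -> measurable_fun (setT : set Om) (F : Om -> T).
Proof. by move=> mF _ Y mY; apply: gen_measurable; exact: mF. Qed.

(** [P] restricted to the sigma-algebra generated by [G]. The proof [mG] is mentioned in the body so
    that the measure structure declared next may depend on it. *)
Definition subP : set (g_sigma_algebraType G) -> \bar R := fun A => let _ := mG in P A.

Let subP0 : subP set0 = 0. Proof. exact: measure0. Qed.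
Let subP_ge0 A : 0 <= subP A. Proof. exact: measure_ge0. Qed.
Let subP_sigma : semi_sigma_additive subP.
Proof.
move=> F mF tF mU; apply: (measure_semi_sigma_additive (s := P)) => //.
- by move=> i; apply: gen_measurable; exact: mF.
- by apply: gen_measurable; exact: mU.
Qed.
HB.instance Definition _ := isMeasure.Build _ _ _ subP subP0 subP_ge0 subP_sigma.
Let subPT : subP setT = 1. Proof. exact: probability_setT. Qed.
HB.instance Definition _ := @Measure_isProbability.Build _ _ R subP subPT.

Lemma integral_subP (F : g_sigma_algebraType G -> \bar R) : measurable_fun setT F ->
  (forall x, 0 <= F x) -> \int[subP]_x F x = \int[P]_x (F : Om -> \bar R) x.
Proof.
move=> mF F0.
have mid : measurable_fun (setT : set Om) (id : Om -> g_sigma_algebraType G).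
  by move=> _ Y mY; rewrite setTI; exact: gen_measurable.
rewrite -[RHS](@ge0_integral_pushforward _ _ Om (g_sigma_algebraType G) R _ mid P setT F)//.
Qed.

End One.

Variables G H : set (set Om).
Hypotheses (mG : G `<=` measurable) (mH : H `<=` measurable).
Hypotheses (GI : setI_closed G) (HI : setI_closed H) (GT : G setT) (HT : H setT).
Hypothesis indGH : forall A B, G A -> H B -> P (A `&` B) = P A * P B.

Lemma indep_gen (A B : set Om) : <<s G >> A -> <<s H >> B -> P (A `&` B) = P A * P B.
Proof.
have fP (C : set Om) (mC : measurable C) : (0 <= fine (P C))%R by apply: fine_ge0; exact: measure_ge0.
(* Uniqueness of measures on a pi-system, for [P] restricted to [C] against [P C] times [P]. It is
   used once for each of the two generators. *)
have step (G1 : set (set Om)) (C : set Om) : G1 `<=` measurable -> setI_closed G1 -> G1 setT -> measurable C ->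
    (forall A, G1 A -> P (A `&` C) = P A * P C) -> forall A, <<s G1 >> A -> P (A `&` C) = P A * P C.
  move=> mG1 G1I G1T mC h A1 sA.
  pose m1 := mrestr P mC; pose m2 := mscale (NngNum (fP C mC)) P.
  have m2E A2 : m2 A2 = P A2 * P C by rewrite /m2 /mscale /= fineK ?fin_num_measure// muleC.
  rewrite -m2E.
  apply: (@g_sigma_algebra_measure_unique _ _ _ G1 mG1 (fun=> setT) _ _ m1 m2) => //.
  - by rewrite bigcup_const//; exists 0%N.
  - by move=> A2 GA; rewrite [RHS]m2E; exact: h.
  - by move=> _; change (P (setT `&` C) < +oo); rewrite setTI ltey_eq fin_num_measure.
move=> sA sB; rewrite setIC muleC; apply: (step H) => //; first exact: gen_measurable sA.
move=> B1 HB1; rewrite setIC muleC; apply: (step G) => //; first exact: mH.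
by move=> A1 GA1; exact: indGH.
Qed.

(** By independence the diagonal map sends [P] to the product of its two restrictions; Tonelli's
    theorem then makes [w'] an independent copy of [w]. *)
Lemma decouple (Phi : g_sigma_algebraType G * g_sigma_algebraType H -> \bar R) :
  measurable_fun setT Phi -> (forall z, 0 <= Phi z) ->
  \int[P]_w Phi (w, w) = \int[P]_w \int[P]_w' Phi (w, w').
Proof.
move=> mPhi Phi0.
have mdiag : measurable_fun (setT : set Om) (fun w => (w, w) : g_sigma_algebraType G * g_sigma_algebraType H).
  apply/measurable_fun_pairP; split => _ Y mY; rewrite setTI; exact: gen_measurable mY.
pose Q := pushforward P (fun w => (w, w) : g_sigma_algebraType G * g_sigma_algebraType H).
have E1 : \int[P]_w Phi (w, w) = \int[subP mG \x subP mH]_z Phi z.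
  transitivity (\int[Q]_z Phi z); first by rewrite ge0_integral_pushforward.
  apply: eq_measure_integral => A mA _; symmetry.
  apply: (@product_measure_unique _ _ _ _ _ (subP mG) (subP mH) Q) => // A1 B1 mA1 mB1.
  by rewrite -[RHS]/(P A1 * P B1) -indep_gen//; congr (P _); apply/seteqP; split => w.
rewrite E1 fubini_tonelli1//.
rewrite integral_subP; last 2 first.
- exact: measurable_fun_fubini_tonelli_F.
- by move=> x; apply: integral_ge0.
apply: eq_integral => x _; rewrite /fubini_F integral_subP//.
by apply: measurableT_comp => //; apply: measurable_fun_pair2 => //.
Qed.

Lemma fubini_sub_measurable (Phi : g_sigma_algebraType G * g_sigma_algebraType H -> \bar R) :
  measurable_fun setT Phi -> (forall z, 0 <= Phi z) ->
  measurable_fun (setT : set (g_sigma_algebraType G)) (fun w => \int[P]_w' Phi (w, w')).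
Proof.
move=> mPhi Phi0.
rewrite (_ : (fun w => _) = fubini_F (subP mH) Phi); last first.
  apply/funext => w; rewrite /fubini_F integral_subP//.
  by apply: measurableT_comp => //; apply: measurable_fun_pair2 => //.
exact: measurable_fun_fubini_tonelli_F.
Qed.

(** Conditioning without conditional probabilities: a bound that holds for each fixed first argument
    in [g] survives when both arguments are random. *)
Lemma cond_prob (g : set Om) (D : set (g_sigma_algebraType G * g_sigma_algebraType H)) (e : R) :
  measurable D -> (0 <= e)%R -> <<s G >> g ->
  (forall w, g w -> P [set w' | D (w, w')] <= e%:E) ->
  P [set w | g w /\ D (w, w)] <= e%:E.
Proof.
move=> mD e0 mg h.
pose E := [set z : g_sigma_algebraType G * g_sigma_algebraType H | g z.1 /\ D z].
have mE : measurable E.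
  apply: measurableI => //; rewrite -[X in measurable X]setTI; exact: (measurable_fst measurableT).
have mdiag : measurable_fun (setT : set Om) (fun w => (w, w) : g_sigma_algebraType G * g_sigma_algebraType H).
  by apply/measurable_fun_pairP; split => _ Y mY; rewrite setTI; apply: gen_measurable mY.
have mS : measurable [set w | g w /\ D (w, w)] by have := mdiag measurableT _ mE; rewrite setTI.
have m1 : measurable_fun setT (fun z => (\1_E z)%:E : \bar R) by apply/measurable_EFinP; exact: measurable_indic.
have p1 z : 0 <= (\1_E z)%:E :> \bar R by rewrite lee_fin.
rewrite (_ : P _ = \int[P]_w (\1_E (w, w))%:E); last by rewrite -[in LHS](setIT [set w | _]) -integral_indic.
rewrite (decouple m1 p1).
apply: le_trans (_ : \int[P]_w (cst e%:E w) <= _); last by rewrite integral_cst//= probability_setT mule1.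
apply: ge0_le_integral => //.
- by move=> w _; apply: integral_ge0.
- exact: (measurable_from_sub mG (fubini_sub_measurable m1 p1)).
- move=> w _ /=.
  have [gw|ngw] := pselect (g w); last first.
    by rewrite integral0_eq ?lee_fin// => w' _; rewrite indicE memNset// => -[].
  have mW : measurable ([set w' | D (w, w')] : set Om).
    apply: (gen_measurable mH).
    have mp : measurable_fun (setT : set (g_sigma_algebraType H)) (fun w' => (w, w') : g_sigma_algebraType G * g_sigma_algebraType H).
      by apply/measurable_fun_pairP; split; [exact: measurable_cst|exact: measurable_id].
    by have := mp measurableT _ mD; rewrite setTI.
  rewrite (_ : (fun w' => _) = (fun w' => (\1_([set w' | D (w, w')] : set Om) w')%:E)).
    by rewrite integral_indic ?setIT//; exact: h.
  apply/funext => w'; congr (_%:E); rewrite !indicE; congr ((nat_of_bool _)%:R); apply/idP/idP; rewrite !inE//.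
  by case.
Qed.

Definition mfun_wrt (G1 : set (set Om)) (F : Om -> R) :=
  measurable_fun (setT : set (g_sigma_algebraType G1)) (F : g_sigma_algebraType G1 -> R).

Lemma indep_prod_ge0 (F F' : Om -> R) : mfun_wrt G F -> mfun_wrt H F' ->
  (forall w, 0 <= F w)%R -> (forall w, 0 <= F' w)%R ->
  \int[P]_w (F w * F' w)%:E = (\int[P]_w (F w)%:E) * \int[P]_w (F' w)%:E.
Proof.
move=> mF mF' F0 F'0.
pose Phi (z : g_sigma_algebraType G * g_sigma_algebraType H) := (F z.1 * F' z.2)%:E.
rewrite (_ : \int[P]_w _ = \int[P]_w Phi (w, w))//.
rewrite decouple; last 2 first.
- apply/measurable_EFinP/measurable_funM.
  + exact: (measurableT_comp mF).
  + exact: (measurableT_comp mF').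
- by move=> z; rewrite lee_fin mulr_ge0.
have mE : measurable_fun setT (fun w => (F' w)%:E) by apply/measurable_EFinP; exact: measurable_from_sub mF'.
transitivity (\int[P]_w ((F w)%:E * \int[P]_w' (F' w')%:E)).
  apply: eq_integral => w _; rewrite /Phi /=; under eq_integral do rewrite EFinM.
  by rewrite ge0_integralZl// ?lee_fin//; move=> *; rewrite lee_fin.
rewrite ge0_integralZr//.
- by apply/measurable_EFinP; exact: measurable_from_sub mF.
- by move=> *; rewrite lee_fin.
- by apply: integral_ge0 => *; rewrite lee_fin.
Qed.

End SubSigmaAlgebra.

(** * Sigma-algebras of disjoint groups of independent families *)

Section Blocks.
Context d (Om : measurableType d) (R : realType) (P : probability Om R).
Variables (K : finType) (I : K -> finType) (f : forall k, I k -> Om -> R).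
Arguments f : clear implicits.
Hypothesis mf : forall k j, measurable_fun setT (f k j).
Hypothesis ind : mutually_independent P f.
Local Open Scope ereal_scope.
Implicit Types A B : {set K}.

(** A pi-system generating the sigma-algebra of the families indexed by [A]. The factors outside [A]
    are present but trivial, so that mutual independence applies directly and two blocks intersect
    factor by factor. *)
Definition block A : set (set Om) := [set S | exists2 T : K -> set Om,
  (forall k, gen_sigma (f k) (T k)) /\ (forall k, k \notin A -> T k = setT) & S = \bigcap_(k in setT) T k].

Lemma gen_sigma_measurable k S : gen_sigma (f k) S -> measurable S.
Proof.
apply: smallest_sub; first exact: sigma_algebra_measurable.
by move=> S1 [j _ [B mB <-]]; apply: mf.
Qed.

Lemma gen_sigmaT k : gen_sigma (f k) setT.
Proof. by have := @measurableT _ (g_sigma_algebraType (\bigcup_(j in [set: I k]) preimage_set_system setT (f k j) measurable)). Qed.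

Lemma gen_sigmaI k S T : gen_sigma (f k) S -> gen_sigma (f k) T -> gen_sigma (f k) (S `&` T).
Proof. exact: (@measurableI _ (g_sigma_algebraType (\bigcup_(j in [set: I k]) preimage_set_system setT (f k j) measurable))). Qed.

Lemma block_measurable A : block A `<=` measurable.
Proof.
move=> _ [T [mT _] ->]; apply: fin_bigcap_measurable; first exact: finite_finset.
by move=> k _; apply: gen_sigma_measurable (mT k).
Qed.

Lemma blockI A : setI_closed (block A).
Proof.
move=> _ _ [T [mT T1] ->] [T' [mT' T1'] ->]; exists (fun k => T k `&` T' k).
  split=> [k|k kA]; first exact: gen_sigmaI.
  by rewrite T1// T1'// setIT.
by rewrite bigcapI.
Qed.

Lemma blockT A : block A setT.
Proof.
exists (fun=> setT); first by split=> // k; exact: gen_sigmaT.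
by apply/seteqP; split.
Qed.

Lemma block_indep A B : (forall k, k \in A -> k \notin B) -> forall S T, block A S -> block B T -> P (S `&` T) = P S * P T.
Proof.
move=> dAB _ _ [T [mT T1] ->] [T' [mT' T1'] ->].
rewrite -bigcapI ind; last by move=> k; exact: gen_sigmaI.
rewrite !ind// -big_split /=; apply: eq_bigr => k _.
have [kA|kA] := boolP (k \in A).
  by rewrite T1' ?setIT ?probability_setT ?mule1//; exact: dAB.
by rewrite T1// setTI probability_setT mul1e.
Qed.

Lemma block_sub A B : A \subset B -> block A `<=` block B.
Proof.
move=> AB _ [T [mT T1] ->]; exists T => //; split=> // k kB; apply: T1.
by apply: contra kB; exact: (fintype.subsetP AB).
Qed.

Lemma mfun_block_sub A B (F : Om -> R) : A \subset B -> mfun_wrt (block A) F -> mfun_wrt (block B) F.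
Proof.
move=> AB mF _ Y mY; have := mF measurableT Y mY; apply: sub_smallest2r; [exact: smallest_sigma_algebra|move=> S; exact: block_sub].
Qed.

Lemma mfun_block A k j : k \in A -> mfun_wrt (block A) (f k j).
Proof.
move=> kA _ Y mY; rewrite setTI; apply: sub_sigma_algebra.
exists (fun k' => if k' == k then f k j @^-1` Y else setT).
  split=> [k'|k' k'A].
    case: eqP => [->|_]; last exact: gen_sigmaT.
    by apply: sub_sigma_algebra; exists j => //; exists Y => //; rewrite setTI.
  by case: eqP k'A => [->|//]; rewrite kA.
apply/seteqP; split=> w /=.
  by move=> h k' _; case: eqP.
by move=> /(_ k Logic.I); rewrite eqxx.
Qed.

End Blocks.

(** * Expectations of variables with finite moments of all orders *)

Section Moments.
Context d (Om : measurableType d) (R : realType) (P : probability Om R).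
Implicit Types F G : Om -> R.

Definition Ex F : R := fine (\int[P]_w (F w)%:E)%E.

(** Finiteness of all absolute moments is stable under sums, products and powers, so that
    integrability becomes a syntactic check throughout. *)
Definition Mom F := measurable_fun setT F /\
  forall k, (\int[P]_w (`|F w| ^+ k)%:E < +oo)%E.

Lemma Mom_measurable F : Mom F -> measurable_fun setT F. Proof. by case. Qed.

Lemma measurable_norm_pow F k : measurable_fun setT F -> measurable_fun setT (fun w => `|F w| ^+ k).
Proof. by move=> mF; apply: measurable_funX; exact: measurableT_comp. Qed.

Lemma Mom_int F : Mom F -> P.-integrable setT (EFin \o F).
Proof.
move=> [mF mk]; apply/integrableP; split; first exact/measurable_EFinP.
by under eq_integral do rewrite /= -[`|_|]expr1; exact: mk.
Qed.

Lemma Mom_le F G : measurable_fun setT F -> Mom G -> (forall w, `|F w| <= `|G w|) -> Mom F.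
Proof.
move=> mF [mG kG] FG; split=> // k; apply: le_lt_trans (kG k); apply: ge0_le_integral => //.
- by apply/measurable_EFinP; exact: measurable_norm_pow.
- by apply/measurable_EFinP; exact: measurable_norm_pow.
- by move=> w _; rewrite lee_fin lerXn2r ?nnegrE.
Qed.

Lemma Mom_cst c : Mom (fun=> c).
Proof. split=> // k; rewrite integral_cst//= probability_setT mule1; exact: ltry. Qed.

Lemma MomX F n : Mom F -> Mom (fun w => F w ^+ n).
Proof.
move=> [mF kF]; split; first exact: measurable_funX.
by move=> k; under eq_integral do rewrite normrX -exprM; exact: kF.
Qed.

Lemma Mom_norm F : Mom F -> Mom (fun w => `|F w|).
Proof.
move=> mF; apply: (Mom_le _ mF); first by apply: measurableT_comp => //; case: mF.
by move=> w; rewrite normr_id.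
Qed.

Let scale_fin (F : Om -> R) (c : R) k : measurable_fun setT F -> 0 <= c ->
  (\int[P]_w (`|F w| ^+ k)%:E < +oo)%E -> (\int[P]_w (c * `|F w| ^+ k)%:E < +oo)%E.
Proof.
move=> mF c0 kF; under eq_integral do rewrite EFinM.
rewrite ge0_integralZl//.
- by rewrite lte_mul_pinfty// lee_fin.
- by apply/measurable_EFinP; exact: measurable_norm_pow.
Qed.

Lemma MomZ F c : Mom F -> Mom (fun w => c * F w).
Proof.
move=> [mF kF]; split; first exact: measurable_funM.
by move=> k; under eq_integral do rewrite normrM exprMn; exact: scale_fin.
Qed.

Lemma MomD F G : Mom F -> Mom G -> Mom (fun w => F w + G w).
Proof.
move=> [mF kF] [mG kG].
have mD : measurable_fun setT (fun w => F w + G w) by exact: measurable_funD.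
split=> // k.
have m2 (H : Om -> R) : measurable_fun setT H -> measurable_fun setT (fun w => (2 ^+ k * `|H w| ^+ k)%:E).
  by move=> mH; apply/measurable_EFinP; apply: measurable_funM => //; exact: measurable_norm_pow.
have : (\int[P]_w ((2 ^+ k * `|F w| ^+ k)%:E + (2 ^+ k * `|G w| ^+ k)%:E) < +oo)%E.
  rewrite ge0_integralD//.
  - by rewrite lte_add_pinfty// scale_fin.
  - exact: m2.
  - exact: m2.
apply: le_lt_trans; apply: ge0_le_integral => //.
- by apply/measurable_EFinP; exact: measurable_norm_pow.
- by apply: emeasurable_funD; exact: m2.
- move=> w _; rewrite -EFinD lee_fin -!exprMn.
  have h (a b : R) : 0 <= a -> 0 <= b -> a <= b -> (a + b) ^+ k <= (2 * a) ^+ k + (2 * b) ^+ k.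
    move=> a0 b0 ab; apply: le_trans (_ : (2 * b) ^+ k <= _); last by rewrite lerDr exprn_ge0// mulr_ge0.
    by rewrite lerXn2r ?nnegrE ?addr_ge0 ?mulr_ge0//; lra.
  apply: le_trans (_ : (`|F w| + `|G w|) ^+ k <= _).
    by rewrite lerXn2r ?nnegrE ?addr_ge0// ler_normD.
  have [fg|/ltW fg] := leP `|F w| `|G w|; first exact: h.
  by rewrite addrC [leRHS]addrC; exact: h.
Qed.

Lemma MomN F : Mom F -> Mom (fun w => - F w).
Proof. by move=> /(MomZ (-1)); under eq_fun do rewrite mulN1r. Qed.

Lemma MomB F G : Mom F -> Mom G -> Mom (fun w => F w - G w).
Proof. by move=> mF /MomN mG; exact: MomD. Qed.

(** Polarization reduces the product to squares of sums. *)
Lemma MomM F G : Mom F -> Mom G -> Mom (fun w => F w * G w).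
Proof.
move=> mF mG.
have -> : (fun w => F w * G w) = (fun w => 2^-1 * ((F w + G w) ^+ 2 - (F w ^+ 2 + G w ^+ 2))).
  by apply/funext => w; field.
by apply/MomZ/MomB; [apply/MomX/MomD|apply: MomD; exact: MomX].
Qed.

Lemma Mom_sum (J : Type) (s : seq J) (Q : pred J) (F : J -> Om -> R) :
  (forall j, Q j -> Mom (F j)) -> Mom (fun w => \sum_(j <- s | Q j) F j w).
Proof.
move=> h; elim: s => [|j s IH].
  by under eq_fun do rewrite big_nil; exact: Mom_cst.
under eq_fun do rewrite big_cons.
by case E : (Q j) => //; apply: MomD => //; exact: h.
Qed.

Lemma Mom_bounded F (c : R) : measurable_fun setT F -> (forall w, `|F w| <= c) -> Mom F.
Proof.
by move=> mF Fc; apply: (Mom_le mF (Mom_cst c)) => w; exact: le_trans (ler_norm _).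
Qed.

Lemma ExE F : Mom F -> (Ex F)%:E = (\int[P]_w (F w)%:E)%E.
Proof. by move=> /Mom_int h; rewrite /Ex fineK//; exact: integrable_fin_num. Qed.

Lemma Ex_cst c : Ex (fun=> c) = c.
Proof. by rewrite /Ex integral_cst//= probability_setT mule1. Qed.

Lemma ExD F G : Mom F -> Mom G -> Ex (fun w => F w + G w) = Ex F + Ex G.
Proof.
move=> mF mG; apply: EFin_inj; rewrite EFinD !ExE//; last exact: MomD.
under eq_integral do rewrite EFinD.
by rewrite integralD//; exact: Mom_int.
Qed.

Lemma ExZ F c : Mom F -> Ex (fun w => c * F w) = c * Ex F.
Proof.
move=> mF; apply: EFin_inj; rewrite EFinM !ExE//; last exact: MomZ.
under eq_integral do rewrite EFinM.
by rewrite integralZl//; exact: Mom_int.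
Qed.

Lemma ExN F : Mom F -> Ex (fun w => - F w) = - Ex F.
Proof. by move=> mF; rewrite -mulN1r -ExZ//; congr Ex; apply/funext => w; rewrite mulN1r. Qed.

Lemma ExB F G : Mom F -> Mom G -> Ex (fun w => F w - G w) = Ex F - Ex G.
Proof. by move=> mF mG; rewrite ExD ?ExN//; exact: MomN. Qed.

Lemma Ex_sum (J : Type) (s : seq J) (Q : pred J) (F : J -> Om -> R) :
  (forall j, Q j -> Mom (F j)) -> Ex (fun w => \sum_(j <- s | Q j) F j w) = \sum_(j <- s | Q j) Ex (F j).
Proof.
move=> h; elim: s => [|j s IH].
  by rewrite big_nil; under eq_fun do rewrite big_nil; exact: Ex_cst.
rewrite big_cons; under eq_fun do rewrite big_cons.
by case E : (Q j) => //; rewrite ExD ?IH//; [exact: h|exact: Mom_sum].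
Qed.

Lemma Ex_ge0 F : (forall w, 0 <= F w) -> 0 <= Ex F.
Proof. by move=> F0; apply: fine_ge0; apply: integral_ge0 => w _; rewrite lee_fin. Qed.

Lemma Ex_le F G : Mom F -> Mom G -> (forall w, F w <= G w) -> Ex F <= Ex G.
Proof.
move=> mF mG FG; rewrite -subr_ge0 -ExB//; apply: Ex_ge0 => w; by rewrite subr_ge0.
Qed.

Lemma Ex_norm F : Mom F -> `|Ex F| <= Ex (fun w => `|F w|).
Proof.
move=> mF; have mN := Mom_norm mF; rewrite ler_norml -ExN//; apply/andP; split.
  by apply: Ex_le => //; [exact: MomN|move=> w; rewrite lerNl -normrN ler_norm].
by apply: Ex_le => // w; exact: ler_norm.
Qed.

Lemma Ex_eq F G : F =1 G -> Ex F = Ex G.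
Proof. by move=> FG; congr Ex; exact/funext. Qed.

Lemma markov_ge0 F (c : R) : measurable_fun setT F -> (forall w, 0 <= F w) -> 0 < c ->
  (P [set w | (c <= F w)%R] <= (\int[P]_w (F w)%:E) * (c^-1)%:E)%E.
Proof.
move=> mF F0 c0; rewrite lee_pdivlMr// muleC.
have mS : measurable [set w | c <= F w].
  by rewrite -[X in measurable X]setTI; apply: measurable_fun_le => //.
rewrite -integral_cst//; rewrite integral_mkcond.
apply: ge0_le_integral => //.
- by move=> w _; rewrite patchE; case: ifP => _; rewrite lee_fin// ltW.
- by apply/measurable_restrict => //; exact: measurable_cst.
- exact/measurable_EFinP.
- by move=> w _; rewrite patchE; case: ifPn; rewrite ?inE//= lee_fin.
Qed.

Lemma Ex_markov F (c : R) : Mom F -> (forall w, 0 <= F w) -> 0 < c ->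
  (P [set w | (c <= F w)%R] <= (Ex F / c)%:E)%E.
Proof.
move=> mF F0 c0; rewrite EFinM ExE//; apply: markov_ge0 => //; by case: mF.
Qed.

Lemma Ex_cauchy F G : Mom F -> Mom G -> Ex (fun w => F w * G w) ^+ 2 <= Ex (fun w => F w ^+ 2) * Ex (fun w => G w ^+ 2).
Proof.
move=> mF mG.
have mFG := MomM mF mG; have mF2 := MomX 2 mF; have mG2 := MomX 2 mG.
set a := Ex (fun w => F w ^+ 2); set b := Ex (fun w => G w ^+ 2); set c := Ex _.
have q (s : R) : 0 <= a + (2 * s) * c + s ^+ 2 * b.
  have : 0 <= Ex (fun w => (F w + s * G w) ^+ 2) by apply: Ex_ge0 => w; exact: sqr_ge0.
  rewrite (_ : Ex _ = a + (2 * s) * c + s ^+ 2 * b)//.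
  rewrite (@Ex_eq _ (fun w => F w ^+ 2 + ((2 * s) * (F w * G w) + s ^+ 2 * G w ^+ 2))); last by move=> w; ring.
  rewrite ExD//; last by apply: MomD; exact: MomZ.
  by rewrite ExD ?ExZ ?addrA//; exact: MomZ.
have b0 : 0 <= b by apply: Ex_ge0 => w; exact: sqr_ge0.
have [b1|bn] := eqVneq b 0.
  have [->|cn] := eqVneq c 0; first by rewrite expr0n b1 mulr0.
  have a0 : 0 <= a by apply: Ex_ge0 => w; exact: sqr_ge0.
  have := q (- (a + 1) / (2 * c)); rewrite b1 mulr0 addr0.
  rewrite (_ : 2 * _ * c = - (a + 1)); last by field.
  lra.
have bp : 0 < b by rewrite lt_neqAle eq_sym bn.
have := q (- c / b); rewrite -(pmulr_rge0 _ bp) => h.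
rewrite -subr_ge0; apply: le_trans h _; rewrite le_eqVlt; apply/orP; left; apply/eqP; field.
by rewrite gt_eqF.
Qed.

End Moments.

Section IndepExpectation.
Context d (Om : measurableType d) (R : realType) (P : probability Om R).
Variables G H : set (set Om).
Hypotheses (mG : G `<=` measurable) (mH : H `<=` measurable).
Hypotheses (GI : setI_closed G) (HI : setI_closed H) (GT : G setT) (HT : H setT).
Hypothesis indGH : forall A B, G A -> H B -> (P (A `&` B) = P A * P B)%E.

(** Both factors are split into positive and negative parts, where the extended nonnegative product
    formula applies. *)
Lemma Ex_indep (F F' : Om -> R) : mfun_wrt G F -> mfun_wrt H F' -> Mom P F -> Mom P F' ->
  Ex P (fun w => F w * F' w) = Ex P F * Ex P F'.
Proof.
have pos (A B : Om -> R) : mfun_wrt G A -> mfun_wrt H B -> Mom P A -> Mom P B ->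
    (forall w, 0 <= A w) -> (forall w, 0 <= B w) -> Ex P (fun w => A w * B w) = Ex P A * Ex P B.
  move=> mA mB MA MB A0 B0; apply: EFin_inj; rewrite EFinM !ExE//; last exact: MomM.
  exact: (indep_prod_ge0 mG mH).
move=> mF mF' MF MF'.
pose p (A : Om -> R) w := Num.max (A w) 0; pose q (A : Om -> R) w := Num.max (- A w) 0.
have pq A w : A w = p A w - q A w.
  by rewrite /p /q; case: (leP (A w) 0) => h; case: (leP (- A w) 0) => h'; lra.
have pm G1 A : mfun_wrt G1 A -> mfun_wrt G1 (p A) by move=> mA; apply: measurable_maxr => //; exact: measurable_cst.
have qm G1 A : mfun_wrt G1 A -> mfun_wrt G1 (q A).
  by move=> mA; apply: measurable_maxr; [exact: measurableT_comp|exact: measurable_cst].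
have ab (x : R) : `|Num.max x 0| <= `|x|.
  by case: (leP x 0) => h; rewrite ?normr0// ger0_norm ?ltW// ler_norm.
have pM A : Mom P A -> Mom P (p A).
  move=> MA; apply: (Mom_le _ MA); first by apply: measurable_maxr => //; exact: Mom_measurable MA.
  by move=> w; exact: ab.
have qM A : Mom P A -> Mom P (q A).
  move=> MA; apply: (Mom_le _ MA); last by move=> w; rewrite -(normrN (A w)); exact: ab.
  by apply: measurable_maxr => //; apply: measurableT_comp => //; exact: Mom_measurable MA.
have p0 A w : 0 <= p A w by rewrite /p le_max lexx orbT.
have q0 A w : 0 <= q A w by rewrite /q le_max lexx orbT.
have E1 A : Mom P A -> Ex P A = Ex P (p A) - Ex P (q A).
  by move=> MA; rewrite -ExB//; [apply: Ex_eq => w; exact: pq|exact: pM|exact: qM].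
rewrite (E1 F)// (E1 F')// mulrBl !mulrBr -!pos//; try (by [apply: pm|apply: qm|apply: pM|apply: qM]).
rewrite -!ExB//; try (by [apply: MomM; auto]); last by apply: MomB; apply: MomM; auto.
  apply: Ex_eq => w; rewrite [in LHS](pq F) [in LHS](pq F'); ring.
by apply: MomB; apply: MomM; auto.
Qed.

End IndepExpectation.

Section Families.
Context d (Om : measurableType d) (R : realType) (P : probability Om R).
Variables (K : finType) (I : K -> finType) (f : forall k, I k -> Om -> R).
Arguments f : clear implicits.
Hypothesis mf : forall k j, measurable_fun setT (f k j).
Hypothesis ind : mutually_independent P f.

Lemma Ex_indep_block (A B : {set K}) (F F' : Om -> R) : (forall k, k \in A -> k \notin B) ->
  mfun_wrt (block f A) F -> mfun_wrt (block f B) F' -> Mom P F -> Mom P F' ->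
  Ex P (fun w => F w * F' w) = Ex P F * Ex P F'.
Proof.
move=> AB; apply: Ex_indep; [exact: block_measurable|exact: block_measurable|exact: blockI|exact: blockI
  |exact: blockT|exact: blockT|exact: block_indep].
Qed.

Lemma indep_prod_block (A B : {set K}) (F F' : Om -> R) : (forall k, k \in A -> k \notin B) ->
  mfun_wrt (block f A) F -> mfun_wrt (block f B) F' -> (forall w, 0 <= F w) -> (forall w, 0 <= F' w) ->
  (\int[P]_w (F w * F' w)%:E = (\int[P]_w (F w)%:E) * \int[P]_w (F' w)%:E)%E.
Proof.
move=> AB; apply: (indep_prod_ge0 (G := block f A) (H := block f B)); [exact: block_measurable|exact: block_measurable|exact: blockI|exact: blockI
  |exact: blockT|exact: blockT|exact: block_indep].
Qed.

Lemma decouple_block (A B : {set K}) (Phi : g_sigma_algebraType (block f A) * g_sigma_algebraType (block f B) -> \bar R) :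
  (forall k, k \in A -> k \notin B) -> measurable_fun setT Phi -> (forall z, 0 <= Phi z)%E ->
  (\int[P]_w Phi (w, w) = \int[P]_w \int[P]_w' Phi (w, w'))%E.
Proof.
move=> AB; apply: decouple; [exact: block_measurable|exact: block_measurable|exact: blockI|exact: blockI
  |exact: blockT|exact: blockT|exact: block_indep].
Qed.

Lemma cond_prob_block (A B : {set K}) (g : set Om) (D : set (g_sigma_algebraType (block f A) * g_sigma_algebraType (block f B))) (e : R) :
  (forall k, k \in A -> k \notin B) -> measurable D -> 0 <= e -> (<<s block f A >> g) ->
  (forall w, g w -> (P [set w' | D (w, w')] <= e%:E)%E) ->
  (P [set w | g w /\ D (w, w)] <= e%:E)%E.
Proof.
move=> AB; apply: cond_prob; [exact: block_measurable|exact: block_measurable|exact: blockI|exact: blockI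
  |exact: blockT|exact: blockT|exact: block_indep].
Qed.

End Families.

(** * Gaussian integrals *)

Section Lebesgue.
Context (R : realType).
Local Notation mu := (@lebesgue_measure R).
Local Open Scope ereal_scope.

Lemma lebesgue_affine (a b : R) : (0 < a)%R -> forall A : set (measurableTypeR R), measurable A ->
  mu A = a%:E * mu ((fun x : R => a * x + b)%R @^-1` A).
Proof.
move=> a0.
have ma : measurable_fun setT (fun x : measurableTypeR R => (a * x + b)%R : measurableTypeR R).
  by apply: measurable_funD => //; exact: measurable_funM.
pose m := mscale (NngNum (ltW a0)) (pushforward mu (fun x : measurableTypeR R => (a * x + b)%R : measurableTypeR R)).
move=> A mA; rewrite (_ : _ * _ = m ma A)//.
apply: lebesgue_measure_unique => // _ [[l r] _ <-].
change (mu `]l, r]%classic = a%:E * mu ((fun x : R => a * x + b)%R @^-1` `]l, r]%classic)).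
rewrite (_ : _ @^-1` _ = `](l - b) / a, (r - b) / a]%classic)%R; last first.
  apply/seteqP; split=> x /=; rewrite !in_itv/=; rewrite ltr_pdivrMr// ler_pdivlMr// lterBDr lerBrDr (mulrC x)//.
rewrite !lebesgue_measure_itv/= !lte_fin ltr_pM2r ?invr_gt0// ltrD2r.
case: ifPn => lr; last by rewrite mule0.
rewrite -!EFinB -EFinM; congr (_%:E); field; exact: lt0r_neq0.
Qed.

Lemma integral_affine (a b : R) (f : R -> \bar R) : (0 < a)%R -> measurable_fun setT f -> (forall x, 0 <= f x) ->
  \int[mu]_x f x = a%:E * \int[mu]_x f (a * x + b)%R.
Proof.
move=> a0 mf f0.
have ma : measurable_fun setT (fun x : measurableTypeR R => (a * x + b)%R : measurableTypeR R).
  by apply: measurable_funD => //; exact: measurable_funM.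
pose m := mscale (NngNum (ltW a0)) (pushforward mu (fun x : measurableTypeR R => (a * x + b)%R : measurableTypeR R)).
transitivity (\int[m ma]_x f x).
  by apply: eq_measure_integral => A mA _; exact: (lebesgue_affine b a0).
by rewrite ge0_integral_mscale// ge0_integral_pushforward.
Qed.

Lemma integral_translation (b : R) (f : R -> \bar R) : measurable_fun setT f -> (forall x, 0 <= f x) ->
  \int[mu]_x f (x + b)%R = \int[mu]_x f x.
Proof.
move=> mf f0; rewrite (integral_affine b ltr01 mf f0) mul1e.
by under [RHS]eq_integral do rewrite mul1r.
Qed.

Implicit Types f : R * R -> \bar R.

Lemma measurable_lin (p q : R) : measurable_fun setT (fun z : R * R => p * z.1 + q * z.2)%R.
Proof. by apply: measurable_funD; apply: measurable_funM. Qed.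

Lemma measurable_lin2 (p q p' q' : R) : measurable_fun setT (fun z : R * R => (p * z.1 + q * z.2, p' * z.1 + q' * z.2)%R).
Proof. by apply/measurable_fun_pairP; split; exact: measurable_lin. Qed.

Lemma integral2_swap (f : R * R -> \bar R) : measurable_fun setT f -> (forall z, 0 <= f z) ->
  \int[mu]_x \int[mu]_y f (x, y) = \int[mu]_y \int[mu]_x f (x, y).
Proof.
move=> mf f0; exact: (@fubini_tonelli _ _ _ _ _ mu mu f mf f0).
Qed.

Lemma shear2 (s : R) f : measurable_fun setT f -> (forall z, 0 <= f z) ->
  \int[mu]_x \int[mu]_y f (x, y + s * x)%R = \int[mu]_x \int[mu]_y f (x, y).
Proof.
move=> mf f0; apply: eq_integral => x _.
apply: (integral_translation (s * x) (f := fun y => f (x, y))) => //.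
exact: measurable_fun_pair2.
Qed.

Lemma shear1 (s : R) f : measurable_fun setT f -> (forall z, 0 <= f z) ->
  \int[mu]_x \int[mu]_y f (x + s * y, y)%R = \int[mu]_x \int[mu]_y f (x, y).
Proof.
move=> mf f0.
have mg : measurable_fun setT (fun z : R * R => f (z.1 + s * z.2, z.2)%R).
  have := measurableT_comp mf (measurable_lin2 1 s 0 1).
  by under eq_fun do rewrite /= !mul1r mul0r add0r.
have g0 z : 0 <= f (z.1 + s * z.2, z.2)%R by exact: f0.
apply: etrans (integral2_swap mg g0) _; apply: etrans _ (esym (integral2_swap mf f0)).
apply: eq_integral => y _.
apply: (integral_translation (s * y) (f := fun x => f (x, y))) => //.
exact: measurable_fun_pair1.
Qed.

(* A rotation of angle not a multiple of pi is a product of three shears. *)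
Lemma integral_rotation (c s : R) f : measurable_fun setT f -> (forall z, 0 <= f z) -> (c ^+ 2 + s ^+ 2 = 1)%R -> s != 0%R ->
  \int[mu]_x \int[mu]_y f (c * x - s * y, s * x + c * y)%R = \int[mu]_x \int[mu]_y f (x, y).
Proof.
(* Minus the tangent of half the rotation angle. *)
move=> mf f0 cs s0; pose t := ((c - 1) / s)%R.
pose f1 (z : R * R) := f (z.1 + t * z.2, z.2)%R.
pose f2 (z : R * R) := f1 (z.1, z.2 + s * z.1)%R.
have m1 : measurable_fun setT f1.
  have := measurableT_comp mf (measurable_lin2 1 t 0 1).
  by under eq_fun do rewrite /= !mul1r mul0r add0r.
have m2 : measurable_fun setT f2.
  have := measurableT_comp m1 (measurable_lin2 1 0 s 1).
  by under eq_fun do rewrite /= !mul1r mul0r addr0 (addrC (s * _)%R).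
have f10 z : 0 <= f1 z by exact: f0.
have f20 z : 0 <= f2 z by exact: f0.
apply: etrans _ (shear1 t mf f0); apply: etrans _ (shear2 s m1 f10); apply: etrans _ (shear1 t m2 f20).
apply: eq_integral => x _; apply: eq_integral => y _; rewrite /f2 /f1 /=.
congr (f (_, _)); rewrite /t.
  have -> : (x + (c - 1) / s * y + (c - 1) / s * (y + s * (x + (c - 1) / s * y)) =
    c * x + (y / s) * ((c - 1) * (c + 1)))%R by field.
  have -> : ((c - 1) * (c + 1) = c ^+ 2 + s ^+ 2 - 1 - s ^+ 2)%R by ring.
  rewrite cs.
  by field.
by field.
Qed.

End Lebesgue.

Section Gauss.
Context (R : realType).
Local Notation mu := (@lebesgue_measure R).
Definition gauss := @normal_prob R 0 1.
HB.instance Definition _ := Probability.on gauss.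
Local Notation pdf := (@normal_pdf R 0 1).
Local Open Scope ereal_scope.

Lemma gauss_pdfE x : pdf x = (normal_peak 1 * expR (- (x ^+ 2 / 2)))%R.
Proof.
rewrite normal_pdfE ?oner_neq0//; congr (_ * expR _)%R.
by rewrite subr0 expr1n mulNr.
Qed.

Lemma integral_gauss (f : R -> \bar R) : measurable_fun setT f -> (forall x, 0 <= f x) ->
  \int[gauss]_x f x = \int[mu]_x (f x * (pdf x)%:E).
Proof.
move=> mf f0.
rewrite -(@Radon_Nikodym_SigmaFinite.change_of_variables _ _ R gauss mu _ f setT)//; last exact: normal_prob_dominates.
apply: ae_eq_integral => //.
- apply: emeasurable_funM => //; apply: (measurable_int mu).
  exact: Radon_Nikodym_SigmaFinite.f_integrable (normal_prob_dominates _ _).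
- apply: emeasurable_funM => //=; apply/measurable_EFinP.
  exact: measurable_normal_pdf.
- apply: ae_eqe_mul2l => /=.
  apply: integral_ae_eq => //=.
  + exact: Radon_Nikodym_SigmaFinite.f_integrable (normal_prob_dominates _ _).
  + by apply/measurable_EFinP; exact: measurable_normal_pdf.
  + move=> E E01 mE; rewrite -Radon_Nikodym_SigmaFinite.f_integral//.
    exact: normal_prob_dominates.
Qed.

Lemma mem_pdf : measurable_fun setT (fun x : R => (pdf x)%:E).
Proof. by apply/measurable_EFinP; exact: measurable_normal_pdf. Qed.

Lemma pdf_ge0 x : 0 <= (pdf x)%:E :> \bar R.
Proof. by rewrite lee_fin normal_pdf_ge0. Qed.

(** Translation invariance of Lebesgue measure and completion of the square: the Cameron-Martin
    formula in dimension one. *)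
Lemma gauss_shift (t : R) (f : R -> \bar R) : measurable_fun setT f -> (forall x, 0 <= f x) ->
  \int[gauss]_x f (x + t)%R = \int[gauss]_x (f x * (expR (t * x - t ^+ 2 / 2))%:E).
Proof.
move=> mf f0.
have mft : measurable_fun setT (fun x : R => f (x + t)%R) by apply: measurableT_comp => //; exact: measurable_funD.
have me : measurable_fun setT (fun x : R => (expR (t * x - t ^+ 2 / 2))%:E).
  by apply/measurable_EFinP; apply: measurableT_comp => //; apply: measurable_funB => //; exact: measurable_funM.
have ef0 x : 0 <= (expR (t * x - t ^+ 2 / 2))%:E :> \bar R by rewrite lee_fin expR_ge0.
rewrite integral_gauss// integral_gauss//; last 2 first.
- exact: emeasurable_funM.
- by move=> x; rewrite mule_ge0.
pose g x := f x * (expR (t * x - t ^+ 2 / 2))%:E * (pdf x)%:E.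
have mg : measurable_fun setT g by apply: emeasurable_funM => //; [exact: emeasurable_funM|exact: mem_pdf].
have g0 x : 0 <= g x by rewrite !mule_ge0// pdf_ge0.
apply: etrans _ (integral_translation t mg g0); rewrite /g.
apply: eq_integral => x _; rewrite -muleA -EFinM; congr (_ * _%:E).
rewrite !gauss_pdfE mulrCA -expRD; congr (_ * expR _)%R; by field.
Qed.

(** Homogeneous [f] turn this change of variables into moment identities, and constant [f] into
    exponential moments of the square. *)
Lemma gauss_scale (a : R) (f : R -> \bar R) : (0 < a)%R -> measurable_fun setT f -> (forall x, 0 <= f x) ->
  \int[gauss]_x f x = a%:E * \int[gauss]_x (f (a * x)%R * (expR ((1 - a ^+ 2) / 2 * x ^+ 2))%:E).
Proof.
move=> a0 mf f0.
have mfa : measurable_fun setT (fun x : R => f (a * x)%R) by apply: measurableT_comp => //; exact: measurable_funM.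
have me : measurable_fun setT (fun x : R => (expR ((1 - a ^+ 2) / 2 * x ^+ 2))%:E).
  by apply/measurable_EFinP; apply: measurableT_comp => //; apply: measurable_funM => //; exact: measurable_funX.
have ef0 x : 0 <= (expR ((1 - a ^+ 2) / 2 * x ^+ 2))%:E :> \bar R by rewrite lee_fin expR_ge0.
rewrite integral_gauss// integral_gauss//; last 2 first.
- exact: emeasurable_funM.
- by move=> x; rewrite mule_ge0.
rewrite (integral_affine 0 a0); last 2 first.
- by apply: emeasurable_funM => //; exact: mem_pdf.
- by move=> x; rewrite mule_ge0// pdf_ge0.
congr (_ * _); apply: eq_integral => x _; rewrite addr0 -muleA -EFinM; congr (_ * _%:E).
rewrite !gauss_pdfE mulrCA -expRD; congr (_ * expR _)%R; by field.
Qed.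

Lemma gauss2_lebesgue (f : R * R -> \bar R) : measurable_fun setT f -> (forall z, 0 <= f z) ->
  \int[gauss]_x \int[gauss]_y f (x, y) =
  \int[mu]_x \int[mu]_y (f (x, y) * ((normal_peak 1) ^+ 2 * expR (- ((x ^+ 2 + y ^+ 2) / 2)))%:E).
Proof.
move=> mf f0.
rewrite integral_gauss; last 2 first.
- exact: (@measurable_fun_fubini_tonelli_F _ _ _ _ R gauss f mf f0).
- by move=> x; apply: integral_ge0.
apply: eq_integral => x _.
have mfx : measurable_fun setT (fun y => f (x, y)) by exact: measurable_fun_pair2.
rewrite integral_gauss// -ge0_integralZr//; last 2 first.
- by move=> y _; rewrite mule_ge0// pdf_ge0.
- exact: pdf_ge0.
  apply: eq_integral => y _; rewrite -muleA -EFinM; congr (_ * _%:E).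
  by rewrite !gauss_pdfE mulrACA -expRD expr2; congr (_ * expR _)%R; field.
by apply: emeasurable_funM => //; exact: mem_pdf.
Qed.

Lemma gauss_swap (f : R * R -> \bar R) : measurable_fun setT f -> (forall z, 0 <= f z) ->
  \int[gauss]_x \int[gauss]_y f (x, y) = \int[gauss]_y \int[gauss]_x f (x, y).
Proof. by move=> mf f0; exact: (@fubini_tonelli _ _ _ _ _ gauss gauss f mf f0). Qed.

Let gauss_rotation0 (c s : R) (f : R * R -> \bar R) : measurable_fun setT f -> (forall z, 0 <= f z) ->
  (c ^+ 2 + s ^+ 2 = 1)%R -> s != 0%R ->
  \int[gauss]_x \int[gauss]_y f (c * x - s * y, s * x + c * y)%R = \int[gauss]_x \int[gauss]_y f (x, y).
Proof.
move=> mf f0 cs s0.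
pose g (z : R * R) := f z * ((normal_peak 1) ^+ 2 * expR (- ((z.1 ^+ 2 + z.2 ^+ 2) / 2)))%:E.
have mg : measurable_fun setT g.
  apply: emeasurable_funM => //; apply/measurable_EFinP; apply: measurable_funM => //.
  apply: measurableT_comp => //; apply: measurableT_comp => //; apply: measurable_funM => //.
  by apply: measurable_funD; apply: measurable_funX.
have g0 z : 0 <= g z by rewrite mule_ge0// lee_fin mulr_ge0 ?sqr_ge0 ?expR_ge0.
have mfr : measurable_fun setT (fun z : R * R => f (c * z.1 - s * z.2, s * z.1 + c * z.2)%R).
  have := measurableT_comp mf (measurable_lin2 c (- s) s c).
  by under eq_fun do rewrite /= mulNr.
have fr0 z : 0 <= f (c * z.1 - s * z.2, s * z.1 + c * z.2)%R by exact: f0.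
apply: etrans (gauss2_lebesgue mfr fr0) _; apply: etrans _ (esym (gauss2_lebesgue mf f0)).
apply: etrans _ (integral_rotation mg g0 cs s0).
apply: eq_integral => x _; apply: eq_integral => y _; rewrite /g /=.
congr (_ * (_ * expR (- (_ / 2)))%R%:E).
have -> : ((c * x - s * y) ^+ 2 + (s * x + c * y) ^+ 2 = (c ^+ 2 + s ^+ 2) * (x ^+ 2 + y ^+ 2))%R by ring.
by rewrite cs mul1r.
Qed.

Lemma gauss_rotation (c s : R) (f : R * R -> \bar R) : measurable_fun setT f -> (forall z, 0 <= f z) ->
  (c ^+ 2 + s ^+ 2 = 1)%R ->
  \int[gauss]_x \int[gauss]_y f (c * x - s * y, s * x + c * y)%R = \int[gauss]_x \int[gauss]_y f (x, y).
Proof.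
move=> mf f0 cs; have [s0|] := eqVneq s 0%R; last exact: gauss_rotation0.
have : ((c - 1) * (c + 1) == 0)%R.
  rewrite (_ : (c - 1) * (c + 1) = c ^+ 2 + s ^+ 2 - 1)%R; first by rewrite cs subrr.
  by rewrite s0; ring.
rewrite mulf_eq0 => /orP[|]; rewrite ?subr_eq0 ?addr_eq0 => /eqP ->.
  by apply: eq_integral => x _; apply: eq_integral => y _; rewrite s0 !mul1r !mul0r subr0 add0r.
(* The remaining case [c = -1], [s = 0]: a half turn is a quarter turn applied twice. *)
have h : (0 ^+ 2 + 1 ^+ 2 = 1 :> R)%R by rewrite expr1n expr0n add0r.
pose g (z : R * R) := f (0 * z.1 - 1 * z.2, 1 * z.1 + 0 * z.2)%R.
have mg : measurable_fun setT g.
  have := measurableT_comp mf (measurable_lin2 0 (- 1) 1 0).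
  by under eq_fun do rewrite /= mulNr.
have g0 z : 0 <= g z by exact: f0.
apply: etrans _ (gauss_rotation0 mf f0 h (oner_neq0 _)).
apply: etrans _ (gauss_rotation0 mg g0 h (oner_neq0 _)).
apply: eq_integral => x _; apply: eq_integral => y _; rewrite /g /= s0; congr (f (_, _)); ring.
Qed.

(** The rotation taking [(p, q)] onto the second axis leaves a function of one variable. *)
Lemma gauss_lin (p q : R) : exists2 r : R, (r ^+ 2 = p ^+ 2 + q ^+ 2)%R &
  forall f : R -> \bar R, measurable_fun setT f -> (forall x, 0 <= f x) ->
  \int[gauss]_x \int[gauss]_y f (p * x + q * y)%R = \int[gauss]_y f (r * y)%R.
Proof.
pose r := Num.sqrt (p ^+ 2 + q ^+ 2).
have r2 : (r ^+ 2 = p ^+ 2 + q ^+ 2)%R by rewrite sqr_sqrtr// addr_ge0 ?sqr_ge0.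
exists r => // f mf f0.
have fin (g : R -> \bar R) : measurable_fun setT g -> (forall x, 0 <= g x) ->
    \int[gauss]_x \int[gauss]_y g y = \int[gauss]_y g y.
  move=> mg g0; rewrite integral_cst//= [X in _ * X](_ : _ = 1); first by rewrite mule1.
  exact: (@probability_setT _ _ _ gauss).
have mr : measurable_fun setT (fun y : R => f (r * y)%R) by apply: measurableT_comp => //; exact: measurable_funM.
have r0' y : 0 <= f (r * y)%R by exact: f0.
have [r0|rn] := eqVneq r 0%R.
  move: r2; rewrite r0 expr0n /= => /esym/eqP; rewrite paddr_eq0 ?sqr_ge0// !sqrf_eq0 => /andP[/eqP -> /eqP ->].
  have m0 : measurable_fun setT (fun y : R => f (0 * y)%R) by apply: measurableT_comp => //; exact: measurable_funM.
  have f00 y : 0 <= f (0 * y)%R by exact: f0.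
  apply: etrans _ (fin _ m0 f00).
  by apply: eq_integral => x _; apply: eq_integral => y _; rewrite !mul0r addr0.
apply: etrans _ (fin _ mr r0').
pose c := (q / r)%R; pose s := (- (p / r))%R.
have cs : (c ^+ 2 + s ^+ 2 = 1)%R.
  by rewrite /c /s sqrrN !expr_div_n -mulrDl addrC -r2 divff// sqrf_eq0.
pose g (z : R * R) := f (p * z.1 + q * z.2)%R.
have mg : measurable_fun setT g by apply: measurableT_comp => //; exact: measurable_lin.
have g0 z : 0 <= g z by exact: f0.
apply: etrans (esym (gauss_rotation mg g0 cs)) _.
apply: eq_integral => x _; apply: eq_integral => y _; rewrite /g /=; congr (f _).
rewrite (_ : _ + _ = (p ^+ 2 + q ^+ 2) / r * y)%R; last by rewrite /c /s; field.
by rewrite -r2; field.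
Qed.

(* Two linear forms of a further independent coordinate are absorbed by rotating it into the first variable, then into the second. *)
Lemma gauss_absorb (al be de p q : R) : exists al' be' de' : R,
  [/\ al' ^+ 2 = al ^+ 2 + p ^+ 2, al' * be' = al * be + p * q, be' ^+ 2 + de' ^+ 2 = be ^+ 2 + de ^+ 2 + q ^+ 2 & (
  forall f : R * R -> \bar R, measurable_fun setT f -> (forall z, 0 <= f z) ->
  \int[gauss]_x \int[gauss]_y \int[gauss]_t f (al * x + p * t, be * x + de * y + q * t)%R =
  \int[gauss]_x \int[gauss]_y f (al' * x, be' * x + de' * y)%R)%E]%R.
Proof.
(* The rotation taking [(al, p)] onto the first axis; the identity serves when both vanish. *)
have [c [s [al' [cs a1 a2 a3]]]] : exists c s al', [/\ c ^+ 2 + s ^+ 2 = 1, al * c + p * s = al',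
    p * c - al * s = 0 & al' ^+ 2 = al ^+ 2 + p ^+ 2]%R.
  pose r := Num.sqrt (al ^+ 2 + p ^+ 2).
  have r2 : (r ^+ 2 = al ^+ 2 + p ^+ 2)%R by rewrite sqr_sqrtr// addr_ge0 ?sqr_ge0.
  have [r0|rn] := eqVneq r 0%R.
    move: r2; rewrite r0 expr0n /= => /esym/eqP; rewrite paddr_eq0 ?sqr_ge0// !sqrf_eq0 => /andP[/eqP -> /eqP ->].
    by exists 1%R, 0%R, 0%R; split; rewrite ?expr1n ?expr0n /= ?mul0r ?addr0 ?subr0.
  exists (al / r)%R, (p / r)%R, r; split=> //.
  - by rewrite !expr_div_n -mulrDl -r2 divff// sqrf_eq0.
  - by rewrite !mulrA -mulrDl -!expr2 -r2 expr2 mulfK.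
  - by field.
pose be' := (be * c + q * s)%R; pose d1 := (q * c - be * s)%R.
have [de' d2 Hd] := gauss_lin d1 de.
exists al', be', de'; split; first exact: a3.
- rewrite -a1 /be' (_ : (al * c + p * s) * (be * c + q * s) = (al * be + p * q) * (c ^+ 2 + s ^+ 2) +
    (p * c - al * s) * (be * s - q * c))%R; last by ring.
  by rewrite cs a2 mul0r mulr1 addr0.
- rewrite d2 /be' /d1 (_ : _ + _ = (be ^+ 2 + q ^+ 2) * (c ^+ 2 + s ^+ 2) + de ^+ 2)%R; last by ring.
  by rewrite cs mulr1; ring.
move=> f mf f0.
pose h (z : R * R) := \int[gauss]_y f (al * z.1 + p * z.2, be * z.1 + de * y + q * z.2)%R.
have m3 : measurable_fun setT (fun w : (R * R) * R => f (al * w.1.1 + p * w.1.2, be * w.1.1 + de * w.2 + q * w.1.2)%R).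
  apply: (measurableT_comp mf); apply/measurable_fun_pairP; split=> /=.
    by apply: measurable_funD; apply: measurable_funM => //; apply: measurableT_comp.
  by apply: measurable_funD; [apply: measurable_funD|]; apply: measurable_funM => //; apply: measurableT_comp.
have mh : measurable_fun setT h.
  exact: (@measurable_fun_fubini_tonelli_F _ _ _ _ R gauss _ m3 (fun w => f0 _)).
have h0 z : 0 <= h z by apply: integral_ge0.
transitivity (\int[gauss]_x \int[gauss]_t h (x, t)).
  apply: eq_integral => x _; rewrite /h /=.
  have m2 : measurable_fun setT (fun w : R * R => f (al * x + p * w.2, be * x + de * w.1 + q * w.2)%R).
    apply: (measurableT_comp mf); apply/measurable_fun_pairP; split=> /=.
      by apply: measurable_funD; apply: measurable_funM => //; apply: measurableT_comp.
    by apply: measurable_funD; [apply: measurable_funD|]; apply: measurable_funM => //; apply: measurableT_comp.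
  exact: (gauss_swap m2 (fun w => f0 _)).
rewrite -(gauss_rotation mh h0 cs); apply: eq_integral => x _.
pose g y := f (al' * x, be' * x + y)%R.
have mg : measurable_fun setT g.
  apply: (measurableT_comp mf); apply/measurable_fun_pairP; split=> /=; first exact: measurable_cst.
  exact: measurable_funD.
have g0 y : 0 <= g y by exact: f0.
rewrite -[RHS](Hd g mg g0); apply: eq_integral => t _; apply: eq_integral => y _; rewrite /g /=; congr (f (_, _)).
- rewrite -a1 (_ : _ + _ = (al * c + p * s) * x + (p * c - al * s) * t)%R; last by ring.
  by rewrite a2 mul0r addr0.
- by rewrite /be' /d1; ring.
Qed.

End Gauss.

(** * Half-line moments and the fifth Hermite polynomial *)

Section GaussMoments.
Context (R : realType).
Local Notation gauss := (@gauss R).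

Lemma gaussT : gauss setT = 1%E. Proof. exact: (@probability_setT _ _ _ gauss). Qed.

(** A half turn of the plane, with a dummy second coordinate. *)
Lemma gauss_neg (f : R -> \bar R) : measurable_fun setT f -> (forall x, 0 <= f x)%E ->
  (\int[gauss]_x f (- x)%R = \int[gauss]_x f x)%E.
Proof.
move=> mf f0.
have fin (c : \bar R) : (\int[gauss]_y c = c)%E by rewrite integral_cst//= gaussT mule1.
have mg : measurable_fun setT (fun z : R * R => f z.1) by apply: measurableT_comp.
have h : (-1) ^+ 2 + 0 ^+ 2 = 1 :> R by rewrite expr0n addr0 sqrrN expr1n.
have := gauss_rotation mg (fun z => f0 _) h => /= H.
apply: etrans (etrans _ H) _.
  by apply: eq_integral => x _; rewrite -[LHS]fin; apply: eq_integral => y _; rewrite mul0r subr0 mulN1r.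
by apply: eq_integral => x _; rewrite fin.
Qed.

(** The hypothesis is used for the two functions [max (x, 0)] and [max (- x, 0)], which carries
    identities between laws over to signed expectations. *)
Lemma Ex_ereal_eq d1 d2 (T1 : measurableType d1) (T2 : measurableType d2) (P1 : probability T1 R) (P2 : probability T2 R)
    (F : T1 -> R) (G : T2 -> R) (h : forall k : R -> R, measurable_fun setT k -> (forall x, 0 <= k x) ->
    (\int[P1]_x (k (F x))%:E = \int[P2]_x (k (G x))%:E)%E) : Ex P1 F = Ex P2 G.
Proof.
have m1 : measurable_fun setT (fun x : R => Num.max x 0) by apply: measurable_maxr => //; exact: measurable_cst.
have m2 : measurable_fun setT (fun x : R => Num.max (- x) 0).
  by apply: measurable_maxr => //; exact: measurableT_comp.
rewrite /Ex; congr fine; rewrite integralE [RHS]integralE; congr (_ - _)%E.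
  transitivity (\int[P1]_x (Num.max (F x) 0)%:E)%E; first by apply: eq_integral => x _; rewrite funeposE EFin_max.
  rewrite (h _ m1) => [|x]; first by apply: eq_integral => x _; rewrite funeposE EFin_max.
  by rewrite le_max lexx orbT.
transitivity (\int[P1]_x (Num.max (- F x) 0)%:E)%E; first by apply: eq_integral => x _; rewrite funenegE EFin_max.
rewrite (h _ m2) => [|x]; first by apply: eq_integral => x _; rewrite funenegE EFin_max.
by rewrite le_max lexx orbT.
Qed.

Lemma gauss_exp (t : R) : (\int[gauss]_x (expR (t * x))%:E = (expR (t ^+ 2 / 2))%:E)%E.
Proof.
have := @gauss_shift R t (fun=> 1%E) (measurable_cst _) (fun=> lee01).
rewrite integral_cst//= gaussT mule1 => H.
have me : measurable_fun setT (fun x : R => (expR (t * x - t ^+ 2 / 2))%:E).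
  by apply/measurable_EFinP; apply: measurableT_comp => //; apply: measurable_funB => //; exact: measurable_funM.
rewrite -[RHS]mule1 H -ge0_integralZl//.
- by apply: eq_integral => x _; rewrite mul1e -EFinM -expRD; congr (expR _)%:E; ring.
- by apply: emeasurable_funM => //; exact: measurable_cst.
Qed.

Lemma pow_le_expR (x : R) k : 0 <= x -> x ^+ k <= k`!%:R * expR x.
Proof.
move=> x0; case: k => [|k]; first by rewrite mul1r expr0 -expR0 ler_expR.
rewrite mulrC -ler_pdivrMr ?ltr0n ?fact_gt0//; apply: le_trans (expR_ge1Dxn k x0).
by rewrite lerDr.
Qed.

Lemma Mom_gauss : Mom gauss id.
Proof.
split=> // k.
have mexp (t : R) : measurable_fun setT (fun x : R => (k`!%:R * expR (t * x))%:E).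
  by apply/measurable_EFinP; apply: measurable_funM => //; apply: measurableT_comp => //; exact: measurable_funM.
apply: (@le_lt_trans _ _ (\int[gauss]_x ((k`!%:R * expR (1 * x))%:E + (k`!%:R * expR (-1 * x))%:E))%E).
  apply: ge0_le_integral => //.
  - by apply/measurable_EFinP; apply: measurable_norm_pow.
  - exact: (emeasurable_funD (mexp 1) (mexp (-1))).
  - move=> x _; rewrite -EFinD lee_fin; apply: le_trans (pow_le_expR k (normr_ge0 x)) _.
    rewrite -mulrDr ler_wpM2l// mul1r mulN1r; case: (ger0P x) => _; by rewrite ?lerDl ?lerDr expR_ge0.
rewrite ge0_integralD//; [|exact: (mexp 1)|exact: (mexp (-1))].
have E (t : R) : (\int[gauss]_x (k`!%:R * expR (t * x))%:E = (k`!%:R * expR (t ^+ 2 / 2))%:E)%E.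
  rewrite EFinM -gauss_exp -ge0_integralZl//.
  - by apply/measurable_EFinP; apply: measurableT_comp => //; exact: measurable_funM.
by rewrite !E -EFinD ltry.
Qed.

Lemma Ex_neg (F : R -> R) : Mom gauss F -> Ex gauss (fun x => F (- x)) = Ex gauss F.
Proof.
move=> mF; apply: Ex_ereal_eq => k mk k0.
apply: (gauss_neg (f := fun x => (k (F x))%:E)).
  by apply/measurable_EFinP; apply: measurableT_comp => //; exact: Mom_measurable mF.
by move=> x; rewrite lee_fin.
Qed.

(* Differentiating the scaling identity at a = 1: the inequality D(a) >= 0 is an equality at a = 1. *)
Lemma gauss_homogeneous (phi : R -> R) k : Mom gauss phi -> (forall x, 0 <= phi x) ->
  (forall a x, 0 < a -> phi (a * x) = a ^+ k * phi x) ->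
  Ex gauss (fun x => x ^+ 2 * phi x) = k.+1%:R * Ex gauss phi.
Proof.
move=> mphi phi0 hom.
set h0 := Ex gauss phi; set h2 := Ex gauss _.
have mx2 : Mom gauss (fun x : R => x ^+ 2 * phi x) by apply: MomM => //; exact: (MomX 2 Mom_gauss).
have mp := Mom_measurable mphi.
pose D (a : R) := h0 - a ^+ k.+1 * (h0 + (1 - a ^+ 2) / 2 * h2).
have D0 (a : R) : 0 < a -> 0 <= D a.
  move=> a0; rewrite subr_ge0.
  pose G (x : R) := phi x * expR ((1 - a ^+ 2) / 2 * x ^+ 2).
  have mG : measurable_fun setT G.
    apply: measurable_funM => //; apply: measurableT_comp => //.
    by apply: measurable_funM => //; exact: measurable_funX.
  have G0 x : 0 <= G x by rewrite mulr_ge0// expR_ge0.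
  have E : (h0%:E = (a ^+ k.+1)%:E * \int[gauss]_x (G x)%:E)%E.
    rewrite /h0 ExE// [LHS](gauss_scale a0); last 2 first.
    - exact/measurable_EFinP.
    - by move=> x; rewrite lee_fin.
    rewrite (exprS a k) [in RHS]EFinM -muleA; congr (_ * _)%E.
    rewrite -ge0_integralZl//; last 3 first.
    - exact/measurable_EFinP.
    - by move=> x _; rewrite lee_fin.
    - by rewrite lee_fin exprn_ge0// ltW.
    by apply: eq_integral => x _; rewrite -!EFinM; congr (_%:E); rewrite hom// /G; ring.
  have ak : 0 < a ^+ k.+1 by rewrite exprn_gt0.
  have iG : gauss.-integrable setT (EFin \o G).
    apply/integrableP; split; first exact/measurable_EFinP.
    under eq_integral do rewrite /= ger0_norm//.
    case: (\int[gauss]_x (G x)%:E)%E E => [r _|E|E].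
    - exact: ltry.
    - by move: E; rewrite gt0_muley ?lte_fin.
    - by move: E; rewrite gt0_muleNy ?lte_fin.
  have mA : Mom gauss (fun x => phi x + (1 - a ^+ 2) / 2 * (x ^+ 2 * phi x)) by apply: MomD => //; exact: MomZ.
  rewrite -lee_fin E EFinM lee_pmul2l ?lte_fin//.
  rewrite (_ : h0 + _ = Ex gauss (fun x => phi x + (1 - a ^+ 2) / 2 * (x ^+ 2 * phi x))); last first.
    by rewrite ExD ?ExZ//; exact: MomZ.
  rewrite ExE//; apply: le_integral => //; first exact: Mom_int.
  move=> x _; rewrite lee_fin /G mulrC (_ : _ + _ = phi x * (1 + (1 - a ^+ 2) / 2 * x ^+ 2)); last by ring.
  by rewrite ler_wpM2l// expR_ge1Dx.
have dX n : has_deriv (fun s : R => s ^+ n) 1 n%:R.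
  elim: n => [|n IH]; first by under eq_fun do rewrite expr0; exact: has_deriv_cst.
  have := has_derivM (has_deriv_id 1) IH.
  under eq_fun do rewrite -exprS.
  by rewrite mul1r expr1n mulrS mul1r.
have dD : has_deriv D 1 (h2 - k.+1%:R * h0).
  have h1 : has_deriv (fun a : R => h0 + (1 - a ^+ 2) / 2 * h2) 1 (- h2).
    have := has_derivD (has_deriv_cst (h0 + h2 / 2) 1) (has_derivZ (- (h2 / 2)) (dX 2%N)).
    rewrite (_ : 0 + _ = - h2); last by field.
    rewrite (_ : (fun s => _) = (fun a : R => h0 + (1 - a ^+ 2) / 2 * h2))//.
    by apply/funext => s; field.
  have := has_derivD (has_deriv_cst h0 1) (has_derivZ (-1) (has_derivM (dX k.+1) h1)).
  rewrite (_ : 0 + _ = h2 - k.+1%:R * h0); last by rewrite !expr1n; ring.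
  rewrite (_ : (fun s => _) = D)//.
  by apply/funext => s; rewrite /D; ring.
have D1 : D 1 = 0 by rewrite /D !expr1n subrr !mul0r addr0 mul1r subrr.
set l := h2 - _ in dD.
apply/eqP; rewrite -subr_eq0 -/l; apply/negPn/negP => ln.
have l0 : 0 < `|l| / 2 by rewrite divr_gt0// normr_gt0.
have [d d0 Hd] := dD _ l0.
pose e := Num.min (d / 2) (1 / 2).
have e0 : 0 < e by rewrite lt_min !divr_gt0.
have ed : e < d by rewrite gt_min ltr_pdivrMr// ltr_pMr// ltr1n.
have e1 : e <= 1 / 2 by rewrite ge_min lexx orbT.
pose h := - Num.sg l * e.
have hn : `|h| = e by rewrite normrM normrN normr_sg ln mul1r gtr0_norm.
have : `|h| < d by rewrite hn.
move=> /Hd; rewrite D1 subr0 hn => H.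
have h1 : 0 < 1 + h.
  have : - `|h| <= h by rewrite lerNl -normrN ler_norm.
  by rewrite hn; lra.
have := D0 _ h1.
have : l * h = - (`|l| * e) by rewrite /h mulrA mulrN [l * _]mulrC -normrEsg mulNr.
move=> lh; move: H; rewrite lh ler_norml => /andP[_ H].
have := mulr_gt0 l0 e0; lra.
Qed.

Definition step (x : R) : R := if 0 < x then 1 else 0.

Lemma measurable_step : measurable_fun setT step.
Proof.
apply: measurable_fun_ifT => //; apply: measurable_fun_ltr => //; exact: measurable_cst.
Qed.

Lemma step01 x : 0 <= step x <= 1. Proof. by rewrite /step; case: ifP => _; rewrite ?ler01 ?lexx. Qed.

Lemma step_hom a x : 0 < a -> step (a * x) = step x.
Proof. by move=> a0; rewrite /step pmulr_rgt0. Qed.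

Lemma Mom_step : Mom gauss step.
Proof.
apply: (@Mom_bounded _ _ _ _ _ 1); first exact: measurable_step.
by move=> x; have /andP[h1 h2] := step01 x; rewrite ger0_norm.
Qed.

Lemma gauss_m2 : Ex gauss (fun x => x ^+ 2) = 1.
Proof.
have := @gauss_homogeneous (fun=> 1) 0 (Mom_cst _ 1) (fun=> ler01) (fun a x _ => esym (mul1r 1)).
by under Ex_eq do rewrite mulr1; rewrite Ex_cst mulr1.
Qed.

Lemma gauss_m4 : Ex gauss (fun x => x ^+ 4) = 3.
Proof.
have := @gauss_homogeneous (fun x : R => x ^+ 2) 2 (MomX 2 Mom_gauss) (fun x => sqr_ge0 x) (fun a x _ => exprMn _ _ _).
by rewrite gauss_m2 mulr1 => <-; apply: Ex_eq => x; rewrite -exprD.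
Qed.

(** The number [1 / sqrt (2 pi)], the mean of [relu]. It stays symbolic: the other half-line moments
    are multiples of it, and [half_mean_ge] bounds it below without computing it. *)
Definition half_mean := Ex gauss (fun x => x * step x).

Lemma xstep_ge0 x : 0 <= x * step x.
Proof. by rewrite /step; case: ltP => h; rewrite ?mulr1 ?mulr0// ltW. Qed.

Lemma Mom_xstep k : Mom gauss (fun x : R => x ^+ k * step x).
Proof. by apply: MomM; [exact: (MomX k Mom_gauss)|exact: Mom_step]. Qed.

Lemma half_m3 : Ex gauss (fun x => x ^+ 3 * step x) = 2 * half_mean.
Proof.
rewrite -(@gauss_homogeneous (fun x => x * step x) 1 (Mom_xstep 1) xstep_ge0); last first.
  by move=> a x a0; rewrite step_hom// expr1 mulrA.
by apply: Ex_eq => x; rewrite mulrA -exprSr.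
Qed.

Lemma half_m5 : Ex gauss (fun x => x ^+ 5 * step x) = 8 * half_mean.
Proof.
have := @gauss_homogeneous (fun x => x ^+ 3 * step x) 3 (Mom_xstep 3).
rewrite half_m3 mulrA -natrM => <-.
- by apply: Ex_eq => x; rewrite mulrA -exprD.
- by move=> x; rewrite exprSr -mulrA mulr_ge0 ?sqr_ge0// xstep_ge0.
- by move=> a x a0; rewrite step_hom// exprMn -mulrA.
Qed.

(** By symmetry the mean of [|x|] is twice [half_mean] and that of [|x|^3] four times; taking means
    in [2 x^2 <= |x| + |x|^3] gives [1 <= 3 half_mean]. *)
Lemma half_mean_ge : 1 / 3 <= half_mean.
Proof.
have E k : odd k -> forall x : R, `|x| ^+ k = x ^+ k * step x + (- x) ^+ k * step (- x).
  move=> ok x; rewrite /step oppr_gt0; case: ltgtP => h.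
  - by rewrite mulr0 addr0 mulr1 gtr0_norm.
  - by rewrite mulr0 add0r mulr1 ltr0_norm.
  - by rewrite -h !mulr0 addr0 normr0 expr0n; case: k ok.
have mN k : Mom gauss (fun x : R => (- x) ^+ k * step (- x)).
  apply: MomM; first exact: (MomX k (MomN Mom_gauss)).
  apply: (@Mom_bounded _ _ _ _ _ 1); first by apply: measurableT_comp => //; exact: measurable_step.
  by move=> x; have /andP[h1 h2] := step01 (- x); rewrite ger0_norm.
have A k : odd k -> Ex gauss (fun x => `|x| ^+ k) = 2 * Ex gauss (fun x => x ^+ k * step x).
  move=> ok; under Ex_eq do rewrite E//.
  rewrite ExD//; last exact: Mom_xstep.
  rewrite (Ex_neg (F := fun x => x ^+ k * step x)); first by rewrite mulr2n mulrDl mul1r.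
  exact: Mom_xstep.
have mk k : Mom gauss (fun x : R => `|x| ^+ k) by exact: (MomX k (Mom_norm Mom_gauss)).
have : Ex gauss (fun x => x ^+ 2) <= Ex gauss (fun x => 2^-1 * (`|x| ^+ 1 + `|x| ^+ 3)).
  apply: Ex_le; [exact: (MomX 2 Mom_gauss)|by apply: MomZ; apply: MomD|].
  move=> x; rewrite -(real_normK (num_real x)); have x0 := normr_ge0 x.
  have : 0 <= `|x| * (`|x| - 1) ^+ 2 by rewrite mulr_ge0// sqr_ge0.
  rewrite (_ : `|x| * _ = `|x| ^+ 1 + `|x| ^+ 3 - 2 * `|x| ^+ 2); last by ring.
  lra.
rewrite gauss_m2 ExZ; last by apply: MomD.
rewrite ExD// !A// half_m3 (_ : Ex gauss (fun x => x ^+ 1 * step x) = half_mean)//.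
lra.
Qed.

(** The probabilists' Hermite polynomial of degree 5. *)
Definition he5 (x : R) := x ^+ 5 - 10 * x ^+ 3 + 15 * x.

Lemma Mom_he5 : Mom gauss he5.
Proof.
by apply: MomD; [apply: MomB|apply: MomZ; exact: Mom_gauss]; [exact: (MomX 5 Mom_gauss)|apply: MomZ; exact: (MomX 3 Mom_gauss)].
Qed.

(** The factor 3 is [8 - 10 * 2 + 15], from the half-line moments of orders 5, 3 and 1. *)
Lemma step_he5 : Ex gauss (fun x => step x * he5 x) = 3 * half_mean.
Proof.
rewrite (@Ex_eq _ _ _ gauss _ (fun x : R => (x ^+ 5 * step x + (- 10) * (x ^+ 3 * step x)) + 15 * (x ^+ 1 * step x))); last first.
  by move=> x; rewrite /he5; ring.
rewrite ExD; [|by apply: MomD; [|apply: MomZ]; exact: Mom_xstep|by apply: MomZ; exact: Mom_xstep].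
rewrite ExD; [|exact: Mom_xstep|by apply: MomZ; exact: Mom_xstep].
rewrite !ExZ; [|exact: Mom_xstep|exact: Mom_xstep].
rewrite half_m5 half_m3 (_ : Ex gauss (fun x => x ^+ 1 * step x) = half_mean)//; ring.
Qed.

End GaussMoments.

(** * Pairs of Gaussian variables *)

Section GaussPair.
Context (R : realType).
Local Notation gauss := (@gauss R).

Definition gauss2 : probability (measurableTypeR R * measurableTypeR R)%type R := (gauss \x gauss)%E.

Lemma integral_gauss2 (f : R * R -> \bar R) : measurable_fun setT f -> (forall z, 0 <= f z)%E ->
  (\int[gauss2]_z f z = \int[gauss]_x \int[gauss]_y f (x, y))%E.
Proof. by move=> mf f0; exact: (@fubini_tonelli1 _ _ _ _ _ gauss gauss f mf f0). Qed.

Lemma gauss2_fst (F : R -> \bar R) : measurable_fun setT F -> (forall x, 0 <= F x)%E ->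
  (\int[gauss2]_z F z.1 = \int[gauss]_x F x)%E.
Proof.
move=> mF F0; rewrite (@integral_gauss2 (fun z => F z.1))//; last exact: (measurableT_comp mF).
by apply: eq_integral => x _ /=; rewrite integral_cst//= gaussT mule1.
Qed.

Lemma gauss2_snd (F : R -> \bar R) : measurable_fun setT F -> (forall x, 0 <= F x)%E ->
  (\int[gauss2]_z F z.2 = \int[gauss]_x F x)%E.
Proof.
move=> mF F0; rewrite (@integral_gauss2 (fun z => F z.2))//; last exact: (measurableT_comp mF).
by rewrite /= integral_cst//= gaussT mule1.
Qed.

Lemma Mom_gauss2_fst (F : R -> R) : Mom gauss F -> Mom gauss2 (fun z => F z.1).
Proof.
move=> [mF kF]; split; first exact: (measurableT_comp mF).
move=> k; rewrite (gauss2_fst (F := fun x => (`|F x| ^+ k)%:E)); [exact: kF| |by move=> x; rewrite lee_fin exprn_ge0].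
by apply/measurable_EFinP; exact: measurable_norm_pow.
Qed.

Lemma Mom_gauss2_snd (F : R -> R) : Mom gauss F -> Mom gauss2 (fun z => F z.2).
Proof.
move=> [mF kF]; split; first exact: (measurableT_comp mF).
move=> k; rewrite (gauss2_snd (F := fun x => (`|F x| ^+ k)%:E)); [exact: kF| |by move=> x; rewrite lee_fin exprn_ge0].
by apply/measurable_EFinP; exact: measurable_norm_pow.
Qed.

Lemma Ex_gauss2_fst (F : R -> R) : measurable_fun setT F -> Ex gauss2 (fun z => F z.1) = Ex gauss F.
Proof.
move=> mF; apply: Ex_ereal_eq => k mk k0; apply: (gauss2_fst (F := fun x => (k (F x))%:E)).
  by apply/measurable_EFinP; exact: measurableT_comp.
by move=> x; rewrite lee_fin.
Qed.

Lemma Ex_gauss2_snd (F : R -> R) : measurable_fun setT F -> Ex gauss2 (fun z => F z.2) = Ex gauss F.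
Proof.
move=> mF; apply: Ex_ereal_eq => k mk k0; apply: (gauss2_snd (F := fun x => (k (F x))%:E)).
  by apply/measurable_EFinP; exact: measurableT_comp.
by move=> x; rewrite lee_fin.
Qed.

Lemma Ex_gauss2_prod (F G : R -> R) : Mom gauss F -> Mom gauss G ->
  Ex gauss2 (fun z => F z.1 * G z.2) = Ex gauss F * Ex gauss G.
Proof.
move=> MF MG; have mF := Mom_measurable MF; have mG := Mom_measurable MG.
rewrite -(Ex_gauss2_fst mF) -(Ex_gauss2_snd mG).
pose G1 : set (set (R * R)) := [set A `*` setT | A in measurable].
pose H1 : set (set (R * R)) := [set setT `*` A | A in measurable].
apply: (@Ex_indep _ _ _ gauss2 G1 H1).
- by move=> _ [A mA <-]; exact: measurableX.
- by move=> _ [A mA <-]; exact: measurableX.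
- by move=> _ _ [A mA <-] [B mB <-]; exists (A `&` B); [exact: measurableI|rewrite -setXI setIT].
- by move=> _ _ [A mA <-] [B mB <-]; exists (A `&` B); [exact: measurableI|rewrite -setXI setIT].
- by exists setT => //; rewrite setXTT.
- by exists setT => //; rewrite setXTT.
- move=> _ _ [A mA <-] [B mB <-]; rewrite -setXI setIT setTI.
  have E C D : measurable C -> measurable D -> gauss2 (C `*` D) = (gauss C * gauss D)%E.
    by move=> mC mD; exact: (@product_measure1E _ _ _ _ R gauss gauss).
  by rewrite !E// gaussT mule1 mul1e.
- move=> _ Y mY; rewrite setTI; apply: sub_sigma_algebra; exists (F @^-1` Y).
    by rewrite -[X in measurable X]setTI; exact: mF.
  by apply/seteqP; split => -[x y] /=; [case|].
- move=> _ Y mY; rewrite setTI; apply: sub_sigma_algebra; exists (G @^-1` Y).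
    by rewrite -[X in measurable X]setTI; exact: mG.
  by apply/seteqP; split => -[x y] /=; [case|].
- exact: Mom_gauss2_fst.
- exact: Mom_gauss2_snd.
Qed.

(* Hermite polynomials are eigenfunctions of the Ornstein-Uhlenbeck averaging. *)
Lemma Ex_he5 (F : R -> R) (be de : R) : Mom gauss F -> be ^+ 2 + de ^+ 2 = 1 ->
  Ex gauss2 (fun z => F z.1 * he5 (be * z.1 + de * z.2)) = be ^+ 5 * Ex gauss (fun x => F x * he5 x).
Proof.
move=> MF bd.
have Mx k : Mom gauss (fun x : R => x ^+ k) by exact: (MomX k (@Mom_gauss R)).
have MFx k : Mom gauss (fun x : R => F x * x ^+ k) by exact: MomM.
have odd0 k : odd k -> Ex gauss (fun x : R => x ^+ k) = 0.
  move=> ok; have := Ex_neg (Mx k).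
  rewrite (@Ex_eq _ _ _ gauss (fun x : R => (- x) ^+ k) (fun x => - x ^+ k)) ?ExN//; first by lra.
  by move=> x; rewrite exprNn -signr_odd ok expr1 mulN1r.
have E k j : Ex gauss2 (fun z => (F z.1 * z.1 ^+ k) * z.2 ^+ j) = Ex gauss (fun x => F x * x ^+ k) * Ex gauss (fun x => x ^+ j).
  exact: (Ex_gauss2_prod (MFx k) (Mx j)).
have ME k j : Mom gauss2 (fun z => (F z.1 * z.1 ^+ k) * z.2 ^+ j).
  by apply: MomM; [exact: (Mom_gauss2_fst (MFx k))|exact: (Mom_gauss2_snd (Mx j))].
pose T k j c := fun z : R * R => c * ((F z.1 * z.1 ^+ k) * z.2 ^+ j).
have MT k j c : Mom gauss2 (T k j c) by exact: MomZ.
rewrite (@Ex_eq _ _ _ gauss2 _ (fun z => T 5%N 0%N (be ^+ 5) z + T 4%N 1%N (5 * be ^+ 4 * de) z + T 3%N 2%N (10 * be ^+ 3 * de ^+ 2) z +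
   T 2%N 3%N (10 * be ^+ 2 * de ^+ 3) z + T 1%N 4%N (5 * be * de ^+ 4) z + T 0%N 5%N (de ^+ 5) z +
   T 3%N 0%N (- 10 * be ^+ 3) z + T 2%N 1%N (- 30 * be ^+ 2 * de) z + T 1%N 2%N (- 30 * be * de ^+ 2) z + T 0%N 3%N (- 10 * de ^+ 3) z +
   T 1%N 0%N (15 * be) z + T 0%N 1%N (15 * de) z)); last first.
  by move=> z; rewrite /T /he5; ring.
rewrite !ExD; do ?[exact: MT]; do ?[repeat (apply: MomD; last exact: MT); exact: MT].
rewrite /T !ExZ; do ?[exact: ME].
rewrite !E gauss_m4 gauss_m2 !(odd0 1%N) ?(odd0 3%N) ?(odd0 5%N)//.
rewrite (@Ex_eq _ _ _ gauss (fun x : R => x ^+ 0) (fun=> 1))// Ex_cst.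
have -> : Ex gauss (fun x => F x * he5 x) = Ex gauss (fun x => F x * x ^+ 5) - 10 * Ex gauss (fun x => F x * x ^+ 3) + 15 * Ex gauss (fun x => F x * x ^+ 1).
  rewrite (@Ex_eq _ _ _ gauss _ (fun x : R => F x * x ^+ 5 + (- 10) * (F x * x ^+ 3) + 15 * (F x * x ^+ 1))); last by move=> x; rewrite /he5; ring.
  by rewrite !ExD ?ExZ ?mulNr//; do ?[exact: MomZ]; apply: MomD => //; exact: MomZ.
have -> : de ^+ 4 = (1 - be ^+ 2) ^+ 2 by rewrite -bd; ring.
have -> : de ^+ 2 = 1 - be ^+ 2 by rewrite -bd; ring.
ring.
Qed.

End GaussPair.

(** * Gaussian linear forms *)

Section GaussFunctions.
Context (R : realType).
Local Notation gauss := (@gauss R).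
Implicit Types x y : R.

Lemma he5_odd (x : R) : he5 (- x) = - he5 x. Proof. by rewrite /he5; ring. Qed.

Lemma measurable_he5 : measurable_fun setT (@he5 R).
Proof. exact: Mom_measurable (@Mom_he5 R). Qed.

(** Its value is [5! = 120]; it is kept symbolic, and its positivity follows from the pairing with
    [step]. *)
Definition he5_norm := Ex gauss (fun x : R => he5 x ^+ 2).

Lemma relu_step x : relu x = x * step x.
Proof. by rewrite /relu /step; case: ltP => h; rewrite ?mulr1 ?mulr0. Qed.

Lemma measurable_relu : measurable_fun setT (@relu R).
Proof. by apply: measurable_maxr => //; exact: measurable_cst. Qed.

Lemma relu_norm x : `|relu x| <= `|x|.
Proof. by rewrite /relu; case: (leP x 0) => h; rewrite ?normr0// ger0_norm ?ltW// ler_norm. Qed.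

Lemma Mom_relu d (Om : measurableType d) (P : probability Om R) (F : Om -> R) : Mom P F -> Mom P (fun w => relu (F w)).
Proof.
move=> MF; apply: (Mom_le _ MF) => [|w]; last exact: relu_norm.
by apply: measurableT_comp; [exact: measurable_relu|exact: Mom_measurable MF].
Qed.

Lemma Ex_relu : Ex gauss (@relu R) = half_mean R.
Proof. by apply: Ex_eq => x; exact: relu_step. Qed.

(** Comes out of the proof of [relu_cov]: the first factor dominates the centred [relu], the second
    its Lipschitz increment. *)
Definition relu_cov_cst := Ex gauss (fun x => (`|x| + half_mean R) * `|x|).

End GaussFunctions.

Section GaussianVector.
Context d (Om : measurableType d) (R : realType) (P : probability Om R).
Variables (K : finType) (I : K -> finType) (f : forall k, I k -> Om -> R).
Arguments f : clear implicits.
Hypothesis mf : forall k j, measurable_fun setT (f k j).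
Hypothesis ind : mutually_independent P f.
Variables (n : nat) (g : 'I_n -> K) (idx : forall k, I (g k)).
Hypothesis ginj : injective g.
Hypothesis gw : forall k, std_gaussian P (f (g k) (idx k)).
Local Notation gauss := (@gauss R).
Local Notation gauss2 := (@gauss2 R).

Definition gcoord k : Om -> R := f (g k) (idx k).
Local Notation W := gcoord.

Definition gform (p : 'I_n -> R) (w : Om) : R := \sum_k p k * W k w.

Let bl (s : seq 'I_n) : {set K} := [set x | has (fun k => g k == x) s]%SET.

Lemma std_gaussian_integral (F : R -> \bar R) k : measurable_fun setT F -> (forall x, 0 <= F x)%E ->
  (\int[P]_w F (W k w) = \int[gauss]_x F x)%E.
Proof.
move=> mF F0; have [mW hW] := gw k.
rewrite -[LHS](@ge0_integral_pushforward _ _ Om (measurableTypeR R) R (W k) mW P setT F)//.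
by apply: eq_measure_integral => A mA _; exact: hW.
Qed.

Lemma mfun_gsum (A : {set K}) (p : 'I_n -> R) (s : seq 'I_n) : (forall k, k \in s -> g k \in A) ->
  mfun_wrt (block f A) (fun w => \sum_(k <- s) p k * W k w).
Proof.
elim: s => [|x s IH] sA.
  by rewrite /mfun_wrt; under eq_fun do rewrite big_nil; exact: measurable_cst.
rewrite /mfun_wrt; under eq_fun do rewrite big_cons; apply: measurable_funD.
  apply: measurable_funM => //; apply: (@mfun_block _ _ _ _ _ f A (g x) (idx x)); apply: sA; exact: mem_head.
by apply: IH => k ks; apply: sA; rewrite inE ks orbT.
Qed.

Lemma mfun_gform (A : {set K}) (p : 'I_n -> R) : (forall k, g k \in A) -> mfun_wrt (block f A) (gform p).
Proof. by move=> gA; apply: mfun_gsum. Qed.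

(** The coefficients [al], [be], [de] are the Cholesky factor of the Gram matrix of the two forms.
    Each further coordinate is split off by independence and absorbed into them. *)
Lemma pair_law_seq (p q : 'I_n -> R) (s : seq 'I_n) : uniq s ->
  exists al be de : R, [/\ al ^+ 2 = \sum_(k <- s) p k ^+ 2, al * be = \sum_(k <- s) p k * q k,
    be ^+ 2 + de ^+ 2 = \sum_(k <- s) q k ^+ 2 &
    forall F : R * R -> \bar R, measurable_fun setT F -> (forall z, 0 <= F z)%E ->
      (\int[P]_w F ((\sum_(k <- s) p k * W k w)%R, (\sum_(k <- s) q k * W k w)%R) =
       \int[gauss]_x \int[gauss]_y F (al * x, be * x + de * y)%R)%E].
Proof.
elim: s => [_|x s IH /= /andP[xs us]].
  exists 0, 0, 0; rewrite !big_nil !mulr0 expr0n addr0; split=> // F mF F0.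
  under eq_integral do rewrite !big_nil.
  rewrite integral_cst//= probability_setT mule1.
  under eq_integral do under eq_integral do rewrite !mul0r addr0.
  have fin (c : \bar R) : (\int[gauss]_y c = c)%E by rewrite integral_cst//= gaussT mule1.
  exact/esym/(etrans (fin _) (fin _)).
have [al [be [de [E1 E2 E3 HF]]]] := IH us.
have [al' [be' [de' [F1 F2 F3 HF']]]] := gauss_absorb al be de (p x) (q x).
exists al', be', de'; rewrite !big_cons F1 F2 F3 E1 E2 E3; split; do ?[by rewrite addrC].
move=> F mF F0.
set U1 := fun w => \sum_(k <- s) p k * W k w; set U2 := fun w => \sum_(k <- s) q k * W k w.
have mU1 : mfun_wrt (block f (bl s)) U1.
  by apply: mfun_gsum => k ks; rewrite inE; apply/hasP; exists k.
have mU2 : mfun_wrt (block f (bl s)) U2.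
  by apply: mfun_gsum => k ks; rewrite inE; apply/hasP; exists k.
have mW : mfun_wrt (block f [set g x]%SET) (W x) by apply: (@mfun_block _ _ _ _ _ f _ (g x) (idx x)); rewrite inE.
have mF3 : measurable_fun setT (fun z : (R * R) * R => F (z.1.1 + p x * z.2, z.1.2 + q x * z.2)).
  apply: (measurableT_comp mF); apply/measurable_fun_pairP; split=> /=.
    by apply: measurable_funD; [|apply: measurable_funM => //]; apply: measurableT_comp.
  by apply: measurable_funD; [|apply: measurable_funM => //]; apply: measurableT_comp.
pose Phi (z : g_sigma_algebraType (block f (bl s)) * g_sigma_algebraType (block f [set g x]%SET)) : \bar R :=
  F (U1 z.1 + p x * W x z.2, U2 z.1 + q x * W x z.2).
have mPhi : measurable_fun setT Phi.
  apply: (measurableT_comp mF); apply/measurable_fun_pairP; split=> /=.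
    apply: measurable_funD; [exact: (measurableT_comp mU1)|apply: measurable_funM => //; exact: (measurableT_comp mW)].
  apply: measurable_funD; [exact: (measurableT_comp mU2)|apply: measurable_funM => //; exact: (measurableT_comp mW)].
have disj k : k \in bl s -> k \notin [set g x]%SET.
  rewrite !inE => /hasP[k' k's /eqP <-]; apply: contra xs => /eqP /ginj <-//.
have := decouple_block mf ind disj mPhi (fun z => F0 _).
pose H (u : R * R) := (\int[gauss]_t F (u.1 + p x * t, u.2 + q x * t)%R)%E.
have mH : measurable_fun setT H.
  exact: (@measurable_fun_fubini_tonelli_F _ _ _ _ R gauss _ mF3 (fun w => F0 _)).
have H0 u : (0 <= H u)%E by apply: integral_ge0.
move=> D; transitivity (\int[P]_w Phi (w, w))%E.
  by apply: eq_integral => w _; rewrite !big_cons /Phi /U1 /U2 /= ![p x * _ + _]addrC ![q x * _ + _]addrC.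
rewrite D; transitivity (\int[P]_w H (U1 w, U2 w))%E.
  apply: eq_integral => w _; rewrite /Phi /H /=.
  apply: (std_gaussian_integral (F := fun t => F (U1 w + p x * t, U2 w + q x * t))) => //.
  apply: (measurableT_comp mF); apply/measurable_fun_pairP; split=> /=.
    by apply: measurable_funD => //; exact: measurable_funM.
  by apply: measurable_funD => //; exact: measurable_funM.
rewrite (HF H mH H0) -(HF' F mF F0).
by [].
Qed.

Lemma pair_law (p q : 'I_n -> R) :
  exists al be de : R, [/\ al ^+ 2 = \sum_k p k ^+ 2, al * be = \sum_k p k * q k,
    be ^+ 2 + de ^+ 2 = \sum_k q k ^+ 2 &
    forall F : R * R -> \bar R, measurable_fun setT F -> (forall z, 0 <= F z)%E ->
      (\int[P]_w F (gform p w, gform q w) =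
       \int[gauss2]_z F (al * z.1, be * z.1 + de * z.2)%R)%E].
Proof.
have [al [be [de [E1 E2 E3 HF]]]] := pair_law_seq p q (index_enum_uniq 'I_n).
exists al, be, de; split=> // F mF F0; rewrite HF//.
rewrite (@integral_gauss2 _ (fun z => F (al * z.1, be * z.1 + de * z.2)))//.
have := measurableT_comp mF (measurable_lin2 al 0 be de).
by under eq_fun do rewrite /= mul0r addr0.
Qed.

Lemma Ex_pair_law (p q : 'I_n -> R) :
  exists al be de : R, [/\ al ^+ 2 = \sum_k p k ^+ 2, al * be = \sum_k p k * q k,
    be ^+ 2 + de ^+ 2 = \sum_k q k ^+ 2 &
    forall F : R * R -> R, measurable_fun setT F ->
      Ex P (fun w => F (gform p w, gform q w)) = Ex gauss2 (fun z => F (al * z.1, be * z.1 + de * z.2))].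
Proof.
have [al [be [de [E1 E2 E3 HF]]]] := pair_law p q.
exists al, be, de; split=> // F mF; apply: Ex_ereal_eq => k mk k0.
apply: (HF (fun z => (k (F z))%:E)); first by apply/measurable_EFinP; exact: measurableT_comp.
by move=> z; rewrite lee_fin.
Qed.

Lemma form_law (p : 'I_n -> R) (F : R -> \bar R) : measurable_fun setT F -> (forall z, 0 <= F z)%E ->
  (\int[P]_w F (gform p w) = \int[gauss]_x F (Num.sqrt (\sum_k p k ^+ 2) * x)%R)%E.
Proof.
move=> mF F0; have [al [be [de [E1 _ _ HF]]]] := pair_law p p.
have mFc (c : R) : measurable_fun setT (fun x : R => F (c * x)) by apply: measurableT_comp => //; exact: measurable_funM.
have := HF (fun z => F z.1) (measurableT_comp mF (@measurable_fst _ _ R R)) (fun z => F0 _).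
move=> /= ->; rewrite (gauss2_fst (mFc al) (fun x => F0 _)).
rewrite -E1 sqrtr_sqr; case: (ger0P al) => [//|al0].
rewrite -(gauss_neg (mFc (- al)) (fun x => F0 _)).
by apply: eq_integral => x _; rewrite mulrNN.
Qed.

Lemma unit_form_law (p : 'I_n -> R) (F : R -> \bar R) : \sum_k p k ^+ 2 = 1 -> measurable_fun setT F -> (forall z, 0 <= F z)%E ->
  (\int[P]_w F (gform p w) = \int[gauss]_x F x)%E.
Proof.
move=> p1 mF F0; rewrite form_law// p1 sqrtr1.
by apply: eq_integral => x _; rewrite mul1r.
Qed.

Lemma measurable_gform p : measurable_fun setT (gform p).
Proof.
apply: (measurable_from_sub (G := block f [set: K]%SET)); first exact: block_measurable.
by apply: mfun_gform => k; rewrite inE.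
Qed.

Lemma Mom_gform p : Mom P (gform p).
Proof.
split; first exact: measurable_gform.
move=> k; rewrite (form_law p (F := fun x => (`|x| ^+ k)%:E)).
- by have [_ ] := MomZ (Num.sqrt (\sum_k p k ^+ 2)) (@Mom_gauss R); exact.
- by apply/measurable_EFinP; apply: measurable_norm_pow.
- by move=> x; rewrite lee_fin exprn_ge0.
Qed.

Lemma Ex_unit_form p (F : R -> R) : \sum_k p k ^+ 2 = 1 -> measurable_fun setT F ->
  Ex P (fun w => F (gform p w)) = Ex gauss F.
Proof.
move=> p1 mF; apply: Ex_ereal_eq => k mk k0.
apply: (unit_form_law (F := fun x => (k (F x))%:E)) => //.
  by apply/measurable_EFinP; exact: measurableT_comp.
by move=> z; rewrite lee_fin.
Qed.

Section UnitPair.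
Variables p q : 'I_n -> R.
Hypotheses (p1 : \sum_k p k ^+ 2 = 1) (q1 : \sum_k q k ^+ 2 = 1).
Local Notation rho := (\sum_k p k * q k).

Lemma unit_pair_law : exists al be de : R, [/\ al = 1 \/ al = -1, be = al * rho, be ^+ 2 + de ^+ 2 = 1 &
    forall F : R * R -> R, measurable_fun setT F ->
      Ex P (fun w => F (gform p w, gform q w)) = Ex gauss2 (fun z => F (al * z.1, be * z.1 + de * z.2))].
Proof.
have [al [be [de [E1 E2 E3 HF]]]] := Ex_pair_law p q.
exists al, be, de; split=> //; last by rewrite E3.
- have : (al - 1) * (al + 1) == 0.
    by rewrite (_ : _ * _ = al ^+ 2 - 1); [rewrite E1 p1 subrr|ring].
  by rewrite mulf_eq0 subr_eq0 addr_eq0 => /orP[] /eqP ->; [left|right].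
- by rewrite -E2 mulrA -expr2 E1 p1 mul1r.
Qed.

(** The eigenfunction property [Ex_he5] extracts [be ^+ 5]; when [al = -1] the signs of [be ^+ 5]
    and of the reflected step cancel because [he5] is odd. *)
Lemma Ex_step_he5 : Ex P (fun w => step (gform p w) * he5 (gform q w)) = 3 * half_mean R * rho ^+ 5.
Proof.
have [al [be [de [al1 beE bd HF]]]] := unit_pair_law.
have mF : measurable_fun setT (fun z : R * R => step z.1 * he5 z.2).
  apply: measurable_funM; [exact: (measurableT_comp (@measurable_step R))|exact: (measurableT_comp (@measurable_he5 R))].
rewrite (HF (fun z => step z.1 * he5 z.2) mF) /=.
have Ms (c : R) : Mom gauss (fun x => step (c * x)).
  apply: (@Mom_bounded _ _ _ _ _ 1); first by apply: (measurableT_comp (@measurable_step R)); exact: measurable_funM.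
  by move=> x; have /andP[s1 s2] := step01 (c * x); rewrite ger0_norm.
rewrite (Ex_he5 (Ms al) bd) beE; case: al1 => ->.
  rewrite mul1r mulrC; congr (_ * _); rewrite -step_he5; apply: Ex_eq => x; by rewrite mul1r.
rewrite -(@step_he5 R) -[in RHS]Ex_neg; last by apply: MomM; [exact: Mom_step|exact: Mom_he5].
rewrite [in RHS](@Ex_eq _ _ _ gauss _ (fun x => - (step (-1 * x) * he5 x))).
  by rewrite ExN; [ring|apply: MomM; [exact: Ms|exact: Mom_he5]].
by move=> x; rewrite mulN1r he5_odd mulrN.
Qed.

Lemma Ex_he5_he5 : Ex P (fun w => he5 (gform p w) * he5 (gform q w)) = he5_norm R * rho ^+ 5.
Proof.
have [al [be [de [al1 beE bd HF]]]] := unit_pair_law.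
have mF : measurable_fun setT (fun z : R * R => he5 z.1 * he5 z.2).
  by apply: measurable_funM; exact: (measurableT_comp (@measurable_he5 R)).
rewrite (HF (fun z => he5 z.1 * he5 z.2) mF) /=.
rewrite (@Ex_eq _ _ _ gauss2 _ (fun z => al * (he5 z.1 * he5 (be * z.1 + de * z.2)))); last first.
  by move=> z; case: al1 => ->; rewrite ?mul1r// !mulN1r he5_odd mulNr.
have Mh : Mom gauss2 (fun z => he5 z.1 * he5 (be * z.1 + de * z.2)).
  have M1 := Mom_gauss2_fst (@Mom_gauss R); have M2 := Mom_gauss2_snd (@Mom_gauss R).
  apply: MomM; first exact: (Mom_gauss2_fst (@Mom_he5 R)).
  have M3 : Mom gauss2 (fun z => be * z.1 + de * z.2) by apply: MomD; exact: MomZ.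
  by apply: MomD; [apply: MomB; [exact: MomX|apply: MomZ; exact: MomX]|exact: MomZ].
rewrite ExZ// (Ex_he5 (@Mom_he5 R) bd) beE.
rewrite (_ : Ex gauss (fun x => he5 x * he5 x) = he5_norm R)//.
by case: al1 => ->; ring.
Qed.

(** Replacing [relu (be x + de y)] by [relu (de y)] makes the factors independent, with a centred
    first one, so that part vanishes; the replacement costs at most [|be| |x|], and [|be|] is the
    absolute correlation. *)
Lemma relu_cov : `|Ex P (fun w => (relu (gform p w) - half_mean R) * (relu (gform q w) - half_mean R))| <= relu_cov_cst R * `|rho|.
Proof.
have [al [be [de [al1 beE bd HF]]]] := unit_pair_law.
set mu := half_mean R.
have mF : measurable_fun setT (fun z : R * R => (relu z.1 - mu) * (relu z.2 - mu)).
  by apply: measurable_funM; apply: measurable_funB => //; exact: (measurableT_comp (@measurable_relu R)).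
rewrite (HF (fun z => (relu z.1 - mu) * (relu z.2 - mu)) mF) /=.
pose G (x : R) := relu (al * x) - mu.
have MG : Mom gauss G by apply: MomB; [exact: (Mom_relu (MomZ _ (@Mom_gauss R)))|exact: Mom_cst].
have EG : Ex gauss G = 0.
  rewrite /G ExB ?Ex_cst; [|exact: (Mom_relu (MomZ _ (@Mom_gauss R)))|exact: Mom_cst].
  apply/eqP; rewrite subr_eq0 /mu -Ex_relu; apply/eqP; case: al1 => ->.
    by apply: Ex_eq => x; rewrite mul1r.
  rewrite -[RHS]Ex_neg; last exact: (Mom_relu (@Mom_gauss R)).
  by apply: Ex_eq => x; rewrite mulN1r.
pose H (z : R * R) := G z.1 * (relu (be * z.1 + de * z.2) - relu (de * z.2)).
have M1 := Mom_gauss2_fst (@Mom_gauss R); have M2 := Mom_gauss2_snd (@Mom_gauss R).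
have MG2 := Mom_gauss2_fst MG.
have Mr (c e : R) : Mom gauss2 (fun z => relu (c * z.1 + e * z.2)).
  by apply: Mom_relu; apply: MomD; exact: MomZ.
have Mr2 := Mom_gauss2_snd (Mom_relu (MomZ de (@Mom_gauss R))).
have MH : Mom gauss2 H by apply: MomM => //; apply: MomB.
have EH : Ex gauss2 (fun z => G z.1 * (relu (be * z.1 + de * z.2) - mu)) = Ex gauss2 H.
  rewrite (@Ex_eq _ _ _ gauss2 _ (fun z => H z + G z.1 * (relu (de * z.2) - mu))); last by move=> z; rewrite /H; ring.
  have MM : Mom gauss (fun y => relu (de * y) - mu) by apply: MomB; [exact: (Mom_relu (MomZ _ (@Mom_gauss R)))|exact: Mom_cst].
  rewrite ExD//; last by apply: MomM => //; exact: (Mom_gauss2_snd MM).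
  by rewrite (Ex_gauss2_prod MG MM) EG mul0r addr0.
rewrite EH; apply: le_trans (Ex_norm MH) _.
have rE : `|be| = `|rho| by rewrite beE normrM; case: al1 => ->; rewrite ?normrN normr1 mul1r.
have MB : Mom gauss (fun x => (`|x| + mu) * `|x|).
  by apply: MomM; [apply: MomD; [exact: Mom_norm (@Mom_gauss R)|exact: Mom_cst]|exact: Mom_norm (@Mom_gauss R)].
rewrite -rE mulrC /relu_cov_cst -(Ex_gauss2_fst (Mom_measurable MB)) -ExZ; last exact: (Mom_gauss2_fst MB).
apply: Ex_le; [exact: Mom_norm|by apply: MomZ; exact: (Mom_gauss2_fst MB)|].
move=> z; rewrite /H normrM.
have a1 : `|relu (be * z.1 + de * z.2) - relu (de * z.2)| <= `|be| * `|z.1|.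
  by apply: le_trans (relu_lip _ _) _; rewrite addrK normrM.
have a2 : `|G z.1| <= `|z.1| + mu.
  apply: le_trans (ler_normB _ _) _; apply: lerD; last by rewrite ger0_norm// (le_trans _ (half_mean_ge R)).
  by apply: le_trans (relu_norm _) _; rewrite normrM; case: al1 => ->; rewrite ?normrN normr1 mul1r.
apply: le_trans (ler_pM (normr_ge0 _) (normr_ge0 _) a2 a1) _.
by rewrite le_eqVlt; apply/orP; left; apply/eqP; ring.
Qed.

End UnitPair.

Lemma small_ball p (tau : R) : \sum_k p k ^+ 2 = 1 -> 0 <= tau ->
  (P [set w | (gform p w ^+ 2 <= tau ^+ 2)%R] <= (2 * tau)%:E)%E.
Proof.
move=> p1 t0.
have E1 (x : R) : (x ^+ 2 <= tau ^+ 2) = (`|x| <= tau).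
  by rewrite -(real_normK (num_real x)) ler_sqr ?nnegrE.
pose F (x : R) : \bar R := (\1_(`[- tau, tau]%classic : set R) x)%:E.
have mF : measurable_fun setT F by apply/measurable_EFinP; exact: measurable_indic.
have F0 x : (0 <= F x)%E by rewrite lee_fin.
have mg := measurable_gform p.
have -> : P [set w | gform p w ^+ 2 <= tau ^+ 2] = (\int[P]_w F (gform p w))%E.
  transitivity (\int[P]_w (\1_(gform p @^-1` `[- tau, tau]) w)%:E)%E => //.
  rewrite integral_indic// ?setIT.
    by congr (P _); apply/seteqP; split=> w /=; rewrite in_itv/= E1 ler_norml.
  by rewrite -[X in measurable X]setTI; apply: mg.
rewrite (unit_form_law p1 mF F0) integral_indic//= setIT /gauss /normal_prob.
apply: le_trans (_ : (\int[lebesgue_measure]_(x in `[(- tau)%R, tau]) 1 <= _)%E).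
  apply: ge0_le_integral => //.
  - by move=> x _; rewrite lee_fin normal_pdf_ge0.
  - by apply: measurable_funTS; exact: mem_pdf.
  (* The Gaussian density is at most [1 / sqrt (2 pi)], hence at most 1. *)
  move=> x _; rewrite lee_fin; apply: le_trans (normal_pdf_ub 0 x (oner_neq0 _)) _.
  rewrite /normal_peak invf_le1 ?sqrtr_gt0; last by rewrite expr1n mul1r mulrn_wgt0// pi_gt0.
  rewrite -[leLHS]sqrtr1 ler_wsqrtr// expr1n mul1r mulr2n.
  by have := pi_ge2 R; lra.
rewrite integral_cst//= mul1e lebesgue_measure_itv/= lte_fin.
case: ifP => _; [rewrite -EFinD lee_fin; lra|by rewrite lee_fin mulr_ge0].
Qed.

Lemma gauss_exp_sqr : (\int[gauss]_x (expR (4^-1 * x ^+ 2))%:E = (Num.sqrt 2)%:E)%E.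
Proof.
have s2 : 0 < Num.sqrt 2 :> R by rewrite sqrtr_gt0.
(* Scaling by [1 / sqrt 2] is what makes the exponent [(1 - a^2) / 2] equal to [1 / 4]. *)
have a0 : 0 < (Num.sqrt 2)^-1 :> R by rewrite invr_gt0.
have := gauss_scale a0 (measurable_cst (1%E : \bar R)) (fun=> lee01).
rewrite integral_cst//= gaussT mule1 => H.
have E : (1 - (Num.sqrt 2)^-1 ^+ 2) / 2 = 4^-1 :> R by rewrite exprVn sqr_sqrtr//; lra.
have -> : (Num.sqrt 2)%:E = ((Num.sqrt 2 : R)%:E * 1)%E by rewrite mule1.
rewrite H muleA -EFinM divff ?gt_eqF// mul1e; apply: eq_integral => x _.
by rewrite mul1e E.
Qed.

Lemma unit_form_exp_sqr p : \sum_k p k ^+ 2 = 1 ->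
  (\int[P]_w (expR (4^-1 * gform p w ^+ 2))%:E = (Num.sqrt 2)%:E)%E.
Proof.
move=> p1; rewrite -gauss_exp_sqr; apply: (unit_form_law (F := fun x => (expR (4^-1 * x ^+ 2))%:E)) => //.
  apply/measurable_EFinP; apply: measurableT_comp => //; apply: measurable_funM => //; exact: measurable_funX.
Qed.

End GaussianVector.

(** * The uniform law on the sphere *)

Section Householder.
Context (R : realType) (n : nat).

(** The reflection exchanging the basis vector [k0] with [u], along their difference; when the two
    coincide the difference vanishes and the identity is taken. *)
Lemma householder (k0 : 'I_n) (u : 'I_n -> R) : \sum_k u k ^+ 2 = 1 ->
  exists2 Q : 'M[R]_n, Q *m Q^T = 1%:M & forall k, Q k k0 = u k.
Proof.
move=> u1; pose v : 'cV[R]_n := \col_k (u k - (k == k0)%:R).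
have vv : (v^T *m v) 0 0 = 2 * (1 - u k0).
  rewrite mxE (eq_bigr (fun k => u k ^+ 2 + (- 2 * u k + 1) * (k == k0)%:R)); last first.
    by move=> k _; rewrite !mxE; case: eqP => _; rewrite /= ?mulr1 ?mulr0; ring.
  rewrite big_split /= u1 (bigD1 k0)//= eqxx mulr1 big1 ?addr0; first by ring.
  by move=> k /negbTE ->; rewrite mulr0.
have [v0|vn] := eqVneq (u k0) 1.
  exists 1%:M; first by rewrite trmx1 mulmx1.
  have v00 : sqnorm v = 0.
    by rewrite sqnormE dotvE vv v0 subrr mulr0.
  move: v00 => /eqP; rewrite sqnorm_eq0 => /eqP v00 k.
  have := congr1 (fun A : 'cV[R]_n => A k 0) v00; rewrite !mxE => /eqP; rewrite subr_eq0 => /eqP ->.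
  by [].
pose c := (1 - u k0)^-1.
have un : 1 - u k0 != 0 by rewrite subr_eq0 eq_sym.
have vvE : v^T *m v = (2 * (1 - u k0))%:M.
  by rewrite [LHS]mx11_scalar vv.
pose S := v *m v^T.
have St : S^T = S by rewrite /S trmx_mul trmxK.
have SS : S *m S = (2 * (1 - u k0)) *: S by rewrite /S mulmxA -(mulmxA v) vvE mul_mx_scalar -scalemxAl.
exists (1%:M - c *: S).
  have -> : (1%:M - c *: S)^T = 1%:M - c *: S by rewrite linearB /= trmx1 linearZ /= St.
  rewrite mulmxBl mul1mx mulmxBr mulmx1 -scalemxAl -scalemxAr SS !scalerA.
  have -> : c * c * (2 * (1 - u k0)) = c + c by rewrite /c; field.
  by rewrite scalerDl opprB addrK subrK.
move=> k; rewrite !mxE big_ord1 !mxE eqxx /= /c.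
by field.
Qed.

End Householder.

Lemma integral_eq_law d (Om : measurableType d) (R : realType) (P : probability Om R) (f g : Om -> R) (F : R -> \bar R) :
  measurable_fun setT f -> measurable_fun setT g ->
  (forall A, measurable A -> P (f @^-1` A) = P (g @^-1` A)) ->
  measurable_fun setT F -> (forall z, 0 <= F z)%E -> (\int[P]_w F (f w) = \int[P]_w F (g w))%E.
Proof.
move=> mf mg fg mF F0.
rewrite -[LHS](@ge0_integral_pushforward _ _ Om (measurableTypeR R) R f mf P setT F)//.
rewrite -[RHS](@ge0_integral_pushforward _ _ Om (measurableTypeR R) R g mg P setT F)//.
by apply: eq_measure_integral => A mA _; exact: fg.
Qed.

Section Sphere.
Context d (Om : measurableType d) (R : realType) (P : probability Om R) (n : nat).
Variable x : Om -> 'rV[R]_n.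
Hypothesis ux : uniform_sphere P x.

Definition sdot (u : 'I_n -> R) w := \sum_k x w 0 k * u k.

Lemma measurable_sdot u : measurable_fun setT (sdot u).
Proof.
have [mx _] := ux; rewrite /sdot.
apply: measurable_sum => k; apply: measurable_funM => //.
Qed.

Lemma sphere_unit_set : measurable [set w | \sum_j x w ord0 j ^+ 2 = 1].
Proof.
have [mx _] := ux.
have m : measurable_fun setT (fun w => \sum_j x w ord0 j ^+ 2).
  by apply: measurable_sum => k; apply: measurable_funX.
by have := m measurableT _ (measurable_set1 1); rewrite setTI.
Qed.

Lemma sphere_null : P (~` [set w | \sum_j x w ord0 j ^+ 2 = 1]) = 0%E.
Proof.
have [_ [P1 _]] := ux.
by have := probability_setC P sphere_unit_set; rewrite P1 subee.
Qed.

(** Rectangles that constrain only the coordinate [k0], rotated by a matrix with column [u], turn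
    invariance of the law into equality of all one-dimensional projections. *)
Lemma sphere_coord_law (k0 : 'I_n) u (B : set R) : \sum_k u k ^+ 2 = 1 -> measurable B ->
  P (sdot u @^-1` B) = P ((fun w => x w 0 k0) @^-1` B).
Proof.
move=> u1 mB; have [_ [_ inv]] := ux.
have [Q QQ Qu] := householder k0 u1.
have mBj (j : 'I_n) : measurable (if j == k0 then B else setT : set R) by case: ifP.
have H := inv Q QQ (fun j => if j == k0 then B else setT) mBj.
have E (f : Om -> 'rV[R]_n) : \bigcap_(j in [set: 'I_n]) [set w | f w ord0 j \in (if j == k0 then B else setT)] = (fun w => f w 0 k0) @^-1` B.
  apply/seteqP; split=> w /=.
    by move=> /(_ k0 Logic.I) /=; rewrite eqxx inE.
  by move=> Bw j _ /=; case: eqP => [->|_]; rewrite inE.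
have E2 w : (x w *m Q) 0 k0 = sdot u w by rewrite mxE; apply: eq_bigr => k _; rewrite Qu.
rewrite !E in H; rewrite -H; congr (P _); apply/seteqP; split=> w /=; by rewrite E2.
Qed.

Lemma sphere_law u u' (F : R -> \bar R) : \sum_k u k ^+ 2 = 1 -> \sum_k u' k ^+ 2 = 1 ->
  measurable_fun setT F -> (forall z, 0 <= F z)%E ->
  (\int[P]_w F (sdot u w) = \int[P]_w F (sdot u' w))%E.
Proof.
move=> u1 u1' mF F0.
have [[k0 _]|no] := pselect (exists k : 'I_n, True); last first.
  have := u1; rewrite big1 => [/eqP|k _]; first by rewrite eq_sym oner_eq0.
  by case: no; exists k.
apply: (integral_eq_law (measurable_sdot u) (measurable_sdot u')) => // A mA.
by rewrite !(sphere_coord_law k0)//.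
Qed.

Lemma sphere_scaled_law u (v : 'I_n -> R) (F : R -> \bar R) : \sum_k u k ^+ 2 = 1 ->
  measurable_fun setT F -> (forall z, 0 <= F z)%E ->
  (\int[P]_w F (sdot v w) = \int[P]_w F (Num.sqrt (\sum_k v k ^+ 2) * sdot u w)%R)%E.
Proof.
move=> u1 mF F0; set r := Num.sqrt _.
have v0 : 0 <= \sum_k v k ^+ 2 by apply: sumr_ge0 => k _; exact: sqr_ge0.
have [r0|rn] := eqVneq r 0.
  have h k : v k = 0.
    have : \sum_k v k ^+ 2 = 0 by rewrite -(sqr_sqrtr v0) -/r r0 expr0n.
    move=> /eqP; rewrite psumr_eq0 => [/allP /(_ k)|j _]; last exact: sqr_ge0.
    by rewrite mem_index_enum sqrf_eq0 => /(_ isT) /eqP.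
  apply: eq_integral => w _; rewrite r0 mul0r /sdot big1// => k _; by rewrite h mulr0.
pose u' k := v k / r.
have u1' : \sum_k u' k ^+ 2 = 1.
  rewrite /u'; under eq_bigr do rewrite expr_div_n.
  by rewrite -mulr_suml /r sqr_sqrtr// divff// -(sqr_sqrtr v0) sqrf_eq0.
have mF' : measurable_fun setT (fun z : R => F (r * z)) by apply: measurableT_comp => //; exact: measurable_funM.
rewrite -(sphere_law u1' u1 mF' (fun z => F0 _)); apply: eq_integral => w _; congr F.
by rewrite /sdot mulr_sumr; apply: eq_bigr => k _; rewrite /u'; field.
Qed.

End Sphere.

Lemma Ex_le_integral d (Om : measurableType d) (R : realType) (P : probability Om R) (F : Om -> R) (G : Om -> \bar R) :
  Mom P F -> measurable_fun setT G -> (forall w, 0 <= G w)%E -> (forall w, (F w)%:E <= G w)%E ->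
  ((Ex P F)%:E <= \int[P]_w G w)%E.
Proof.
move=> MF mG G0 FG.
have [->|] := eqVneq (\int[P]_w G w)%E +oo%E; first exact: leey.
rewrite -ltey => Gfin; rewrite ExE//; apply: le_integral => //; first exact: Mom_int.
apply/integrableP; split=> //.
by under eq_integral do rewrite gee0_abs//.
Qed.

Section SphereExp.
Context d (Om : measurableType d) (R : realType) (P : probability Om R).
Variables (K : finType) (I : K -> finType) (f : forall k, I k -> Om -> R).
Arguments f : clear implicits.
Hypothesis mf : forall k j, measurable_fun setT (f k j).
Hypothesis ind : mutually_independent P f.
Variables (n : nat) (g : 'I_n -> K) (idx : forall k, I (g k)).
Hypothesis ginj : injective g.
Hypothesis gw : forall k, std_gaussian P (f (g k) (idx k)).
Variable x : Om -> 'rV[R]_n.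
Hypothesis ux : uniform_sphere P x.
Local Notation W := (gcoord f idx).

Lemma Mom_gcoord k : Mom P (W k).
Proof.
split; first by case: (gw k).
move=> j; rewrite (std_gaussian_integral gw (F := fun t => (`|t| ^+ j)%:E)).
- by case: (@Mom_gauss R) => _; exact.
- by apply/measurable_EFinP; apply: measurable_norm_pow.
- by move=> t; rewrite lee_fin exprn_ge0.
Qed.

Lemma Ex_gcoord_sqr k : Ex P (fun w => W k w ^+ 2) = 1.
Proof.
rewrite -(@gauss_m2 R); apply: Ex_ereal_eq => h mh h0.
apply: (std_gaussian_integral gw (F := fun t => (h (t ^+ 2))%:E)).
- by apply/measurable_EFinP; apply: measurableT_comp => //; exact: measurable_funX.
- by move=> t; rewrite lee_fin.
Qed.

(* Jensen's inequality against an independent Gaussian vector, of squared length n on average. *)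
Lemma sphere_exp_sqr u : \sum_k u k ^+ 2 = 1 ->
  (\int[P]_w (expR (n%:R / 4 * sdot x u w ^+ 2))%:E <= (Num.sqrt 2)%:E)%E.
Proof.
move=> u1.
have mu := measurable_sdot ux u.
have m_exp (c : R) : measurable_fun setT (fun t : R => (expR (c * t ^+ 2))%:E).
  by apply/measurable_EFinP; apply: measurableT_comp => //; apply: measurable_funM => //; exact: measurable_funX.
pose s w := Num.min (sdot x u w ^+ 2) 1.
have ms : measurable_fun setT s by apply: measurable_minr => //; exact: measurable_funX.
have s0 w : 0 <= s w by rewrite le_min sqr_ge0 ler01.
have s1 w : s w <= 1 by rewrite ge_min lexx orbT.
pose e w := expR (n%:R / 4 * s w).
have Ms : Mom P s by apply: (@Mom_bounded _ _ _ _ _ 1) => // w; rewrite ger0_norm.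
have me : measurable_fun setT e by apply: measurableT_comp => //; exact: measurable_funM.
have n4 : 0 <= n%:R / 4 :> R by rewrite divr_ge0.
have Me : Mom P e.
  apply: (@Mom_bounded _ _ _ _ _ (expR (n%:R / 4))) => // w.
  by rewrite ger0_norm ?expR_ge0// ler_expR ler_piMr.
pose A := Ex P e; pose B := Ex P (fun w => e w * s w).
pose r w := \sum_k W k w ^+ 2.
have Mr : Mom P r by apply: Mom_sum => k _; exact: (MomX 2 (Mom_gcoord k)).
have Er : Ex P r = n%:R.
  rewrite Ex_sum; last by move=> k _; exact: (MomX 2 (Mom_gcoord k)).
  by under eq_bigr do rewrite Ex_gcoord_sqr; rewrite sumr_const card_ord.
pose Phi (z : Om * Om) : \bar R := (expR (4^-1 * (\sum_k x z.1 0 k * W k z.2) ^+ 2))%:E.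
have mPhi : measurable_fun setT Phi.
  apply: (@measurableT_comp _ _ _ _ _ _ (fun t : R => (expR (4^-1 * t ^+ 2))%:E)) => //.
  apply: measurable_sum => k; apply: measurable_funM.
    by apply: (@measurableT_comp _ _ _ _ _ _ (fun w => x w 0 k)) => //; case: ux.
  by apply: (@measurableT_comp _ _ _ _ _ _ (W k)) => //; case: (gw k).
have Phi0 z : (0 <= Phi z)%E by rewrite lee_fin expR_ge0.
(* For a fixed unit vector the Gaussian form is a standard Gaussian variable. *)
have upper : (\int[P]_w \int[P]_w' Phi (w, w') <= (Num.sqrt 2)%:E)%E.
  have sq2 : (0 <= (Num.sqrt 2 : R)%:E)%E by rewrite lee_fin.
  have [_ [P1 _]] := ux.
  have -> : (\int[P]_w \int[P]_w' Phi (w, w') = \int[P]_w (cst (Num.sqrt 2)%:E) w)%E.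
    apply: ae_eq_integral => //.
      exact: (@measurable_fun_fubini_tonelli_F _ _ _ _ R P Phi mPhi Phi0).
    exists (~` [set w | \sum_j x w ord0 j ^+ 2 = 1]); split.
    - by apply: measurableC; exact: (sphere_unit_set ux).
    - exact: (sphere_null ux).
    - move=> w /=; apply: contra_not => h _.
      exact: (unit_form_exp_sqr mf ind ginj gw (p := fun k => x w 0 k) h).
  by rewrite integral_cst//= probability_setT mule1.
(* For fixed weights only their length matters, by rotation invariance. The exponential is bounded
   below by its tangent at squared length [n], whose linear term has mean zero. *)
have lower : (A%:E <= \int[P]_w' \int[P]_w Phi (w, w'))%E.
  have MF : Mom P (fun w' => A + 4^-1 * B * (r w' - n%:R)).
    by apply: MomD; [exact: Mom_cst|apply: MomZ; apply: MomB => //; exact: Mom_cst].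
  have EF : Ex P (fun w' => A + 4^-1 * B * (r w' - n%:R)) = A.
    rewrite ExD; [|exact: Mom_cst|by apply: MomZ; apply: MomB => //; exact: Mom_cst].
    rewrite Ex_cst ExZ; last by apply: MomB => //; exact: Mom_cst.
    by rewrite ExB ?Er ?Ex_cst ?subrr ?mulr0 ?addr0//; exact: Mom_cst.
  rewrite -[X in X%:E]EF; apply: Ex_le_integral => //.
  - exact: (@measurable_fun_fubini_tonelli_G _ _ _ _ R P Phi mPhi Phi0).
  - by move=> w'; apply: integral_ge0.
  move=> w'.
  have -> : (\int[P]_w Phi (w, w') = \int[P]_w (expR (4^-1 * (r w' * sdot x u w ^+ 2)))%:E)%E.
    have F0 (t : R) : (0 <= (expR (4^-1 * t ^+ 2))%:E)%E by rewrite lee_fin expR_ge0.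
    apply: etrans (sphere_scaled_law ux (fun k => W k w') u1 (m_exp 4^-1) F0) _.
      apply: eq_integral => w _; rewrite exprMn sqr_sqrtr//.
      by apply: sumr_ge0 => k _; exact: sqr_ge0.
  have -> : A + 4^-1 * B * (r w' - n%:R) = Ex P (fun w => e w + (4^-1 * (r w' - n%:R)) * (e w * s w)).
    rewrite ExD//; last by apply: MomZ; exact: MomM.
    by rewrite ExZ; [rewrite -/A -/B; ring|exact: MomM].
  apply: Ex_le_integral.
  - by apply: MomD => //; apply: MomZ; exact: MomM.
  - apply/measurable_EFinP; apply: measurableT_comp => //; apply: measurable_funM => //; apply: measurable_funM => //.
    exact: measurable_funX.
  - by move=> w; rewrite lee_fin expR_ge0.
  move=> w; rewrite lee_fin.
  have r0 : 0 <= r w' by apply: sumr_ge0 => k _; exact: sqr_ge0.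
  apply: le_trans (_ : expR (4^-1 * (r w' * s w)) <= _); last first.
    by rewrite ler_expR ler_pM2l ?invr_gt0// ler_wpM2l// ge_min lexx.
  have -> : 4^-1 * (r w' * s w) = n%:R / 4 * s w + (4^-1 * (r w' - n%:R)) * s w by field.
  rewrite expRD -/(e w) (_ : e w + _ = e w * (1 + 4^-1 * (r w' - n%:R) * s w)); last by ring.
  by rewrite ler_pM2l ?expR_gt0// expR_ge1Dx.
have AS : (A%:E <= (Num.sqrt 2)%:E)%E.
  apply: le_trans lower _; apply: le_trans upper.
  by rewrite (@fubini_tonelli _ _ _ _ _ P P Phi mPhi Phi0).
apply: le_trans AS; rewrite ExE//; rewrite le_eqVlt; apply/orP; left; apply/eqP.
have [_ [P1 _]] := ux.
apply: ae_eq_integral => //.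
- by apply: (measurableT_comp (m_exp _)).
- exact/measurable_EFinP.
exists (~` [set w | \sum_j x w ord0 j ^+ 2 = 1]); split.
- by apply: measurableC; exact: (sphere_unit_set ux).
- exact: (sphere_null ux).
- move=> w /=; apply: contra_not => h _.
  rewrite /e /s (_ : Num.min _ _ = sdot x u w ^+ 2)//; apply/min_idPl.
  by apply: le_trans (cauchy_schwarz_sum (fun k => x w 0 k) u) _; rewrite u1 mulr1 h.
Qed.

End SphereExp.

(** * Nets *)

Section Net.
Context (R : realType) (D M : nat).

(** Signed integer vectors of l1 norm at most [M]: after scaling, grid points of an l1 ball, which
    contains the Euclidean ball because the l1 norm is at most [sqrt D] times the Euclidean one. *)
Definition net : {set {ffun 'I_D -> bool * 'I_M.+1}} :=
  [set z : {ffun 'I_D -> bool * 'I_M.+1} | (\sum_k (z k).2 <= M)%N]%SET.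

Definition netpt (h : R) (z : {ffun 'I_D -> bool * 'I_M.+1}) (k : 'I_D) : R :=
  (if (z k).1 then 1 else -1) * (h * (z k).2%:R).

(** Each point of the net has weight at least [2^(- M)] when a vector is weighted by 2 to minus its
    l1 norm, and the total weight is a product of signed geometric series, each at most 4. *)
Lemma net_card : #|net|%:R <= 2 ^+ M * 4 ^+ D :> R.
Proof.
have geo n : \sum_(m < n) 2^-1 ^+ m <= 2 :> R.
  have -> : \sum_(m < n) 2^-1 ^+ m = 2 - 2 * 2^-1 ^+ n :> R.
    elim: n => [|n IH]; first by rewrite big_ord0 expr0; ring.
    by rewrite big_ord_recr /= IH exprS; field.
  by rewrite gerBl mulr_ge0// exprn_ge0// invr_ge0.
pose wt (x : bool * 'I_M.+1) : R := 2^-1 ^+ x.2.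
have w0 x : 0 <= wt x by rewrite exprn_ge0// invr_ge0.
have W4 : \sum_x wt x <= 4.
  have -> : \sum_x wt x = \sum_(b : bool) \sum_(m < M.+1) 2^-1 ^+ m by rewrite pair_bigA.
  by rewrite big_bool; apply: le_trans (lerD (geo M.+1) (geo M.+1)) _; lra.
have two0 : (0 : R) <= 2 ^+ M by rewrite exprn_ge0.
apply: le_trans (_ : \sum_(z in net) 2 ^+ M * \prod_k wt (z k) <= _).
  rewrite -sum1_card natr_sum; apply: ler_sum => z; rewrite inE => zM.
  rewrite /wt prodrXr.
  rewrite exprVn ler_pdivlMr ?exprn_gt0// mul1r ler_weXn2l//.
  by rewrite ler1n.
rewrite -mulr_sumr ler_wpM2l//.
apply: le_trans (_ : \sum_(z : {ffun 'I_D -> bool * 'I_M.+1}) \prod_k wt (z k) <= _).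
  by rewrite [leRHS](bigID (mem net))/= lerDl; apply: sumr_ge0 => z _; apply: prodr_ge0 => k _.
rewrite -(bigA_distr_bigA (fun=> wt)) prodr_const card_ord lerXn2r// ?nnegrE//.
by apply: sumr_ge0.
Qed.

End Net.

(** Coordinates are rounded towards zero with mesh [1 / (sqrt D * q)]: the norm does not increase,
    the squared error is at most [D] times the squared mesh, and [D * q] is [sqrt D] divided by the
    mesh. *)
Lemma net_approx (R : realType) (D q : nat) (u : 'I_D -> R) : (0 < q)%N -> \sum_k u k ^+ 2 = 1 ->
  exists2 z, z \in net D (D * q) &
  \sum_k (u k - netpt (Num.sqrt D%:R * q%:R)^-1 z k) ^+ 2 <= (q%:R ^+ 2)^-1 /\
  \sum_k netpt (Num.sqrt D%:R * q%:R : R)^-1 z k ^+ 2 <= 1.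
Proof.
move=> q0 u1.
have D0 : (0 < D)%N.
  case: D u u1 => // u; rewrite big_ord0 => /esym/eqP; by rewrite oner_eq0.
have sD : 0 < Num.sqrt D%:R :> R by rewrite sqrtr_gt0 ltr0n.
have qR : 0 < q%:R :> R by rewrite ltr0n.
set h := (_)^-1; have h0 : 0 < h by rewrite invr_gt0 mulr_gt0.
have l1 : \sum_k `|u k| <= Num.sqrt D%:R.
  apply: ler_of_sqr => //; rewrite sqr_sqrtr//.
  have := cauchy_schwarz_sum (fun=> 1) (fun k => `|u k|).
  under eq_bigr do rewrite mul1r; move=> /le_trans; apply.
  under [X in X * _]eq_bigr do rewrite expr1n.
  under [X in _ * X]eq_bigr do rewrite real_normK ?num_real//.
  by rewrite u1 mulr1 sumr_const card_ord.
pose m k := Num.truncn (`|u k| / h).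
have mh k : (m k)%:R * h <= `|u k| /\ `|u k| < (m k)%:R * h + h.
  have := truncn_itv (divr_ge0 (normr_ge0 (u k)) (ltW h0)).
  rewrite ler_pdivlMr// ltr_pdivrMr// -/(m k) => /andP[h1 h2]; split=> //.
  by apply: lt_le_trans h2 _; rewrite -natr1 mulrDl mul1r.
have sm : (\sum_k m k <= D * q)%N.
  rewrite -(ler_nat R) natr_sum -(ler_pM2r h0) mulr_suml.
  apply: le_trans (_ : \sum_k `|u k| <= _); first by apply: ler_sum => k _; case: (mh k).
  apply: le_trans l1 _; rewrite /h natrM invfM mulrACA divff ?gt_eqF// mulr1.
  by rewrite -{2}(sqr_sqrtr (ler0n R D)) expr2 mulfK ?gt_eqF.
have mM k : (m k < (D * q).+1)%N.
  by rewrite ltnS; apply: leq_trans sm; rewrite (bigD1 k)//= leq_addr.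
pose z : {ffun 'I_D -> bool * 'I_(D * q).+1} := [ffun k => (0 <= u k, Ordinal (mM k))].
have ptE k : netpt h z k = (if 0 <= u k then 1 else -1) * (h * (m k)%:R) by rewrite /netpt ffunE.
exists z.
  by rewrite inE; under eq_bigr do rewrite ffunE /=.
split.
  apply: le_trans (_ : \sum_(k < D) h ^+ 2 <= _).
    apply: ler_sum => k _; rewrite ptE; have [h1 h2] := mh k.
    have -> : (u k - (if 0 <= u k then 1 else -1) * (h * (m k)%:R)) ^+ 2 = (`|u k| - (m k)%:R * h) ^+ 2.
      by case: ger0P => _; ring.
    by rewrite lerXn2r ?nnegrE ?subr_ge0//; [exact: ltW|lra].
  rewrite sumr_const card_ord /h exprVn exprMn sqr_sqrtr// invfM -mulrnAl -[_ *+ D]mulr_natl divff ?mul1r// pnatr_eq0 -lt0n//.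
rewrite -u1; apply: ler_sum => k _; rewrite ptE exprMn.
have -> : (if 0 <= u k then 1 else -1) ^+ 2 = 1 :> R by case: ifP => _; rewrite ?sqrrN expr1n.
rewrite mul1r -[leRHS](real_normK (num_real _)) lerXn2r ?nnegrE ?mulr_ge0 ?(ltW h0)//.
by rewrite mulrC; case: (mh k).
Qed.

Section NormFromNet.
Context (R : realType) (N D : nat) (X : 'M[R]_(N, D)).

(** With [q = 2] a unit vector differs from a net point by at most [1 / 2], so the best constant [m]
    in [|X u|^2 <= m |u|^2] satisfies [m <= 2 S + m / 2]. Duality then passes the bound from [X] to
    its transpose. *)
Lemma norm_from_net (S : R) :
  (forall z, z \in net D (D * 2) -> \sum_k netpt (Num.sqrt D%:R * 2 : R)^-1 z k ^+ 2 <= 1 ->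
     \sum_i (\sum_k X i k * netpt (Num.sqrt D%:R * 2 : R)^-1 z k) ^+ 2 <= S) ->
  forall q : 'cV[R]_N, sqnorm (X^T *m q) <= 4 * S * sqnorm q.
Proof.
move=> HS.
pose F (u : 'cV[R]_D) := sqnorm (X *m u).
have FE (u : 'cV[R]_D) : F u = \sum_i (\sum_k X i k * u k 0) ^+ 2.
  by apply: eq_bigr => i _; rewrite mxE.
pose T : set R := [set B | 0 <= B /\ forall u, F u <= B * sqnorm u].
have T1 : T (frob X X) by split=> [|u]; [exact: frob_ge0|exact: sqnorm_mul_le].
have S0 : 0 <= S.
  pose z : {ffun 'I_D -> bool * 'I_(D * 2).+1} := [ffun=> (true, ord0)].
  have z0 k : netpt (Num.sqrt D%:R * 2)^-1 z k = 0 :> R by rewrite /netpt ffunE /= !mulr0.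
  apply: le_trans (HS z _ _); first by apply: sumr_ge0 => i _; exact: sqr_ge0.
    by rewrite inE; under eq_bigr do rewrite ffunE /=; rewrite big1.
  by rewrite big1// => k _; rewrite z0 expr0n.
have hom k u : F (k *: u) = k ^+ 2 * F u by rewrite /F -scalemxAr sqnormZ.
have step B : T B -> T (2 * S + 2^-1 * B).
  move=> [B0 TB]; split=> [|u]; first by lra.
  have [->|un] := eqVneq u 0; first by rewrite /F mulmx0 /sqnorm !big1 ?mulr0// => i _; rewrite mxE expr0n.
  have su : 0 < sqnorm u by rewrite lt_neqAle eq_sym sqnorm_eq0 un sqnorm_ge0.
  pose r := Num.sqrt (sqnorm u).
  have r0 : 0 < r by rewrite sqrtr_gt0.
  have r2 : r ^+ 2 = sqnorm u by rewrite sqr_sqrtr// ltW.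
  pose v : 'cV[R]_D := r^-1 *: u.
  have v1 : sqnorm v = 1 by rewrite sqnormZ exprVn r2 mulVf ?gt_eqF.
  have uE : u = r *: v by rewrite /v scalerA divff ?gt_eqF// scale1r.
  rewrite uE hom sqnormZ v1 mulr1 mulrC ler_wpM2r ?sqr_ge0//.
  have [z zn [z1 z2]] := @net_approx R D 2 (fun k => v k 0) isT v1.
  pose p : 'cV[R]_D := \col_k netpt (Num.sqrt D%:R * 2)^-1 z k.
  have h1 : F p <= S.
    by rewrite FE; under eq_bigr do under eq_bigr do rewrite mxE; exact: HS.
  have h2 : F (v - p) <= B / 4.
    apply: le_trans (TB _) _.
    rewrite ler_wpM2l//; apply: le_trans (_ : (2%:R ^+ 2)^-1 <= _); last by rewrite -natrX.
    apply: le_trans z1; rewrite le_eqVlt; apply/orP; left; apply/eqP.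
    by apply: eq_bigr => k _; rewrite !mxE.
  have -> : v = p + (v - p) by rewrite addrC subrK.
  apply: le_trans (_ : 2 * F p + 2 * F (v - p) <= _); last by lra.
  rewrite /F mulmxDr /sqnorm !mulr_sumr -big_split; apply: ler_sum => i _; rewrite mxE /=.
  set a := (X *m p) i 0; set b := (X *m (v - p)) i 0.
  by have := sqr_ge0 (a - b); rewrite sqrrB sqrrD; lra.
have T4 : T (4 * S).
  have hT : has_inf T by split; [exists (frob X X)|exists 0 => B []].
  have m0 : 0 <= inf T by apply: lb_le_inf => [|B []]; [exists (frob X X)|].
  have Tm : T (inf T).
    split=> // u; have [->|un] := eqVneq u 0; first by rewrite /F mulmx0 /sqnorm !big1 ?mulr0// => i _; rewrite mxE expr0n.
    have su : 0 < sqnorm u by rewrite lt_neqAle eq_sym sqnorm_eq0 un sqnorm_ge0.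
    rewrite -ler_pdivrMr//; apply: lb_le_inf => [|B [_ TB]]; first by exists (frob X X).
    by rewrite ler_pdivrMr.
  have m4 : inf T <= 2 * S + 2^-1 * inf T by apply: ge_inf; [case: hT|exact: step].
  split=> [|u]; first by rewrite mulr_ge0.
  have [_ Tm'] := Tm; apply: le_trans (Tm' u) _; rewrite ler_wpM2r ?sqnorm_ge0//; lra.
move=> q; set w := X^T *m q.
have w0 := sqnorm_ge0 w.
have h : sqnorm w ^+ 2 <= sqnorm q * (4 * S * sqnorm w).
  have wE : sqnorm w = dotv q (X *m w) by rewrite /w dotv_mul -sqnormE.
  rewrite [X in X ^+ 2]wE.
  apply: le_trans (dotv_cauchy _ _) _; rewrite ler_wpM2l ?sqnorm_ge0//.
  by have [_ T4'] := T4; exact: T4'.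
have [->|wn] := eqVneq (sqnorm w) 0; first by rewrite !mulr_ge0 ?sqnorm_ge0.
have wp : 0 < sqnorm w by rewrite lt_neqAle eq_sym wn.
rewrite -(ler_pM2r wp) -expr2; apply: le_trans h _.
by rewrite le_eqVlt; apply/orP; left; apply/eqP; ring.
Qed.

End NormFromNet.

(** * The activation kernel from a net to all directions *)

Section Activation.
Context (R : realType) (N D n : nat) (X : 'M[R]_(N, D)) (A : 'M[R]_(N, n)) (B : R).
Hypothesis XB : forall q : 'cV[R]_N, sqnorm (X^T *m q) <= B * sqnorm q.
Hypothesis A01 : forall i j, 0 <= A i j <= 1.
Hypothesis B0 : 0 <= B.

Definition act_vec (u : 'I_N -> R) j : 'cV[R]_N := \col_i (A i j * u i).
Definition act_form (u : 'I_N -> R) j : R := sqnorm (X^T *m act_vec u j).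

Lemma act_form_ub u j : act_form u j <= B * \sum_i u i ^+ 2.
Proof.
apply: le_trans (XB _) _; rewrite ler_wpM2l// /sqnorm; apply: ler_sum => i _; rewrite mxE exprMn.
have /andP[a0 a1] := A01 i j.
by rewrite ler_piMl ?sqr_ge0// -(expr1n _ 2) lerXn2r ?nnegrE.
Qed.

Lemma act_form_split u p j : act_form p j <= 2 * act_form u j + 2 * act_form (fun i => u i - p i) j.
Proof.
rewrite /act_form.
have -> : act_vec p j = act_vec u j - act_vec (fun i => u i - p i) j.
  by apply/matrixP => i k; rewrite !mxE; ring.
rewrite mulmxBr /sqnorm !mulr_sumr -big_split; apply: ler_sum => i _; rewrite mxE [X in (_ + X) ^+ 2]mxE /=.
set a := (X^T *m act_vec u j) i 0; set b := (X^T *m _) i 0.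
by have := sqr_ge0 (a + b); rewrite sqrrB sqrrD; lra.
Qed.

(** A net point near a unit vector keeps a quarter of its squared norm. The kernel at the point is
    at most twice the kernel at the vector plus [2 n B / q^2], and the mesh condition makes this
    error at most [k n / 8]. *)
Lemma act_form_from_net (q : nat) (k : R) : (1 < q)%N -> 0 <= k -> 16 * B <= k * q%:R ^+ 2 ->
  (forall z, z \in net N (N * q) -> 4^-1 <= \sum_i netpt (Num.sqrt N%:R * q%:R : R)^-1 z i ^+ 2 ->
     k * n%:R <= \sum_j act_form (netpt (Num.sqrt N%:R * q%:R)^-1 z) j) ->
  forall u : 'cV[R]_N, k / 4 * n%:R * sqnorm u <= \sum_j sqnorm (X^T *m (\col_i (A i j * u i 0))).
Proof.
move=> q1 k0 kB Hz.
have q0 : (0 < q)%N by exact: ltnW.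
have qR : 0 < q%:R :> R by rewrite ltr0n.
have main (u : 'I_N -> R) : \sum_i u i ^+ 2 = 1 -> k / 4 * n%:R <= \sum_j act_form u j.
  move=> u1; have [z zn [z1 z2]] := net_approx q0 u1.
  set p := netpt _ z in z1 z2.
  have q4 : (q%:R ^+ 2)^-1 <= 4^-1 :> R.
    by rewrite lef_pV2 ?posrE ?exprn_gt0// -natrX ler_nat -[4%N]/(2 ^ 2)%N leq_exp2r.
  have p4 : 4^-1 <= \sum_i p i ^+ 2.
    have : \sum_i u i ^+ 2 <= \sum_i (2 * p i ^+ 2 + 2 * (u i - p i) ^+ 2).
      by apply: ler_sum => i _; have := sqr_ge0 (u i - p i - p i); rewrite !sqrrB; lra.
    by rewrite big_split /= -!mulr_sumr u1 => h; lra.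
  have h1 := Hz z zn p4.
  have h2 : \sum_j act_form p j <= 2 * (\sum_j act_form u j) + 2 * (n%:R * (B * (q%:R ^+ 2)^-1)).
    apply: le_trans (_ : \sum_j (2 * act_form u j + 2 * (B * (q%:R ^+ 2)^-1)) <= _).
      apply: ler_sum => j _; apply: le_trans (act_form_split u p j) _; rewrite lerD2l ler_pM2l//.
      by apply: le_trans (act_form_ub _ _) _; rewrite ler_wpM2l.
    rewrite big_split /= -mulr_sumr sumr_const card_ord -mulr_natl.
    by rewrite lerD2l le_eqVlt; apply/orP; left; apply/eqP; ring.
  have h3 : B * (q%:R ^+ 2)^-1 <= k / 16.
    by rewrite ler_pdivrMr ?exprn_gt0//; lra.
  have h4 : n%:R * (B * (q%:R ^+ 2)^-1) <= n%:R * (k / 16) by rewrite ler_wpM2l.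
  move: h1; rewrite -/p => h1; have kn : 0 <= k * n%:R by rewrite mulr_ge0.
  lra.
move=> u; have [->|un] := eqVneq u 0.
  rewrite {1}/sqnorm big1 ?mulr0; first by apply: sumr_ge0 => j _; exact: sqnorm_ge0.
  by move=> i _; rewrite mxE expr0n.
have su : 0 < sqnorm u by rewrite lt_neqAle eq_sym sqnorm_eq0 un sqnorm_ge0.
pose r := Num.sqrt (sqnorm u).
have r0 : 0 < r by rewrite sqrtr_gt0.
have r2 : r ^+ 2 = sqnorm u by rewrite sqr_sqrtr// ltW.
have v1 : \sum_i (r^-1 * u i 0) ^+ 2 = 1.
  by under eq_bigr do rewrite exprMn; rewrite -mulr_sumr exprVn r2 mulVf ?gt_eqF.
have := ler_wpM2r (ltW su) (main _ v1); move/le_trans; apply.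
rewrite mulr_suml le_eqVlt; apply/orP; left; apply/eqP; apply: eq_bigr => j _.
rewrite /act_form mulrC -r2 -sqnormZ scalemxAr; congr (sqnorm (_ *m _)).
by apply/matrixP => i l; rewrite !mxE; field; rewrite gt_eqF.
Qed.

End Activation.

(** * Concentration *)

Section Families.
Context d (Om : measurableType d) (R : realType) (P : probability Om R).
Variables (K : finType) (I : K -> finType) (f : forall k, I k -> Om -> R).
Arguments f : clear implicits.
Hypothesis mf : forall k j, measurable_fun setT (f k j).
Hypothesis ind : mutually_independent P f.
Variables (J : eqType) (A : J -> {set K}).
Hypothesis Adisj : forall j j', j != j' -> forall k, k \in A j -> k \notin A j'.

Definition blocks (s : seq J) : {set K} := [set k | has (fun j => k \in A j) s]%SET.

Lemma blocks_cons_disj x s : x \notin s -> forall k, k \in A x -> k \notin blocks s.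
Proof.
move=> xs k kx; rewrite inE; apply/hasPn => j js; apply: Adisj kx.
by apply: contra xs => /eqP ->.
Qed.

Lemma sub_blocks j s : j \in s -> A j \subset blocks s.
Proof. by move=> js; apply/fintype.subsetP => k kj; rewrite inE; apply/hasP; exists j. Qed.

Lemma mfun_blocks j s (F : Om -> R) : j \in s -> mfun_wrt (block f (A j)) F -> mfun_wrt (block f (blocks s)) F.
Proof. by move=> js; apply: mfun_block_sub; exact: sub_blocks. Qed.

Lemma indep_family_prod (F : J -> Om -> R) (s : seq J) (a : R) : uniq s -> 0 <= a ->
  (forall j, mfun_wrt (block f (A j)) (F j)) -> (forall j w, 0 <= F j w) ->
  (forall j, (\int[P]_w (F j w)%:E <= a%:E)%E) ->
  (\int[P]_w (\prod_(j <- s) F j w)%:E <= (a ^+ size s)%:E)%E.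
Proof.
move=> us a0 mF F0 Fa; elim: s us => [_|x s IH /= /andP[xs us]].
  under eq_integral do rewrite big_nil.
  by rewrite integral_cst//= probability_setT mule1.
under eq_integral do rewrite big_cons.
rewrite (@indep_prod_block _ _ _ _ _ _ _ mf ind (A x) (blocks s)) ?exprS ?EFinM//.
- by apply: lee_pmul => //; [apply: integral_ge0 => w _; rewrite lee_fin|apply: integral_ge0 => w _; rewrite lee_fin prodr_ge0|exact: IH].
- exact: blocks_cons_disj.
- have h (t : seq J) : {subset t <= s} -> mfun_wrt (block f (blocks s)) (fun w => \prod_(j <- t) F j w).
    elim: t => [_|y t IHt ts]; first by rewrite /mfun_wrt; under eq_fun do rewrite big_nil; exact: measurable_cst.
    rewrite /mfun_wrt; under eq_fun do rewrite big_cons; apply: measurable_funM.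
      by apply: (@mfun_blocks y) => //; apply: ts; rewrite mem_head.
    by apply: IHt => z zt; apply: ts; rewrite inE zt orbT.
  exact: h.
- by move=> w; apply: prodr_ge0.
Qed.

Lemma mfun_measurable (B : {set K}) (F : Om -> R) : mfun_wrt (block f B) F -> measurable_fun setT F.
Proof. by move=> mF; apply: (measurable_from_sub (G := block f B)) => //; exact: block_measurable. Qed.

Lemma family_chernoff (Y : J -> Om -> R) (s : seq J) (a t : R) : uniq s ->
  (forall j, mfun_wrt (block f (A j)) (Y j)) -> (forall j, (\int[P]_w (expR (Y j w))%:E <= (expR a)%:E)%E) ->
  (P [set w | (t <= \sum_(j <- s) Y j w)%R] <= (expR ((size s)%:R * a - t))%:E)%E.
Proof.
move=> us mY Ya.
have mS : measurable_fun setT (fun w => \sum_(j <- s) Y j w).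
  by apply: measurable_sum => j; apply: mfun_measurable (mY j).
have -> : [set w | t <= \sum_(j <- s) Y j w] = [set w | expR t <= expR (\sum_(j <- s) Y j w)].
  by apply/seteqP; split=> w /=; rewrite ler_expR.
apply: le_trans (markov_ge0 P _ _ _) _; rewrite ?expR_gt0//.
  exact: measurableT_comp.
rewrite expRB EFinM lee_pmul2r ?lte_fin ?invr_gt0 ?expR_gt0//.
rewrite mulrC expRM_natr.
under eq_integral do rewrite expR_sum.
apply: (@indep_family_prod (fun j w => expR (Y j w))) => //.
by move=> j; exact: measurableT_comp (mY j).
Qed.

(** Induction on the number of independent summands. Expanding [(S + u)^2 (T + v)^2], every term
    with an odd factor on one side has mean zero, and the mixed term contributes four times the
    product of two covariances. *)
Lemma pair_fourth_moment (U V : J -> Om -> R) (s : seq J) (a c m4 : R) : uniq s ->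
  (forall j, mfun_wrt (block f (A j)) (U j)) -> (forall j, mfun_wrt (block f (A j)) (V j)) ->
  (forall j, Mom P (U j)) -> (forall j, Mom P (V j)) ->
  (forall j, Ex P (U j) = 0) -> (forall j, Ex P (V j) = 0) ->
  (forall j, Ex P (fun w => U j w ^+ 2) = a) -> (forall j, Ex P (fun w => V j w ^+ 2) = a) ->
  (forall j, `|Ex P (fun w => U j w * V j w)| <= c) -> (forall j, Ex P (fun w => U j w ^+ 2 * V j w ^+ 2) <= m4) ->
  Ex P (fun w => (\sum_(j <- s) U j w) ^+ 2 * (\sum_(j <- s) V j w) ^+ 2) <=
  ((size s)%:R * a) ^+ 2 + 2 * ((size s)%:R * c) ^+ 2 + (size s)%:R * m4 /\
  Ex P (fun w => (\sum_(j <- s) U j w) ^+ 2) = (size s)%:R * a.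
Proof.
move=> us mU mV MU MV U0 V0 U2 V2 UV UV4.
(* The induction has to carry the means, the second moments and the covariance along with the fourth
   moment. *)
suff H : [/\ Ex P (fun w => \sum_(j <- s) U j w) = 0, Ex P (fun w => \sum_(j <- s) V j w) = 0,
  Ex P (fun w => (\sum_(j <- s) U j w) ^+ 2) = (size s)%:R * a, Ex P (fun w => (\sum_(j <- s) V j w) ^+ 2) = (size s)%:R * a &
  `|Ex P (fun w => (\sum_(j <- s) U j w) * (\sum_(j <- s) V j w))| <= (size s)%:R * c /\
  Ex P (fun w => (\sum_(j <- s) U j w) ^+ 2 * (\sum_(j <- s) V j w) ^+ 2) <=
  ((size s)%:R * a) ^+ 2 + 2 * ((size s)%:R * c) ^+ 2 + (size s)%:R * m4] by case: H => _ _ h1 _ [_ h2].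
elim: s us => [_|x s IH /= /andP[xs us]].
  have e0 (F : Om -> R) : (forall w, F w = 0) -> Ex P F = 0.
    by move=> F0; rewrite (@Ex_eq _ _ _ P F (fun=> 0)) ?Ex_cst.
  by rewrite !e0 ?normr0 ?mul0r ?expr0n ?mulr0 ?addr0//= => w; rewrite ?big_nil ?expr0n ?mul0r.
have [S0 T0 S2 T2 [ST ST4]] := IH us.
set S := fun w => \sum_(j <- s) U j w in S0 S2 ST ST4; set T := fun w => \sum_(j <- s) V j w in T0 T2 ST ST4.
have MS : Mom P S by apply: Mom_sum.
have MT : Mom P T by apply: Mom_sum.
have mST (F : J -> Om -> R) : (forall j, mfun_wrt (block f (A j)) (F j)) ->
    mfun_wrt (block f (blocks s)) (fun w => \sum_(j <- s) F j w).
  move=> mF; have h (t : seq J) : {subset t <= s} -> mfun_wrt (block f (blocks s)) (fun w => \sum_(j <- t) F j w).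
    elim: t => [_|y t IHt ts]; first by rewrite /mfun_wrt; under eq_fun do rewrite big_nil; exact: measurable_cst.
    rewrite /mfun_wrt; under eq_fun do rewrite big_cons; apply: measurable_funD.
      by apply: (@mfun_blocks y) => //; apply: ts; rewrite mem_head.
    by apply: IHt => z zt; apply: ts; rewrite inE zt orbT.
  exact: h.
have mS := mST U mU; have mT := mST V mV.
have sz : ((size s).+1)%:R = (size s)%:R + 1 :> R by rewrite -natr1.
set m : R := (size s)%:R in S2 T2 ST ST4 sz *.
pose u := U x; pose v := V x.
have E F G : mfun_wrt (block f (blocks s)) F -> mfun_wrt (block f (A x)) G -> Mom P F -> Mom P G ->
    Ex P (fun w => F w * G w) = Ex P F * Ex P G.
  apply: (Ex_indep_block mf ind) => k ks; apply/negP => kx.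
  by have := blocks_cons_disj xs kx; rewrite ks.
have mX G (F : Om -> R) k : mfun_wrt (block f G) F -> mfun_wrt (block f G) (fun w => F w ^+ k).
  by move=> mF; exact: measurable_funX.
have mM G (F H : Om -> R) : mfun_wrt (block f G) F -> mfun_wrt (block f G) H -> mfun_wrt (block f G) (fun w => F w * H w).
  by move=> mF mH; exact: measurable_funM.
have Mu := MU x; have Mv := MV x; have mu := mU x; have mv := mV x.
have cs (F : J -> Om -> R) w : \sum_(j <- x :: s) F j w = \sum_(j <- s) F j w + F x w by rewrite big_cons addrC.
have sq (F : J -> Om -> R) (Sf := fun w => \sum_(j <- s) F j w) : Mom P Sf -> Mom P (F x) -> mfun_wrt (block f (blocks s)) Sf ->
    mfun_wrt (block f (A x)) (F x) -> Ex P (F x) = 0 -> Ex P (fun w => F x w ^+ 2) = a -> Ex P (fun w => Sf w ^+ 2) = m * a ->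
    Ex P (fun w => (\sum_(j <- x :: s) F j w) ^+ 2) = (m + 1) * a.
  move=> M1 M2 m1 m2 F0 F2 S2'.
  rewrite (@Ex_eq _ _ _ P _ (fun w => Sf w ^+ 2 + (2 * (Sf w * F x w) + F x w ^+ 2))); last first.
    by move=> w; rewrite cs -/(Sf w); ring.
  have MM := MomM M1 M2.
  rewrite ExD; [|exact: MomX|by apply: MomD; [exact: MomZ|exact: MomX]].
  rewrite ExD; [|exact: MomZ|exact: MomX].
  by rewrite ExZ// E// F0 F2 S2'; ring.
split.
- rewrite (@Ex_eq _ _ _ P _ (fun w => S w + u w)); last by move=> w; rewrite cs.
  by rewrite ExD// S0 U0 addr0.
- rewrite (@Ex_eq _ _ _ P _ (fun w => T w + v w)); last by move=> w; rewrite cs.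
  by rewrite ExD// T0 V0 addr0.
- by rewrite sz; exact: sq.
- by rewrite sz; exact: sq.
split.
  rewrite (@Ex_eq _ _ _ P _ (fun w => (S w * T w + u w * v w) + (S w * v w + T w * u w))); last first.
    by move=> w; rewrite !cs -/(S w) -/(T w) /u /v; ring.
  rewrite ExD; [|by apply: MomD; exact: MomM|by apply: MomD; exact: MomM].
  rewrite ExD; [|exact: MomM|exact: MomM]; rewrite ExD; [|exact: MomM|exact: MomM].
  rewrite (E S v)// (E T u)// S0 T0 !mul0r !addr0 sz mulrDl mul1r.
  by apply: le_trans (ler_normD _ _) _; apply: lerD; [exact: ST|exact: UV].
pose S_2 w := S w ^+ 2; pose T_2 w := T w ^+ 2; pose u2 w := u w ^+ 2; pose v2 w := v w ^+ 2.
have MS2 : Mom P S_2 by exact: MomX. have MT2 : Mom P T_2 by exact: MomX.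
have Mu2 : Mom P u2 by exact: MomX. have Mv2 : Mom P v2 by exact: MomX.
have mS2 : mfun_wrt (block f (blocks s)) S_2 by exact: mX.
have mT2 : mfun_wrt (block f (blocks s)) T_2 by exact: mX.
have mu2 : mfun_wrt (block f (A x)) u2 by exact: mX.
have mv2 : mfun_wrt (block f (A x)) v2 by exact: mX.
pose F1 w := S_2 w * T_2 w; pose F2 w := S_2 w * T w; pose F3 w := S w * T_2 w; pose F4 w := S w * T w.
pose G1 w := u2 w * v2 w; pose G2 w := u2 w * v w; pose G3 w := u w * v2 w; pose G4 w := u w * v w.
rewrite (@Ex_eq _ _ _ P _ (fun w => F1 w + G1 w + (S_2 w * v2 w + T_2 w * u2 w + 4 * (F4 w * G4 w)) +
   2 * ((F2 w * v w + F3 w * u w) + (S w * G3 w + T w * G2 w)))); last first.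
  by move=> w; rewrite !cs -/(S w) -/(T w) /F1 /F2 /F3 /F4 /G1 /G2 /G3 /G4 /S_2 /T_2 /u2 /v2 /u /v; ring.
have [MF1 MF2 MF3 MF4] : [/\ Mom P F1, Mom P F2, Mom P F3 & Mom P F4] by split; exact: MomM.
have [MG1 MG2 MG3 MG4] : [/\ Mom P G1, Mom P G2, Mom P G3 & Mom P G4] by split; exact: MomM.
have [mF2 mF3 mF4] : [/\ mfun_wrt (block f (blocks s)) F2, mfun_wrt (block f (blocks s)) F3 & mfun_wrt (block f (blocks s)) F4].
  by split; exact: mM.
have [mG2 mG3 mG4] : [/\ mfun_wrt (block f (A x)) G2, mfun_wrt (block f (A x)) G3 & mfun_wrt (block f (A x)) G4].
  by split; exact: mM.
have MA : Mom P (fun w => F1 w + G1 w + (S_2 w * v2 w + T_2 w * u2 w + 4 * (F4 w * G4 w))).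
  apply: MomD; first exact: MomD MF1 MG1.
  apply: MomD; last by apply: MomZ; exact: MomM MF4 MG4.
  by apply: MomD; [exact: MomM MS2 Mv2|exact: MomM MT2 Mu2].
have MB : Mom P (fun w => F2 w * v w + F3 w * u w + (S w * G3 w + T w * G2 w)).
  apply: MomD; apply: MomD; [exact: MomM MF2 Mv|exact: MomM MF3 Mu|exact: MomM MS MG3|exact: MomM MT MG2].
rewrite (ExD MA (MomZ 2 MB)) (ExZ 2 MB).
rewrite ExD; [|exact: MomD|by do ?apply: MomD; do ?apply: MomZ; exact: MomM].
rewrite [Ex P (fun w => F1 w + _)]ExD//.
rewrite ExD; [|by apply: MomD; exact: MomM|by apply: MomZ; exact: MomM].
rewrite ExZ; last exact: MomM.
rewrite ExD; [|exact: MomM|exact: MomM].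
rewrite ExD; [|by apply: MomD; exact: MomM|by apply: MomD; exact: MomM].
rewrite ExD; [|exact: MomM|exact: MomM]; rewrite ExD; [|exact: MomM|exact: MomM].
rewrite (E S_2 v2)// (E T_2 u2)// (E F4 G4)// (E F2 v)// (E F3 u)// (E S G3)// (E T G2)//.
rewrite S0 T0 (_ : Ex P u = 0); last exact: U0.
rewrite (_ : Ex P v = 0); last exact: V0.
rewrite (_ : Ex P v2 = a); last exact: V2.
rewrite (_ : Ex P u2 = a); last exact: U2.
rewrite (_ : Ex P S_2 = m * a)// (_ : Ex P T_2 = m * a)//.
rewrite sz.
have h3 : Ex P F4 * Ex P G4 <= m * c * c.
  apply: le_trans (ler_norm _) _; rewrite normrM; apply: ler_pM => //; exact: UV.
have h1 : Ex P F1 <= (m * a) ^+ 2 + 2 * (m * c) ^+ 2 + m * m4 by [].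
have h2 : Ex P G1 <= m4 by exact: UV4.
have := sqr_ge0 a; have := sqr_ge0 c; nra.
Qed.

End Families.

Section RealBounds.
Context (R : realType).
Implicit Types x : R.

Lemma expR1_le4 : expR 1 <= 4 :> R.
Proof.
have h : expR 2^-1 <= 2 :> R.
  have := expR_ge1Dx (- 2^-1 : R); rewrite expRN => h.
  rewrite -[leRHS]invrK -[leLHS]invrK lef_pV2 ?posrE ?invr_gt0 ?expR_gt0//; lra.
have -> : expR 1 = expR 2^-1 ^+ 2 :> R by rewrite -expRM_natr; congr expR; lra.
by apply: le_trans (_ : 2 ^+ 2 <= _); [rewrite lerXn2r ?nnegrE ?expR_ge0|rewrite -natrX].
Qed.

Lemma expRN_le x : 0 <= x <= 1 -> expR (- x) <= 1 - x / 2.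
Proof.
move=> /andP[x0 x1]; rewrite expRN; apply: le_trans (_ : (1 + x)^-1 <= _).
  by rewrite lef_pV2 ?posrE ?expR_gt0 ?expR_ge1Dx//; lra.
by rewrite -[leLHS]mul1r ler_pdivrMr; [nra|lra].
Qed.

End RealBounds.

(** The row of the Gram matrix is [q = x r] with [r] a unit vector, so [|q|^2 = (x^T q, r)] is at
    most [sqrt B |q|]. *)
Lemma gram_row_sum (R : realType) (N D : nat) (x : 'M[R]_(N, D)) (B : R) :
  (forall i, \sum_k x i k ^+ 2 = 1) ->
  (forall q : 'cV[R]_N, sqnorm (x^T *m q) <= B * sqnorm q) ->
  forall i, \sum_j (\sum_k x i k * x j k) ^+ 2 <= B.
Proof.
move=> x1 xB i; pose q : 'cV[R]_N := \col_j \sum_k x i k * x j k.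
have -> : \sum_j (\sum_k x i k * x j k) ^+ 2 = sqnorm q.
  by apply: eq_bigr => j _; rewrite mxE.
pose r : 'cV[R]_D := \col_k x i k.
have r1 : sqnorm r = 1 by rewrite -(x1 i); apply: eq_bigr => k _; rewrite mxE.
have qE : q = x *m r.
  by apply/matrixP => j k; rewrite !mxE; apply: eq_bigr => a _; rewrite !mxE mulrC.
have h : sqnorm q ^+ 2 <= B * sqnorm q.
  rewrite {1}(_ : sqnorm q = dotv (x^T *m q) r); last by rewrite -dotv_mul -qE sqnormE.
  by apply: le_trans (dotv_cauchy _ _) _; rewrite r1 mulr1.
have [q0|qn] := eqVneq (sqnorm q) 0.
  rewrite q0; have := xB (\col_j (j == i)%:R).
  have -> : sqnorm (\col_j (j == i)%:R : 'cV[R]_N) = 1.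
    rewrite /sqnorm (bigD1 i)//= mxE eqxx expr1n big1 ?addr0// => j ji.
    by rewrite mxE (negbTE ji) expr0n.
  by rewrite mulr1; apply: le_trans; exact: sqnorm_ge0.
have qp : 0 < sqnorm q by rewrite lt_neqAle eq_sym qn sqnorm_ge0.
by rewrite -(ler_pM2r qp) -expr2.
Qed.

(** * Events over the independent columns of the weights *)

Section Columns.
Context d (Om : measurableType d) (R : realType) (P : probability Om R).
Variables (K : finType) (I : K -> finType) (f : forall k, I k -> Om -> R).
Arguments f : clear implicits.
Hypothesis mf : forall k j, measurable_fun setT (f k j).
Hypothesis ind : mutually_independent P f.
Variables (N D n : nat) (g : 'I_D * 'I_n -> K) (idx : forall p, I (g p)).
Hypothesis ginj : injective g.
Hypothesis gw : forall p, std_gaussian P (f (g p) (idx p)).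

Definition gmx (w : Om) : 'M[R]_(D, n) := \matrix_(k, j) f (g (k, j)) (idx (k, j)) w.
Definition colB (j : 'I_n) : {set K} := [set g (k, j) | k : 'I_D]%SET.

Lemma colB_disj j j' : j != j' -> forall k, k \in colB j -> k \notin colB j'.
Proof.
move=> jj k /imsetP[a _ ->]; apply/negP => /imsetP[b _ /ginj[_ E]].
by rewrite E eqxx in jj.
Qed.

Variable x : 'M[R]_(N, D).
Hypothesis x1 : forall i, \sum_k x i k ^+ 2 = 1.

Local Notation form i j := (gform f (g := fun k => g (k, j)) (fun k => idx (k, j)) (fun k => x i k)).

Let injc j : injective (fun k => g (k, j)).
Proof. by move=> a b /ginj[]. Qed.

Let gwc j k : std_gaussian P (f (g (k, j)) (idx (k, j))). Proof. exact: gw. Qed.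

Lemma gmxE i j w : (x *m gmx w) i j = form i j w.
Proof. by rewrite mxE; apply: eq_bigr => k _; rewrite mxE. Qed.

Let mfun_form i j : mfun_wrt (block f (colB j)) (form i j).
Proof. by apply: mfun_gform => k; apply: imset_f. Qed.

Let M_form i j : Mom P (form i j). Proof. exact: (Mom_gform mf ind (@injc j) (gwc j)). Qed.

Let m_form i j : measurable_fun setT (form i j). Proof. by case: (M_form i j). Qed.

Definition small (tau t : R) : R := if t ^+ 2 <= tau ^+ 2 then 1 else 0.

Lemma measurable_small tau : measurable_fun setT (small tau).
Proof.
by apply: measurable_fun_ifT => //; apply: measurable_fun_ler; [exact: measurable_funX|exact: measurable_cst].
Qed.

(** On [{0, 1}] one has [expR s <= 1 + 3 s], as [e <= 4]. With the small ball probability [2 tau]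
    each exponential mean is at most [1 + 6 tau <= expR (6 tau)], and the threshold [8 n tau] leaves
    [2 n tau] in the exponent. *)
Lemma small_count tau i : 0 <= tau ->
  (P [set w | (8 * n%:R * tau <= \sum_j small tau ((x *m gmx w) i j))%R] <= (expR (- (2 * n%:R * tau)))%:E)%E.
Proof.
move=> t0; under eq_set do under eq_bigr do rewrite gmxE.
apply: le_trans (family_chernoff mf ind colB_disj (Y := fun j w => small tau (form i j w)) (a := 6 * tau) _ (index_enum_uniq _) _ _) _.
- by move=> j; apply: (measurableT_comp (measurable_small tau)); exact: mfun_form.
- move=> j.
  have ms : measurable_fun setT (fun w => (3 * small tau (form i j w))%:E).
    by apply/measurable_EFinP; apply: measurable_funM => //; apply: measurableT_comp (m_form i j); exact: measurable_small.
  have s0 w : 0 <= small tau (form i j w) by rewrite /small; case: ifP.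
  apply: le_trans (_ : \int[P]_w (1 + (3 * small tau (form i j w))%:E) <= _)%E.
    apply: ge0_le_integral => //.
    - apply/measurable_EFinP; apply: measurableT_comp => //; apply: measurableT_comp (m_form i j); exact: measurable_small.
    - by apply: emeasurable_funD => //.
    - move=> w _; rewrite lee_fin /small; case: ifP => _; last by rewrite mulr0 addr0 expR0.
      by rewrite mulr1 (_ : 1 + 3 = 4) ?expR1_le4//; lra.
  rewrite ge0_integralD//; last by move=> w _; rewrite lee_fin mulr_ge0.
  rewrite integral_cst//= probability_setT mule1.
  have -> : (\int[P]_w (3 * small tau (form i j w))%:E = 3%:E * P [set w | (form i j w ^+ 2 <= tau ^+ 2)%R])%E.
    have mA : measurable [set w | form i j w ^+ 2 <= tau ^+ 2].
      rewrite -[X in measurable X]setTI; apply: measurable_fun_ler => //; exact: measurable_funX.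
    rewrite -(@setIT _ [set w | _]) -integral_indic//.
    rewrite -ge0_integralZl//; last by apply/measurable_EFinP; exact: measurable_indic.
    apply: eq_integral => w _; rewrite -EFinM indicE /small; congr (3 * _)%:E.
    by case: ifP => h; [rewrite mem_set|rewrite memNset//= h].
  apply: le_trans (_ : 1 + 3%:E * (2 * tau)%:E <= _)%E.
    by rewrite leeD2l// lee_pmul2l// (small_ball mf ind (@injc j) (gwc j)).
  rewrite -EFinM -EFinD lee_fin; apply: le_trans (expR_ge1Dx _); lra.
by rewrite lee_fin ler_expR /index_enum -enumT size_enum_ord; lra.
Qed.

Definition act_total (A : 'M[R]_(N, n)) (u : 'I_N -> R) : R :=
  \sum_j \sum_k (\sum_i x i k * (A i j * u i)) ^+ 2.

Lemma act_formE (A : 'M[R]_(N, n)) u j : act_form x A u j = \sum_k (\sum_i x i k * (A i j * u i)) ^+ 2.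
Proof.
by apply: eq_bigr => k _; rewrite mxE; congr (_ ^+ 2); apply: eq_bigr => i _; rewrite !mxE.
Qed.

Lemma act_patternE w i j : act_pattern x (gmx w) i j = step (form i j w).
Proof. by rewrite mxE gmxE. Qed.

Local Notation hm := (half_mean R).
Local Notation hn := (he5_norm R).

Section ActivationForm.
Variables (B : R).
Hypothesis B0 : 0 < B.
Hypothesis xB : forall q : 'cV[R]_N, sqnorm (x^T *m q) <= B * sqnorm q.
Local Notation rho i k := (\sum_a x i a * x k a).
Hypothesis xrho : forall i k, i != k -> rho i k ^+ 4 * B <= 2^-1.
Variable u : 'I_N -> R.

Let A j k w := \sum_i x i k * (step (form i j w) * u i).

(** For [i != k] the product [u i * u k] is absorbed by the two squares and four powers of [rho] by
    [xrho]; the remaining [rho^2] is summed along a row by [gram_row_sum]. The off-diagonal part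
    thus costs at most half of the diagonal. *)
Lemma gram6_ge : 2^-1 * \sum_i u i ^+ 2 <= \sum_i \sum_k u i * u k * rho i k ^+ 6.
Proof.
have off i k : i != k -> - (4^-1 * (u i ^+ 2 + u k ^+ 2) * (rho i k ^+ 2 / B)) <= u i * u k * rho i k ^+ 6.
  move=> ik; have := xrho ik; rewrite -ler_pdivlMr// => h.
  have E : rho i k ^+ 6 = rho i k ^+ 2 * rho i k ^+ 4 by rewrite -exprD.
  have h2 : 0 <= rho i k ^+ 6 <= rho i k ^+ 2 * (2^-1 / B).
    by rewrite exprn_even_ge0//= E ler_wpM2l ?sqr_ge0.
  have h3 : - (2^-1 * (u i ^+ 2 + u k ^+ 2)) <= u i * u k by have := sqr_ge0 (u i + u k); rewrite sqrrD; lra.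
  have h4 : 0 <= 2^-1 * (u i ^+ 2 + u k ^+ 2) by rewrite mulr_ge0// addr_ge0 ?sqr_ge0.
  move/andP: h2 => [h5 h6].
  have -> : 4^-1 * (u i ^+ 2 + u k ^+ 2) * (rho i k ^+ 2 / B) = 2^-1 * (u i ^+ 2 + u k ^+ 2) * (rho i k ^+ 2 * (2^-1 / B)).
    by field; rewrite gt_eqF.
  apply: le_trans (_ : - (2^-1 * (u i ^+ 2 + u k ^+ 2)) * rho i k ^+ 6 <= _).
    by rewrite mulNr lerN2 ler_wpM2l.
  by rewrite ler_wpM2r.
have symS : \sum_i \sum_k u k ^+ 2 * rho i k ^+ 2 = \sum_i \sum_k u i ^+ 2 * rho i k ^+ 2.
  rewrite exchange_big; apply: eq_bigr => i _; apply: eq_bigr => k _; congr (_ * _ ^+ 2).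
  by apply: eq_bigr => a _; rewrite mulrC.
have rB : \sum_i \sum_k u i ^+ 2 * rho i k ^+ 2 <= B * \sum_i u i ^+ 2.
  rewrite mulr_sumr; apply: ler_sum => i _; rewrite -mulr_sumr mulrC ler_wpM2r ?sqr_ge0//.
  exact: gram_row_sum.
have lowd : \sum_i \sum_k ((k == i)%:R * u i ^+ 2 - 4^-1 * (u i ^+ 2 + u k ^+ 2) * (rho i k ^+ 2 / B)) <=
    \sum_i \sum_k u i * u k * rho i k ^+ 6.
  apply: ler_sum => i _; apply: ler_sum => k _; have [->|ki] := eqVneq k i.
    have -> : rho i i = 1 by rewrite -[RHS](x1 i); apply: eq_bigr => a _; rewrite expr2.
    rewrite !expr1n (mulr1 (u i * u i)) -expr2 [true%:R * _]mul1r gerBl !mulr_ge0 ?addr_ge0 ?sqr_ge0// ?invr_ge0// ltW//.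
  by rewrite mul0r add0r; apply: off; rewrite eq_sym.
apply: le_trans lowd.
have -> : \sum_i \sum_k ((k == i)%:R * u i ^+ 2 - 4^-1 * (u i ^+ 2 + u k ^+ 2) * (rho i k ^+ 2 / B)) =
   \sum_i u i ^+ 2 - (4 * B)^-1 * (\sum_i \sum_k u i ^+ 2 * rho i k ^+ 2 + \sum_i \sum_k u k ^+ 2 * rho i k ^+ 2).
  rewrite -big_split /= mulr_sumr -sumrB; apply: eq_bigr => i _.
  rewrite -big_split /= mulr_sumr sumrB; congr (_ - _).
    by rewrite (bigD1 i)//= eqxx mul1r big1 ?addr0// => k /negbTE ->; rewrite mul0r.
  by apply: eq_bigr => k _; field; rewrite gt_eqF.
rewrite symS; move: rB; set S := \sum_i \sum_k _; set T := \sum_i _ => rB.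
rewrite (_ : (4 * B)^-1 * (S + S) = S / (2 * B)); last by field; rewrite gt_eqF.
have : S / (2 * B) <= 2^-1 * T by rewrite ler_pdivrMr ?mulr_gt0//; lra.
lra.
Qed.

Let m_step i j : measurable_fun setT (fun w => step (form i j w)).
Proof. by apply: measurableT_comp (m_form i j); exact: measurable_step. Qed.

Let M_step i j : Mom P (fun w => step (form i j w)).
Proof.
apply: (@Mom_bounded _ _ _ _ _ 1) => // w.
by have /andP[h1 h2] := step01 (form i j w); rewrite ger0_norm.
Qed.

Let M_he i j : Mom P (fun w => he5 (form i j w)).
Proof.
rewrite /he5; apply: MomD; last exact: MomZ.
by apply: MomB; [exact: MomX|apply: MomZ; exact: MomX].
Qed.

Lemma he5_norm_gt0 : 0 < hn.
Proof.
rewrite lt_neqAle eq_sym; apply/andP; split; last by apply: Ex_ge0 => t; exact: sqr_ge0.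
apply/eqP => h0; have := Ex_cauchy (Mom_step R) (Mom_he5 R); rewrite step_he5 -/hn h0 mulr0.
by have := half_mean_ge R => h; rewrite leNgt exprn_gt0//; lra.
Qed.

Let Mom_A j k : Mom P (A j k).
Proof. by apply: Mom_sum => i _; apply: MomZ; under eq_fun do rewrite mulrC; exact: MomZ. Qed.

(* Duality: with V = sum_k u_k x_k he5 (x_k . w), expand Ex |A - V / hn|^2 >= 0; both Ex <A, V> and Ex |V|^2 are multiples of the form of gram6_ge. *)
Lemma act_form_mean j : (2 * hn)^-1 * \sum_i u i ^+ 2 <= Ex P (fun w => \sum_k A j k w ^+ 2).
Proof.
have hn0 := he5_norm_gt0; have hm3 := half_mean_ge R.
pose V k w := \sum_i x i k * (he5 (form i j w) * u i).
pose Q := \sum_i \sum_k u i * u k * rho i k ^+ 6.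
have MV k : Mom P (V k).
  by apply: Mom_sum => i _; apply: MomZ; under eq_fun do rewrite mulrC; exact: MomZ.
have prodE (F G : R -> R) w : \sum_k (\sum_i x i k * (F (form i j w) * u i)) * (\sum_i x i k * (G (form i j w) * u i)) =
    \sum_i \sum_l (u i * u l * rho i l) * (F (form i j w) * G (form l j w)).
  transitivity (\sum_k \sum_i \sum_l (x i k * (F (form i j w) * u i)) * (x l k * (G (form l j w) * u l))).
    by apply: eq_bigr => k _; rewrite mulr_suml; apply: eq_bigr => i _; rewrite mulr_sumr.
  rewrite exchange_big; apply: eq_bigr => i _; rewrite exchange_big; apply: eq_bigr => l _.
  by rewrite mulr_sumr mulr_suml; apply: eq_bigr => a _; ring.
have ExM (F G : R -> R) (c : R) : (forall i, Mom P (fun w => F (form i j w))) -> (forall i, Mom P (fun w => G (form i j w))) ->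
    (forall i l, Ex P (fun w => F (form i j w) * G (form l j w)) = c * rho i l ^+ 5) ->
    Ex P (fun w => \sum_k (\sum_i x i k * (F (form i j w) * u i)) * (\sum_i x i k * (G (form i j w) * u i))) = c * Q.
  move=> MF MG FG; rewrite (@Ex_eq _ _ _ P _ _ (prodE F G)) Ex_sum; last first.
    by move=> i _; apply: Mom_sum => l _; apply: MomZ; exact: MomM.
  rewrite mulr_sumr; apply: eq_bigr => i _; rewrite Ex_sum; last by move=> l _; apply: MomZ; exact: MomM.
  rewrite mulr_sumr; apply: eq_bigr => l _; rewrite ExZ; last exact: MomM.
  by rewrite FG; ring.
have AV : Ex P (fun w => \sum_k A j k w * V k w) = 3 * hm * Q.
  apply: (ExM (@step R) (@he5 R)) => // i l.
  exact: (Ex_step_he5 mf ind (@injc j) (gwc j) (x1 i) (x1 l)).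
have VV : Ex P (fun w => \sum_k V k w * V k w) = hn * Q.
  apply: (ExM (@he5 R) (@he5 R)) => // i l.
  exact: (Ex_he5_he5 mf ind (@injc j) (gwc j) (x1 i) (x1 l)).
have MA2 : Mom P (fun w => \sum_k A j k w ^+ 2) by apply: Mom_sum => k _; exact: MomX.
have MAV : Mom P (fun w => \sum_k A j k w * V k w) by apply: Mom_sum => k _; exact: MomM.
have MVV : Mom P (fun w => \sum_k V k w * V k w) by apply: Mom_sum => k _; exact: MomM.
have : 0 <= Ex P (fun w => \sum_k A j k w ^+ 2 + ((- (2 / hn)) * \sum_k A j k w * V k w + (hn ^+ 2)^-1 * \sum_k V k w * V k w)).
  apply: Ex_ge0 => w; rewrite !mulr_sumr -!big_split /=; apply: sumr_ge0 => k _.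
  have -> : A j k w ^+ 2 + (- (2 / hn) * (A j k w * V k w) + (hn ^+ 2)^-1 * (V k w * V k w)) = (A j k w - V k w / hn) ^+ 2.
    by field; rewrite gt_eqF.
  exact: sqr_ge0.
rewrite ExD//; last by apply: MomD; exact: MomZ.
rewrite ExD; [|exact: MomZ|exact: MomZ]; rewrite !ExZ// AV VV.
have Q1 := gram6_ge; rewrite -/Q in Q1.
have Q0 : 0 <= Q by apply: le_trans Q1; rewrite mulr_ge0// sumr_ge0// => i _; exact: sqr_ge0.
(* The bound [half_mean >= 1 / 3] is exactly what makes the factor [6 hm - 1] at least 1. *)
have -> : - (2 / hn) * (3 * hm * Q) + (hn ^+ 2)^-1 * (hn * Q) = - ((6 * hm - 1) * (Q / hn)) by field; rewrite gt_eqF.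
have Qn : 0 <= Q / hn by rewrite divr_ge0// ltW.
have : Q / hn <= (6 * hm - 1) * (Q / hn) by rewrite ler_peMl//; lra.
have : 2^-1 * (\sum_i u i ^+ 2) / hn <= Q / hn by rewrite ler_pM2r ?invr_gt0.
rewrite (_ : (2 * hn)^-1 * \sum_i u i ^+ 2 = 2^-1 * (\sum_i u i ^+ 2) / hn); last by field; rewrite gt_eqF.
lra.
Qed.

Lemma act_totalE w : act_total (act_pattern x (gmx w)) u = \sum_j \sum_k A j k w ^+ 2.
Proof.
by apply: eq_bigr => j _; apply: eq_bigr => k _; congr (_ ^+ 2); apply: eq_bigr => i _; rewrite act_patternE.
Qed.

Let A_ub j w : \sum_k A j k w ^+ 2 <= B * \sum_i u i ^+ 2.
Proof.
have := act_form_ub (A := act_pattern x (gmx w)) xB _ (ltW B0) u j; rewrite act_formE.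
under eq_bigr do under eq_bigr do rewrite act_patternE.
by apply=> i k; rewrite act_patternE step01.
Qed.

(** Divided by the pointwise bound [B S], each column contributes a variable in [[0, 1]] whose mean
    is at least [(2 hn)^-1 / B]. Passing to [expR (- Z)] halves the exponent, and the threshold at a
    quarter of the mean bound takes half of what remains. *)
Lemma act_total_lower_tail : 0 < \sum_i u i ^+ 2 ->
  (P [set w | (act_total (act_pattern x (gmx w)) u <= n%:R * (2 * hn)^-1 / 4 * \sum_i u i ^+ 2)%R] <=
   (expR (- (n%:R * (2 * hn)^-1 / (4 * B))))%:E)%E.
Proof.
set S := \sum_i u i ^+ 2 => S0; set ka := (2 * hn)^-1.
have BS : 0 < B * S by rewrite mulr_gt0.
pose Z j w := (\sum_k A j k w ^+ 2) / (B * S).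
have Z01 j w : 0 <= Z j w <= 1.
  rewrite /Z ler_pdivrMr// mul1r A_ub divr_ge0 ?(ltW BS)//.
  by apply: sumr_ge0 => k _; exact: sqr_ge0.
have mfA j k : mfun_wrt (block f (colB j)) (A j k).
  apply: measurable_sum => i; apply: measurable_funM => //; apply: measurable_funM => //.
  by apply: measurableT_comp; [exact: measurable_step|exact: mfun_form].
have mfZ j : mfun_wrt (block f (colB j)) (Z j).
  by apply: measurable_funM => //; apply: measurable_sum => k; apply: measurable_funX; exact: mfA.
have MZ' j : Mom P (Z j).
  apply: (@Mom_bounded _ _ _ _ _ 1); first exact: mfun_measurable (mfZ j).
  by move=> w; have /andP[h1 h2] := Z01 j w; rewrite ger0_norm.
rewrite [X in P X](_ : _ = [set w | - (n%:R * ka / (4 * B)) <= \sum_j - Z j w]); last first.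
  apply: eq_set => w; rewrite act_totalE sumrN lerN2.
  have -> : \sum_j Z j w = (\sum_j \sum_k A j k w ^+ 2) / (B * S) by rewrite mulr_suml.
  have E : n%:R * ka / (4 * B) * (B * S) = n%:R * ka / 4 * S by field; rewrite gt_eqF.
  by rewrite ler_pdivrMr// E.
apply: le_trans (family_chernoff mf ind colB_disj (Y := fun j w => - Z j w) (a := - (ka / (2 * B))) _ (index_enum_uniq _) _ _) _.
- by move=> j; apply: measurableT_comp (mfZ j).
- move=> j.
  have Me : Mom P (fun w => expR (- Z j w)).
    apply: (@Mom_bounded _ _ _ _ _ 1).
      apply: measurableT_comp => //; apply: measurableT_comp => //; exact: Mom_measurable (MZ' j).
    by move=> w; have /andP[h1 h2] := Z01 j w; rewrite ger0_norm ?expR_ge0// -expR0 ler_expR oppr_le0.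
  rewrite -ExE// lee_fin; apply: le_trans (_ : Ex P (fun w => 1 + (- 2^-1) * Z j w) <= _).
    apply: Ex_le => //; first by apply: MomD; [exact: Mom_cst|exact: MomZ].
    by move=> w; apply: le_trans (expRN_le (Z01 j w)) _; lra.
  rewrite ExD; [|exact: Mom_cst|exact: MomZ]; rewrite Ex_cst ExZ//.
  apply: le_trans (expR_ge1Dx _); rewrite lerD2l mulNr lerN2.
  have := act_form_mean j; rewrite -/ka -/S => h.
  rewrite (@Ex_eq _ _ _ P (Z j) (fun w => (B * S)^-1 * \sum_k A j k w ^+ 2)); last by move=> w; rewrite mulrC.
  rewrite ExZ; last by apply: Mom_sum => k _; exact: MomX.
  rewrite (_ : ka / (2 * B) = 2^-1 * ((B * S)^-1 * (ka * S))); last by field; rewrite !gt_eqF.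
  by rewrite ler_wpM2l// ler_wpM2l// invr_ge0 ltW.
rewrite lee_fin ler_expR /index_enum -enumT size_enum_ord.
by rewrite le_eqVlt; apply/orP; left; apply/eqP; field; rewrite gt_eqF.
Qed.

End ActivationForm.

Definition relu_var : R := Ex (@gauss R) (fun t : R => (relu t - hm) ^+ 2).
Definition relu_m4 : R := Ex (@gauss R) (fun t : R => (relu t - hm) ^+ 4).

Definition out_norm (v : 'cV[R]_n) (z : 'M[R]_(N, n)) : R := \sum_i (\sum_j v j 0 * relu (z i j)) ^+ 2.

(** The entries of [v] sum to zero, so the mean of [relu] can be subtracted and each output is a sum
    of centred independent terms. Chebyshev's inequality applies to the squared norm of the outputs;
    its variance comes from correlations between samples, whose squares sum to at most [B] along a
    row, and from the fourth moment of a single neuron. *)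
Lemma out_norm_tail (B a : R) (v : 'cV[R]_n) : (0 < N)%N -> (0 < n)%N -> 0 < a ->
  (forall q : 'cV[R]_N, sqnorm (x^T *m q) <= B * sqnorm q) ->
  (forall j, v j 0 ^+ 2 = a ^+ 2) -> \sum_j v j 0 = 0 ->
  (P [set w | (N%:R * (a ^+ 2 * n%:R) * (relu_var + 1) <= out_norm v (x *m gmx w))%R] <=
   (2 * relu_cov_cst R ^+ 2 * B / N%:R + relu_m4 / n%:R)%:E)%E.
Proof.
move=> N0 n0 a0 xB va v0.
have NR : 0 < N%:R :> R by rewrite ltr0n.
have nR : 0 < n%:R :> R by rewrite ltr0n.
pose U i j w := v j 0 * (relu (form i j w) - hm).
pose S i w := \sum_j U i j w.
have outE w : out_norm v (x *m gmx w) = \sum_i S i w ^+ 2.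
  apply: eq_bigr => i _; congr (_ ^+ 2); rewrite /S /U.
  under [RHS]eq_bigr do rewrite mulrBr.
  by rewrite sumrB -mulr_suml v0 mul0r subr0; apply: eq_bigr => j _; rewrite gmxE.
have mU i j : mfun_wrt (block f (colB j)) (U i j).
  apply: measurable_funM => //; apply: measurable_funB => //.
  by apply: measurableT_comp; [exact: measurable_relu|exact: mfun_form].
have MU i j : Mom P (U i j).
  by apply: MomZ; apply: MomB; [apply: Mom_relu|exact: Mom_cst].
have MS i : Mom P (S i) by apply: Mom_sum => j _; exact: MU.
have mrelu k : measurable_fun setT (fun t : R => (relu t - hm) ^+ k).
  by apply: measurable_funX; apply: measurable_funB => //; exact: measurable_relu.
have U0 i j : Ex P (U i j) = 0.
  rewrite ExZ; last by apply: MomB; [apply: Mom_relu|exact: Mom_cst].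
  rewrite ExB; [|exact: Mom_relu|exact: Mom_cst].
  have := Ex_unit_form mf ind (@injc j) (gwc j) (x1 i) (@measurable_relu R).
  by rewrite Ex_relu Ex_cst => ->; rewrite subrr mulr0.
have U2 i j : Ex P (fun w => U i j w ^+ 2) = a ^+ 2 * relu_var.
  rewrite (@Ex_eq _ _ _ P _ (fun w => a ^+ 2 * (relu (form i j w) - hm) ^+ 2)); last by move=> w; rewrite exprMn va.
  rewrite ExZ; last by apply: MomX; apply: MomB; [apply: Mom_relu|exact: Mom_cst].
  congr (_ * _); exact: (Ex_unit_form mf ind (@injc j) (gwc j) (x1 i) (mrelu 2)).
have U4 i j : Ex P (fun w => U i j w ^+ 4) = a ^+ 4 * relu_m4.
  rewrite (@Ex_eq _ _ _ P _ (fun w => a ^+ 4 * (relu (form i j w) - hm) ^+ 4)); last first.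
    by move=> w; rewrite exprMn; congr (_ * _); rewrite -[4%N]/(2 * 2)%N !exprM va.
  rewrite ExZ; last by apply: MomX; apply: MomB; [apply: Mom_relu|exact: Mom_cst].
  congr (_ * _); exact: (Ex_unit_form mf ind (@injc j) (gwc j) (x1 i) (mrelu 4)).
have U22 i l j : Ex P (fun w => U i j w ^+ 2 * U l j w ^+ 2) <= a ^+ 4 * relu_m4.
  apply: le_trans (_ : Ex P (fun w => 2^-1 * U i j w ^+ 4 + 2^-1 * U l j w ^+ 4) <= _).
    apply: Ex_le; first by apply: MomM; exact: MomX.
      by apply: MomD; apply: MomZ; exact: MomX.
    move=> w; have := sqr_ge0 (U i j w ^+ 2 - U l j w ^+ 2); rewrite sqrrB -!exprM; lra.
  rewrite ExD; [|by apply: MomZ; exact: MomX|by apply: MomZ; exact: MomX].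
  rewrite !ExZ; [|exact: MomX|exact: MomX]; rewrite !U4; lra.
have UV i l j : `|Ex P (fun w => U i j w * U l j w)| <= a ^+ 2 * (relu_cov_cst R * `|\sum_k x i k * x l k|).
  rewrite (@Ex_eq _ _ _ P _ (fun w => a ^+ 2 * ((relu (form i j w) - hm) * (relu (form l j w) - hm)))); last first.
    by move=> w; rewrite -(va j) /U; ring.
  rewrite ExZ; last by apply: MomM; apply: MomB; [exact: Mom_relu|exact: Mom_cst|exact: Mom_relu|exact: Mom_cst].
  rewrite normrM ger0_norm ?sqr_ge0// ler_wpM2l ?sqr_ge0//.
  exact: (relu_cov mf ind (@injc j) (gwc j) (x1 i) (x1 l)).
pose b := a ^+ 2 * n%:R; have b0 : 0 < b by rewrite mulr_gt0// exprn_gt0.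
have szE : size (index_enum 'I_n) = n by rewrite /index_enum -enumT size_enum_ord.
have key i l := pair_fourth_moment mf ind colB_disj (index_enum_uniq 'I_n) (mU i) (mU l) (MU i) (MU l) (U0 i) (U0 l) (U2 i) (U2 l) (UV i l) (U22 i l).
rewrite szE in key.
pose Z w := \sum_i S i w ^+ 2.
have MZ' : Mom P Z by apply: Mom_sum => i _; exact: MomX.
have EZ : Ex P Z = N%:R * (b * relu_var).
  rewrite Ex_sum; last by move=> i _; exact: MomX.
  rewrite (eq_bigr (fun=> b * relu_var)); first by rewrite sumr_const card_ord mulr_natl.
  by move=> i _; have [_ ->] := key i i; rewrite /b; ring.
have EZ2 : Ex P (fun w => Z w ^+ 2) <= (N%:R * (b * relu_var)) ^+ 2 + 2 * b ^+ 2 * relu_cov_cst R ^+ 2 * (N%:R * B) + N%:R ^+ 2 * b ^+ 2 * (relu_m4 / n%:R).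
  rewrite (@Ex_eq _ _ _ P _ (fun w => \sum_i \sum_l S i w ^+ 2 * S l w ^+ 2)); last first.
    by move=> w; rewrite expr2 mulr_suml; apply: eq_bigr => i _; rewrite mulr_sumr.
  rewrite Ex_sum; last by move=> i _; apply: Mom_sum => l _; apply: MomM; exact: MomX.
  apply: le_trans (_ : \sum_(i < N) (N%:R * (b * relu_var) ^+ 2 + 2 * b ^+ 2 * relu_cov_cst R ^+ 2 * B + N%:R * b ^+ 2 * (relu_m4 / n%:R)) <= _); last first.
    rewrite sumr_const card_ord -[leLHS]mulr_natl le_eqVlt; apply/orP; left; apply/eqP; ring.
  apply: ler_sum => i _; rewrite Ex_sum; last by move=> l _; apply: MomM; exact: MomX.
  apply: le_trans (_ : \sum_(l < N) ((b * relu_var) ^+ 2 + 2 * b ^+ 2 * relu_cov_cst R ^+ 2 * (\sum_k x i k * x l k) ^+ 2 + b ^+ 2 * (relu_m4 / n%:R)) <= _).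
    apply: ler_sum => l _; have [h _] := key i l; apply: le_trans h _.
    rewrite -[X in _ <= _ + _ * X + _](real_normK (num_real _)).
    rewrite le_eqVlt; apply/orP; left; apply/eqP; rewrite /b; field; rewrite gt_eqF//.
  have spl (c1 c2 c3 : R) (F : 'I_N -> R) : \sum_l (c1 + c2 * F l + c3) = N%:R * c1 + c2 * (\sum_l F l) + N%:R * c3.
    by rewrite big_split big_split /= -mulr_sumr !sumr_const card_ord !mulr_natl.
  rewrite spl -[X in _ <= _ + X]mulrA lerD2r lerD2l ler_wpM2l ?gram_row_sum//.
  by apply: mulr_ge0; [apply: mulr_ge0 => //; exact: sqr_ge0|exact: sqr_ge0].
have MC : Mom P (fun w => Z w - N%:R * (b * relu_var)) by apply: MomB => //; exact: Mom_cst.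
have VZ : Ex P (fun w => (Z w - N%:R * (b * relu_var)) ^+ 2) <= 2 * b ^+ 2 * relu_cov_cst R ^+ 2 * (N%:R * B) + N%:R ^+ 2 * b ^+ 2 * (relu_m4 / n%:R).
  rewrite (@Ex_eq _ _ _ P _ (fun w => Z w ^+ 2 + ((- 2 * (N%:R * (b * relu_var))) * Z w + (N%:R * (b * relu_var)) ^+ 2))); last first.
    by move=> w; ring.
  rewrite ExD; [|exact: MomX|by apply: MomD; [exact: MomZ|exact: Mom_cst]].
  rewrite ExD; [|exact: MomZ|exact: Mom_cst]; rewrite ExZ// Ex_cst EZ.
  move: EZ2; lra.
have Nb : 0 < (N%:R * b) ^+ 2 by rewrite exprn_gt0// mulr_gt0.
apply: le_trans (_ : P [set w | ((N%:R * b) ^+ 2 <= (Z w - N%:R * (b * relu_var)) ^+ 2)%R] <= _)%E.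
  apply: le_measure; rewrite ?inE.
  - rewrite -[X in measurable X]setTI; apply: measurable_fun_ler => //.
    by under eq_fun do rewrite outE; exact: Mom_measurable MZ'.
  - rewrite -[X in measurable X]setTI; apply: measurable_fun_ler => //.
    exact: Mom_measurable (MomX 2 MC).
  move=> w /=; rewrite outE -/(Z w) -/b mulrDr mulr1 => h.
  have h0 : 0 <= N%:R * b by rewrite mulr_ge0// ltW.
  have h1 : N%:R * b <= Z w - N%:R * (b * relu_var) by lra.
  by rewrite lerXn2r ?nnegrE//; exact: le_trans h1.
apply: le_trans (Ex_markov (MomX 2 MC) (fun w => sqr_ge0 _) Nb) _.
rewrite lee_fin ler_pdivrMr//; apply: le_trans VZ _.
by rewrite le_eqVlt; apply/orP; left; apply/eqP; field; rewrite !gt_eqF.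
Qed.

End Columns.

(** * The random network *)

Section FiniteUnions.
Context (R : realType).

Lemma fin_exists_cons (T : Type) (J : eqType) j (s : seq J) (F : J -> set T) :
  [set w | exists2 i, i \in j :: s & F i w] = F j `|` [set w | exists2 i, i \in s & F i w].
Proof.
apply/seteqP; split=> w /= [].
  by move=> i; rewrite inE => /orP[/eqP -> ?|? ?]; [left|right; exists i].
  by move=> ?; exists j => //; rewrite mem_head.
by move=> [i i_s Fi]; exists i => //; rewrite inE i_s orbT.
Qed.

Lemma fin_exists_nil (T : Type) (J : eqType) (F : J -> set T) :
  [set w | exists2 i, i \in (nil : seq J) & F i w] = set0.
Proof. by apply/seteqP; split=> w // [i]; rewrite in_nil. Qed.

Lemma fin_exists_measurable d (T : measurableType d) (J : eqType) (s : seq J) (F : J -> set T) :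
  (forall j, measurable (F j)) -> measurable [set w | exists2 j, j \in s & F j w].
Proof.
move=> mF; elim: s => [|j s IH]; first by rewrite fin_exists_nil; exact: measurable0.
by rewrite fin_exists_cons; exact: measurableU.
Qed.

Lemma fin_exists_prob d (T : measurableType d) (P : probability T R) (J : eqType) (s : seq J) (F : J -> set T) (e : R) :
  (forall j, measurable (F j)) -> (forall j, j \in s -> (P (F j) <= e%:E)%E) ->
  (P [set w | exists2 j, j \in s & F j w] <= ((size s)%:R * e)%:E)%E.
Proof.
move=> mF; elim: s => [|j s IH] Fe; first by rewrite fin_exists_nil measure0 mul0r.
rewrite fin_exists_cons; apply: le_trans (measureU2 _ _ _) _ => //; first exact: fin_exists_measurable.
rewrite (_ : (size (j :: s))%:R * e = e + (size s)%:R * e); last by rewrite /= -natr1; ring.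
rewrite EFinD; apply: leeD; first by apply: Fe; rewrite mem_head.
by apply: IH => i i_s; apply: Fe; rewrite inE i_s orbT.
Qed.

End FiniteUnions.

Section EventMeasurability.
Context d (T : measurableType d) (R : realType) (N D n : nat).
Variables (X : T -> 'M[R]_(N, D)) (W : T -> 'M[R]_(D, n)).
Hypothesis mX : forall i k, measurable_fun setT (fun t => X t i k).
Hypothesis mW : forall k j, measurable_fun setT (fun t => W t k j).

Lemma measurable_set_le (F G : T -> R) : measurable_fun setT F -> measurable_fun setT G ->
  measurable [set t | F t <= G t].
Proof. by move=> mF mG; rewrite -[X in measurable X]setTI; exact: measurable_fun_ler. Qed.

Lemma measurable_preact i j : measurable_fun setT (fun t => (X t *m W t) i j).
Proof. by under eq_fun do rewrite mxE; apply: measurable_sum => k; exact: measurable_funM. Qed.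

Lemma measurable_small_sum tau i : measurable_fun setT (fun t => \sum_j small tau ((X t *m W t) i j)).
Proof. by apply: measurable_sum => j; apply: measurableT_comp (measurable_preact i j); exact: measurable_small. Qed.

Lemma measurable_act_total u : measurable_fun setT (fun t => act_total (X t) (act_pattern (X t) (W t)) u).
Proof.
apply: measurable_sum => j; apply: measurable_sum => k; apply: measurable_funX; apply: measurable_sum => i.
apply: measurable_funM => //; apply: measurable_funM => //.
under eq_fun do rewrite mxE.
exact: (measurableT_comp (@measurable_step R) (measurable_preact i j)).
Qed.

Lemma measurable_out_norm v : measurable_fun setT (fun t => out_norm v (X t *m W t)).
Proof.
apply: measurable_sum => i; apply: measurable_funX; apply: measurable_sum => j; apply: measurable_funM => //.
exact: (measurableT_comp (@measurable_relu R) (measurable_preact i j)).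
Qed.

End EventMeasurability.

(** * The random model and the events of the data *)

Section Model.
Context d (Om : measurableType d) (R : realType) (P : probability Om R) (N D n : nat).
Variables (X : Om -> 'M[R]_(N, D)) (W0 : Om -> 'M[R]_(D, n)).
Hypotheses (N0 : (0 < N)%N) (D0 : (0 < D)%N) (n0 : (0 < n)%N).
Hypothesis uX : forall i, uniform_sphere P (fun w => row i (X w)).
Hypothesis gW : forall a b, std_gaussian P (fun w => W0 w a b).

(** All families share the index type ['I_D], so a Gaussian entry is a constant family; [j0] picks
    one of its copies. *)
Definition entries (k : ('I_N + 'I_D * 'I_n)%type) (j : 'I_D) (w : Om) : R :=
  match k with inl i => X w i j | inr ab => W0 w ab.1 ab.2 end.

Hypothesis ind : @mutually_independent R d Om P _ (fun=> 'I_D) entries.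

Local Notation f := (entries : forall k : ('I_N + 'I_D * 'I_n)%type, (fun=> ('I_D : finType)) k -> Om -> R).

Let j0 : 'I_D := Ordinal D0.

Lemma X_measurable i k : measurable_fun setT (fun w => X w i k).
Proof. by have [m _] := uX i; have := m k; under eq_fun do rewrite mxE. Qed.

Lemma entries_measurable k j : measurable_fun setT (f k j).
Proof. by case: k j => [i|p] j /=; [exact: X_measurable|case: (gW p.1 p.2)]. Qed.

Local Notation mf := entries_measurable.
Local Notation g := (fun p : 'I_D * 'I_n => inr p : ('I_N + 'I_D * 'I_n)%type).
Local Notation idx := (fun p : 'I_D * 'I_n => j0).

Lemma inr_inj : injective g. Proof. by move=> p q []. Qed.

Lemma gW' p : std_gaussian P (f (g p) j0). Proof. exact: gW. Qed.

Lemma gmx_entries w : gmx (R := R) f (g := g) idx w = W0 w.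
Proof. by apply/matrixP => k j; rewrite mxE. Qed.

Definition rowblock : {set 'I_N + 'I_D * 'I_n} := [set k | if k is inl _ then true else false]%SET.
Definition colblock : {set 'I_N + 'I_D * 'I_n} := [set k | if k is inr _ then true else false]%SET.

Lemma mfun_X i k : mfun_wrt (block f rowblock) (fun w => X w i k).
Proof. by apply: (@mfun_block _ _ _ _ _ f rowblock (inl i) k); rewrite inE. Qed.

Lemma mfun_W k j : mfun_wrt (block f colblock) (fun w => W0 w k j).
Proof. by apply: (@mfun_block _ _ _ _ _ f colblock (inr (k, j)) j0); rewrite inE. Qed.

Definition unit_rows w := forall i, \sum_k X w i k ^+ 2 = 1.

Lemma unit_rows_block : <<s block f rowblock >> [set w | unit_rows w].
Proof.
pose T := g_sigma_algebraType (block f rowblock).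
have m i : measurable ([set w | \sum_k X w i k ^+ 2 = 1] : set T).
  rewrite -[X in measurable X]setTI; have := @measurable_sum _ T R setT 'I_D (index_enum _) (fun k w => X w i k ^+ 2).
  move=> /(_ (fun k => measurable_funX 2 (mfun_X i k))) /(_ measurableT [set 1]); exact.
have -> : [set w | unit_rows w] = ~` [set w : T | exists2 i, i \in enum 'I_N & (~` [set w : T | \sum_k X w i k ^+ 2 = 1]) w].
  apply/seteqP; split=> w /= H; first by move=> [i _]; apply; exact: H.
  by move=> i; apply: contrapT => h; apply: H; exists i => //; rewrite mem_enum.
by apply: (@measurableC _ T); apply: fin_exists_measurable => i; exact: measurableC.
Qed.

Lemma unit_rows_null : P (~` [set w | unit_rows w]) = 0%E.
Proof.
apply/eqP; rewrite eq_le measure_ge0 andbT.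
have -> : ~` [set w | unit_rows w] = [set w | exists2 i, i \in enum 'I_N & (~` [set w | \sum_k (row i (X w)) ord0 k ^+ 2 = 1]) w].
  apply/seteqP; split=> w /= H.
    apply: contrapT => H2; apply: H => i; apply: contrapT => h; apply: H2; exists i; first by rewrite mem_enum.
    by under eq_bigr do rewrite mxE.
  by move: H => [i _ h] h2; apply: h; under eq_bigr do rewrite mxE; exact: h2.
apply: le_trans (@fin_exists_prob _ _ _ P _ (enum 'I_N) (fun i => ~` [set w | \sum_k (row i (X w)) ord0 k ^+ 2 = 1]) 0 _ _) _.
- by move=> i; apply: measurableC; exact: (sphere_unit_set (uX i)).
- by move=> i _; rewrite (sphere_null (uX i)).
- by rewrite mulr0.
Qed.

Lemma sphere_exp_sqr_le i u : \sum_k u k ^+ 2 <= 1 ->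
  (\int[P]_w (expR (D%:R / 4 * (\sum_k X w i k * u k) ^+ 2))%:E <= (Num.sqrt 2)%:E)%E.
Proof.
move=> u1.
pose e k : R := (k == j0)%:R.
have e1 : \sum_k e k ^+ 2 = 1.
  rewrite (bigD1 j0)//= big1 /e ?eqxx ?expr1n ?addr0// => k /negbTE ->; exact: expr0n.
have b : n%:R = n%:R :> R by [].
pose jn : 'I_n := Ordinal n0.
(* A column of [W0] supplies the auxiliary Gaussian vector. *)
have H := @sphere_exp_sqr _ _ _ P _ _ f mf ind D (fun k => g (k, jn)) (fun=> j0) _ _ _ (uX i) e e1.
apply: le_trans (H _ _); last 2 first.
- by move=> a c [].
- by move=> k; exact: gW.
have m_exp (c : R) : measurable_fun setT (fun t : R => (expR (c * t ^+ 2))%:E).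
  by apply/measurable_EFinP; apply: measurableT_comp => //; apply: measurable_funM => //; exact: measurable_funX.
have E w : \sum_k X w i k * u k = sdot (fun w => row i (X w)) u w.
  by apply: eq_bigr => k _; rewrite mxE.
under eq_integral do rewrite E.
rewrite (sphere_scaled_law (uX i) u (F := fun t => (expR (D%:R / 4 * t ^+ 2))%:E) e1)//.
have mc c : measurable_fun setT (fun w => (expR (D%:R / 4 * (c * sdot (fun w => row i (X w)) e w) ^+ 2))%:E).
  apply: (measurableT_comp (m_exp (D%:R / 4))); apply: measurable_funM => //; exact: measurable_sdot (uX i) e.
apply: ge0_le_integral => //.
  by have := mc 1; under eq_fun do rewrite mul1r.
move=> w _; rewrite lee_fin ler_expR ler_wpM2l ?divr_ge0// exprMn sqr_sqrtr; last first.
  by apply: sumr_ge0 => k _; exact: sqr_ge0.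
by rewrite ler_piMl// sqr_ge0.
Qed.

Lemma sqrt2_le2 : Num.sqrt 2 <= 2 :> R.
Proof.
have s0 : 0 <= Num.sqrt 2 :> R by [].
have s2 : Num.sqrt 2 ^+ 2 = 2 :> R by rewrite sqr_sqrtr.
by rewrite leNgt; apply/negP => h; nra.
Qed.

Lemma sqrt2_le : Num.sqrt 2 <= expR 1 :> R.
Proof.
apply: le_trans (_ : 2 <= _); last by have := expR_ge1Dx (1 : R); lra.
exact: sqrt2_le2.
Qed.

Lemma norm_net_tail (t : R) (u : 'I_D -> R) : \sum_k u k ^+ 2 <= 1 ->
  (P [set w | (4 * t / D%:R <= \sum_i (\sum_k X w i k * u k) ^+ 2)%R] <= (expR (N%:R - t))%:E)%E.
Proof.
move=> u1; have DR : 0 < D%:R :> R by rewrite ltr0n.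
pose Y i w := D%:R / 4 * (\sum_k X w i k * u k) ^+ 2.
rewrite [X in P X](_ : _ = [set w | t <= \sum_i Y i w]); last first.
  apply: eq_set => w; rewrite -mulr_sumr ler_pdivrMr// (_ : D%:R / 4 * _ = (\sum_i (\sum_k X w i k * u k) ^+ 2) * D%:R / 4).
    by rewrite ler_pdivlMr// mulrC.
  by field.
have dis : forall i j : 'I_N, i != j -> forall k, k \in [set inl i : ('I_N + 'I_D * 'I_n)%type]%SET -> k \notin [set inl j : ('I_N + 'I_D * 'I_n)%type]%SET.
  by move=> i j ij k; rewrite !inE => /eqP ->; apply: contra ij => /eqP[->].
apply: le_trans (family_chernoff mf ind (A := fun i : 'I_N => [set inl i]%SET) dis (Y := Y) (a := 1) t (index_enum_uniq _) _ _) _.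
- move=> i; apply: measurable_funM => //; apply: measurable_funX; apply: measurable_sum => k; apply: measurable_funM => //.
  by apply: (@mfun_block _ _ _ _ _ f [set inl i]%SET (inl i) k); rewrite inE.
- by move=> i; apply: le_trans (sphere_exp_sqr_le i u1) _; rewrite lee_fin sqrt2_le.
by rewrite /index_enum -enumT size_enum_ord mulr1.
Qed.

(** Row [k] is fixed first: when it has norm 1, the inner product is a fixed linear form of the
    independent row [i], and the exponential moment of its square applies. *)
Lemma corr_tail (e : R) (i k : 'I_N) : i != k ->
  (P [set w | (unit_rows w) /\ (e <= (\sum_a X w i a * X w k a) ^+ 2)%R] <= (2 * expR (- (D%:R * e / 4)))%:E)%E.
Proof.
move=> ik; have DR : 0 < D%:R :> R by rewrite ltr0n.
pose Ak : {set 'I_N + 'I_D * 'I_n} := [set inl k]%SET; pose Ai : {set 'I_N + 'I_D * 'I_n} := [set inl i]%SET.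
pose Tk := g_sigma_algebraType (block f Ak); pose Ti := g_sigma_algebraType (block f Ai).
have mk a : measurable_fun (setT : set Tk) (fun w => X w k a).
  by apply: (@mfun_block _ _ _ _ _ f Ak (inl k) a); rewrite inE.
have mi a : measurable_fun (setT : set Ti) (fun w => X w i a).
  by apply: (@mfun_block _ _ _ _ _ f Ai (inl i) a); rewrite inE.
pose Dk : set (Tk * Ti) := [set z | e <= (\sum_a X z.2 i a * X z.1 k a) ^+ 2].
pose gk : set Om := [set w | \sum_a X w k a ^+ 2 = 1].
have mDk : measurable Dk.
  rewrite -[X in measurable X]setTI; apply: measurable_fun_ler => //; apply: measurable_funX.
  apply: measurable_sum => a; apply: measurable_funM.
    exact: (measurableT_comp (mi a) (@measurable_snd _ _ Tk Ti)).
  exact: (measurableT_comp (mk a) (@measurable_fst _ _ Tk Ti)).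
have mgk : <<s block f Ak >> gk.
  have : measurable (gk : set Tk).
    rewrite -[X in measurable X]setTI; have := @measurable_sum _ Tk R setT 'I_D (index_enum _) (fun a w => X w k a ^+ 2).
    by move=> /(_ (fun a => measurable_funX 2 (mk a))) /(_ measurableT [set 1]); exact.
  by [].
have H := @cond_prob_block _ _ _ _ _ _ f mf ind Ak Ai gk Dk (2 * expR (- (D%:R * e / 4))).
have m1 : measurable [set w | unit_rows w /\ e <= (\sum_a X w i a * X w k a) ^+ 2].
  apply: measurableI; first by apply: gen_measurable unit_rows_block; exact: (block_measurable mf).
  apply: measurable_set_le => //; apply: measurable_funX; apply: measurable_sum => a; apply: measurable_funM; exact: X_measurable.
have m2 : measurable [set w | gk w /\ Dk (w, w)].
  apply: measurableI; first by apply: gen_measurable mgk; exact: (block_measurable mf).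
  apply: measurable_set_le => //; apply: measurable_funX; apply: measurable_sum => a; apply: measurable_funM; exact: X_measurable.
apply: le_trans (_ : P [set w | gk w /\ Dk (w, w)] <= _)%E.
  by apply: le_measure; rewrite ?inE// => w /= [h1 h2]; split; first exact: h1.
apply: H => //; first by move=> l; rewrite !inE => /eqP ->; apply: contra ik => /eqP[->].
move=> w gw.
have w1 : \sum_a X w k a ^+ 2 <= 1 by rewrite gw.
pose F w' := expR (D%:R / 4 * (\sum_a X w' i a * X w k a) ^+ 2).
have mF : measurable_fun setT F.
  apply: measurableT_comp => //; apply: measurable_funM => //; apply: measurable_funX; apply: measurable_sum => a.
  by apply: measurable_funM => //; exact: X_measurable.
rewrite [X in P X](_ : _ = [set w' | expR (D%:R * e / 4) <= F w']); last first.
  by apply: eq_set => w'; rewrite /Dk /F /= ler_expR (_ : D%:R * e / 4 = D%:R / 4 * e) ?ler_pM2l ?divr_gt0//; field.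
apply: le_trans (markov_ge0 P mF _ (expR_gt0 _)) _; first by move=> w'; exact: expR_ge0.
rewrite expRN EFinM lee_pmul2r ?lte_fin ?invr_gt0 ?expR_gt0//.
apply: le_trans (sphere_exp_sqr_le i w1) _; rewrite lee_fin.
exact: sqrt2_le2.
Qed.

(** Phrased on the finite net rather than by the operator norm: the event is then plainly measurable
    for the rows alone. *)
Definition norm_bad (S : R) : set Om := [set w | exists2 z, z \in enum (net D (D * 2)) &
  \sum_k netpt (Num.sqrt D%:R * 2 : R)^-1 z k ^+ 2 <= 1 /\
  S <= \sum_i (\sum_k X w i k * netpt (Num.sqrt D%:R * 2 : R)^-1 z k) ^+ 2].

Definition corr_bad (e : R) : set Om := [set w | exists2 p, p \in enum {: 'I_N * 'I_N} &
  p.1 != p.2 /\ e <= (\sum_a X w p.1 a * X w p.2 a) ^+ 2].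

Definition good_data (S e : R) : set Om := [set w | unit_rows w /\ ~ norm_bad S w /\ ~ corr_bad e w].

Let measurable_andl d' (T : measurableType d') (Q : Prop) (A : set T) : measurable A -> measurable [set t | Q /\ A t].
Proof.
move=> mA; have [q|nq] := pselect Q.
  by rewrite (_ : [set t | _] = A)//; apply/seteqP; split=> t // [].
by rewrite (_ : [set t | _] = set0)//; apply/seteqP; split=> t // [].
Qed.

Lemma norm_bad_block S : <<s block f rowblock >> (norm_bad S).
Proof.
pose T := g_sigma_algebraType (block f rowblock).
apply: (@fin_exists_measurable _ T) => z; apply: (@measurable_andl _ T).
apply: measurable_set_le => //; apply: measurable_sum => i; apply: measurable_funX; apply: measurable_sum => k.
by apply: measurable_funM => //; exact: mfun_X.
Qed.

Lemma corr_bad_block e : <<s block f rowblock >> (corr_bad e).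
Proof.
pose T := g_sigma_algebraType (block f rowblock).
apply: (@fin_exists_measurable _ T) => p; apply: (@measurable_andl _ T).
apply: measurable_set_le => //; apply: measurable_funX; apply: measurable_sum => a.
by apply: measurable_funM; exact: mfun_X.
Qed.

Lemma good_data_block S e : <<s block f rowblock >> (good_data S e).
Proof.
pose T := g_sigma_algebraType (block f rowblock).
apply: (@measurableI _ T); first exact: unit_rows_block.
by apply: (@measurableI _ T); apply: (@measurableC _ T); [exact: norm_bad_block|exact: corr_bad_block].
Qed.

Let rb (A : set Om) : <<s block f rowblock >> A -> measurable A.
Proof. by apply: gen_measurable; exact: (block_measurable mf). Qed.

Lemma norm_bad_prob (t : R) : (P (norm_bad (4 * t / D%:R)) <= (2 ^+ (D * 2) * 4 ^+ D * expR (N%:R - t))%:E)%E.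
Proof.
apply: le_trans (@fin_exists_prob _ _ _ P _ _ (fun z : {ffun 'I_D -> bool * 'I_(D * 2).+1} => [set w | \sum_k netpt (Num.sqrt D%:R * 2 : R)^-1 z k ^+ 2 <= 1 /\
  4 * t / D%:R <= \sum_i (\sum_k X w i k * netpt (Num.sqrt D%:R * 2 : R)^-1 z k) ^+ 2]) (expR (N%:R - t)) _ _) _.
- move=> z; apply: measurable_andl; apply: measurable_set_le => //; apply: measurable_sum => i; apply: measurable_funX; apply: measurable_sum => k.
  by apply: measurable_funM => //; exact: X_measurable.
- move=> z _; have [z1|z1] := lerP (\sum_k netpt (Num.sqrt D%:R * 2 : R)^-1 z k ^+ 2) 1.
    rewrite [X in P X](_ : _ = [set w | 4 * t / D%:R <= \sum_i (\sum_k X w i k * netpt (Num.sqrt D%:R * 2 : R)^-1 z k) ^+ 2]).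
      exact: norm_net_tail.
    by apply/seteqP; split=> w // [].
  rewrite [X in P X](_ : _ = set0) ?measure0 ?lee_fin ?expR_ge0//.
  by apply/seteqP; split=> w // [].
rewrite lee_fin ler_wpM2r ?expR_ge0// -cardE; exact: net_card.
Qed.

Lemma corr_bad_prob (e : R) : (P (~` [set w | unit_rows w] `|` corr_bad e) <= (N%:R ^+ 2 * (2 * expR (- (D%:R * e / 4))))%:E)%E.
Proof.
have mU := rb unit_rows_block.
pose F (p : 'I_N * 'I_N) : set Om := [set w | p.1 != p.2 /\ (unit_rows w /\ e <= (\sum_a X w p.1 a * X w p.2 a) ^+ 2)].
have mF p : measurable (F p).
  apply: measurable_andl; apply: measurableI => //; apply: measurable_set_le => //; apply: measurable_funX; apply: measurable_sum => a.
  by apply: measurable_funM; exact: X_measurable.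
have Fe p : (P (F p) <= (2 * expR (- (D%:R * e / 4)))%:E)%E.
  have [pp|pp] := eqVneq p.1 p.2.
    rewrite (_ : F p = set0) ?measure0 ?lee_fin ?mulr_ge0 ?expR_ge0//.
    by apply/seteqP; split=> w // [/=]; rewrite pp eqxx.
  by apply: le_trans (corr_tail e pp); rewrite le_eqVlt; apply/orP; left; apply/eqP; congr (P _); apply/seteqP; split=> w //= [].
have cov : ~` [set w | unit_rows w] `|` corr_bad e `<=` ~` [set w | unit_rows w] `|` [set w | exists2 p, p \in enum {: 'I_N * 'I_N} & F p w].
  move=> w /=; have [u|nu] := pselect (unit_rows w); last by left.
  by case=> [//|[p pe [p1 p2]]]; right; exists p.
apply: le_trans (le_measure _ _ _ cov) _; rewrite ?inE.
- by apply: measurableU; [exact: measurableC|exact: rb (corr_bad_block e)].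
- by apply: measurableU; [exact: measurableC|exact: fin_exists_measurable].
apply: le_trans (measureU2 _ _ _) _; [exact: measurableC|exact: fin_exists_measurable|].
rewrite [X in (X + _)%E](_ : _ = 0%E); last exact: unit_rows_null.
rewrite add0e; apply: le_trans (fin_exists_prob mF (fun p _ => Fe p)) _.
by rewrite lee_fin -cardT card_prod !card_ord natrM expr2.
Qed.

Lemma good_data_prob (t e : R) : (P (~` good_data (4 * t / D%:R) e) <=
  (2 ^+ (D * 2) * 4 ^+ D * expR (N%:R - t) + N%:R ^+ 2 * (2 * expR (- (D%:R * e / 4))))%:E)%E.
Proof.
have mU := rb unit_rows_block.
rewrite (_ : ~` good_data _ _ = norm_bad (4 * t / D%:R) `|` (~` [set w | unit_rows w] `|` corr_bad e)); last first.
  apply/seteqP; split=> w /=.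
    rewrite /good_data /= => h; have [u|nu] := pselect (unit_rows w); last by right; left.
    have [b|nb] := pselect (norm_bad (4 * t / D%:R) w); first by left.
    by right; right; apply: contrapT => c; apply: h.
  by rewrite /good_data /= => -[|[|]] h [h1 [h2 h3]].
apply: le_trans (measureU2 _ _ _) _; [exact: rb (norm_bad_block _)|by apply: measurableU; [exact: measurableC|exact: rb (corr_bad_block _)]|].
by rewrite EFinD; apply: leeD; [exact: norm_bad_prob|exact: corr_bad_prob].
Qed.

Lemma good_data_norm S e w : good_data S e w -> forall q : 'cV[R]_N, sqnorm ((X w)^T *m q) <= 4 * S * sqnorm q.
Proof.
move=> [_ [nb _]]; apply: norm_from_net => z zn z1; rewrite leNgt; apply/negP => h.
by apply: nb; exists z; [rewrite mem_enum|split=> //; exact: ltW].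
Qed.

Lemma good_data_corr S e w : good_data S e w -> forall i k, i != k -> (\sum_a X w i a * X w k a) ^+ 2 <= e.
Proof.
move=> [_ [_ nb]] i k ik; rewrite leNgt; apply/negP => h.
by apply: nb; exists (i, k); [rewrite mem_enum|split=> //; exact: ltW].
Qed.

(** * Events of the weights for given data *)

Section WeightEvents.
Variables (v : 'cV[R]_n) (tau : R) (q : nat) (a : R).

Local Notation kap := ((2 * he5_norm R)^-1).
Local Notation pt := (netpt (Num.sqrt N%:R * q%:R : R)^-1).

Definition count_bad (x : 'M[R]_(N, D)) (W : 'M[R]_(D, n)) : Prop :=
  exists2 i, i \in enum 'I_N & 8 * n%:R * tau <= \sum_j small tau ((x *m W) i j).

(** Without the clause on the norm, the net point 0 would make this event certain. *)
Definition act_bad (x : 'M[R]_(N, D)) (W : 'M[R]_(D, n)) : Prop :=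
  exists2 z, z \in enum (net N (N * q)) & 4^-1 <= \sum_i pt z i ^+ 2 /\
    act_total x (act_pattern x W) (pt z) <= n%:R * kap / 4 * \sum_i pt z i ^+ 2.

Definition out_bad (x : 'M[R]_(N, D)) (W : 'M[R]_(D, n)) : Prop :=
  N%:R * (a ^+ 2 * n%:R) * (relu_var R + 1) <= out_norm v (x *m W).

Section BadMeasurable.
Context d' (T : measurableType d') (Y : T -> 'M[R]_(N, D)) (V : T -> 'M[R]_(D, n)).
Hypothesis mY : forall i k, measurable_fun setT (fun t => Y t i k).
Hypothesis mV : forall k j, measurable_fun setT (fun t => V t k j).

Lemma count_bad_measurable : measurable [set t | count_bad (Y t) (V t)].
Proof.
apply: fin_exists_measurable => i; apply: measurable_set_le => //.
exact: (measurable_small_sum mY mV).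
Qed.

Lemma act_bad_measurable : measurable [set t | act_bad (Y t) (V t)].
Proof.
apply: fin_exists_measurable => z; apply: measurable_andl; apply: measurable_set_le => //.
exact: (measurable_act_total mY mV).
Qed.

Lemma out_bad_measurable : measurable [set t | out_bad (Y t) (V t)].
Proof. by apply: measurable_set_le => //; exact: (measurable_out_norm mY mV). Qed.

End BadMeasurable.

Lemma count_bad_prob (x : 'M[R]_(N, D)) : (forall i, \sum_k x i k ^+ 2 = 1) -> 0 <= tau ->
  (P [set w | count_bad x (W0 w)] <= (N%:R * expR (- (2 * n%:R * tau)))%:E)%E.
Proof.
move=> x1 t0.
have mW k j : measurable_fun setT (fun w => W0 w k j) by case: (gW k j).
apply: le_trans (@fin_exists_prob _ _ _ P _ (enum 'I_N) (fun i => [set w | 8 * n%:R * tau <= \sum_j small tau ((x *m W0 w) i j)]) (expR (- (2 * n%:R * tau))) _ _) _.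
- by move=> i; apply: measurable_set_le => //; exact: (measurable_small_sum (X := fun=> x)).
- move=> i _; have := small_count (x := x) mf ind (g := g) (idx := idx) inr_inj gW' x1 i t0.
  by under eq_set do under eq_bigr do rewrite gmx_entries.
by rewrite size_enum_ord.
Qed.

Lemma act_bad_prob (B : R) (x : 'M[R]_(N, D)) : (forall i, \sum_k x i k ^+ 2 = 1) -> 0 < B ->
  (forall q : 'cV[R]_N, sqnorm (x^T *m q) <= B * sqnorm q) ->
  (forall i k, i != k -> (\sum_a x i a * x k a) ^+ 4 * B <= 2^-1) ->
  (P [set w | act_bad x (W0 w)] <= (2 ^+ (N * q) * 4 ^+ N * expR (- (n%:R * kap / (4 * B))))%:E)%E.
Proof.
move=> x1 B0 xB xrho.
have mW k j : measurable_fun setT (fun w => W0 w k j) by case: (gW k j).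
have mA z : measurable [set w | act_total x (act_pattern x (W0 w)) (pt z) <= n%:R * kap / 4 * \sum_i pt z i ^+ 2].
  by apply: measurable_set_le => //; exact: (measurable_act_total (X := fun=> x)).
apply: le_trans (@fin_exists_prob _ _ _ P _ (enum (net N (N * q))) (fun z => [set w | 4^-1 <= \sum_i pt z i ^+ 2 /\
    act_total x (act_pattern x (W0 w)) (pt z) <= n%:R * kap / 4 * \sum_i pt z i ^+ 2]) (expR (- (n%:R * kap / (4 * B)))) _ _) _.
- by move=> z; apply: measurable_andl; exact: mA.
- move=> z _; have [z1|z1] := lerP 4^-1 (\sum_i pt z i ^+ 2); last first.
    rewrite [X in P X](_ : _ = set0) ?measure0 ?lee_fin ?expR_ge0//.
    by apply/seteqP; split=> w // [].
  rewrite [X in P X](_ : _ = [set w | act_total x (act_pattern x (W0 w)) (pt z) <= n%:R * kap / 4 * \sum_i pt z i ^+ 2]); last first.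
    by apply/seteqP; split=> w // [].
  have S0 : 0 < \sum_i pt z i ^+ 2 by apply: lt_le_trans z1; rewrite invr_gt0.
  have := act_total_lower_tail (x := x) mf ind (g := g) (idx := idx) inr_inj gW' x1 B0 xB xrho S0.
  by under eq_set do rewrite gmx_entries.
rewrite lee_fin ler_wpM2r ?expR_ge0// -cardE; exact: net_card.
Qed.

Lemma out_bad_prob (B : R) (x : 'M[R]_(N, D)) : (forall i, \sum_k x i k ^+ 2 = 1) -> 0 < a ->
  (forall q : 'cV[R]_N, sqnorm (x^T *m q) <= B * sqnorm q) ->
  (forall j, v j 0 ^+ 2 = a ^+ 2) -> \sum_j v j 0 = 0 ->
  (P [set w | out_bad x (W0 w)] <= (2 * relu_cov_cst R ^+ 2 * B / N%:R + relu_m4 R / n%:R)%:E)%E.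
Proof.
move=> x1 a0 xB va v0.
have := out_norm_tail (x := x) mf ind (g := g) (idx := idx) inr_inj gW' x1 N0 n0 a0 xB va v0.
by under eq_set do rewrite gmx_entries.
Qed.

(** Measurability is asked over every space because it is needed on the product of the
    sigma-algebras of the data and of the weights. *)
Lemma cond_weights (Q : 'M[R]_(N, D) -> 'M[R]_(D, n) -> Prop) (S e p : R) :
  (forall d' (T : measurableType d') (Y : T -> 'M[R]_(N, D)) (V : T -> 'M[R]_(D, n)),
     (forall i k, measurable_fun setT (fun t => Y t i k)) -> (forall k j, measurable_fun setT (fun t => V t k j)) ->
     measurable [set t | Q (Y t) (V t)]) -> 0 <= p ->
  (forall w, good_data S e w -> (P [set w' | Q (X w) (W0 w')] <= p%:E)%E) ->
  (P [set w | good_data S e w /\ Q (X w) (W0 w)] <= p%:E)%E.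
Proof.
move=> mQ p0 Qp.
pose Tx := g_sigma_algebraType (block f rowblock); pose Tw := g_sigma_algebraType (block f colblock).
apply: (@cond_prob_block _ _ _ _ _ _ f mf ind rowblock colblock (good_data S e) [set z : Tx * Tw | Q (X z.1) (W0 z.2)]) => //.
- by move=> [i|p']; rewrite !inE.
- apply: (mQ _ (Tx * Tw)%type (fun z => X z.1) (fun z => W0 z.2)).
    by move=> i k; exact: (measurableT_comp (mfun_X i k) (@measurable_fst _ _ Tx Tw)).
  by move=> k j; exact: (measurableT_comp (mfun_W k j) (@measurable_snd _ _ Tx Tw)).
- exact: good_data_block.
Qed.

Definition good_run (S e : R) : set Om :=
  [set w | good_data S e w /\ ~ (count_bad (X w) (W0 w) \/ act_bad (X w) (W0 w) \/ out_bad (X w) (W0 w))].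

Let mW k j : measurable_fun setT (fun w => W0 w k j). Proof. by case: (gW k j). Qed.

Lemma good_run_measurable S e : measurable (good_run S e).
Proof.
apply: measurableI; first exact: rb (good_data_block S e).
apply: measurableC; apply: measurableU; first exact: (count_bad_measurable X_measurable mW).
apply: measurableU; first exact: (act_bad_measurable X_measurable mW).
exact: (out_bad_measurable X_measurable mW).
Qed.

(** A union bound. [B] is four times the net threshold [4 t / D], the loss in [norm_from_net]; the
    terms stand for the norm, the correlations, the small pre-activations, the kernel and the
    outputs. *)
Lemma good_run_prob (t e : R) (B := 16 * t / D%:R) : 0 < t -> 0 <= e -> e ^+ 2 * B <= 2^-1 -> 0 <= tau -> 0 < a ->
  (forall j, v j 0 ^+ 2 = a ^+ 2) -> \sum_j v j 0 = 0 ->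
  (P (~` good_run (4 * t / D%:R) e) <=
   (2 ^+ (D * 2) * 4 ^+ D * expR (N%:R - t) + N%:R ^+ 2 * (2 * expR (- (D%:R * e / 4))) +
    (N%:R * expR (- (2 * n%:R * tau)) + (2 ^+ (N * q) * 4 ^+ N * expR (- (n%:R * kap / (4 * B))) +
     (2 * relu_cov_cst R ^+ 2 * B / N%:R + relu_m4 R / n%:R))))%:E)%E.
Proof.
move=> t0 e0 eB tau0 a0 va v0; set S := 4 * t / D%:R.
have BE : B = 4 * S by rewrite /B /S; ring.
have DR : 0 < D%:R :> R by rewrite ltr0n.
have B0 : 0 < B by rewrite divr_gt0// mulr_gt0.
have mg := rb (good_data_block S e).
have mc := count_bad_measurable X_measurable mW.
have ma := act_bad_measurable X_measurable mW.
have mo := out_bad_measurable X_measurable mW.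
have m4 : 0 <= relu_m4 R by apply: Ex_ge0 => z; exact: exprn_even_ge0.
have cov : ~` good_run S e `<=` ~` good_data S e `|`
    ([set w | good_data S e w /\ count_bad (X w) (W0 w)] `|` ([set w | good_data S e w /\ act_bad (X w) (W0 w)] `|`
     [set w | good_data S e w /\ out_bad (X w) (W0 w)])).
  move=> w /= h; have [gd|ngd] := pselect (good_data S e w); last by left.
  right; have [h1|h1] := pselect (count_bad (X w) (W0 w)); first by left.
  right; have [h2|h2] := pselect (act_bad (X w) (W0 w)); first by left.
  right; split=> //; apply: contrapT => h3; apply: h; split=> //.
  by move=> [|[]].
have m1 : measurable [set w | good_data S e w /\ count_bad (X w) (W0 w)] by exact: measurableI.
have m2 : measurable [set w | good_data S e w /\ act_bad (X w) (W0 w)] by exact: measurableI.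
have m3 : measurable [set w | good_data S e w /\ out_bad (X w) (W0 w)] by exact: measurableI.
apply: le_trans (le_measure _ _ _ cov) _; rewrite ?inE.
- by apply: measurableC; exact: good_run_measurable.
- by apply: measurableU; [exact: measurableC|apply: measurableU => //; exact: measurableU].
apply: le_trans (measureU2 _ _ _) _; [exact: measurableC|by apply: measurableU => //; exact: measurableU|].
rewrite EFinD; apply: leeD; first exact: good_data_prob.
apply: le_trans (measureU2 _ _ _) _ => //; first exact: measurableU.
rewrite EFinD; apply: leeD.
  apply: (cond_weights (Q := count_bad)); first by move=> *; exact: count_bad_measurable.
    by rewrite mulr_ge0 ?expR_ge0.
  by move=> w [u _]; exact: count_bad_prob.
apply: le_trans (measureU2 _ _ _) _ => //.
rewrite EFinD; apply: leeD.
  apply: (cond_weights (Q := act_bad)); first by move=> *; exact: act_bad_measurable.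
    by rewrite !mulr_ge0 ?expR_ge0 ?exprn_ge0.
  move=> w gw; have [u _] := gw; apply: act_bad_prob => //.
    by move=> z; rewrite BE; exact: good_data_norm gw z.
  move=> i k ik; apply: le_trans eB; rewrite ler_wpM2r ?(ltW B0)// (exprM _ 2 2).
  by rewrite lerXn2r ?nnegrE ?sqr_ge0//; exact: good_data_corr gw _ _ ik.
apply: (cond_weights (Q := out_bad)); first by move=> *; exact: out_bad_measurable.
  apply: addr_ge0; apply: divr_ge0 => //; apply: mulr_ge0 (ltW B0).
  by apply: mulr_ge0 => //; exact: sqr_ge0.
move=> w gw; have [u _] := gw; apply: out_bad_prob => //.
by move=> z; rewrite BE; exact: good_data_norm gw z.
Qed.

(** At net points of squared norm at least [1 / 4] the threshold [kap / 4] becomes [kap / 16], and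
    the passage from the net to all directions costs another factor 4: hence [kap / 64]. Twice the
    initial loss is at most [2 |y|^2 (relu_var + 2)], from [(s - y)^2 <= 2 s^2 + 2 y^2]. *)
Lemma good_run_event (t e r : R) (B := 16 * t / D%:R) (kappa := kap / 64) (y : 'cV[R]_N) w :
  (1 < q)%N -> 256 * B <= kap * q%:R ^+ 2 -> 0 < t -> 0 < tau -> 0 < a -> 0 < r ->
  (forall j, v j 0 ^+ 2 = a ^+ 2) -> N%:R * (a ^+ 2 * n%:R) = sqnorm y ->
  B * (8 * n%:R * tau + r ^+ 2 / tau ^+ 2) <= kappa * n%:R / 4 ->
  8 * (relu_var R + 2) * N%:R < kappa * r ^+ 2 ->
  good_run (4 * t / D%:R) e w -> good_event 2^-1 (X w) v y (W0 w).
Proof.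
move=> q1 Bq t0 tau0 a0 r0 va ay Hf Hr [gd nb].
have [u _] := gd.
have DR : 0 < D%:R :> R by rewrite ltr0n.
have nR : 0 < n%:R :> R by rewrite ltr0n.
have B0 : 0 < B by rewrite divr_gt0// mulr_gt0.
have kap0 : 0 < kap by rewrite invr_gt0 mulr_gt0// he5_norm_gt0.
have b0 : 0 < a ^+ 2 * n%:R by rewrite mulr_gt0// exprn_gt0.
have XB z : sqnorm ((X w)^T *m z) <= B * sqnorm z.
  by have := good_data_norm gd z; rewrite (_ : 4 * (4 * t / D%:R) = B)// /B; ring.
apply: (@good_event_deterministic _ _ _ _ (X w) v y (W0 w) a B kappa tau (8 * n%:R * tau) (2 * sqnorm y * (relu_var R + 2)) r) => //.
- move=> z; have A01 i j : 0 <= act_pattern (X w) (W0 w) i j <= 1 by rewrite mxE -/(step _) step01.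
  have := @act_form_from_net _ _ _ _ (X w) (act_pattern (X w) (W0 w)) B XB A01 (ltW B0) q (kap / 16) q1.
  rewrite (_ : kap / 16 / 4 = kappa); last by rewrite /kappa; field; rewrite gt_eqF// he5_norm_gt0.
  apply; [by rewrite divr_ge0// ltW|by lra|].
  move=> p pn p4; apply: le_trans (_ : n%:R * kap / 4 * \sum_i pt p i ^+ 2 <= _).
    have h : 0 <= n%:R * kap by rewrite mulr_ge0// ltW.
    nra.
  rewrite (eq_bigr _ (fun j _ => act_formE (X w) (act_pattern (X w) (W0 w)) _ j)) leNgt; apply/negP => h.
  by apply: nb; right; left; exists p; [rewrite mem_enum|split=> //; exact: ltW].
- move=> i; have <- : \sum_j small tau ((X w *m W0 w) i j) = #|[set j | (X w *m W0 w) i j ^+ 2 <= tau ^+ 2]%SET|%:R.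
    rewrite -sum1_card natr_sum [RHS]big_mkcond; apply: eq_bigr => j _.
    by rewrite inE /small; case: ifP.
  rewrite leNgt; apply/negP => h; apply: nb; left; exists i; [by rewrite mem_enum|exact: ltW].
- rewrite lossE mulrA divff ?mul1r//.
  apply: le_trans (_ : 2 * out_norm v (X w *m W0 w) + 2 * sqnorm y <= _).
    rewrite !mulr_sumr -big_split; apply: ler_sum => i _; rewrite /residual /=.
    under [X in (X - _) ^+ 2]eq_bigr do rewrite mulrC.
    set S := \sum_j _; have := sqr_ge0 (S + y i 0); rewrite sqrrB sqrrD; lra.
  have : out_norm v (X w *m W0 w) <= sqnorm y * (relu_var R + 1).
    by rewrite -ay leNgt; apply/negP => h; apply: nb; right; right; exact: ltW.
  lra.
- exact: ltW.
- by rewrite divr_gt0.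
- have := ltr_pM2r b0 (8 * (relu_var R + 2) * N%:R) (kappa * r ^+ 2); rewrite Hr.
  rewrite -ay => h; rewrite (_ : 4 * _ = 8 * (relu_var R + 2) * N%:R * (a ^+ 2 * n%:R)); last by ring.
  by rewrite (_ : kappa * _ * _ = kappa * r ^+ 2 * (a ^+ 2 * n%:R)) ?h//; ring.
Qed.

End WeightEvents.

End Model.

(** * Constants *)

Section Constants.
Context (R : realType).

Definition mean_cst : R := (2 * he5_norm R)^-1.
Definition rank_cst : R := mean_cst / 64.
(** For [q >= net_cst * N / d0] and [B = 96 N / d0] the mesh condition [256 B <= mean_cst q^2]
    holds. *)
Definition net_cst : R := 256 * 96 / mean_cst + 1.
(** Solves [B r^2 / tau^2 <= rank_cst * d1 / 8] for the width, with [B = 96 N / d0],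
    [tau = rank_cst / (64 B)] and [r^2 = 9 (relu_var + 2) N / rank_cst]. *)
Definition flip_cst : R := 8 * 9 * (relu_var R + 2) * (64 * 96) ^+ 2 * 96 / rank_cst ^+ 4.
(** Makes [d1 * tau] at least [N], so that the union bound over samples is harmless. *)
Definition count_cst : R := 64 * 96 / rank_cst.
(** Lets the Chernoff exponent of the kernel exceed the logarithm of the size of the net, which is
    at most [N (q + 2)]. *)
Definition tail_cst : R := 384 * (net_cst + 6) / mean_cst.
Definition width_cst : R := flip_cst + count_cst + tail_cst + 1.
Definition corr_cst : R := 256 * 192 ^+ 2 * 12 ^+ 4.
Definition failure_cst : R := 3 + 2 * corr_cst ^+ 3 + 192 * relu_cov_cst R ^+ 2 + relu_m4 R.

Lemma relu_var_ge0 : 0 <= relu_var R.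
Proof. by apply: Ex_ge0 => t; exact: sqr_ge0. Qed.

Lemma relu_m4_ge0 : 0 <= relu_m4 R.
Proof. by apply: Ex_ge0 => t; exact: exprn_even_ge0. Qed.

Lemma mean_cst_gt0 : 0 < mean_cst.
Proof. by rewrite invr_gt0 mulr_gt0// he5_norm_gt0. Qed.

Lemma rank_cst_gt0 : 0 < rank_cst.
Proof. by rewrite divr_gt0// mean_cst_gt0. Qed.

Lemma net_cst_ge1 : 1 <= net_cst.
Proof.
rewrite lerDr; apply: mulr_ge0; last by rewrite invr_ge0; exact: ltW mean_cst_gt0.
by apply: mulr_ge0; exact: ler0n.
Qed.

Lemma flip_cst_ge0 : 0 <= flip_cst.
Proof.
have := relu_var_ge0 => h; rewrite divr_ge0 ?exprn_ge0 ?(ltW rank_cst_gt0)// !mulr_ge0 ?exprn_ge0//.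
by rewrite addr_ge0.
Qed.

Lemma count_cst_ge0 : 0 <= count_cst.
Proof. by rewrite divr_ge0 ?(ltW rank_cst_gt0). Qed.

Lemma tail_cst_ge0 : 0 <= tail_cst.
Proof.
have h := net_cst_ge1; apply: divr_ge0; last exact: ltW mean_cst_gt0.
by apply: mulr_ge0; [exact: ler0n|lra].
Qed.

Lemma corr_cst_gt0 : 0 < corr_cst.
Proof. by apply: mulr_gt0; [apply: mulr_gt0|]; rewrite ?exprn_gt0 ?ltr0n. Qed.

Lemma failure_cst_ge0 : 0 <= failure_cst.
Proof.
have h1 := relu_m4_ge0; have h2 : 0 <= corr_cst ^+ 3 by rewrite exprn_ge0// ltW// corr_cst_gt0.
have h3 := sqr_ge0 (relu_cov_cst R).
rewrite /failure_cst; lra.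
Qed.

Lemma width_cst_gt0 : 0 < width_cst.
Proof.
have := flip_cst_ge0; have := count_cst_ge0; have := tail_cst_ge0.
by rewrite /width_cst => *; lra.
Qed.

Lemma exp2_le k : 2 ^+ k <= expR k%:R :> R.
Proof.
rewrite -[k%:R]mul1r expRM_natr lerXn2r ?nnegrE ?expR_ge0//.
by have := expR_ge1Dx (1 : R); lra.
Qed.

Lemma expRN_le_inv (x : R) : 0 < x -> expR (- x) <= x^-1.
Proof.
by move=> x0; rewrite expRN lef_pV2 ?posrE ?expR_gt0//; apply: le_trans (expR_ge1Dx x); lra.
Qed.

Section Scaling.
Variables (x z n : R).
Hypotheses (x1 : 1 <= x) (z1 : 1 <= z) (zx : z <= x) (xz : x <= z ^+ 2).
Hypothesis wide : width_cst * (x ^+ 5 / z ^+ 4) <= n.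

Let z0 : 0 < z. Proof. exact: lt_le_trans ltr01 z1. Qed.
Let x0 : 0 < x. Proof. exact: lt_le_trans ltr01 x1. Qed.
Let m1 : 1 <= x / z. Proof. by rewrite ler_pdivlMr// mul1r. Qed.

(** As [x / z >= 1], the quantities [x^(k + 1) / z^k = x (x / z)^k] increase with [k]: every width
    requirement with [k <= 4] follows from the one with [k = 4]. *)
Lemma wide_term (c : R) (k : nat) : (k <= 4)%N -> 0 <= c -> c <= width_cst -> c * (x ^+ k.+1 / z ^+ k) <= n.
Proof.
move=> k4 c0 cw; apply: le_trans wide; apply: ler_pM => //.
  by rewrite divr_ge0// exprn_ge0// ltW.
have E j : x ^+ j.+1 / z ^+ j = x * (x / z) ^+ j by rewrite expr_div_n exprS mulrA.
by rewrite (E k) (E 4%N) ler_pM2l//; apply: ler_weXn2l.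
Qed.

Lemma wide_flip : flip_cst * (x ^+ 4 / z ^+ 3) <= n.
Proof.
apply: (@wide_term _ 3) => //; first exact: flip_cst_ge0.
by have := count_cst_ge0; have := tail_cst_ge0; rewrite /width_cst => *; lra.
Qed.

Lemma wide_count : count_cst * (x ^+ 2 / z) <= n.
Proof.
apply: (@wide_term _ 1) => //; first exact: count_cst_ge0.
by have := flip_cst_ge0; have := tail_cst_ge0; rewrite /width_cst => *; lra.
Qed.

Lemma wide_tail : tail_cst * (x ^+ 3 / z ^+ 2) <= n.
Proof.
apply: (@wide_term _ 2) => //; first exact: tail_cst_ge0.
by have := flip_cst_ge0; have := count_cst_ge0; rewrite /width_cst => *; lra.
Qed.

Lemma wide_one : x <= n.
Proof.
rewrite (_ : x = 1 * (x ^+ 1 / z ^+ 0)); last by rewrite expr0 expr1 divr1 mul1r.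
apply: wide_term => //.
by have := flip_cst_ge0; have := count_cst_ge0; have := tail_cst_ge0; rewrite /width_cst => *; lra.
Qed.

(** The exponent may grow only like [x^(1/4)], at [z = sqrt x]. The twelfth power in
    [expR t >= (t / 12)^12] turns it into [x^3], which beats the [x^2] pairs of samples; [corr_cst]
    collects the numbers in [(t / 12)^4 >= x / corr_cst]. *)
Lemma corr_exp_bound : x ^+ 2 * (2 * expR (- (z * Num.sqrt (z / (192 * x)) / 4))) <= 2 * corr_cst ^+ 3 / x.
Proof.
have [c c0 cE] : exists2 c : R, 0 < c & c = corr_cst by exists corr_cst => //; exact: corr_cst_gt0.
rewrite -cE; set e := Num.sqrt _; have e0 : 0 <= e by exact: sqrtr_ge0.
have e2 : e ^+ 2 = z / (192 * x).
  apply: sqr_sqrtr; apply: divr_ge0; first exact: ltW.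
  by apply: mulr_ge0; [exact: ler0n|exact: ltW].
set t := z * e / 4.
have t0 : 0 <= t by rewrite divr_ge0// mulr_ge0// ltW.
have t12 : 0 <= t / 12 by exact: divr_ge0 t0 (ler0n _ 12).
have h4 : x / c <= (t / 12) ^+ 4.
  have -> : (t / 12) ^+ 4 = (z ^+ 2) ^+ 3 / (c * x ^+ 2).
    have -> : (t / 12) ^+ 4 = z ^+ 4 * (e ^+ 2) ^+ 2 / (256 * 12 ^+ 4) by rewrite /t; field.
    by rewrite e2 cE /corr_cst; field; rewrite gt_eqF.
  rewrite ler_pdivlMr ?mulr_gt0 ?exprn_gt0// (_ : x / c * (c * x ^+ 2) = x ^+ 3); last by field; rewrite gt_eqF.
  by rewrite lerXn2r ?nnegrE ?exprn_ge0// ltW.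
have h12 : (x / c) ^+ 3 <= expR t.
  apply: le_trans (_ : ((t / 12) ^+ 4) ^+ 3 <= _).
    rewrite lerXn2r ?nnegrE//; [by rewrite divr_ge0// ltW|exact: exprn_ge0].
  rewrite -exprM (_ : expR t = expR (t / 12) ^+ 12); last by rewrite -expRM_natr; congr expR; field.
  rewrite lerXn2r ?nnegrE ?expR_ge0//.
  by have := expR_ge1Dx (t / 12); lra.
have xc : 0 < (x / c) ^+ 3 by rewrite exprn_gt0// divr_gt0.
have : expR (- t) <= ((x / c) ^+ 3)^-1 by rewrite expRN lef_pV2 ?posrE ?expR_gt0.
rewrite (_ : ((x / c) ^+ 3)^-1 = c ^+ 3 / x ^+ 3); last by field; rewrite !gt_eqF.
move=> h; apply: le_trans (_ : x ^+ 2 * (2 * (c ^+ 3 / x ^+ 3)) <= _).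
  by apply: ler_wpM2l; [exact: sqr_ge0|exact: ler_wpM2l].
by rewrite le_eqVlt; apply/orP; left; apply/eqP; field; rewrite gt_eqF.
Qed.

Lemma sqrt_bound : x^-1 <= (Num.sqrt x)^-1 /\ z^-1 <= (Num.sqrt x)^-1.
Proof.
have s0 : 0 < Num.sqrt x by rewrite sqrtr_gt0.
have s2 : Num.sqrt x ^+ 2 = x by rewrite sqr_sqrtr// ltW.
split; rewrite lef_pV2 ?posrE//.
  rewrite -[leRHS]s2 expr2 ler_peMl ?(ltW s0)//.
  by rewrite -sqrtr1 ler_wsqrtr.
by rewrite -[leRHS](ger0_norm (ltW z0)) -sqrtr_sqr ler_wsqrtr.
Qed.

End Scaling.

End Constants.

(** * Choice of the parameters and the final probability *)

Section WithHighProbability.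
Context d (Om : measurableType d) (R : realType) (P : probability Om R) (N D n : nat).
Variables (X : Om -> 'M[R]_(N, D)) (W0 : Om -> 'M[R]_(D, n)).
Hypothesis N0 : (0 < N)%N.
Hypotheses (ND : Num.sqrt (N%:R : R) <= D%:R) (DN : (D <= N)%N).
Hypothesis wide : width_cst R * (N%:R ^+ 5 / D%:R ^+ 4) <= n%:R.
Hypothesis uX : forall i, uniform_sphere P (fun w => row i (X w)).
Hypothesis gW : forall a b, std_gaussian P (fun w => W0 w a b).
Hypothesis ind : @mutually_independent R d Om P _ (fun=> 'I_D) (entries X W0).

Lemma good_event_whp (v : 'cV[R]_n) (y : 'cV[R]_N) (a : R) : 0 < a ->
  (forall j, v j 0 ^+ 2 = a ^+ 2) -> \sum_j v j 0 = 0 -> N%:R * (a ^+ 2 * n%:R) = sqnorm y ->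
  exists E : set Om, [/\ measurable E, E `<=` [set w | good_event 2^-1 (X w) v y (W0 w)] &
    (P (~` E) <= (failure_cst R / Num.sqrt N%:R)%:E)%E].
Proof.
move=> a0 va v0 ay.
have x1 : 1 <= N%:R :> R by rewrite ler1n.
have xp : 0 < N%:R :> R by rewrite ltr0n.
have sx1 : 1 <= Num.sqrt N%:R :> R by rewrite -[leLHS]sqrtr1 ler_wsqrtr.
have z1 : 1 <= D%:R :> R by exact: le_trans ND.
have zp : 0 < D%:R :> R by exact: lt_le_trans z1.
have D0 : (0 < D)%N by rewrite -(ltr0n R).
have zx : D%:R <= N%:R :> R by rewrite ler_nat.
have xz : N%:R <= D%:R ^+ 2 :> R.
  by rewrite -[leLHS](sqr_sqrtr (ltW xp)) lerXn2r ?nnegrE ?sqrtr_ge0// ltW.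
have nx := wide_one x1 z1 zx wide.
have np : 0 < n%:R :> R by exact: lt_le_trans nx.
have n0 : (0 < n)%N by rewrite -(ltr0n R).
have ka0 := mean_cst_gt0 R; have rk0 := rank_cst_gt0 R; have L1 := net_cst_ge1 R.
have s0 := relu_var_ge0 R; have m40 := relu_m4_ge0 R.
have fl := wide_flip x1 z1 zx wide.
have ct := wide_count x1 z1 zx wide.
have tl := wide_tail x1 z1 zx wide.
have cb := corr_exp_bound x1 z1 xz.
have [sb1 sb2] := sqrt_bound x1 z1 xz.
set x : R := N%:R in x1 xp sx1 zx xz nx fl ct tl cb sb1 sb2 ay *.
set z : R := D%:R in z1 zp zx xz fl ct tl cb sb2 *.
set m : R := n%:R in np nx fl ct tl ay *.
set ka := mean_cst R in ka0 *; set rk := rank_cst R in rk0 *.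
have m1 : 1 <= x / z by rewrite ler_pdivlMr// mul1r.
have four k : 4 ^+ k = 2 ^+ (k * 2) :> R by rewrite mulnC exprM; congr (_ ^+ _); rewrite -natrX.
(* The net has at most [2^(4 D) <= expR (4 N)] points and each fails with probability at most
   [expR (N - t)]; [t = 6 N] leaves [expR (- N)]. *)
pose t : R := 6 * x; pose B : R := 16 * t / z.
have t0 : 0 < t by rewrite mulr_gt0.
have BE : B = 64 * 96 / 64 * (x / z) by rewrite /B /t; field; rewrite gt_eqF.
have B0 : 0 < B by rewrite divr_gt0// mulr_gt0.
(* The small pre-activations then use exactly half of the flip budget:
   [B * (8 m tau) = rk m / 8]. *)
pose tau := rk / (64 * B).
have tau0 : 0 < tau by rewrite divr_gt0// mulr_gt0.
(* Adding 2 makes [1 < q] immediate and costs at most [2 x / z], since [x / z >= 1]. *)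
pose q := (Num.truncn (net_cst R * (x / z))).+2.
have Lm1 : 1 <= net_cst R * (x / z).
  by rewrite -[leLHS]mulr1; apply: ler_pM => //; rewrite ler_pdivlMr// mul1r.
have [q1 q2] : net_cst R * (x / z) <= q%:R /\ q%:R <= (net_cst R + 2) * (x / z).
  have := truncn_itv (le_trans ler01 Lm1) => /andP[h1 h2]; split.
    by apply: ltW (lt_trans h2 _); rewrite ltr_nat.
  by rewrite /q -natr1 -natr1; lra.
(* Chosen so that [e ^+ 2 * B] equals [1 / 2]. *)
pose e := Num.sqrt (z / (192 * x)).
have e2 : e ^+ 2 = z / (192 * x).
  apply: sqr_sqrtr; apply: divr_ge0; first exact: ltW.
  by apply: mulr_ge0; [exact: ler0n|exact: ltW].
(* The 9 leaves room for the strict inequality with 8 in [good_run_event]. *)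
pose r := Num.sqrt (9 * (relu_var R + 2) * x / rk).
have r2p : 0 < 9 * (relu_var R + 2) * x / rk by rewrite divr_gt0// !mulr_gt0//; lra.
have r0 : 0 < r by rewrite sqrtr_gt0.
have r2 : r ^+ 2 = 9 * (relu_var R + 2) * x / rk by rewrite sqr_sqrtr// ltW.
exists (good_run X W0 v tau q a (4 * t / z) e); split.
- exact: (good_run_measurable uX gW).
- move=> w; apply: (good_run_event (r := r) N0 D0 n0) => //; rewrite -/ka -/z -/m -/x -/B.
  + apply: le_trans (_ : ka * q%:R <= _); last first.
      by rewrite ler_wpM2l ?(ltW ka0)// expr2 ler_peMr// (le_trans _ q1)// (le_trans ler01).
    apply: le_trans (_ : ka * (net_cst R * (x / z)) <= _); last by rewrite ler_wpM2l ?(ltW ka0).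
    have -> : ka * (net_cst R * (x / z)) = (256 * 96 + ka) * (x / z) by rewrite /net_cst -/ka; field; rewrite !gt_eqF.
    have := mulr_ge0 (ltW ka0) (le_trans ler01 m1).
    rewrite BE; set p := x / z => *; lra.
  + rewrite -/rk -[_ / 64]/rk r2.
    have -> : B * (8 * m * tau + 9 * (relu_var R + 2) * x / rk / tau ^+ 2) =
       rk * m / 8 + rk / 8 * (flip_cst R * (x ^+ 4 / z ^+ 3)).
      rewrite /flip_cst -/rk /tau BE; field; rewrite !gt_eqF//.
    have : rk / 8 * (flip_cst R * (x ^+ 4 / z ^+ 3)) <= rk / 8 * m by rewrite ler_wpM2l// divr_ge0// ltW.
    lra.
  + rewrite -[_ / 64]/rk r2 (_ : rk * _ = 9 * (relu_var R + 2) * x); last by field; rewrite gt_eqF.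
    by rewrite (ltr_pM2r xp) ltr_pM2r ?ltr_nat// ltr_wpDl.
have eB : e ^+ 2 * B <= 2^-1.
  by rewrite e2 BE le_eqVlt; apply/orP; left; apply/eqP; field; rewrite !gt_eqF.
have := good_run_prob N0 D0 n0 uX gW ind q t0 (sqrtr_ge0 _) eB (ltW tau0) a0 va v0.
rewrite -/x -/z -/m -[(2 * he5_norm R)^-1]/ka -/B -/e => /le_trans; apply; rewrite lee_fin.
have T1 : 2 ^+ (D * 2) * 4 ^+ D * expR (x - t) <= x^-1.
  apply: le_trans (expRN_le_inv xp).
  have -> : 2 ^+ (D * 2) * 4 ^+ D = 2 ^+ (D * 4) :> R by rewrite four -exprD -?mulnDr.
  apply: le_trans (_ : expR (D * 4)%:R * expR (x - t) <= _); first by rewrite ler_wpM2r ?expR_ge0 ?exp2_le.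
  by rewrite -expRD ler_expR natrM -/z /t; lra.
have T3 : x * expR (- (2 * m * tau)) <= x^-1.
  have h : x <= m * tau.
    have := ct; rewrite (_ : count_cst R * (x ^+ 2 / z) = x / tau); first by rewrite ler_pdivrMr.
    by rewrite /count_cst -/rk /tau BE; field; rewrite !gt_eqF.
  have := expRN_le_inv xp => h1.
  apply: le_trans (_ : x * (expR (- x) * expR (- x)) <= _).
    by rewrite ler_wpM2l ?(ltW xp)// -expRD ler_expR; lra.
  apply: le_trans (_ : x * (x^-1 * x^-1) <= _).
    by rewrite ler_wpM2l ?(ltW xp)//; apply: ler_pM; rewrite ?expR_ge0.
  by rewrite mulrA divff ?mul1r// gt_eqF.
have T4 : 2 ^+ (N * q) * 4 ^+ N * expR (- (m * ka / (4 * B))) <= x^-1.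
  apply: le_trans (expRN_le_inv xp).
  have -> : 2 ^+ (N * q) * 4 ^+ N = 2 ^+ (N * q + N * 2) :> R by rewrite four -exprD -?mulnDr.
  apply: le_trans (_ : expR (N * q + N * 2)%:R * expR (- (m * ka / (4 * B))) <= _); first by rewrite ler_wpM2r ?expR_ge0 ?exp2_le.
  rewrite -expRD ler_expR natrD !natrM -/x.
  have h : (net_cst R + 6) * (x / z) * x <= m * ka / (4 * B).
    have B4 : 0 < 4 * B by rewrite pmulr_rgt0.
    rewrite ler_pdivlMr//.
    have -> : (net_cst R + 6) * (x / z) * x * (4 * B) = tail_cst R * (x ^+ 3 / z ^+ 2) * ka.
      by rewrite /tail_cst -/ka BE; field; rewrite !gt_eqF.
    by rewrite ler_pM2r.
  have h3 : x <= x / z * x by exact: ler_peMl (ltW xp) m1.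
  have h4 : x * q%:R <= x * ((net_cst R + 2) * (x / z)) by rewrite ler_pM2l.
  have h5 : x * ((net_cst R + 2) * (x / z)) = (net_cst R + 6) * (x / z) * x - 4 * (x / z * x) by ring.
  lra.
have T6 : 2 * relu_cov_cst R ^+ 2 * B / x <= 192 * relu_cov_cst R ^+ 2 / z.
  by rewrite BE le_eqVlt; apply/orP; left; apply/eqP; field; rewrite !gt_eqF.
have T7 : relu_m4 R / m <= relu_m4 R / x by rewrite ler_wpM2l// lef_pV2.
have S6 : 192 * relu_cov_cst R ^+ 2 / z <= 192 * relu_cov_cst R ^+ 2 / Num.sqrt x.
  by apply: ler_wpM2l sb2; apply: mulr_ge0; [exact: ler0n|exact: sqr_ge0].
have S7 : relu_m4 R / x <= relu_m4 R / Num.sqrt x by exact: ler_wpM2l sb1.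
have S2 : 2 * corr_cst R ^+ 3 / x <= 2 * corr_cst R ^+ 3 / Num.sqrt x.
  apply: ler_wpM2l sb1; apply: mulr_ge0; first exact: ler0n.
  by apply: exprn_ge0; exact: ltW (corr_cst_gt0 R).
have -> : failure_cst R / Num.sqrt x = (Num.sqrt x)^-1 + 2 * corr_cst R ^+ 3 / Num.sqrt x +
    ((Num.sqrt x)^-1 + ((Num.sqrt x)^-1 + (192 * relu_cov_cst R ^+ 2 / Num.sqrt x + relu_m4 R / Num.sqrt x))).
  by rewrite /failure_cst; ring.
apply: lerD; first by apply: lerD; [exact: le_trans T1 sb1|exact: le_trans cb S2].
apply: lerD; first exact: le_trans T3 sb1.
apply: lerD; first exact: le_trans T4 sb1.
by apply: lerD; [exact: le_trans T6 S6|exact: le_trans T7 S7].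
Qed.

End WithHighProbability.

Lemma sqrt_inv_cvg0 (R : realType) (c : R) : (fun N : nat => c / Num.sqrt N%:R) @ \oo --> (0 : R).
Proof.
apply/cvgrPdist_lt => eps eps0; near=> N; rewrite sub0r normrN normrM normrV ?unitfE; last first.
  by rewrite sqrtr_eq0 -ltNge; near: N; exists 1%N => // N /= N1; rewrite ltr0n.
have s0 : 0 < Num.sqrt N%:R :> R.
  by rewrite sqrtr_gt0 ltr0n; near: N; exists 1%N.
rewrite (ger0_norm (ltW s0)) ltr_pdivrMr// -ltr_pdivrMl//.
rewrite -[ltLHS]ger0_norm ?mulr_ge0 ?invr_ge0 ?(ltW eps0)// -sqrtr_sqr ltr_sqrt ?ltr0n; last first.
  by near: N; exists 1%N.
near: N; exists (Num.truncn ((eps^-1 * `|c|) ^+ 2)).+1 => // N /= hN.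
by apply: lt_le_trans (truncnS_gt _) _; rewrite ler_nat.
Unshelve. all: by end_near.
Qed.

Theorem theoremG2 (R : realType) :
  exists2 C : R, 0 < C & exists2 c : R, 0 < c &
  forall (K : R) (d0 d1 : nat -> nat)
    (y : forall N : nat, 'cV[R]_N) (v : forall N : nat, 'cV[R]_(d1 N))
    (dd : nat -> measure_display) (Om : forall N : nat, measurableType (dd N))
    (P : forall N : nat, probability (Om N) R)
    (X : forall N : nat, Om N -> 'M[R]_(N, d0 N))
    (W0 : forall N : nat, Om N -> 'M[R]_(d0 N, d1 N)),
  (* |y_i| = O(1) *)
  (forall N (i : 'I_N), `|y N i 0| <= K) ->
  (* d0 in [sqrt N, N] *)
  (forall N : nat, (0 < N)%N -> Num.sqrt (N%:R : R) <= (d0 N)%:R /\ (d0 N <= N)%N) ->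
  (* d1 >= C max(N log N / d0, N^5 / d0^4) *)
  (forall N : nat, (0 < N)%N ->
     C * Num.max ((N%:R : R) * ln (N%:R : R) / (d0 N)%:R) (N%:R ^+ 5 / (d0 N)%:R ^+ 4)
       <= (d1 N)%:R) ->
  (* half the entries of v equal ||y||/sqrt(N d1), the other half the opposite *)
  (forall N : nat, exists S : {set 'I_(d1 N)},
     (#|S|.*2 = d1 N)%N /\
     forall j : 'I_(d1 N),
       v N j 0 = (if j \in S then 1 else -1) *
                 (Num.sqrt (sqnorm (y N)) / Num.sqrt ((N%:R : R) * (d1 N)%:R))) ->
  (* rows of X uniform on the unit sphere *)
  (forall N (i : 'I_N), uniform_sphere (P N) (fun w => row i (X N w))) ->
  (* entries of W0 standard Gaussian *)
  (forall N (a : 'I_(d0 N)) (b : 'I_(d1 N)), std_gaussian (P N) (fun w => W0 N w a b)) ->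
  (* the rows of X and the entries of W0 are all mutually independent *)
  (forall N : nat,
     mutually_independent (P N)
       (fun (k : ('I_N + 'I_(d0 N) * 'I_(d1 N))%type) (j : 'I_(d0 N)) (w : Om N) =>
          match k with
          | inl i => X N w i j
          | inr ab => W0 N w ab.1 ab.2
          end)) ->
  (* with high probability: the good event contains measurable events whose
     probability tends to 1 *)
  exists2 E : forall N : nat, set (Om N),
    (forall N, measurable (E N)) /\
    (forall N, E N `<=` [set w | good_event c (X N w) (v N) (y N) (W0 N w)]) &
    ((fun N => P N (E N)) @ \oo --> 1%E).
Proof.
exists (width_cst R); first exact: width_cst_gt0.
exists 2^-1; first by rewrite invr_gt0.
move=> K d0 d1 y v dd Om P X W0 _ d0N d1N vN uX gW ind.
have main N : exists E : set (Om N), [/\ measurable E, E `<=` [set w | good_event 2^-1 (X N w) (v N) (y N) (W0 N w)] &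
    ((0 < N)%N -> P N (~` E) <= (failure_cst R / Num.sqrt N%:R)%:E)%E].
  have [S [S2 vS]] := vN N.
  (* This includes [N = 0], where [y] is empty. The formula for [v] gives [v = 0], and every outcome
     is good. *)
  have [y0|yn0] := eqVneq (sqnorm (y N)) 0.
    exists setT; split=> // [w _|_].
      apply: good_event_degenerate => [j|i]; first by rewrite vS y0 sqrtr0 mul0r mulr0.
      by move/eqP: y0; rewrite sqnorm_eq0 => /eqP ->; rewrite mxE.
    by rewrite setCT measure0 lee_fin divr_ge0// failure_cst_ge0.
  have N0 : (0 < N)%N.
    case: N y {d0N d1N v vN uX gW ind W0 X P S S2 vS} yn0 => // y0; by rewrite /sqnorm big_ord0 eqxx.
  have [h1 h2] := d0N N N0.
  have NR : 0 < N%:R :> R by rewrite ltr0n.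
  have DR : 0 < (d0 N)%:R :> R by apply: lt_le_trans h1; rewrite sqrtr_gt0.
  have wide : width_cst R * (N%:R ^+ 5 / (d0 N)%:R ^+ 4) <= (d1 N)%:R.
    apply: le_trans (d1N N N0); rewrite ler_wpM2l ?(ltW (width_cst_gt0 R))//.
    by rewrite le_max lexx orbT.
  have nR : 0 < (d1 N)%:R :> R.
    by apply: lt_le_trans wide; rewrite mulr_gt0 ?width_cst_gt0// divr_gt0 ?exprn_gt0.
  have yp : 0 < sqnorm (y N) by rewrite lt_neqAle eq_sym yn0 sqnorm_ge0.
  pose a := Num.sqrt (sqnorm (y N)) / Num.sqrt ((N%:R : R) * (d1 N)%:R).
  have a0 : 0 < a by rewrite divr_gt0 ?sqrtr_gt0// mulr_gt0.
  have a2 : a ^+ 2 = sqnorm (y N) / (N%:R * (d1 N)%:R).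
    by rewrite /a expr_div_n !sqr_sqrtr ?(ltW yp)// mulr_ge0.
  have va j : v N j 0 ^+ 2 = a ^+ 2.
    by rewrite vS -/a exprMn; case: ifP => _; rewrite ?sqrrN expr1n mul1r.
  have v0 : \sum_j v N j 0 = 0.
    under eq_bigr do rewrite vS -/a; rewrite -mulr_suml.
    rewrite (bigID (mem S))/=.
    under eq_bigr do rewrite ifT//.
    under [X in _ + X]eq_bigr => j /negbTE h do rewrite h.
    have E : \sum_(j < d1 N | j \notin S) 1 = \sum_(j in S) 1 :> R.
      rewrite !sumr_const; congr (_ *+ _); have := etrans (cardC (mem S)) (etrans (card_ord _) (esym S2)).
      by rewrite -addnn => /eqP; rewrite eqn_add2l => /eqP <-; apply: eq_card => i; rewrite !inE.
    by rewrite sumrN E subrr mul0r.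
  have ay : N%:R * (a ^+ 2 * (d1 N)%:R) = sqnorm (y N).
    by rewrite a2; field; rewrite !gt_eqF.
  have [E [mE Eg PE]] := good_event_whp N0 h1 h2 wide (uX N) (gW N) (ind N) a0 va v0 ay.
  by exists E; split.
pose E N := projT1 (cid (main N)).
have HE N : [/\ measurable (E N), E N `<=` [set w | good_event 2^-1 (X N w) (v N) (y N) (W0 N w)] &
    ((0 < N)%N -> P N (~` E N) <= (failure_cst R / Num.sqrt N%:R)%:E)%E].
  exact: projT2 (cid (main N)).
exists E; first by split=> N; case: (HE N).
apply: (@squeeze_cvge _ _ _ _ (fun N => (1 - failure_cst R / Num.sqrt N%:R)%:E) _ (fun=> 1%E)).
- exists 1%N => // N /= N1; have [mE _ /(_ N1) PE] := HE N.
  rewrite probability_le1// andbT.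
  have -> : P N (E N) = (1 - P N (~` E N))%E.
    by rewrite -[in LHS](setCK (E N)) probability_setC//; exact: measurableC.
  rewrite EFinB; exact: leeB.
- apply: cvg_EFin; first by near=> N.
  rewrite -[X in _ --> X]subr0; apply: cvgB; first exact: cvg_cst.
  exact: sqrt_inv_cvg0.
- exact: cvg_cst.
Unshelve. all: by end_near.
Qed.
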